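(* Let $e\in\mathcal N_2$, with associated parabolic subgroup $P$, abelian ideal $\mathfrak a$, set of roots $\Psi$, and $\widetilde X=G\times_P\mathfrak a$. The $B$-orbits on $\widetilde X$ are parametrized by $W^P\times\mathrm{Ort}(\Psi)$: the map $$W^P\times\mathrm{Ort}(\Psi)\longrightarrow B\backslash\widetilde X,\qquad (w,S)\longmapsto Bw\tilde e_S,$$ is a bijection.
   Context: $G$ is an almost simple algebraic group over an algebraically closed field of characteristic zero, with Borel subgroup $B$ and maximal torus $T\subset B$; $\mathfrak g,\mathfrak b,\mathfrak t$ are the Lie algebras. $\Phi$ is the root system of $(G,T)$, with simple roots $\Delta$ defined by $B$, and Weyl group $W=N_G(T)/T$. For every $\alpha\in\Phi$ fix a nonzero $e_\alpha$ in the root space $\mathfrak g_\alpha$; for $S\subset\Phi$ put $e_S=\sum_{\alpha\in S}e_\alpha$. For a nilpotent $e$, $\mathrm{ht}(e)=\max\{n\in\mathbb N : \mathrm{ad}(e)^n\neq0\}$, and $\mathcal N_2$ is the set of nilpotent elements of $\mathfrak g$ of height at most $2$. For $e\in\mathcal N_2$ let $h\in\mathfrak t$ be the dominant characteristic of $Ge$: the unique $h\in\mathfrak t$ with $\alpha(h)\geq0$ for all $\alpha\in\Delta$ which is the semisimple element of an $\mathfrak{sl}_2$-triple whose nilpositive element lies in $Ge$. Put $\mathfrak g(i)=\{x\in\mathfrak g : [h,x]=ix\}$. $P$ is the standard parabolic subgroup with Lie algebra $\bigoplus_{i\geq0}\mathfrak g(i)$, $\mathfrak a=\mathfrak g(2)$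 (an abelian ideal of $\mathfrak b$), $\Psi=\{\alpha\in\Phi : \alpha(h)=2\}$, $\mathrm{Ort}(\Psi)$ is the set of subsets of $\Psi$ consisting of pairwise orthogonal roots, and $W^P$ is the set of minimal length representatives of the cosets $W/W_L$, where $W_L$ is the Weyl group of the Levi factor $L$ of $P$ with Lie algebra $\mathfrak g(0)$. For $S\in\mathrm{Ort}(\Psi)$ put $\tilde e_S=[1,e_S]\in\widetilde X$; elements of $W$ act on $\widetilde X$ via representatives in $N_G(T)$, and $Bw\tilde e_S$ does not depend on the representative. *)

(* Defs.v *)
From HB Require Import structures.
From mathcomp Require Import all_boot all_algebra.
From mathcomp Require Import finmap boolp classical_sets functions.
From mathcomp Require Import mpoly.

Set Implicit Arguments.
Unset Strict Implicit.
Unset Printing Implicit Defensive.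

Import GRing.Theory.
Local Open Scope classical_set_scope.
Local Open Scope ring_scope.

(* An affine algebraic group over the algebraically closed field k is taken   *)
(* as a Zariski closed subgroup of some GL_n(k), identified with its set of   *)
(* k-points; its Lie algebra is then a subspace of 'M[k]_n, with Ad given by  *)
(* matrix conjugation and the bracket by the commutator.                      *)

Section LinearAlgebraicGroups.
Variables (k : closedFieldType) (n : nat).
Local Notation M := 'M[k]_n.
Implicit Types (A B C D G H K P L N T U : set M) (a b g x y z : M).

Definition mxeval (f : {mpoly k[n * n]}) x : k := f.@[fun i => mxvec x 0 i].

Definition vanishes_on A (f : {mpoly k[n * n]}) : Prop :=
  forall x, A x -> mxeval f x = 0.

(* Closed in GL_n: every closed subset of GL_n is cut out by polynomials in   *)
(* the matrix entries alone, the powers of 1/det being units.                 *)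
Definition zclosed A : Prop :=
  A `<=` [set x | x \in unitmx] /\
  forall x, x \in unitmx ->
    (forall f, vanishes_on A f -> mxeval f x = 0) -> A x.

Definition zconnected A : Prop :=
  forall C D, zclosed C -> zclosed D -> A = C `|` D -> C `&` D = set0 ->
    C = set0 \/ D = set0.

Definition conj g x : M := g *m x *m invmx g.

Definition subgroup H : Prop :=
  [/\ H `<=` [set x | x \in unitmx], H 1%:M,
      forall x y, H x -> H y -> H (x *m y) & forall x, H x -> H (invmx x)].

Definition closed_subgroup H : Prop := subgroup H /\ zclosed H.

Definition normal_in G N : Prop :=
  N `<=` G /\ forall g x, G g -> N x -> N (conj g x).

Definition commutative H : Prop := forall x y, H x -> H y -> x *m y = y *m x.

Definition generated A : set M :=
  [set x | forall H, subgroup H -> A `<=` H -> H x].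

Definition derived H : set M :=
  generated [set z | exists x y, [/\ H x, H y &
    z = x *m y *m invmx x *m invmx y]].

Definition solvable_group H : Prop := exists m, iter m derived H = [set 1%:M].

Definition unipotent H : Prop := forall x, H x -> exists m, (x - 1%:M) ^+ m = 0.

Definition almost_simple G : Prop :=
  [/\ closed_subgroup G, zconnected G, ~ commutative G &
      forall N, closed_subgroup N -> zconnected N -> normal_in G N ->
        N = [set 1%:M] \/ N = G].

Definition connected_solvable H : Prop :=
  [/\ closed_subgroup H, zconnected H & solvable_group H].

Definition borel G B : Prop :=
  [/\ B `<=` G, connected_solvable B &
      forall K, K `<=` G -> connected_solvable K -> B `<=` K -> K = B].

Definition torus T : Prop :=
  [/\ closed_subgroup T, zconnected T &
      exists2 g, g \in unitmx & forall t, T t -> is_diag_mx (conj g t)].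

Definition maximal_torus G T : Prop :=
  [/\ T `<=` G, torus T &
      forall K, K `<=` G -> torus K -> T `<=` K -> K = T].

Definition unipotent_radical P U : Prop :=
  let good N := [/\ closed_subgroup N, zconnected N, unipotent N
                  & normal_in P N] in
  good U /\ forall N, good N -> N `<=` U.

Definition levi_factor P L : Prop :=
  [/\ closed_subgroup L, L `<=` P &
      exists2 U, unipotent_radical P U &
        L `&` U = [set 1%:M] /\
        P = [set z | exists l u, [/\ L l, U u & z = l *m u]]].

(* Derivative of f at the identity in the direction x. *)
Definition dpoly1 (f : {mpoly k[n * n]}) x : k :=
  \sum_(i < n * n) mxeval f^`M(i) 1%:M * mxvec x 0 i.

Definition tangent1 H : set M :=
  [set x | forall f, vanishes_on H f -> dpoly1 f x = 0].

Definition Lie H : {vspace M} :=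
  xget 0%VS [set V : {vspace M} | forall x, x \in V <-> tangent1 H x].

Lemma tangent1D H x y : tangent1 H x -> tangent1 H y -> tangent1 H (x + y).
Proof.
move=> hx hy f hf; rewrite -[RHS]addr0 -{1}(hx f hf) -(hy f hf) -big_split /=.
by apply: eq_bigr => i _; rewrite linearD mxE mulrDr.
Qed.

Lemma tangent1Z H c x : tangent1 H x -> tangent1 H (c *: x).
Proof.
move=> hx f hf; rewrite -[RHS](mulr0 c) -(hx f hf) mulr_sumr.
by apply: eq_bigr => i _; rewrite linearZ mxE mulrCA.
Qed.

Lemma LieP H x : x \in Lie H <-> tangent1 H x.
Proof.
suff : exists V : {vspace M}, forall y, y \in V <-> tangent1 H y.
  move=> [V hV]; rewrite /Lie.
  exact: (@xgetPex _ 0%VS [set V : {vspace M} |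
    forall x, x \in V <-> tangent1 H x] (ex_intro _ V hV) x).
pose Q (d : nat) := `[< exists2 V : {vspace M},
  (forall y, y \in V -> tangent1 H y) & \dim V = d >].
have Q0 : exists d, Q d.
  exists 0%N; apply/asboolP; exists 0%VS; last by rewrite dimv0.
  move=> y; rewrite memv0 => /eqP -> f _.
  by rewrite /dpoly1 big1 // => i _; rewrite linear0 mxE mulr0.
have Qb d : Q d -> (d <= \dim {: M}%VS)%N.
  by move=> /asboolP[V _ <-]; rewrite dimvS ?subvf.
case: (ex_maxnP Q0 Qb) => d /asboolP[V hV dV] dmax.
exists V => y; split; first exact: hV.
move=> hy; have sub : (V <= V + <[y]>)%VS by rewrite addvSl.
have : Q (\dim (V + <[y]>)).
  apply/asboolP; exists (V + <[y]>)%VS => // z.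
  case/memv_addP => u uV [v /vlineP[c ->] ->].
  by apply: tangent1D; [exact: hV|exact: tangent1Z].
move=> /dmax; rewrite -dV => le_d.
have /eqP -> : V == (V + <[y]>)%VS by rewrite eqEdim sub le_d.
by rewrite -{1}[y]add0r memv_add ?mem0v ?memv_line.
Qed.

Definition lie x y : M := x *m y - y *m x.

Definition ad_power_neq0 G x m : Prop :=
  exists2 y, y \in Lie G & iter m (lie x) y != 0.

Definition is_height G x m : Prop :=
  ad_power_neq0 G x m /\ forall m', ad_power_neq0 G x m' -> (m' <= m)%N.

Definition nilpotent_elt G x : Prop := x \in Lie G /\ exists m, x ^+ m = 0.

Definition N2 G : set M :=
  [set x | nilpotent_elt G x /\ exists2 m, is_height G x m & (m <= 2)%N].

(* Trace over Lie G of the map z |-> [x, [y, z]]. *)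
Definition killing G x y : k :=
  \sum_(i < \dim (Lie G))
    coord (vbasis (Lie G)) i (lie x (lie y (vbasis (Lie G))`_i)).

Section Roots.
Variables (G B T : set M).

Definition cartan := subvs_of (Lie T).
Definition cartan_dual := 'Hom(cartan, k^o).
Implicit Types (al be la mu : cartan_dual) (h : cartan).

(* chi = f / det^m on T. *)
Definition represents (f : {mpoly k[n * n]}) (m : nat) (chi : M -> k) : Prop :=
  forall t, T t -> chi t * \det t ^+ m = mxeval f t.

Definition is_character (chi : M -> k) : Prop :=
  [/\ exists f m, represents f m chi, forall t, T t -> chi t != 0 &
      forall s t, T s -> T t -> chi (s *m t) = chi s * chi t].

(* Differentiate chi * det^m = f at 1, where d(det)_1 = \tr. *)
Definition is_differential (chi : M -> k) la : Prop :=
  exists f m, represents f m chi /\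
    forall h, la h = dpoly1 f (vsval h) - m%:R * \tr (vsval h).

(* Characters of T are identified with their differentials in the dual of     *)
(* Lie T (in characteristic 0 this is injective).                             *)
Definition root_space al : set M :=
  [set x | x \in Lie G /\ exists chi, [/\ is_character chi,
     is_differential chi al & forall t, T t -> conj t x = chi t *: x]].

Definition is_root al : Prop := al != 0 /\ exists2 x, x != 0 & root_space al x.

Definition positive_root al : Prop :=
  is_root al /\ forall x, root_space al x -> x \in Lie B.

Definition simple_root al : Prop :=
  positive_root al /\
  ~ exists be ga, [/\ positive_root be, positive_root ga & al = be + ga].

(* The Killing form transported to the dual of Lie T. *)
Definition killing_dual la : cartan :=
  xget 0 [set h | forall h', killing G (vsval h) (vsval h') = la h'].

Definition dual_form la mu : k :=
  killing G (vsval (killing_dual la)) (vsval (killing_dual mu)).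

Definition normalizer g : Prop := G g /\ forall t, T t <-> T (conj g t).

(* An element of N_G(T)/T is the coset gT, as a set of matrices. *)
Definition coset g : set M := [set g *m t | t in T].

Definition weyl : set (set M) :=
  [set w | exists2 g, normalizer g & w = coset g].

Definition setmulmx (u v : set M) : set M :=
  [set z | exists x y, [/\ u x, v y & z = x *m y]].

(* gT acts on the dual of Lie T, by (g la)(h) = la (g^-1 h g), as s_al. *)
Definition acts_as_reflection g al : Prop :=
  forall la h h', vsval h' = conj (invmx g) (vsval h) ->
    la h' = la h - 2 * dual_form la al / dual_form al al * al h.

Definition simple_reflection (s : set M) : Prop :=
  exists al g, [/\ simple_root al, normalizer g, s = coset g
                 & acts_as_reflection g al].

Inductive has_word : nat -> set M -> Prop :=
| has_word0 : has_word 0 T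
| has_wordS m s w :
    simple_reflection s -> has_word m w -> has_word m.+1 (setmulmx s w).

Definition weyl_length (w : set M) : nat :=
  xget 0%N [set m | has_word m w /\
    forall m', has_word m' w -> (m <= m')%N].

(* The values al h of the roots at a characteristic are integers, whence the  *)
(* meaning of al h >= 0 in k.                                                 *)
Definition dominant h : Prop :=
  forall al, simple_root al -> exists m : nat, al h = m%:R.

Definition sl2_triple x h f : Prop :=
  [/\ lie (vsval h) x = 2 *: x, lie (vsval h) f = - 2 *: f
    & lie x f = vsval h].

Definition dominant_characteristic x h : Prop :=
  dominant h /\
  exists g f, [/\ G g, f \in Lie G & sl2_triple (conj g x) h f].

Definition grade h (i : int) : set M :=
  [set x | x \in Lie G /\ lie (vsval h) x = i%:~R *: x].

Definition nonneg_grades h : set M :=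
  [set x | exists (m : nat) (y : nat -> M),
     (forall i : nat, grade h i (y i)) /\ x = \sum_(i < m) y i].

Definition standard_parabolic P : Prop :=
  [/\ closed_subgroup P, B `<=` P & P `<=` G].

Definition Psi h : set cartan_dual := [set al | is_root al /\ al h = 2].

Definition Ort h : set {fset cartan_dual} :=
  [set S | (forall al, al \in S -> Psi h al) /\
     forall al be, al \in S -> be \in S -> al != be -> dual_form al be = 0].

Definition eS (e_ : cartan_dual -> M) (S : {fset cartan_dual}) : M :=
  \sum_(al <- S) e_ al.

End Roots.

(* Minimal length representatives of W / W_L; the cosets are w W_L. *)
Definition min_reps G B T L : set (set M) :=
  [set w | weyl G T w /\ forall u, weyl L T u ->
     (weyl_length G B T w <= weyl_length G B T (setmulmx w u))%N].

(* The point [g, x] of G x_P V, as the P-class {(g p, p^-1 x) | p in P}. *)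
Definition bundle_pt P g x : set (M * M) :=
  [set q | exists2 p, P p & q = (g *m p, conj (invmx p) x)].

Definition bundle G P (V : set M) : set (set (M * M)) :=
  [set c | exists g x, [/\ G g, V x & c = bundle_pt P g x]].

Definition bundle_act g (c : set (M * M)) : set (M * M) :=
  [set (g *m q.1, q.2) | q in c].

Definition bundle_orbits H (X : set (set (M * M))) : set (set (set (M * M))) :=
  [set [set bundle_act b c | b in H] | c in X].

(* The set B w c, for w a coset gT: the union over all representatives of w. *)
Definition double_orbit B (w : set M) (c : set (M * M)) : set (set (M * M)) :=
  [set d | exists b g, [/\ B b, w g & d = bundle_act b (bundle_act g c)]].

End LinearAlgebraicGroups.

(* Main.v *)
From HB Require Import structures.
Require Import Defs.
From mathcomp Require Import all_boot all_order all_algebra.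
From mathcomp Require Import finmap boolp classical_sets functions.
From mathcomp Require Import mpoly.
From mathcomp Require Import zify.

Set Implicit Arguments.
Unset Strict Implicit.
Unset Printing Implicit Defensive.

Import Order.TTheory GRing.Theory Num.Theory.
Local Open Scope classical_set_scope.
Local Open Scope ring_scope.

(** The proof reduces orbits on the bundle to orbits on the ideal g(2), which
    are described by means of orthogonal roots. Let U be the unipotent radical
    of B, N the normaliser of T, and let n_S denote a representative of the
    product of the reflections in the roots of an orthogonal set S.

    Reduction. By the Bruhat decomposition G = U N U ([bruhat]) and since L has
    representatives of its Weyl group in P, every B-orbit contains a point
    [w, x] with w in N of minimal length modulo W_L. Such a w maps positive roots
    of L to positive roots ([min_reps_pos], by deletion in words of simple
    reflections). Therefore two minimal w, w' with B w P = B w' P are equal in W,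
    and b w' p = w forces p in B ([parabolic_coset]). Conversely the p in P with
    w p w^-1 in B include T and the positive root subgroups of L. Hence it is
    enough to show that each orbit of B on g(2) contains a unique e_S, and that
    T and the positive root subgroups of L suffice to reach it.

    Existence ([orthogonal_rep]). Roots in Psi have no obtuse angles, because
    g(4) = 0. Let Psi be graded by an element y of Lie T that is positive on the
    roots of B. Suppose that the components of x below degree d are orthogonal
    and that a root of degree d in x, also written d, is not orthogonal to a lower
    component c. Then d - c is a positive root of L, and the exponential of one of
    its root vectors kills the component at d ([kill_root]); a computation with
    Cartan integers shows that the lower ones are not disturbed ([nodisturb]).
    At the end, the torus rescales the orthogonal components independently.

    Uniqueness ([orth_uniq]). Orthogonal roots have commuting sl2-triples, and
    their sum satisfies exp(-e_S) = exp(-f_S) n_S exp(-f_S), with f_S in g(-2).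
    If an element of B carries e_S to e_S', its factor in exp(g(1) + g(2)) fixes
    e_S, so that n_S and n_S' are in the same cell of the Bruhat decomposition
    for the Borel subgroup with the positive roots of L and the roots negative
    on h. The uniqueness of that decomposition ([bruhat_uniq]) makes the products
    of reflections equal, and this determines S ([orth_subset]).

    The structure theory of G that this uses is developed from the definitions.
    In characteristic 0 a polynomial function on a connected group H with
    vanishing Taylor series along Lie H at the identity is zero
    ([identity_theorem], through Krull's intersection theorem). So connected
    groups are controlled by their Lie algebras, and the product of opposite
    Borel subgroups is dense. The trace form of the given representation is
    nondegenerate on Lie G ([trace_nondeg]): its radical is nilpotent, and would
    give a commutative normal subgroup. Replicas of semisimple parts show that
    Lie T is its own centraliser, and sl2-theory gives the root system. An
    integral element y of Lie T, regular and positive on the roots of B, grades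
    all matrices; then B = T U, where U consists of the g in G such that g - 1
    raises degrees ([borel_grading]). The Bruhat decomposition of q follows from
    an element of Lie B :&: Ad(q) Lie B with regular torus parts, and its
    uniqueness from the fact that y has centraliser T ([regular_centraliser]). *)

(** * Noetherian rings *)

Section Noetherian.

(** The form of the ascending chain condition that can be transported along ring
    morphisms and to polynomial rings without speaking of ideals. *)
Definition noetherian (R : comNzRingType) : Prop :=
  forall u : nat -> R, exists s (c : nat -> R), u s = \sum_(i < s) c i * u i.

Lemma noetherian_surj (R S : comNzRingType) (f : {rmorphism R -> S}) (g : S -> R) :
  cancel g f -> noetherian R -> noetherian S.
Proof.
move=> gK nR u; case: (nR (g \o u)) => s [c cE].
exists s, (f \o c); rewrite -[u s]gK -[g (u s)]/((g \o u) s) cE rmorph_sum.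
by apply: eq_bigr => i _ /=; rewrite rmorphM /= gK.
Qed.

Lemma noetherian_field (F : fieldType) : noetherian F.
Proof.
move=> u; case: (eqVneq (u 0%N) 0) => [u0|u0].
  by exists 0%N, u; rewrite big_ord0.
by exists 1%N, (fun=> u 1%N / u 0%N); rewrite big_ord1 divfK.
Qed.

Variable R : comNzRingType.
Implicit Types (L : seq R) (u : nat -> R).

Definition in_span L x := exists c : nat -> R, x = \sum_(i < size L) c i * L`_i.

Lemma in_span0 L : in_span L 0.
Proof. by exists (fun=> 0); rewrite big1 // => i _; rewrite mul0r. Qed.

Lemma in_spanD L x y : in_span L x -> in_span L y -> in_span L (x + y).
Proof.
move=> [c ->] [d ->]; exists (fun i => c i + d i).
by rewrite -big_split; apply: eq_bigr => i _; rewrite mulrDl.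
Qed.

Lemma in_spanM L a x : in_span L x -> in_span L (a * x).
Proof.
move=> [c ->]; exists (fun i => a * c i).
by rewrite mulr_sumr; apply: eq_bigr => i _; rewrite mulrA.
Qed.

Lemma in_span_sum L n (F : nat -> R) :
  (forall i, (i < n)%N -> in_span L (F i)) -> in_span L (\sum_(i < n) F i).
Proof.
elim: n => [|n IHn] h; first by rewrite big_ord0; exact: in_span0.
rewrite big_ord_recr /=; apply: in_spanD; last by apply: h.
by apply: IHn => i lt_in; apply: h; apply: ltnW.
Qed.

Lemma in_span_mem L x : x \in L -> in_span L x.
Proof.
move=> xL; have lt_i : (index x L < size L)%N by rewrite index_mem.
exists (fun i => (i == index x L)%:R); rewrite (bigD1 (Ordinal lt_i)) //=.
rewrite eqxx mul1r nth_index // big1 ?addr0 // => i ne_i.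
by case: eqP => [e|]; rewrite ?mul0r //; case/eqP: ne_i; apply: val_inj.
Qed.

Lemma in_span_sub L L' x : {subset L <= L'} -> in_span L x -> in_span L' x.
Proof.
move=> sub [c ->]; apply: (@in_span_sum _ _ (fun i => c i * L`_i)) => i lt_i.
by apply/in_spanM/in_span_mem/sub/mem_nth.
Qed.

(** Otherwise dependent choice yields a sequence in S, each term of which
    escapes the span of the earlier ones. *)
Lemma noetherian_fin (S : set R) : noetherian R ->
  exists2 L, (forall x, x \in L -> S x) & forall x, S x -> in_span L x.
Proof.
move=> nR; apply: contrapT => hS.
have next L : exists x, (forall y, y \in L -> S y) -> S x /\ ~ in_span L x.
  case: (pselect (forall y, y \in L -> S y)) => hL; last by exists 0.
  apply: contrapT => hx; apply: hS; exists L => // x Sx.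
  by apply: contrapT => nx; apply: hx; exists x.
have [g gP] := choice next.
pose Ls := fix Ls n := if n is m.+1 then rcons (Ls m) (g (Ls m)) else [::].
have LsS n : forall y, y \in Ls n -> S y.
  elim: n => //= n IHn y; rewrite mem_rcons inE => /orP[/eqP->|/IHn//].
  by case: (gP _ IHn).
have sL n : size (Ls n) = n by elim: n => //= n IHn; rewrite size_rcons IHn.
have nthL n i : (i < n)%N -> (Ls n)`_i = g (Ls i).
  elim: n => // n IHn; rewrite ltnS leq_eqVlt => /orP[/eqP->|lt_in] /=.
    by rewrite nth_rcons sL ltnn eqxx.
  by rewrite nth_rcons sL lt_in IHn.
case: (nR (fun n => g (Ls n))) => s [c cE].
case: (gP _ (LsS s)) => _; apply; exists c; rewrite cE sL.
by apply: eq_bigr => i _; rewrite nthL.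
Qed.

End Noetherian.

(** Hilbert's basis theorem: a sequence of elements of minimal degree, each
    outside the ideal of the earlier ones, would have leading coefficients that
    contradict the hypothesis on R. *)
Lemma noetherian_poly (R : comNzRingType) : noetherian R -> noetherian {poly R}.
Proof.
move=> nR u; apply: contrapT => nu.
pose A p := exists n, in_span [seq u i | i <- iota 0 n] p.
have AD p q : A p -> A q -> A (p + q).
  move=> [n hp] [m hq]; exists (maxn n m).
  by apply: in_spanD; [move: hp|move: hq]; apply: in_span_sub => x;
     case/mapP=> i; rewrite mem_iota => hi ->; apply: map_f;
     rewrite mem_iota (leq_trans hi) // leq_max leqnn ?orbT.
have AM a p : A p -> A (a * p) by move=> [n hp]; exists n; exact: in_spanM.
have nA L : (forall y, y \in L -> A y) -> exists2 p, A p & ~ in_span L p.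
  move=> LA; apply: contrapT => hL.
  have [n hn] : exists n, forall y, y \in L -> in_span [seq u i | i <- iota 0 n] y.
    elim: L LA {hL} => [|y L IHL] LA; first by exists 0%N.
    have [|n hn] := IHL; first by move=> z zL; apply: LA; rewrite inE zL orbT.
    have [m hm] := LA y (mem_head _ _); exists (maxn n m) => z.
    rewrite inE => /orP[/eqP->|/hn]; [move: hm|]; apply: in_span_sub => x;
    by case/mapP=> i; rewrite mem_iota => hi ->; apply: map_f;
       rewrite mem_iota (leq_trans hi) // leq_max leqnn ?orbT.
  have : in_span L (u n).
    apply: contrapT => h; apply: hL; exists (u n) => //; exists n.+1.
    by apply: in_span_mem; apply: map_f; rewrite mem_iota /= add0n.
  move=> [c cE]; apply: nu; exists n.
  have [d dE] : in_span [seq u i | i <- iota 0 n] (u n).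
    rewrite cE; apply: (@in_span_sum _ _ _ (fun i => c i * L`_i)) => i lt_i.
    by apply: in_spanM; apply: hn; apply: mem_nth.
  exists d; rewrite {1}dE size_map size_iota; apply: eq_bigr => i _.
  by rewrite (nth_map 0%N) ?size_iota // nth_iota.
have next L : exists p, (forall y, y \in L -> A y) -> [/\ A p, ~ in_span L p &
    forall q, A q -> ~ in_span L q -> (size p <= size q)%N].
  case: (pselect (forall y, y \in L -> A y)) => LA; last by exists 0.
  have [p Ap np] := nA L LA.
  pose Q m := `[< exists p, [/\ A p, ~ in_span L p & size p = m] >].
  have Q0 : exists m, Q m by exists (size p); apply/asboolP; exists p.
  case: (ex_minnP Q0) => m /asboolP[q [Aq nq <-]] mmin.
  exists q => _; split=> // r Ar nr; apply: mmin.
  by apply/asboolP; exists r.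
have [g gP] := choice next.
pose Ls := fix Ls n := if n is m.+1 then rcons (Ls m) (g (Ls m)) else [::].
have LsA n : forall y, y \in Ls n -> A y.
  elim: n => //= n IHn y; rewrite mem_rcons inE => /orP[/eqP->|/IHn//].
  by case: (gP _ IHn).
have sub i n : (i <= n)%N -> {subset Ls i <= Ls n}.
  elim: n => [|n IHn]; first by rewrite leqn0 => /eqP->.
  rewrite leq_eqVlt => /orP[/eqP-> //|/IHn h x /h].
  by rewrite /= mem_rcons inE => ->; rewrite orbT.
have memL i n : (i < n)%N -> g (Ls i) \in Ls n.
  by move=> lt_in; apply: (sub i.+1) => //=; rewrite mem_rcons mem_head.
have le_size i n : (i < n)%N -> (size (g (Ls i)) <= size (g (Ls n)))%N.
  move=> lt_in; have [_ _] := gP _ (LsA i); apply; first by case: (gP _ (LsA n)).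
  have [_ nn _] := gP _ (LsA n); move=> h; apply: nn; apply: in_span_sub h.
  exact/sub/ltnW.
have [s [c cE]] := nR (fun n => lead_coef (g (Ls n))).
have [As ns mins] := gP _ (LsA s).
pose F i := (c i)%:P * 'X^(size (g (Ls s)) - size (g (Ls i))) * g (Ls i).
have inF i : (i < s)%N -> in_span (Ls s) (F i).
  by move=> lt_is; apply/in_spanM/in_span_mem/memL.
have AF : A (\sum_(i < s) F i).
  have A0 : A 0 by exists 0%N; exact: in_span0.
  elim/big_ind: _ => // i _; apply: AM; by case: (gP _ (LsA i)).
pose q := g (Ls s) - \sum_(i < s) F i.
have Aq : A q by apply: AD => //; rewrite -mulN1r; apply: AM.
have nq : ~ in_span (Ls s) q.
  move=> hq; apply: ns; rewrite -[g _](subrK (\sum_(i < s) F i)).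
  by apply: in_spanD => //; apply: in_span_sum.
have g0 i : (0 < size (g (Ls i)))%N.
  rewrite size_poly_gt0; apply/eqP=> e; have [_ + _] := gP _ (LsA i).
  by apply; rewrite e; exact: in_span0.
have := mins q Aq nq; apply/negP; rewrite -ltnNge.
have szg : (size (g (Ls s))).-1.+1 = size (g (Ls s)) by rewrite prednK.
rewrite -szg ltnS; apply/leq_sizeP => j le_j; rewrite coefB coef_sum.
move: le_j; rewrite leq_eqVlt => /orP[/eqP <-|lt_j].
  rewrite -lead_coefE cE -sumrB big1 // => i _.
  rewrite /F -mulrA coefCM coefXnM.
  have lei := le_size _ _ (ltn_ord i).
  have := g0 i; case: ifP => [lt|ge] gi; first by exfalso; lia.
  have -> : ((size (g (Ls s))).-1 - (size (g (Ls s)) - size (g (Ls i))) =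
        (size (g (Ls i))).-1)%N by move/negbT: ge; rewrite -leqNgt; lia.
  by rewrite subrr.
have -> : (g (Ls s))`_j = 0 by apply: nth_default; rewrite -szg.
rewrite big1 ?subrr // => i _.
rewrite /F -mulrA coefCM coefXnM; case: ifP => _; rewrite ?mulr0 //.
have -> : (g (Ls i))`_(j - (size (g (Ls s)) - size (g (Ls i)))) = 0.
  apply: nth_default; have := le_size _ _ (ltn_ord i); move: lt_j szg.
  by move: (size (g (Ls i))) (size (g (Ls s))) => b a; lia.
by rewrite mulr0.
Qed.

(** * Polynomial functions on matrices and invariant vector fields *)

Lemma mpoly_alg_ind (R : comNzRingType) (m : nat) (Q : {mpoly R[m]} -> Prop) :
  (forall c, Q c%:MP) -> (forall i, Q 'X_i) ->
  (forall p q, Q p -> Q q -> Q (p + q)) ->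
  (forall p q, Q p -> Q q -> Q (p * q)) -> forall p, Q p.
Proof.
move=> QC QX QD QM; apply: mpolyind => [|c mm p _ _ Qp]; first by rewrite -mpolyC0.
apply: QD => //; rewrite -mul_mpolyC; apply: (QM) => //.
have Q1 : Q 1 by rewrite -mpolyC1.
rewrite mpolyXE_id; apply: (big_ind Q) => [||i _]; [exact: Q1|exact: QM|].
by elim: (mm i) => [|j IHj]; rewrite ?expr0 // exprS; apply: (QM).
Qed.

Lemma noetherian_mpoly (R : comNzRingType) m :
  noetherian R -> noetherian {mpoly R[m]}.
Proof.
move=> nR; elim: m => [|m IHm].
  have gK : cancel (fun p : {mpoly R[0]} => p@_0%MM) (@mpolyC 0 R).
    move=> p; apply/mpolyP => mm; rewrite mcoeffC.
    have -> : mm = 0%MM by apply/mnmP => -[].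
    by rewrite eqxx mulr1.
  exact: noetherian_surj gK nR.
have nP := noetherian_poly IHm.
pose h : {poly {mpoly R[m]}} -> {mpoly R[m.+1]} :=
  fun p => (map_poly (@mwiden m R) p).['X_ord_max].
have hD : {morph h : p q / p - q} by move=> p q; rewrite /h rmorphB /= hornerD hornerN.
have hM : {morph h : p q / p * q} by move=> p q; rewrite /h rmorphM /= hornerM.
have h1 : h 1 = 1 by rewrite /h rmorph1 hornerC.
have hC c : h (c%:MP)%:P = c%:MP by rewrite /h map_polyC hornerC /= mwidenC.
pose H := HB.pack h (GRing.isZmodMorphism.Build _ _ h hD)
  (GRing.isMonoidMorphism.Build _ _ h (h1, hM)) : {rmorphism {poly {mpoly R[m]}} -> {mpoly R[m.+1]}}.
have hs p : exists q, H q = p.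
  elim/mpoly_alg_ind: p => [c|i|p q [p' <-] [q' <-]|p q [p' <-] [q' <-]].
  - by exists (c%:MP)%:P; exact: hC.
  - case: (unliftP ord_max i) => [j ->|->].
      exists ('X_j)%:P; rewrite /= /h map_polyC hornerC /= mwidenX mnmwiden1.
      by congr 'X_[U_(_)]; apply: val_inj; rewrite /= /bump leqNgt ltn_ord.
    by exists 'X; rewrite /= /h map_polyX hornerX.
  - by exists (p' + q'); rewrite rmorphD.
  - by exists (p' * q'); rewrite rmorphM.
have [g gP] := choice hs; exact: (noetherian_surj gP nP).
Qed.

Section Separation.
Variables (F : fieldType) (W : vectType F).

Lemma separating_form (V : {vspace W}) w : w \notin V ->
  exists phi : 'Hom(W, F^o), (forall v, v \in V -> phi v = 0) /\ phi w != 0.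
Proof.
move=> nw; pose q := (\1 - projv V)%VF.
have qV v : v \in V -> q v = 0 by move=> vV; rewrite !lfunE /= !lfunE /= projv_id ?subrr.
have qw : q w != 0.
  apply: contraNneq nw; rewrite !lfunE /= !lfunE /= => /eqP.
  by rewrite subr_eq0 => /eqP->; rewrite memv_proj.
have [i ci] : exists i, coord (vbasis {:W}) i (q w) != 0.
  apply: contrapT => h; move/eqP: qw; apply.
  rewrite (coord_vbasis (memvf (q w))) big1 // => i _.
  by have [->|ne] := eqVneq (coord (vbasis {:W}) i (q w)) 0; rewrite ?scale0r //; case: h; exists i.
have lin : linear (fun x => coord (vbasis {:W}) i (q x) : F^o).
  by move=> a x y; rewrite !linearP.
pose f := HB.pack (fun x => coord (vbasis {:W}) i (q x) : F^o)
  (GRing.isLinear.Build _ _ _ _ _ lin) : {linear W -> F^o}.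
exists (linfun f); split; last by rewrite lfunE.
by move=> v vV; rewrite lfunE /= qV // linear0.
Qed.

(** A subspace of largest dimension among those contained in Q is all of Q. *)
Lemma vspace_of_pred (Q : W -> Prop) :
  Q 0 -> (forall a x y, Q x -> Q y -> Q (a *: x + y)) ->
  exists V : {vspace W}, forall x, x \in V <-> Q x.
Proof.
move=> Q0 QL.
pose A (d : nat) := `[< exists2 V : {vspace W}, (forall y, y \in V -> Q y) & \dim V = d >].
have A0 : exists d, A d.
  by exists 0%N; apply/asboolP; exists 0%VS; rewrite ?dimv0 // => y; rewrite memv0 => /eqP->.
have Ab d : A d -> (d <= \dim {:W}%VS)%N by move=> /asboolP[V _ <-]; rewrite dimvS ?subvf.
case: (ex_maxnP A0 Ab) => d /asboolP[V hV dV] dmax.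
exists V => y; split; first exact: hV.
move=> hy; have sub : (V <= V + <[y]>)%VS by rewrite addvSl.
have : A (\dim (V + <[y]>)).
  apply/asboolP; exists (V + <[y]>)%VS => // z.
  case/memv_addP => u uV [v /vlineP[c ->] ->].
  by rewrite addrC; apply: QL => //; exact: hV.
move=> /dmax; rewrite -dV => le_d.
have /eqP -> : V == (V + <[y]>)%VS by rewrite eqEdim sub le_d.
by rewrite -{1}[y]add0r memv_add ?mem0v ?memv_line.
Qed.

End Separation.

Section VectorFields.
Variables (k : closedFieldType) (n : nat).
Local Notation M := 'M[k]_n.
Local Notation N := (n * n)%N.
Local Notation A := {mpoly k[N]}.
Implicit Types (f p q : A) (x y g v : M) (H : set M).

Lemma mxevalD f p g : mxeval (f + p) g = mxeval f g + mxeval p g.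
Proof. exact: mevalD. Qed.
Lemma mxevalN f g : mxeval (- f) g = - mxeval f g.
Proof. exact: mevalN. Qed.
Lemma mxevalB f p g : mxeval (f - p) g = mxeval f g - mxeval p g.
Proof. exact: mevalB. Qed.
Lemma mxevalM f p g : mxeval (f * p) g = mxeval f g * mxeval p g.
Proof. exact: mevalM. Qed.
Lemma mxevalC c g : mxeval (c%:MP : A) g = c.
Proof. exact: mevalC. Qed.
Lemma mxevalX i g : mxeval ('X_i : A) g = mxvec g 0 i.
Proof. exact: mevalXU. Qed.
Lemma mxevalZ c f g : mxeval (c *: f) g = c * mxeval f g.
Proof. exact: mevalZ. Qed.
Lemma mxeval_sum I (r : seq I) (Q : pred I) (F : I -> A) g :
  mxeval (\sum_(i <- r | Q i) F i) g = \sum_(i <- r | Q i) mxeval (F i) g.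
Proof. by rewrite /mxeval raddf_sum. Qed.
Definition mxevalE := (mxevalD, mxevalN, mxevalM, mxevalC, mxevalX, mxevalZ, mxeval_sum).

Lemma mderivXU (i j : 'I_N) : ('X_i : A)^`M(j) = ((i == j)%:R)%:MP.
Proof.
rewrite mderivX mnmE; case: eqP => [->|_]; last by rewrite scale0r mpolyC0.
have -> : (U_(j) - U_(j) = 0 :> 'X_{1..N})%MM by apply/mnmP => l; rewrite mnmBE subnn mnm0E.
by rewrite mpolyX0 scale1r.
Qed.

(** The chain rule for a derivation delta along h. *)
Lemma mderiv_chain (S : comNzRingType) (h : {rmorphism A -> S}) (delta : S -> S) :
  (forall a b, delta (a + b) = delta a + delta b) ->
  (forall a b, delta (a * b) = delta a * b + a * delta b) ->
  (forall c, delta (h c%:MP) = 0) ->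
  forall f, delta (h f) = \sum_j h f^`M(j) * delta (h 'X_j).
Proof.
move=> dD dM dC; elim/mpoly_alg_ind => [c|i|f p IHf IHp|f p IHf IHp].
- by rewrite dC big1 // => j _; rewrite mderivC rmorph0 mul0r.
- rewrite (bigD1 i) //= mderivXU eqxx mpolyC1 rmorph1 mul1r.
  rewrite big1 ?addr0 // => j ne_ji; rewrite mderivXU eq_sym (negPf ne_ji).
  by rewrite mpolyC0 rmorph0 mul0r.
- rewrite rmorphD dD IHf IHp -big_split /=; apply: eq_bigr => j _.
  by rewrite mderivD rmorphD mulrDl.
- rewrite rmorphM dM IHf IHp mulr_suml mulr_sumr -big_split /=.
  apply: eq_bigr => j _; rewrite mderivM rmorphD !rmorphM mulrDl.
  by congr (_ + _); rewrite ?mulrA // mulrAC.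
Qed.

Definition lform (l : M -> k) : A := \sum_i l (vec_mx (delta_mx 0 i)) *: 'X_i.

Lemma scalar_coord l v : scalar l ->
  l v = \sum_i mxvec v 0 i * l (vec_mx (delta_mx 0 i)).
Proof.
move=> ll; have lD u w : l (u + w) = l u + l w by rewrite -[u]scale1r ll mul1r scale1r.
have l0 : l 0 = 0 by apply: (addrI (l 0)); rewrite -lD !addr0.
rewrite -{1}[v]mxvecK {1}(row_sum_delta (mxvec v)) linear_sum.
rewrite (big_morph l lD l0); apply: eq_bigr => i _.
by rewrite linearZ /= -[_ *: vec_mx _]addr0 ll l0 addr0.
Qed.

Lemma lformE l g : scalar l -> mxeval (lform l) g = l g.
Proof.
move=> ll; rewrite (scalar_coord _ ll) mxeval_sum.
by apply: eq_bigr => i _; rewrite mxevalZ mxevalX mulrC.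
Qed.

Lemma lform_eq l l' : l =1 l' -> lform l = lform l'.
Proof. by move=> e; apply: eq_bigr => i _; rewrite e. Qed.

Lemma scalar_entry (c : M -> M) i : linear c -> scalar (fun g => mxvec (c g) 0 i).
Proof. by move=> lc a u v; rewrite lc linearP !mxE. Qed.

Lemma linear_mulr x : linear (fun g => g *m x).
Proof. by move=> a u v; rewrite mulmxDl -scalemxAl. Qed.
Lemma linear_mull x : linear (fun g => x *m g).
Proof. by move=> a u v; rewrite mulmxDr -scalemxAr. Qed.
Hint Resolve linear_mulr linear_mull : core.

Lemma lform_coord i : lform (fun g => mxvec g 0 i) = 'X_i.
Proof.
rewrite /lform (bigD1 i) //= vec_mxK mxE !eqxx scale1r big1 ?addr0 // => j ne.
by rewrite vec_mxK mxE eqxx eq_sym (negPf ne) scale0r.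
Qed.

Definition dd f g v : k := \sum_i mxeval f^`M(i) g * mxvec v 0 i.

(** The left invariant vector field on GL_n with value x at the identity. *)
Definition Dx x f : A := \sum_i f^`M(i) * lform (fun g => mxvec (g *m x) 0 i).

Lemma mxeval_Dx x f g : mxeval (Dx x f) g = dd f g (g *m x).
Proof.
rewrite mxeval_sum; apply: eq_bigr => i _; rewrite mxevalM lformE //.
exact: scalar_entry.
Qed.

Lemma DxD x f p : Dx x (f + p) = Dx x f + Dx x p.
Proof.
by rewrite -big_split; apply: eq_bigr => i _; rewrite mderivD mulrDl.
Qed.
Lemma DxZ x c f : Dx x (c *: f) = c *: Dx x f.
Proof. by rewrite scaler_sumr; apply: eq_bigr => i _; rewrite mderivZ scalerAl. Qed.
Lemma DxC x c : Dx x c%:MP = 0.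
Proof. by rewrite /Dx big1 // => i _; rewrite mderivC mul0r. Qed.
Lemma DxM x f p : Dx x (f * p) = Dx x f * p + f * Dx x p.
Proof.
rewrite mulr_suml mulr_sumr -big_split /=; apply: eq_bigr => i _.
by rewrite mderivM mulrDl -!mulrA [p * _]mulrC.
Qed.
Lemma Dx0 x : Dx x 0 = 0. Proof. by rewrite -mpolyC0 DxC. Qed.
Lemma DxB x f p : Dx x (f - p) = Dx x f - Dx x p.
Proof. by rewrite DxD -scaleN1r DxZ scaleN1r. Qed.
Lemma Dx_sum x I (r : seq I) (Q : pred I) (F : I -> A) :
  Dx x (\sum_(i <- r | Q i) F i) = \sum_(i <- r | Q i) Dx x (F i).
Proof. exact: (big_morph (Dx x) (DxD x) (Dx0 x)). Qed.

Lemma mpoly_derivation_eq (d e : A -> A) :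
  (forall a b, d (a + b) = d a + d b) -> (forall a b, e (a + b) = e a + e b) ->
  (forall a b, d (a * b) = d a * b + a * d b) ->
  (forall a b, e (a * b) = e a * b + a * e b) ->
  (forall c, d c%:MP = 0) -> (forall c, e c%:MP = 0) ->
  (forall i, d 'X_i = e 'X_i) -> d =1 e.
Proof.
move=> dD eD dM eM dC eC h; elim/mpoly_alg_ind => [c|i|f p|f p].
- by rewrite dC eC.
- exact: h.
- by rewrite dD eD => -> ->.
- by rewrite dM eM => -> ->.
Qed.

Lemma Dx_X x i : Dx x 'X_i = lform (fun g => mxvec (g *m x) 0 i).
Proof.
rewrite /Dx (bigD1 i) //= mderivXU eqxx mpolyC1 mul1r big1 ?addr0 // => j ne_ji.
by rewrite mderivXU eq_sym (negPf ne_ji) mpolyC0 mul0r.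
Qed.

Lemma Dx_lform x l : scalar l -> Dx x (lform l) = lform (fun g => l (g *m x)).
Proof.
move=> ll; rewrite {1}/lform Dx_sum.
under eq_bigr do rewrite DxZ Dx_X scaler_sumr.
rewrite exchange_big /=; apply: eq_bigr => j _.
under eq_bigr do rewrite scalerA.
rewrite -scaler_suml; congr (_ *: _); rewrite (scalar_coord _ ll).
by apply: eq_bigr => i _; rewrite mulrC.
Qed.

Lemma lform_sub l l' : lform (fun g => l g - l' g) = lform l - lform l'.
Proof. by rewrite -sumrB; apply: eq_bigr => i _; rewrite scalerBl. Qed.

(** Derivations of the polynomial ring are determined by their values on the
    coordinates, where both sides come from right multiplications. *)
Lemma Dx_lie x y f : Dx x (Dx y f) - Dx y (Dx x f) = Dx (lie x y) f.
Proof.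
have := @mpoly_derivation_eq (fun f => Dx x (Dx y f) - Dx y (Dx x f)) (Dx (lie x y)).
apply=> [a b|a b|a b|a b|c|c|i].
- by rewrite !DxD opprD addrACA.
- exact: DxD.
- rewrite !(DxM, DxD) mulrBl mulrBr.
  rewrite [Dx y a * Dx x b]mulrC [Dx x a * Dx y b]mulrC.
  set t1 := Dx x (Dx y a) * b; set t2 := Dx y (Dx x a) * b.
  set t3 := a * Dx x (Dx y b); set t4 := a * Dx y (Dx x b).
  set s1 := Dx x b * _; set s2 := Dx y b * _.
  rewrite [s2 + t3]addrC [s1 + t4]addrC addrACA [t2 + s2 + _]addrACA.
  by rewrite [s2 + s1]addrC opprD [LHS]addrACA subrr addr0 opprD addrACA.
- exact: DxM.
- by rewrite !DxC ?Dx0 subr0.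
- exact: DxC.
rewrite !Dx_X !Dx_lform; try exact: scalar_entry.
rewrite -lform_sub; apply: lform_eq => g.
by rewrite /lie mulmxBr linearB !mxE !mulmxA.
Qed.

Lemma lformD l l' : lform (fun g => l g + l' g) = lform l + lform l'.
Proof. by rewrite -big_split; apply: eq_bigr => i _; rewrite scalerDl. Qed.
Lemma lformZ c l : lform (fun g => c * l g) = c *: lform l.
Proof. by rewrite scaler_sumr; apply: eq_bigr => i _; rewrite scalerA. Qed.

Lemma Dx_addl x y f : Dx (x + y) f = Dx x f + Dx y f.
Proof.
rewrite /Dx -big_split; apply: eq_bigr => i _ /=; rewrite -mulrDr -lformD.
by congr (_ * _); apply: lform_eq => g; rewrite mulmxDr linearD mxE.
Qed.

Definition msub (c : M -> M) f : A := f \mPo [tuple lform (fun g => mxvec (c g) 0 i) | i < N].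

Lemma mxeval_comp (F : 'I_N -> A) f g h : (forall i, mxeval (F i) g = mxvec h 0 i) ->
  mxeval (f \mPo [tuple F i | i < N]) g = mxeval f h.
Proof.
move=> hF; rewrite /mxeval comp_mpoly_meval; apply: meval_eq => i.
by rewrite tnth_mktuple; apply: hF.
Qed.

Lemma mxeval_msub c f g : linear c -> mxeval (msub c f) g = mxeval f (c g).
Proof. by move=> lc; apply: mxeval_comp => i; rewrite lformE //; apply: scalar_entry. Qed.

Lemma msub_X c i : msub c 'X_i = lform (fun g => mxvec (c g) 0 i).
Proof. by rewrite /msub comp_mpolyXU -tnth_nth tnth_mktuple. Qed.

Lemma msub_lform c l : scalar l -> linear c -> msub c (lform l) = lform (fun g => l (c g)).
Proof.
move=> ll lc; rewrite /msub {1}/lform raddf_sum /=.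
under eq_bigr do rewrite comp_mpolyZ -/(msub c 'X__) msub_X scaler_sumr.
rewrite exchange_big /=; apply: eq_bigr => j _.
under eq_bigr do rewrite scalerA.
rewrite -scaler_suml; congr (_ *: _); rewrite (scalar_coord _ ll).
by apply: eq_bigr => i _; rewrite mulrC.
Qed.

Lemma Dx_msub_mull x a f : Dx x (msub (mulmx a) f) = msub (mulmx a) (Dx x f).
Proof.
elim/mpoly_alg_ind: f => [c|i|f p|f p].
- by rewrite DxC /msub comp_mpolyC DxC comp_mpoly0.
- rewrite msub_X Dx_X Dx_lform ?msub_lform //; try exact: scalar_entry.
  by apply: lform_eq => g; rewrite mulmxA.
- by rewrite DxD /msub !comp_mpolyD DxD => -> ->.
- by rewrite DxM /msub !rmorphM /= !rmorphD !rmorphM /= DxM => -> ->.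
Qed.

Lemma tangent_at H f a x : subgroup H -> H a -> vanishes_on H f -> tangent1 H x ->
  dd f a (a *m x) = 0.
Proof.
move=> [_ _ HM _] Ha hf hx; rewrite -mxeval_Dx -[a in LHS]mulmx1.
rewrite -(mxeval_msub _ _ (linear_mull a)) -Dx_msub_mull mxeval_Dx mul1mx.
by apply: hx => b Hb; rewrite (mxeval_msub _ _ (linear_mull a)); apply/hf/HM.
Qed.

(** Translating by a point of H reduces the claim to tangency at the identity.
    *)
Lemma vanish_Dx H f x : subgroup H -> vanishes_on H f -> tangent1 H x ->
  vanishes_on H (Dx x f).
Proof. by move=> gH hf hx a Ha; rewrite mxeval_Dx; apply: tangent_at hx. Qed.

Lemma tangent_lie H x y : subgroup H -> tangent1 H x -> tangent1 H y ->
  tangent1 H (lie x y).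
Proof.
move=> gH hx hy f hf; have [_ H1 _ _] := gH.
rewrite /dpoly1 -/(dd _ _ _) -[lie x y]mul1mx -mxeval_Dx -Dx_lie mxevalB.
by rewrite !(vanish_Dx gH (vanish_Dx gH hf _) _ H1) ?subrr.
Qed.

End VectorFields.
#[export] Hint Resolve linear_mulr linear_mull : core.

(** * The identity theorem for connected groups *)

Lemma choice2 (I J : Type) (P Q : I -> J -> Prop) :
  (forall i, exists2 j, P i j & Q i j) ->
  exists2 d, (forall i, P i (d i)) & forall i, Q i (d i).
Proof.
move=> h; have [i|d hd] := @choice I J (fun i j => P i j /\ Q i j).
  by have [j Pj Qj] := h i; exists j.
by exists d => i; case: (hd i).
Qed.

Section IdealPowers.
Variables (R : comNzRingType) (N : nat) (x : 'I_N -> R).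
Implicit Types f p : R.

(** The powers of the ideal generated by the family x. *)
Fixpoint ideal_pow r f : Prop :=
  if r is s.+1 then
    exists2 c : 'I_N -> R, (forall i, ideal_pow s (c i)) & f = \sum_i c i * x i
  else True.

Arguments ideal_pow : simpl never.

Lemma ideal_powSE r f : ideal_pow r.+1 f =
  exists2 c : 'I_N -> R, (forall i, ideal_pow r (c i)) & f = \sum_i c i * x i.
Proof. by []. Qed.

Lemma ideal_pow0 r : ideal_pow r 0.
Proof.
elim: r => // r IHr; rewrite ideal_powSE; exists (fun=> 0) => //.
by rewrite big1 // => i _; rewrite mul0r.
Qed.

Lemma ideal_powD r f p : ideal_pow r f -> ideal_pow r p -> ideal_pow r (f + p).
Proof.
elim: r f p => // r IHr f p; rewrite !ideal_powSE => -[c hc ->] [d hd ->].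
exists (fun i => c i + d i) => [i|]; first exact: IHr.
by rewrite -big_split; apply: eq_bigr => i _; rewrite mulrDl.
Qed.

Lemma ideal_pow_mull r p f : ideal_pow r f -> ideal_pow r (p * f).
Proof.
elim: r f p => // r IHr f p; rewrite !ideal_powSE => -[c hc ->].
exists (fun i => p * c i) => [i|]; first exact: IHr.
by rewrite mulr_sumr; apply: eq_bigr => i _; rewrite mulrA.
Qed.

Lemma ideal_powB r f p : ideal_pow r f -> ideal_pow r p -> ideal_pow r (f - p).
Proof. by move=> hf hp; rewrite -mulN1r; apply: ideal_powD => //; apply: ideal_pow_mull. Qed.

Lemma ideal_pow_sum r I (s : seq I) (Q : pred I) (F : I -> R) :
  (forall i, Q i -> ideal_pow r (F i)) -> ideal_pow r (\sum_(i <- s | Q i) F i).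
Proof.
by move=> h; elim/big_rec: _ => [|i p Qi]; [exact: ideal_pow0|apply: ideal_powD; apply: h].
Qed.

Lemma ideal_powM r s f p : ideal_pow r f -> ideal_pow s p -> ideal_pow (r + s) (f * p).
Proof.
elim: r f => [|r IHr] f; first by move=> _; exact: ideal_pow_mull.
rewrite addSn !ideal_powSE => -[c hc ->] hp; exists (fun i => c i * p) => [i|]; first exact: IHr.
by rewrite mulr_suml; apply: eq_bigr => i _; rewrite mulrAC.
Qed.

Lemma ideal_powS r f : ideal_pow r.+1 f -> ideal_pow r f.
Proof.
elim: r f => // r IHr f; rewrite ideal_powSE => -[c hc ->]; rewrite ideal_powSE.
by exists c => // i; apply: IHr.
Qed.

Lemma ideal_pow_gen i : ideal_pow 1 (x i).
Proof.
rewrite ideal_powSE; exists (fun j => (j == i)%:R) => //.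
rewrite (bigD1 i) //= eqxx mul1r big1 ?addr0 // => j ne.
by rewrite (negPf ne) mul0r.
Qed.

(** The Rees algebra of the ideal, as a quotient of a polynomial ring over R. *)
Let rees : {mpoly R[N]} -> {poly R} := mmap polyC (fun i => x i *: 'X).

Let reesD P Q : rees (P + Q) = rees P + rees Q. Proof. exact: rmorphD. Qed.
Let reesM P Q : rees (P * Q) = rees P * rees Q. Proof. exact: rmorphM. Qed.
Let rees_sum I (s : seq I) (F : I -> {mpoly R[N]}) :
  rees (\sum_(i <- s) F i) = \sum_(i <- s) rees (F i).
Proof. exact: rmorph_sum. Qed.

Let rees_pow P j : ideal_pow j (rees P)`_j.
Proof.
elim/mpoly_alg_ind: P j => [c|i|P Q hP hQ|P Q hP hQ] j.
- rewrite /rees mmapC coefC; case: j => //= j; exact: ideal_pow0.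
- rewrite /rees mmapX mmap1U coefZ coefX; case: eqP => [->|_].
    by rewrite mulr1; apply: ideal_pow_gen.
  by rewrite mulr0; exact: ideal_pow0.
- by rewrite reesD coefD; apply: ideal_powD.
- rewrite reesM coefM; apply: ideal_pow_sum => i _.
  by rewrite -{1}(subnKC (leq_ord i)); apply: ideal_powM.
Qed.

Let pow_rees r f : ideal_pow r f -> exists P, rees P = f *: 'X^r.
Proof.
elim: r f => [|r IHr] f.
  by exists f%:MP; rewrite /rees mmapC expr0 alg_polyC.
rewrite ideal_powSE => -[c hc ->].
have [P PE] := choice (fun i => IHr (c i) (hc i)).
exists (\sum_i P i * 'X_i); rewrite rees_sum scaler_suml; apply: eq_bigr => i _.
by rewrite reesM PE /rees mmapX mmap1U -scalerAr -scalerAl scalerA exprSr mulrC.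
Qed.

(** The heart of Perdry's proof of Krull's intersection theorem: u r is lifted
    to a form of degree r with coefficients in R, and the basis theorem applies
    to the forms. *)
Lemma ideal_pow_relation (u : nat -> R) : noetherian R ->
  (forall r, ideal_pow r (u r)) -> exists s (c : nat -> R),
  (forall j, (j < s)%N -> ideal_pow (s - j) (c j)) /\ u s = \sum_(j < s) c j * u j.
Proof.
move=> nR hu; have [P PE] := choice (fun r => pow_rees (hu r)).
have [s [Q PsE]] := noetherian_mpoly (m := N) nR P.
exists s, (fun j => (rees (Q j))`_(s - j)); split => [j _|]; first exact: rees_pow.
have := congr1 (fun T => (rees T)`_s) PsE.
rewrite PE coefZ coefXn eqxx mulr1 rees_sum coef_sum => ->.
apply: eq_bigr => i _; rewrite reesM PE -scalerAr coefZ coefMXn.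
by rewrite ltnNge (ltnW (ltn_ord i)) mulrC.
Qed.

End IdealPowers.

Section IdentityTheorem.
Variables (k : closedFieldType) (n : nat).
Hypothesis char0 : [pchar k] =i pred0.
Local Notation M := 'M[k]_n.
Local Notation N := (n * n)%N.
Local Notation A := {mpoly k[N]}.
Implicit Types (f p q : A) (x y g v : M) (H : set M).

Lemma char0_natf_eq0 m : (m%:R == 0 :> k) = (m == 0)%N.
Proof. by move/pcharf0P: char0 => ->. Qed.

Lemma mxvecDE (u v : M) i : mxvec (u + v) 0 i = mxvec u 0 i + mxvec v 0 i.
Proof. by rewrite linearD !mxE. Qed.

(** Coordinates centred at the identity; locked, as they are not to be expanded
    by simplification. *)
Definition coord1 (i : 'I_N) : A := locked ('X_i - (mxvec (1%:M : M) 0 i)%:MP).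

Lemma coord1E i : coord1 i = 'X_i - (mxvec (1%:M : M) 0 i)%:MP.
Proof. by rewrite /coord1 -lock. Qed.

Lemma mxeval_coord1 i g : mxeval (coord1 i) g = mxvec (g - 1%:M) 0 i.
Proof. by rewrite coord1E !mxevalE linearB !mxE. Qed.

Local Notation order_ge := (ideal_pow coord1).

Lemma order_ge1 f : mxeval f 1%:M = 0 -> order_ge 1 f.
Proof.
suff h : order_ge 1 (f - (mxeval f 1%:M)%:MP) by move=> f0; rewrite f0 mpolyC0 subr0 in h.
elim/mpoly_alg_ind: f => [c|i|f p hf hp|f p hf hp].
- by rewrite mxevalC subrr; exact: ideal_pow0.
- rewrite mxevalX -coord1E; rewrite ideal_powSE; exists (fun j => (j == i)%:R) => //.
  rewrite (bigD1 i) //= eqxx mul1r big1 ?addr0 // => j ne.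
  by rewrite (negPf ne) mul0r.
- by rewrite mxevalD mpolyCD opprD addrACA; apply: ideal_powD.
- rewrite mxevalM mpolyCM.
  rewrite -[f * p](subrK (f * (mxeval p 1%:M)%:MP)) -mulrBr -addrA -mulrBl.
  by rewrite [X in _ + X]mulrC; apply: ideal_powD; apply: ideal_pow_mull.
Qed.

Lemma order_ge_eval r f : order_ge r.+1 f -> mxeval f 1%:M = 0.
Proof.
case=> c _ ->; rewrite mxeval_sum big1 // => i _.
by rewrite mxevalM mxeval_coord1 subrr linear0 mxE mulr0.
Qed.

Lemma mderiv_coord1 i j : (coord1 i)^`M(j) = ((i == j)%:R)%:MP.
Proof. by rewrite coord1E mderivB mderivC subr0 mderivXU. Qed.

Lemma mderiv_sum I (r : seq I) (F : I -> A) j :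
  (\sum_(i <- r) F i)^`M(j) = \sum_(i <- r) (F i)^`M(j).
Proof. exact: (big_morph (mderiv j) (mderivD j) (mderiv0 _ j)). Qed.

Lemma order_ge_mderiv r f j : order_ge r.+1 f -> order_ge r f^`M(j).
Proof.
elim: r f => // r IHr f; rewrite ideal_powSE => -[c hc ->]; rewrite mderiv_sum; apply: ideal_pow_sum => i _.
rewrite mderivM; apply: ideal_powD.
  rewrite -addn1; apply: ideal_powM; first by apply: IHr; exact: hc.
  exact: ideal_pow_gen.
by rewrite mulrC; apply: ideal_pow_mull; exact: hc.
Qed.

(** Euler's identity modulo higher order terms. *)
Lemma order_ge_euler r f : order_ge r f ->
  order_ge r.+1 ((\sum_j coord1 j * f^`M(j)) - r%:R *: f).
Proof.
elim: r f => [|r IHr] f.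
  move=> _; rewrite scale0r subr0; apply: order_ge1; rewrite mxeval_sum big1 // => j _.
  by rewrite mxevalM mxeval_coord1 subrr linear0 mxE mul0r.
rewrite ideal_powSE => -[c hc fE].
have e : \sum_j coord1 j * f^`M(j) =
    \sum_i (\sum_j coord1 j * (c i)^`M(j)) * coord1 i + f.
  under [\sum_i _ * coord1 i]eq_bigr do rewrite mulr_suml.
  rewrite exchange_big fE -big_split /=; apply: eq_bigr => j _.
  rewrite raddf_sum mulr_sumr /=; under eq_bigr do rewrite mderivM mulrDr !mulrA mderiv_coord1.
  rewrite big_split /=; congr (_ + _).
  rewrite (bigD1 j) //= eqxx mpolyC1 mulr1 mulrC.
  by rewrite big1 ?addr0 // => i ne; rewrite (negPf ne) mpolyC0 !mulr0.
rewrite ideal_powSE; exists (fun i => (\sum_j coord1 j * (c i)^`M(j)) - r%:R *: c i) => [i|].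
  exact: IHr.
under [RHS]eq_bigr do rewrite mulrBl -scalerAl.
by rewrite e sumrB -scaler_sumr -fE -natr1 scalerDl scale1r opprD addrACA subrr addr0.
Qed.

(** By Euler's identity r f is determined by the derivatives of f, up to higher
    order, and r is invertible in characteristic 0. *)
Lemma order_ge_char0 r f : mxeval f 1%:M = 0 -> (forall j, order_ge r f^`M(j)) ->
  order_ge r.+1 f.
Proof.
move=> f0; elim: r => [|r IHr] h; first exact: order_ge1.
have fr : order_ge r.+1 f by apply: IHr => j; apply: ideal_powS.
have nz : (r.+1%:R : k) != 0 by rewrite char0_natf_eq0.
have -> : f = r.+1%:R^-1 *: ((\sum_j coord1 j * f^`M(j)) -
    ((\sum_j coord1 j * f^`M(j)) - r.+1%:R *: f)).
  by rewrite opprB addrC subrK scalerA mulVf ?scale1r.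
rewrite -mul_mpolyC; apply: ideal_pow_mull; apply: ideal_powB; last exact: order_ge_euler.
apply: ideal_pow_sum => j _; rewrite -[r.+2]add1n; apply: ideal_powM => //.
by apply: order_ge1; rewrite mxeval_coord1 subrr linear0 mxE.
Qed.

Section ConnectedGroup.
Variable H : set M.
Hypotheses (grpH : closed_subgroup H) (conH : zconnected H).

Let sgH : subgroup H. Proof. by case: grpH. Qed.
Let H1 : H 1%:M. Proof. by case: sgH. Qed.
Let clH : zclosed H. Proof. by case: grpH. Qed.

Definition Dxs (s : seq M) f := foldr (@Dx k n) f s.

Lemma Dxs_cons x s f : Dxs (x :: s) f = Dx x (Dxs s f).
Proof. by []. Qed.

(** The functions whose Taylor series at the identity vanishes along H. *)
Definition flat f := forall s, (forall x, x \in s -> tangent1 H x) -> mxeval (Dxs s f) 1%:M = 0.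

Lemma vanish_Dxs f s : vanishes_on H f -> (forall x, x \in s -> tangent1 H x) ->
  vanishes_on H (Dxs s f).
Proof.
move=> hf; elim: s => //= x s IHs hs; apply: vanish_Dx => //.
  by apply: IHs => y ys; apply: hs; rewrite inE ys orbT.
by apply: hs; rewrite mem_head.
Qed.

Lemma vanish_flat f : vanishes_on H f -> flat f.
Proof. by move=> hf s hs; apply: vanish_Dxs. Qed.

Lemma DxsD s f p : Dxs s (f + p) = Dxs s f + Dxs s p.
Proof. by elim: s => //= x s ->; rewrite DxD. Qed.

Lemma flatD f p : flat f -> flat p -> flat (f + p).
Proof. by move=> hf hp s hs; rewrite DxsD mxevalD hf ?hp ?addr0. Qed.

Lemma Dxs_rcons s x f : Dxs (rcons s x) f = Dxs s (Dx x f).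
Proof. by rewrite /Dxs foldr_rcons. Qed.

Lemma flat_Dx f x : tangent1 H x -> flat f -> flat (Dx x f).
Proof.
move=> hx hf s hs; rewrite -Dxs_rcons; apply: hf => y.
by rewrite mem_rcons inE => /orP[/eqP->|/hs].
Qed.

Lemma flatM p f : flat f -> flat (p * f).
Proof.
move=> hf s; elim/last_ind: s f hf p => [|s x IHs] f hf p hs.
  by rewrite /= mxevalM (hf [::]) ?mulr0.
have hx : tangent1 H x by apply: hs; rewrite mem_rcons mem_head.
have hs' y : y \in s -> tangent1 H y by move=> ys; apply: hs; rewrite mem_rcons inE ys orbT.
rewrite Dxs_rcons DxM DxsD mxevalD !IHs ?addr0 //; exact: flat_Dx.
Qed.

(** Substituting the affine projection of GL_n onto 1 + Lie H. *)
Let pi : M -> M := projv (Lie H).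

Let pi_lin : linear pi. Proof. by move=> a u v; rewrite /pi linearP. Qed.

Let piT x : tangent1 H (pi x). Proof. by apply/LieP; apply: memv_proj. Qed.

Let pf i : A := lform (fun g => mxvec (pi g) 0 i) + (mxvec (1%:M - pi 1%:M) 0 i)%:MP.

Let Psub f : A := f \mPo [tuple pf i | i < N].

Let PsubM f p : Psub (f * p) = Psub f * Psub p. Proof. exact: rmorphM. Qed.
Let PsubD f p : Psub (f + p) = Psub f + Psub p. Proof. exact: rmorphD. Qed.
Let PsubB f p : Psub (f - p) = Psub f - Psub p. Proof. exact: rmorphB. Qed.

Let Psub_sum I (r : seq I) (F : I -> A) : Psub (\sum_(i <- r) F i) = \sum_(i <- r) Psub (F i).
Proof. exact: (big_morph Psub PsubD (comp_mpoly0 _)). Qed.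

Let mxeval_Psub f : mxeval (Psub f) 1%:M = mxeval f 1%:M.
Proof.
apply: mxeval_comp => i; rewrite /pf mxevalD mxevalC lformE; last exact: scalar_entry.
by rewrite -mxvecDE addrC subrK.
Qed.

Let mderiv_lform l j : (lform l)^`M(j) = (l (vec_mx (delta_mx 0 j)))%:MP :> A.
Proof.
rewrite /lform raddf_sum (bigD1 j) //= linearZ /= mderivXU eqxx mpolyC1.
rewrite big1 ?addr0 => [|i ne]; first by rewrite -mul_mpolyC mulr1.
by rewrite linearZ /= mderivXU (negPf ne) mpolyC0 scaler0.
Qed.

Let Psub_order r f : order_ge r f -> order_ge r (Psub f).
Proof.
elim: r f => // r IHr f; rewrite ideal_powSE => -[c hc ->]; rewrite Psub_sum; apply: ideal_pow_sum => i _.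
rewrite PsubM -addn1; apply: ideal_powM; first exact: IHr.
by apply: order_ge1; rewrite mxeval_Psub mxeval_coord1 subrr linear0 mxE.
Qed.

Let Psub_mderiv f i : (Psub f)^`M(i) =
  Psub (\sum_j f^`M(j) * (mxvec (pi (vec_mx (delta_mx 0 i))) 0 j)%:MP).
Proof.
pose h : {rmorphism A -> A} := comp_mpoly [tuple pf i | i < N].
rewrite -[Psub f]/(h f) (@mderiv_chain k n {mpoly k[N]} h (fun a => a^`M(i))) /=.
- rewrite /Psub raddf_sum /=; apply: eq_bigr => j _.
  rewrite rmorphM /= comp_mpolyC; congr (_ * _).
  by rewrite comp_mpolyXU -tnth_nth tnth_mktuple /pf mderivD mderivC addr0 mderiv_lform.
- by move=> a b; rewrite mderivD.
- by move=> a b; rewrite mderivM.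
- by move=> c; rewrite comp_mpolyC mderivC.
Qed.

Let Dx_const r x f : order_ge r f ->
  order_ge r (Dx x f - \sum_j f^`M(j) * (mxvec x 0 j)%:MP).
Proof.
case: r => // r hf; rewrite /Dx -sumrB; apply: ideal_pow_sum => j _.
rewrite -mulrBr -addn1; apply: ideal_powM; first exact: order_ge_mderiv.
apply: order_ge1; rewrite mxevalB mxevalC lformE ?mul1mx ?subrr //.
exact: scalar_entry.
Qed.

(** The differential of Psub f only involves directions in Lie H, along which
    the derivatives of f are flat again. *)
Let flat_Psub r f : flat f -> order_ge r f -> order_ge r.+1 (Psub f).
Proof.
elim: r f => [|r IHr] f hf fr.
  by apply: order_ge1; rewrite mxeval_Psub; apply: (hf [::]).
apply: order_ge_char0 => [|i]; first by rewrite mxeval_Psub; apply: (hf [::]).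
rewrite Psub_mderiv; set x := pi _; set d := \sum_j _.
rewrite -[d](subKr (Dx x f)) PsubB; apply: ideal_powB; last first.
  by apply: Psub_order; apply: Dx_const.
apply: IHr; first exact: flat_Dx (piT _) hf.
by apply: ideal_pow_sum => j _; rewrite mulrC; apply/ideal_pow_mull/order_ge_mderiv.
Qed.

(** Otherwise some matrix x separates l from the differentials of the functions
    vanishing on H; these kill x, so that x is tangent to H, whereas l x <> 0.
    *)
Let annihilator l : scalar l -> (forall x, tangent1 H x -> l x = 0) ->
  exists2 f, vanishes_on H f & forall j, mxeval f^`M(j) 1%:M = l (vec_mx (delta_mx 0 j)).
Proof.
move=> ll lH.
pose Q (w : 'rV[k]_N) := exists2 f, vanishes_on H f & forall j, mxeval f^`M(j) 1%:M = w 0 j.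
have [|a x y [f hf fx] [p hp py]|V VP] := @vspace_of_pred _ _ Q.
- by exists 0 => [x _|j]; rewrite ?raddf0 ?mxE /mxeval meval0.
- exists (a *: f + p) => [z Hz|j]; first by rewrite mxevalD mxevalZ hf ?hp ?mulr0 ?addr0.
  by rewrite mderivD mderivZ mxevalD mxevalZ fx py !mxE.
pose w := \row_j l (vec_mx (delta_mx 0 j)).
case: (boolP (w \in V)) => [/VP[f hf fw]|nw].
  by exists f => // j; rewrite fw mxE.
have [phi [phiV /eqP[]]] := separating_form nw.
pose x := vec_mx (\row_j phi (delta_mx 0 j)) : M.
have phiE u : phi u = \sum_j u 0 j * mxvec x 0 j.
  rewrite {1}[u]row_sum_delta linear_sum; apply: eq_bigr => j _.
  by rewrite linearZ vec_mxK mxE.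
rewrite phiE -[RHS](lH x) ?(scalar_coord x ll).
  by apply: eq_bigr => j _; rewrite mxE mulrC.
move=> f hf; rewrite -[RHS](phiV (\row_j mxeval f^`M(j) 1%:M)) ?phiE.
  by apply: eq_bigr => j _; rewrite mxE.
by apply/VP; exists f => // j; rewrite mxE.
Qed.

Let coord_diff i : exists2 f, vanishes_on H f & order_ge 2 (coord1 i - Psub (coord1 i) - f).
Proof.
pose l v := mxvec v 0 i - mxvec (pi v) 0 i.
have ll : scalar l.
  by move=> a u v; rewrite /l pi_lin !linearP !mxE /= mulrBr opprD addrACA.
have lH x : tangent1 H x -> l x = 0.
  by move/LieP => hx; rewrite /l /pi projv_id ?subrr.
have [f hf fl] := annihilator ll lH; exists f => //.
have fE : mxeval (coord1 i - Psub (coord1 i) - f) 1%:M = 0.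
  by rewrite mxevalB (hf _ H1) subr0 mxevalB mxeval_Psub subrr.
apply: order_ge_char0 => // j; apply: order_ge1.
have e1 : mxeval (coord1 i)^`M(j) 1%:M = (i == j)%:R by rewrite mderiv_coord1 mxevalC.
have e2 : mxeval (Psub (coord1 i))^`M(j) 1%:M = mxvec (pi (vec_mx (delta_mx 0 j))) 0 i.
  rewrite Psub_mderiv mxeval_Psub mxeval_sum (bigD1 i) //= mderiv_coord1 eqxx mpolyC1 mul1r mxevalC.
  by rewrite big1 ?addr0 // => l' ne; rewrite mderiv_coord1 eq_sym (negPf ne) mpolyC0 mul0r /mxeval meval0.
rewrite (mderivB j _ f) mxevalB (mderivB j (coord1 i)) mxevalB fl e1 e2.
by rewrite /l vec_mxK mxE eqxx subrr.
Qed.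

(** Up to higher order, a function and its restriction to 1 + Lie H differ by a
    function vanishing on H. For a coordinate this is the case of [annihilator];
    products are treated one factor at a time. *)
Let sub_diff r f : order_ge r f ->
  exists2 p, vanishes_on H p & order_ge r.+1 (f - Psub f - p).
Proof.
have v0 : vanishes_on H (0 : A) by move=> x _; rewrite /mxeval meval0.
elim: r f => [|r IHr] f.
  move=> _; exists 0 => //; apply: order_ge1.
  by rewrite !mxevalB mxeval_Psub subrr sub0r /mxeval meval0 oppr0.
rewrite ideal_powSE => -[c hc ->].
have [d hd dP] := choice2 (fun i => IHr (c i) (hc i)).
have [e he eP] := choice2 coord_diff.
exists (\sum_i (d i * coord1 i + Psub (c i) * e i)).
  move=> x Hx; rewrite mxeval_sum big1 // => i _.
  by rewrite !mxevalE hd ?he ?mul0r ?mulr0 ?addr0.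
rewrite Psub_sum -sumrB -sumrB; apply: ideal_pow_sum => i _.
rewrite PsubM.
have -> : c i * coord1 i - Psub (c i) * Psub (coord1 i) -
    (d i * coord1 i + Psub (c i) * e i) =
  (c i - Psub (c i) - d i) * coord1 i + Psub (c i) * (coord1 i - Psub (coord1 i) - e i).
  rewrite !mulrBl !mulrBr opprD !addrA; set x := Psub (c i) * coord1 i.
  set y := d i * coord1 i; set z := c i * coord1 i.
  by rewrite [z - x - y]addrAC subrK [z - y - _]addrAC.
apply: ideal_powD.
  rewrite -[r.+2]addn1; apply: ideal_powM => //.
  exact: ideal_pow_gen.
by rewrite -[r.+2]addn2; apply: ideal_powM => //; apply: Psub_order.
Qed.

(** When f is flat, Psub f has higher order than f, so that [sub_diff] improves
    the order of the remainder at each step. *)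
Lemma flat_order f : flat f -> forall r, exists2 p, vanishes_on H p & order_ge r (f - p).
Proof.
move=> hf; elim=> [|r [p hp fp]]; first by exists 0 => // x _; rewrite /mxeval meval0.
have [q hq fq] := sub_diff fp; exists (p + q).
  by move=> x Hx; rewrite mxevalD hp ?hq ?addr0.
have -> : f - (p + q) = (f - p - Psub (f - p) - q) + Psub (f - p).
  by rewrite addrAC subrK opprD addrA.
apply: ideal_powD => //; apply: flat_Psub => //.
apply: flatD => //; rewrite -mulN1r; apply: flatM; exact: vanish_flat.
Qed.

(** Krull's intersection theorem, for the local ring of H at the identity. *)
Lemma krull f : flat f -> exists2 q, mxeval q 1%:M = 0 & vanishes_on H (f - q * f).
Proof.
move=> hf; have [p hp fp] := choice2 (flat_order hf).
have nA : noetherian {mpoly k[N]} by apply/noetherian_mpoly/noetherian_field.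
have [s [c [hc cE]]] := ideal_pow_relation nA fp.
exists (\sum_(j < s) c j).
  rewrite mxeval_sum big1 // => i _; have := hc i (ltn_ord i).
  by case: (s - i)%N (ltn_ord i) (subn_gt0 i s) => [->|m _ _ /order_ge_eval].
move=> x Hx; rewrite -{1}(subrK (p s) f) cE mxevalB mxevalD hp // addr0 mulr_suml.
rewrite -mxevalB -sumrB mxeval_sum big1 // => i _.
by rewrite -mulrBr mxevalM addrAC subrr sub0r mxevalN hp // oppr0 mulr0.
Qed.

(** By [krull] and finite generation, one function q with q(1) = 1 kills all the
    flat functions on H. Hence the points of H at which all flat functions
    vanish form a closed subset C0 whose complement C1 in H is closed as well:
    translates of q cut it out. *)
Theorem identity_theorem f : flat f -> vanishes_on H f.
Proof.
have nA : noetherian {mpoly k[N]} by apply/noetherian_mpoly/noetherian_field.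
have [L LF Lspan] := noetherian_fin flat nA.
have [q q1 hq] : exists2 q, mxeval q 1%:M = 1 & forall f, flat f -> vanishes_on H (q * f).
  suff [q q1 hq] : exists2 q, mxeval q 1%:M = 1 & forall f, f \in L -> vanishes_on H (q * f).
    exists q => // p /Lspan[c ->] x Hx; rewrite mulr_sumr mxeval_sum big1 // => i _.
    by rewrite mulrCA mxevalM hq ?mulr0 // mem_nth.
  elim: L LF {Lspan} => [|l L IHL] LF; first by exists 1; rewrite // /mxeval meval1.
  have [|q q1 hq] := IHL; first by move=> y yL; apply: LF; rewrite inE yL orbT.
  have [p p1 hp] := krull (LF l (mem_head _ _)).
  exists (q * (1 - p)) => [|y].
    by rewrite mxevalM q1 mul1r mxevalB p1 subr0 /mxeval meval1.
  rewrite inE => /orP[/eqP->|yL] x Hx; rewrite -mulrA mxevalM.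
    by rewrite mulrBl mul1r hp ?mulr0.
  by rewrite mxevalM mulrCA -mxevalM hq ?mulr0.
(* C0 and C1 partition H; C1 is cut out by the translates of q. *)
move=> hf; pose C0 : set M := [set a | H a /\ forall p, flat p -> mxeval p a = 0].
have flatL a p : C0 a -> flat p -> flat (msub (mulmx a) p).
  move=> [Ha ha] hp s hs; have -> : Dxs s (msub (mulmx a) p) = msub (mulmx a) (Dxs s p).
    by elim: s {hs} => // x s IHs; rewrite !Dxs_cons IHs Dx_msub_mull.
  rewrite mxeval_msub // mulmx1; apply: ha => t ht; rewrite /Dxs -foldr_cat; apply: hp.
  by move=> x; rewrite mem_cat => /orP[/ht|/hs].
pose C1 : set M := [set b | H b /\ forall a, C0 a -> mxeval q (invmx a *m b) = 0].
have HU : H `<=` [set x | x \in unitmx] by case: sgH.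
have clC0 : zclosed C0.
  split=> [x [/HU//]|x ux hx]; split; last by move=> p hp; apply: hx => y [_]; apply.
  by case: clH => _; apply=> // p hp; apply: hx => y [Hy _]; apply: hp.
have clC1 : zclosed C1.
  split=> [x [/HU//]|x ux hx]; split.
    by case: clH => _; apply=> // p hp; apply: hx => y [Hy _]; apply: hp.
  move=> a ha; rewrite -(mxeval_msub _ _ (linear_mull (invmx a))); apply: hx => y [_ hy].
  by rewrite mxeval_msub //; apply: hy.
have C01 : C0 `&` C1 = set0.
  apply/seteqP; split=> // x [hx [_ /(_ _ hx)]]; have [/HU ux _] := hx.
  by rewrite mulVmx // q1 => /eqP; rewrite oner_eq0.
have HC : H = C0 `|` C1.
  apply/seteqP; split=> [x Hx|x [[]|[]] //].
  have [|nx] := pselect (forall p, flat p -> mxeval p x = 0); first by left.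
  right; split=> // a ha; have [p hp px] : exists2 p, flat p & mxeval p x != 0.
    apply: contrapT => h; apply: nx => p hp; apply/eqP/negP => /negP px.
    by apply: h; exists p.
  have := hq _ (flatL _ _ ha hp) (invmx a *m x); have [Ha _] := ha.
  case: sgH => _ _ HM HV; rewrite mxevalM mxeval_msub // mulKVmx; last exact: HU.
  by move=> /(_ (HM _ _ (HV _ Ha) Hx))/eqP; rewrite mulf_eq0 (negPf px) orbF => /eqP.
have C0_1 : C0 1%:M by split=> // p hp; apply: (hp [::]).
have [C00|C10] := conH clC0 clC1 HC C01; first by move: C0_1; rewrite C00.
by move=> x; rewrite HC C10 setU0 => -[_]; apply.
Qed.

End ConnectedGroup.

End IdentityTheorem.

(** * Zariski closure, polynomial functions and arcs *)

Section Closure.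
Variables (k : closedFieldType) (n : nat).
Hypothesis char0 : [pchar k] =i pred0.
Local Notation M := 'M[k]_n.
Implicit Types (x y g a : M) (H K T C D : set M).

Lemma natr_inj0 : injective (fun i : nat => i%:R : k).
Proof.
move=> i j; wlog le_ij : i j / (i <= j)%N => [hw e|].
  by case/orP: (leq_total i j) => [/hw/(_ e)|/hw/(_ (esym e))].
move=> e; apply/eqP; rewrite eqn_leq le_ij /= -subn_eq0 -(char0_natf_eq0 char0).
by rewrite natrB // e subrr.
Qed.

Lemma poly0_nz (p : {poly k}) : (forall s, s != 0 -> p.[s] = 0) -> p = 0.
Proof.
move=> hp; apply/eqP; apply: contraT => p0.
have := @max_poly_roots _ p [seq i.+1%:R | i <- iota 0 (size p)] p0.
rewrite size_map size_iota ltnn; apply; last first.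
  by rewrite map_inj_uniq ?iota_uniq // => i j /natr_inj0[].
by apply/allP => _ /mapP[i _ ->]; rewrite rootE hp ?char0_natf_eq0.
Qed.

(** Clearing denominators: d is a common denominator for the entries of phi, and
    a power of it is one for any polynomial in these entries. *)
Lemma pullback_fun (X : Type) (S : (X -> k) -> Prop) (Y : set X) (phi : X -> M) (d : X -> k) :
  (forall c, S (fun=> c)) -> (forall u v, S u -> S v -> S (fun t => u t + v t)) ->
  (forall u v, S u -> S v -> S (fun t => u t * v t)) -> S d ->
  (forall i j, exists2 u, S u & forall t, Y t -> u t = d t * phi t i j) ->
  forall f, exists u e, S u /\ forall t, Y t -> u t = mxeval f (phi t) * d t ^+ e.
Proof.
move=> SC SD SM Sd Sphi.
have SX e : S (fun t => d t ^+ e).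
  elim: e => [|e IHe]; first exact: SC.
  have -> : (fun t => d t ^+ e.+1) = (fun t => d t * d t ^+ e) by apply/funext => t; rewrite exprS.
  exact: (SM _ _ Sd IHe).
elim/mpoly_alg_ind => [c|i|f p [u [e [Su uE]]] [v [e' [Sv vE]]]
    |f p [u [e [Su uE]]] [v [e' [Sv vE]]]].
- by exists (fun=> c), 0%N; split=> // x _; rewrite mxevalC mulr1.
- case: (mxvec_indexP i) => i1 j1.
  have [u Su uE] := Sphi i1 j1; exists u, 1%N; split=> // x Yx.
  by rewrite uE // expr1 mxevalX mxvecE mulrC.
- exists (fun t => u t * d t ^+ e' + v t * d t ^+ e), (e + e')%N; split.
    by apply: SD; apply: SM => //; apply: SX.
  move=> x Yx; rewrite uE // vE // mxevalD mulrDl -!mulrA -!exprD.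
  by rewrite [(e' + e)%N]addnC.
- exists (fun t => u t * v t), (e + e')%N; split; first exact: SM.
  by move=> x Yx; rewrite uE // vE // mxevalM exprD mulrACA.
Qed.

Definition pfun (u : M -> k) : Prop := exists f, forall x, mxeval f x = u x.

Lemma pfunC c : pfun (fun=> c).
Proof. by exists c%:MP => x; rewrite mxevalC. Qed.
Lemma pfunD u v : pfun u -> pfun v -> pfun (fun x => u x + v x).
Proof. by move=> [f fE] [p pE]; exists (f + p) => x; rewrite mxevalD fE pE. Qed.
Lemma pfunM u v : pfun u -> pfun v -> pfun (fun x => u x * v x).
Proof. by move=> [f fE] [p pE]; exists (f * p) => x; rewrite mxevalM fE pE. Qed.
Lemma pfun_ext u v : u =1 v -> pfun u -> pfun v.
Proof. by move=> e [f fE]; exists f => x; rewrite fE e. Qed.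
Lemma pfun_sum (I : eqType) (r : seq I) (P : pred I) (u : I -> M -> k) :
  (forall i, pfun (u i)) -> pfun (fun x => \sum_(i <- r | P i) u i x).
Proof.
move=> hu; elim: r => [|i r IHr].
  by apply: (pfun_ext _ (pfunC 0)) => x; rewrite big_nil.
case: (boolP (P i)) => Pi.
  by apply: (pfun_ext _ (pfunD (hu i) IHr)) => x; rewrite big_cons Pi.
by apply: (pfun_ext _ IHr) => x; rewrite big_cons (negPf Pi).
Qed.
Lemma pfun_prod (I : eqType) (r : seq I) (u : I -> M -> k) :
  (forall i, pfun (u i)) -> pfun (fun x => \prod_(i <- r) u i x).
Proof.
move=> hu; elim: r => [|i r IHr].
  by apply: (pfun_ext _ (pfunC 1)) => x; rewrite big_nil.
by apply: (pfun_ext _ (pfunM (hu i) IHr)) => x; rewrite big_cons.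
Qed.
Lemma pfun_entry i j : pfun (fun x => x i j).
Proof. by exists 'X_(mxvec_index i j) => x; rewrite mxevalX mxvecE. Qed.

Definition pmap (m m' : nat) (c : M -> 'M[k]_(m, m')) : Prop :=
  forall i j, pfun (fun x => c x i j).

Lemma pmap_id : pmap id. Proof. exact: pfun_entry. Qed.
Lemma pmapC m m' (a : 'M[k]_(m, m')) : pmap (fun=> a).
Proof. by move=> i j; exact: pfunC. Qed.
Lemma pmapD m m' (c d : M -> 'M[k]_(m, m')) : pmap c -> pmap d -> pmap (fun x => c x + d x).
Proof. by move=> hc hd i j; apply: (pfun_ext _ (pfunD (hc i j) (hd i j))) => x; rewrite mxE. Qed.
Lemma pmapZ m m' u (c : M -> 'M[k]_(m, m')) : pfun u -> pmap c -> pmap (fun x => u x *: c x).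
Proof. by move=> hu hc i j; apply: (pfun_ext _ (pfunM hu (hc i j))) => x; rewrite mxE. Qed.
Lemma pmapM m m' m'' (c : M -> 'M[k]_(m, m')) (d : M -> 'M[k]_(m', m'')) :
  pmap c -> pmap d -> pmap (fun x => c x *m d x).
Proof.
move=> hc hd i j; have := pfun_sum (index_enum _) xpredT (fun l => pfunM (hc i l) (hd l j)).
by apply: pfun_ext => x; rewrite mxE.
Qed.
Lemma pmapB m m' (c d : M -> 'M[k]_(m, m')) : pmap c -> pmap d -> pmap (fun x => c x - d x).
Proof.
move=> hc hd; have := pmapD hc (pmapZ (pfunC (-1)) hd).
by move=> h i j; apply: (pfun_ext _ (h i j)) => x; rewrite scaleN1r.
Qed.
Lemma pmap_sum m m' (I : eqType) (r : seq I) (c : I -> M -> 'M[k]_(m, m')) :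
  (forall i, pmap (c i)) -> pmap (fun x => \sum_(i <- r) c i x).
Proof.
move=> hc i j; have := pfun_sum r xpredT (fun l => hc l i j).
by apply: pfun_ext => x; rewrite summxE.
Qed.

Lemma pfun_det m (c : M -> 'M[k]_m) : pmap c -> pfun (fun x => \det (c x)).
Proof.
move=> hc; apply: (pfun_sum _ xpredT) => s; apply: pfunM; first exact: pfunC.
by apply: pfun_prod => i.
Qed.

Lemma pmap_adj m (c : M -> 'M[k]_m) : pmap c -> pmap (fun x => \adj (c x)).
Proof.
move=> hc i j.
have h : pfun (fun x => cofactor (c x) j i).
  apply: pfunM; first exact: pfunC.
  apply: pfun_det => a b; apply: (pfun_ext _ (hc (lift j a) (lift i b))) => x.
  by rewrite !mxE.
by apply: (pfun_ext _ h) => x; rewrite mxE.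
Qed.

Lemma pfun_pullback f (c : M -> M) : pmap c -> pfun (fun x => mxeval f (c x)).
Proof.
move=> hc; elim/mpoly_alg_ind: f => [b|i|f p hf hp|f p hf hp].
- by apply: (pfun_ext _ (pfunC b)) => x; rewrite mxevalC.
- case: (mxvec_indexP i) => a b.
  by apply: (pfun_ext _ (hc a b)) => x; rewrite mxevalX mxvecE.
- by apply: (pfun_ext _ (pfunD hf hp)) => x; rewrite mxevalD.
- by apply: (pfun_ext _ (pfunM hf hp)) => x; rewrite mxevalM.
Qed.

Lemma pmap_comp (c d : M -> M) : pmap c -> pmap d -> pmap (fun x => d (c x)).
Proof.
move=> hc hd i j; have [f fE] := hd i j.
by apply: (pfun_ext _ (pfun_pullback f hc)) => x; rewrite fE.
Qed.

Definition zclosure A : set M :=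
  [set x | x \in unitmx /\ forall f, vanishes_on A f -> mxeval f x = 0].

Lemma zclosure_sub K : K `<=` [set x | x \in unitmx] -> K `<=` zclosure K.
Proof. by move=> KU x Kx; split=> [|f]; [exact: KU|apply]. Qed.

Lemma zclosure_vanish K f : vanishes_on K f -> vanishes_on (zclosure K) f.
Proof. by move=> hf x [_]; apply. Qed.

Lemma zclosure_closed K : zclosed (zclosure K).
Proof.
split=> [x []//|x ux hx]; split=> // f hf; apply: hx; exact: zclosure_vanish.
Qed.

Lemma zclosure_min K C : zclosed C -> K `<=` C -> zclosure K `<=` C.
Proof.
by move=> [CU CC] KC x [ux hx]; apply: CC => // f hf; apply: hx => y /KC; apply: hf.
Qed.

(** A closed condition may be checked on a dense subset. *)
Lemma zclosure_pfun K u : pfun u -> (forall x, K x -> u x = 0) ->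
  forall x, zclosure K x -> u x = 0.
Proof.
move=> [f fE] hu x [_ hx]; rewrite -fE; apply: hx => y Ky; rewrite fE; exact: hu.
Qed.

Lemma zclosure_pmap K (c d : M -> M) : pmap c -> pmap d -> (forall x, K x -> c x = d x) ->
  forall x, zclosure K x -> c x = d x.
Proof.
move=> hc hd hK x Kx; apply/matrixP => i j; apply/eqP; rewrite -subr_eq0; apply/eqP.
have := @zclosure_pfun K (fun x => c x i j - d x i j); apply=> //; last first.
  by move=> y Ky; rewrite hK ?subrr.
by have h := pmapB hc hd i j; apply: (pfun_ext _ h) => y; rewrite !mxE.
Qed.

Lemma zclosed_preim C (c : M -> M) K : zclosed C -> pmap c ->
  (forall x, K x -> C (c x)) -> forall x, zclosure K x -> c x \in unitmx -> C (c x).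
Proof.
move=> [_ CC] hc hK x Kx ux; apply: CC => // f hf.
by apply: (zclosure_pfun (pfun_pullback f hc) _ Kx) => y /hK; apply: hf.
Qed.

(** Multiplications are dealt with one side at a time: first by points of K, and
    then, K y being in the closure, by points of the closure. *)
Lemma zclosure_subgroup K : subgroup K -> subgroup (zclosure K).
Proof.
move=> [KU K1 KM KV]; have KC := zclosure_sub KU.
have CC := zclosure_closed K.
have U x : zclosure K x -> x \in unitmx by case.
split=> [x []//||x y Kx Ky|x Kx]; first exact: KC.
  have h a : K a -> zclosure K (a *m y).
    move=> Ka; apply: (zclosed_preim CC (pmapM (pmapC a) pmap_id) _ Ky).
      by move=> z Kz; apply/KC/KM.
    by rewrite unitmx_mul KU // U.
  apply: (zclosed_preim CC (pmapM pmap_id (pmapC y)) h Kx).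
  by rewrite unitmx_mul !U.
split=> [|f hf]; first by rewrite unitmx_inv U.
have := @pullback_fun M pfun [set x | x \in unitmx] (@invmx k n) (fun x => \det x)
  pfunC pfunD pfunM (pfun_det pmap_id).
case/(_ _ f) => [i j|u [e [pu uE]]].
  exists (fun x => \adj x i j); first exact: (pmap_adj pmap_id).
  by move=> z /= uz; rewrite [in RHS]/invmx uz [in RHS]mxE mulrA divff ?mul1r // -unitfE -unitmxE.
have ux := U _ Kx; have := uE _ ux.
have -> : u x = 0.
  apply: (zclosure_pfun pu _ Kx) => z Kz; rewrite uE; last exact: KU.
  by rewrite hf ?mul0r //; apply: KV.
by move/esym/eqP; rewrite mulf_eq0 expf_eq0 => /orP[/eqP//|/andP[_]];
   rewrite -[_ == 0]negbK -unitfE -unitmxE ux.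
Qed.

Lemma conj_unit g x : g \in unitmx -> (conj g x \in unitmx) = (x \in unitmx).
Proof. by move=> ug; rewrite /conj !unitmx_mul unitmx_inv ug andbT. Qed.

Lemma pmap_conj g : pmap (conj g).
Proof. by apply: pmapM; [apply: pmapM; [exact: pmapC|exact: pmap_id]|exact: pmapC]. Qed.

Lemma zclosure_normal G K : subgroup G -> zclosed G -> normal_in G K ->
  normal_in G (zclosure K).
Proof.
move=> [GU _ _ _] cG [KG hK]; have KU : K `<=` [set x | x \in unitmx] by move=> x /KG/GU.
split=> [|g x Gg Kx]; first exact: zclosure_min.
apply: (zclosed_preim (zclosure_closed K) (pmap_conj g) _ Kx).
  by move=> y Ky; apply: zclosure_sub => //; apply: hK.
by rewrite conj_unit; [case: Kx|exact: GU].
Qed.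

Lemma zclosure_commutative K : Defs.commutative K -> Defs.commutative (zclosure K).
Proof.
move=> cK.
have h a : K a -> forall y, zclosure K y -> a *m y = y *m a.
  move=> Ka; apply: (zclosure_pmap (c := mulmx a) (d := fun y => y *m a)).
  - exact: (pmapM (pmapC a) pmap_id).
  - exact: (pmapM pmap_id (pmapC a)).
  - by move=> y Ky; apply: cK.
move=> x y Kx Ky; apply: (zclosure_pmap (c := fun x => x *m y) (d := mulmx y)) Kx.
- exact: (pmapM pmap_id (pmapC y)).
- exact: (pmapM (pmapC y) pmap_id).
- by move=> z Kz; apply: h.
Qed.

(** A curve defined away from 0, along which polynomial functions become
    polynomials once multiplied by a power of the parameter. *)
Definition arc (c : k -> M) : Prop :=
  forall f, exists (p : {poly k}) e, forall s, s != 0 -> mxeval f (c s) * s ^+ e = p.[s].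

Lemma arc_poly (c : k -> M) m :
  (forall i j, exists p : {poly k}, forall s, s != 0 -> p.[s] = s ^+ m * c s i j) -> arc c.
Proof.
move=> hc f; pose S (u : k -> k) := exists p : {poly k}, forall s, u s = p.[s].
have [||||i j|u [e [[p pE] uE]]] :=
    @pullback_fun k S [set s | s != 0] c (fun s => s ^+ m) _ _ _ _ _ f.
- by move=> b; exists b%:P => s; rewrite hornerC.
- by move=> u v [p pE] [q qE]; exists (p + q) => s; rewrite hornerD pE qE.
- by move=> u v [p pE] [q qE]; exists (p * q) => s; rewrite hornerM pE qE.
- by exists 'X^m => s; rewrite hornerXn.
- by have [p pE] := hc i j; exists (fun s => p.[s]); [exists p|].
by exists p, (m * e)%N => s s0; rewrite exprM -uE // pE.
Qed.

(** A nonzero polynomial has finitely many roots, so an arc cannot be shared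
    between two disjoint closed sets. *)
Lemma arc_vanish (c : k -> M) C D s1 s2 : arc c ->
  (forall s, s != 0 -> C (c s) \/ D (c s)) -> zclosed C -> zclosed D ->
  s1 != 0 -> s2 != 0 -> C `&` D = set0 -> C (c s1) -> D (c s2) -> False.
Proof.
move=> hc hCD cC cD s10 s20 CD0 Cs1 Ds2.
have sep K x : zclosed K -> x \in unitmx -> ~ K x -> exists2 f, vanishes_on K f & mxeval f x != 0.
  move=> [_ KC] ux nK; apply: contrapT => h; apply: nK; apply: KC => // f hf.
  by apply/eqP/negP => /negP fx; apply: h; exists f.
have [||f fC f2] := sep C (c s2) cC; first by case: cD => h _; apply: (h _ Ds2).
  by move=> h; have : (C `&` D) (c s2) by []; rewrite CD0.
have [||p pD p1] := sep D (c s1) cD; first by case: cC => h _; apply: (h _ Cs1).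
  by move=> h; have : (C `&` D) (c s1) by []; rewrite CD0.
have [P [e PE]] := hc f; have [Q [e' QE]] := hc p.
have : P * Q = 0.
  apply: poly0_nz => s s0; rewrite hornerM -PE // -QE //.
  by case: (hCD _ s0) => h; rewrite ?(fC _ h) ?(pD _ h) !mul0r ?mulr0.
move/eqP; rewrite mulf_eq0 => /orP[] /eqP e0.
  have := PE _ s20; rewrite e0 horner0 => /eqP; rewrite mulf_eq0 (negPf f2) /=.
  by rewrite expf_eq0 (negPf s20) andbF.
have := QE _ s10; rewrite e0 horner0 => /eqP; rewrite mulf_eq0 (negPf p1) /=.
by rewrite expf_eq0 (negPf s10) andbF.
Qed.

Lemma zconnected_subset T C D : zclosed T -> zconnected T -> zclosed C -> zclosed D ->
  C `&` D = set0 -> T `<=` C `|` D -> T `<=` C \/ T `<=` D.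
Proof.
move=> cT conT cC cD CD0 TCD.
have cI K : zclosed K -> zclosed (T `&` K).
  move=> [KU KC]; split=> [x [_ /KU]//|x ux hx]; split.
    by case: cT => _; apply=> // f hf; apply: hx => y [Ty _]; apply: hf.
  by apply: KC => // f hf; apply: hx => y [_ Ky]; apply: hf.
have [||h|h] := conT _ _ (cI _ cC) (cI _ cD).
- by rewrite -setIUr; apply/esym/setIidPl.
- by rewrite setIACA CD0 setI0.
- right=> x Tx; case: (TCD x Tx) => // Cx; have : (T `&` C) x by [].
  by rewrite h.
- left=> x Tx; case: (TCD x Tx) => // Dx; have : (T `&` D) x by [].
  by rewrite h.
Qed.

(** Each arc stays in whichever of two disjoint closed sets contains T. *)
Lemma zconnected_arcs T K : zclosed T -> zconnected T -> (exists x, T x) ->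
  K `<=` [set x | x \in unitmx] -> T `<=` K ->
  (forall x, K x -> exists c s1 s2, [/\ arc c, s1 != 0, s2 != 0, T (c s1) &
     c s2 = x /\ forall s, s != 0 -> K (c s)]) ->
  zconnected (zclosure K).
Proof.
move=> cT conT [x0 Tx0] KU TK hK.
have wl C D : zclosed C -> zclosed D -> zclosure K = C `|` D -> C `&` D = set0 ->
    T `<=` C -> D = set0.
  move=> cC cD KE CD0 TC; have KCD : K `<=` C `|` D by rewrite -KE; apply: zclosure_sub.
  have KC : K `<=` C.
    move=> x Kx; have [c [s1 [s2 [hc s10 s20 Tc [cx Kc]]]]] := hK x Kx.
    case: (KCD x Kx) => // Dx; exfalso.
    apply: (arc_vanish hc _ cC cD s10 s20 CD0); rewrite ?cx //; last exact: TC.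
    by move=> s s0; apply/KCD/Kc.
  apply/seteqP; split=> // x Dx; rewrite -CD0; split=> //.
  by apply: (zclosure_min cC KC); rewrite KE; right.
move=> C D cC cD KE CD0.
have TCD : T `<=` C `|` D by rewrite -KE => x /TK; apply: zclosure_sub.
have [TC|TD] := zconnected_subset cT conT cC cD CD0 TCD.
  by right; apply: wl TC.
by left; apply: wl TD => //; rewrite ?[D `&` _]setIC ?[D `|` _]setUC.
Qed.

Lemma zclosed1 : zclosed [set (1%:M : M)].
Proof.
split=> [x -> /=|x ux hx]; first by rewrite unitmx1.
apply/matrixP => i j; apply/eqP; rewrite -subr_eq0; apply/eqP.
have [f fE] := pmapB pmap_id (pmapC (1%:M : M)) i j.
have := hx f; rewrite fE !mxE; apply=> y ->.
by rewrite fE !mxE subrr.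
Qed.

Lemma zconnected1 : zconnected [set (1%:M : M)].
Proof.
move=> C D _ _ KE CD0; have : (C `|` D) (1%:M : M) by rewrite -KE.
have e x : (C `|` D) x -> x = 1%:M by rewrite -KE.
case=> h; [right|left]; apply/seteqP; split=> // x hx; rewrite -CD0.
  by rewrite (e x) //; [split=> //; rewrite -(e x) //; right|right].
by rewrite (e x) //; [split=> //; rewrite -(e x) //; left|left].
Qed.

(** The closure of K is a connected normal subgroup; it is not G because it is
    commutative. *)
Lemma almost_simple_trivial G K : almost_simple G -> subgroup K -> normal_in G K ->
  Defs.commutative K ->
  (forall x, K x -> exists c s1 s2, [/\ arc c, s1 != 0, s2 != 0, c s1 = 1%:M &
     c s2 = x /\ forall s, s != 0 -> K (c s)]) ->
  K = [set 1%:M].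
Proof.
move=> [[gG cG] _ ncG sG] gK nK cK hK; have [KU K1 _ _] := gK.
have [||||e] := sG (zclosure K).
- by split; [exact: zclosure_subgroup|exact: zclosure_closed].
- apply: (zconnected_arcs zclosed1 zconnected1) => //; first by exists 1%:M.
  by move=> x ->.
- exact: zclosure_normal.
- move=> e; apply/seteqP; split=> x; last by move=> ->.
  by rewrite -e; apply: zclosure_sub.
- by case: ncG; rewrite -e; apply: zclosure_commutative.
Qed.

(** Functions vanishing on H are flat along K. *)
Lemma Lie_subgroup K H : closed_subgroup K -> zconnected K -> closed_subgroup H ->
  (forall x, tangent1 K x -> tangent1 H x) -> K `<=` H.
Proof.
move=> gK cK gH sub x Kx; have [[_ H1 _ _] [_ HC]] := gH.
apply: HC => [|f hf]; first by case: gK => -[KU _ _ _] _; exact: KU.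
apply: (identity_theorem char0 gK cK) Kx => s hs.
by apply: (vanish_Dxs gH hf) H1 => y /hs/sub.
Qed.

Definition mprod (s : seq M) : M := foldr mulmx 1%:M s.

Lemma Dxs_lform s l : scalar l -> Dxs s (lform l) = lform (fun g => l (g *m mprod s)).
Proof.
move=> ll; elim: s => [|x s IHs]; first by apply: lform_eq => g; rewrite /= mulmx1.
rewrite Dxs_cons IHs Dx_lform.
  by apply: lform_eq => g /=; rewrite mulmxA.
by move=> a u v; rewrite mulmxDl -scalemxAl ll.
Qed.

(** The derivatives of a linear form at the identity are its values on products
    of elements of the Lie algebra. *)
Lemma identity_linear K l : closed_subgroup K -> zconnected K -> scalar l ->
  (forall s, (forall x, x \in s -> tangent1 K x) -> l (mprod s) = 0) ->
  forall x, K x -> l x = 0.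
Proof.
move=> gK cK ll hl x Kx; rewrite -(lformE _ ll).
apply: (identity_theorem char0 gK cK) Kx => s hs.
rewrite Dxs_lform // lformE ?mul1mx ?hl //.
by move=> a u v; rewrite mulmxDl -scalemxAl ll.
Qed.

Lemma commute_Lie K y : closed_subgroup K -> zconnected K ->
  (forall x, tangent1 K x -> x *m y = y *m x) -> forall x, K x -> x *m y = y *m x.
Proof.
move=> gK cK hy x Kx; apply/matrixP => i j; apply/eqP; rewrite -subr_eq0; apply/eqP.
apply: (@identity_linear K (fun x => (x *m y) i j - (y *m x) i j)) Kx => //.
  move=> a u v; rewrite mulmxDl mulmxDr -scalemxAl -scalemxAr !mxE.
  by rewrite mulrBr opprD addrACA.
move=> s hs; suff -> : mprod s *m y = y *m mprod s by rewrite subrr.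
elim: s hs => [|u s IHs] hs; first by rewrite /= mulmx1 mul1mx.
rewrite /= -mulmxA IHs ?mulmxA; last by move=> v vs; apply: hs; rewrite inE vs orbT.
by rewrite hy //; apply: hs; rewrite mem_head.
Qed.

End Closure.

(** * Nilpotent matrices, spectral idempotents and exponentials *)

Section NilpotentTrace.
Variable k : fieldType.

(** For a rank factorisation x = c r, the smaller matrix r c is nilpotent along
    with x; traces and exponents are controlled by induction on the size. *)
Lemma rank_factor_exp n (x : 'M[k]_n) m :
  x ^+ m.+1 = col_base x *m ((row_base x *m col_base x) ^+ m) *m row_base x.
Proof.
elim: m => [|m IHm]; first by rewrite expr1 expr0 mulmx1 mulmx_base.
rewrite exprS IHm -[x in x * _]mulmx_base -mulmxE !mulmxA [in RHS]exprS -mulmxE.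
by rewrite !mulmxA.
Qed.

Lemma rank_factor_nilp n (x : 'M[k]_n) m : x ^+ m.+1 = 0 ->
  (row_base x *m col_base x) ^+ m = 0.
Proof.
rewrite rank_factor_exp => e.
have /row_freeP[B RB] := row_base_free x; have /row_fullP[C CC] := col_base_full x.
have /= := congr1 (fun y => C *m y *m B) e.
by rewrite mulmx0 mul0mx -[col_base x *m _ *m _]mulmxA mulmxA CC mul1mx -mulmxA RB mulmx1.
Qed.

Lemma mxtrace_nilp n (x : 'M[k]_n) m : x ^+ m = 0 -> \tr x = 0.
Proof.
elim: m n x => [|m IHm] n x xm.
  by rewrite -[x]mulmx1 -[1%:M](expr0 x) xm mulmx0 mxtrace0.
by rewrite -(mulmx_base x) mxtrace_mulC; apply/IHm/rank_factor_nilp.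
Qed.

Lemma idem_factor n r (c : 'M[k]_(n, r)) (R : 'M[k]_(r, n)) (C : 'M[k]_(r, n)) (B : 'M[k]_(n, r)) :
  c *m R *m (c *m R) = c *m R -> C *m c = 1%:M -> R *m B = 1%:M -> R *m c = 1%:M.
Proof.
move=> h CC RB; transitivity (C *m (c *m R *m (c *m R)) *m B).
  by rewrite !mulmxA CC mul1mx -mulmxA RB mulmx1.
by rewrite h mulmxA CC mul1mx RB.
Qed.

Lemma mxtrace_idem n (e : 'M[k]_n) : e *m e = e -> \tr e = (\rank e)%:R.
Proof.
move=> ee; have /row_freeP[B RB] := row_base_free e.
have /row_fullP[C CC] := col_base_full e.
have re1 : row_base e *m col_base e = 1%:M.
  by apply: idem_factor CC RB; rewrite mulmx_base.
by rewrite -[e in \tr e]mulmx_base mxtrace_mulC re1 mxtrace1.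
Qed.

Lemma nilp_expn n (x : 'M[k]_n) m : x ^+ m = 0 -> x ^+ n = 0.
Proof.
elim/ltn_ind: n x m => -[|n] IHn x m xm; first by rewrite expr0; apply/matrixP=> -[].
case: m xm => [|m] xm; first by rewrite exprS -[x]mulr1 -(expr0 x) xm mulr0 mul0r.
have rn : (\rank x < n.+1)%N.
  rewrite ltn_neqAle rank_leq_row andbT; apply/negP => /eqP r.
  have ux : x \in unitmx by rewrite -row_free_unit /row_free r.
  have : x ^+ m.+1 \in unitmx by elim: (m.+1) => [|i IHi]; rewrite ?unitmx1 // exprS unitmx_mul ux.
  by rewrite xm unitmxE det0 unitr0.
have := IHn _ rn _ _ (rank_factor_nilp xm).
move=> r0; have : x ^+ (\rank x).+1 = 0 by rewrite rank_factor_exp r0 mulmx0 mul0mx.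
by move=> x0; have := exprD x (n.+1 - (\rank x).+1) (\rank x).+1; rewrite subnK // x0 mulr0.
Qed.

End NilpotentTrace.

Section Spectral.
Variables (k : closedFieldType).

(** Orthogonal idempotents [E a], for [a] in [s], cutting out the generalised
    eigenspaces of [x]. *)
Definition spectral n (x : 'M[k]_n) (s : seq k) (E : k -> 'M[k]_n) : Prop :=
  [/\ uniq s, \sum_(a <- s) E a = 1%:M,
      forall a b, a \in s -> b \in s -> E a *m E b = if a == b then E a else 0,
      exists m, forall a, a \in s -> (x - a%:M) ^+ m *m E a = 0 &
      forall y, x *m y = y *m x -> forall a, E a *m y = y *m E a].

Lemma dvdp_prod_coprime (s : seq k) (q : k -> {poly k}) (p : {poly k}) : uniq s ->
  (forall a b, a \in s -> b \in s -> a != b -> coprimep (q a) (q b)) ->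
  (forall a, a \in s -> q a %| p) -> \prod_(a <- s) q a %| p.
Proof.
elim: s => [|a s IHs] /=; first by rewrite big_nil dvd1p.
case/andP=> nas us cop dv; rewrite big_cons Gauss_dvdp.
  rewrite dv ?mem_head // IHs // => [b c bs cs|b bs].
    by apply: cop; rewrite inE ?bs ?cs orbT.
  by apply: dv; rewrite inE bs orbT.
rewrite big_seq; apply: (big_ind (coprimep (q a))) => [||b bs].
- exact: coprimep1.
- by move=> u v; rewrite coprimepMr => -> ->.
- by apply: cop; rewrite ?mem_head ?inE ?bs ?orbT //; apply: contraNneq nas => ->.
Qed.

(** Chinese remainders for the pairwise coprime factors (X - a)^m, m being the
    size of x: the idempotents are polynomials in x. *)
Lemma spectral_exists n (x : 'M[k]_n) : exists s E, spectral x s E.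
Proof.
case: n x => [|n] x.
  exists [::], (fun=> 0); split=> //; first by apply/matrixP => -[].
  - by exists 0%N.
  - by move=> y _ a; rewrite mul0mx mulmx0.
have [r rE] := closed_field_poly_normal (char_poly x).
rewrite (monicP (char_poly_monic x)) scale1r in rE.
pose s := undup r; pose m := size r; pose q a : {poly k} := ('X - a%:P) ^+ m.
have us : uniq s by apply: undup_uniq.
have cop a b : a != b -> coprimep (q a) (q b).
  move=> ab; apply/coprimep_expl/coprimep_expr.
  by rewrite coprimep_XsubC root_XsubC eq_sym.
have chiP (p : {poly k}) : \prod_(a <- s) q a %| p -> horner_mx x p = 0.
  move=> dv; have : char_poly x %| p.
    apply: dvdp_trans dv; rewrite rE -big_undup_iterop_count.
    apply: (big_ind2 (fun u v : {poly k} => u %| v)) => [||a _].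
    - exact: dvdpp.
    - by move=> u1 u2 v1 v2 hu hv; apply: dvdp_mul hu hv.
    - rewrite Monoid.iteropE; apply: dvdp_trans (dvdp_exp2l _ (count_size (pred1 a) r)).
      by rewrite -iter_mulr_1 dvdpp.
  by case/dvdpP => u ->; rewrite rmorphM /= Cayley_Hamilton mulr0.
pose Q a := \prod_(b <- s | b != a) q b.
have copQ a : coprimep (q a) (Q a).
  apply: (big_ind (coprimep (q a))) => [||b ba].
  - exact: coprimep1.
  - by move=> u v; rewrite coprimepMr => -> ->.
  - by apply: cop; rewrite eq_sym.
have [a|v hv] := @choice _ _ (fun a v => q a %| 1 - v * Q a).
  have /Bezout_eq1_coprimepP[[u w] /= e] := copQ a.
  by exists w; rewrite -e addrK dvdp_mull.
have qQ a b : b \in s -> b != a -> q b %| Q a.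
  by move=> bs ba; rewrite /Q -big_filter (bigD1_seq b) ?filter_uniq ?mem_filter ?ba //= dvdp_mulr.
have PE a : a \in s -> \prod_(b <- s) q b = q a * Q a.
  by move=> sa; rewrite (bigD1_seq a).
pose E a := horner_mx x (v a * Q a).
have EE a b : a \in s -> b \in s -> a != b -> E a *m E b = 0.
  move=> sa sb ab; rewrite mulmxE -rmorphM; apply: chiP.
  rewrite (PE a) // mulrACA; apply: dvdp_mull; rewrite mulrC; apply: dvdp_mul => //.
  by apply: qQ.
have E1 : \sum_(a <- s) E a = 1%:M.
  rewrite -[1%:M](rmorph1 (horner_mx x)) -rmorph_sum; apply/eqP; rewrite -subr_eq0 -rmorphB.
  apply/eqP/chiP/dvdp_prod_coprime => // [a b _ _|b bs]; first exact: cop.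
  rewrite (bigD1_seq b) //=; set R := \sum_(i <- s | _) _.
  have -> : v b * Q b + R - 1 = R - (1 - v b * Q b) by rewrite opprB addrCA addrA.
  rewrite dvdp_sub // /R; apply: (big_ind (fun u : {poly k} => q b %| u)) => [||a ab].
  - exact: dvdp0.
  - by move=> u w; apply: dvdp_add.
  - by apply: dvdp_mull; apply: qQ; rewrite // eq_sym.
exists s, E; split=> //.
- move=> a b sa sb; case: eqVneq => [<-|]; last exact: EE.
  have := congr1 (mulmx (E a)) E1; rewrite mulmx1 mulmx_sumr (bigD1_seq a) //= big1_seq ?addr0 //.
  by move=> c /andP[ca cs]; rewrite EE // eq_sym.
- exists m => a sa; have -> : (x - a%:M) ^+ m = horner_mx x (q a).
    by rewrite rmorphXn rmorphB /= horner_mx_X horner_mx_C.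
  by rewrite mulmxE -rmorphM; apply: chiP; rewrite (PE a) // mulrCA dvdp_mull.
- move=> y xy a; have /comm_horner_mx : comm_mx x y by rewrite /comm_mx xy.
  by move/(_ (v a * Q a)); rewrite /comm_mx => ->.
Qed.

Section SpectralTheory.
Variables (n : nat) (x : 'M[k]_n) (s : seq k) (E : k -> 'M[k]_n).
Hypothesis xE : spectral x s E.

(** Chevalley's replicas: the semisimple part of x with modified eigenvalues. *)
Definition replica (phi : k -> k) : 'M[k]_n := \sum_(a <- s) phi a *: E a.

Lemma replica_idem phi a : a \in s -> replica phi *m E a = phi a *: E a.
Proof.
have [us _ EE _ _] := xE; move=> sa; rewrite mulmx_suml (bigD1_seq a) //=.
rewrite -scalemxAl EE // eqxx big1_seq ?addr0 // => b /andP[ba sb].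
by rewrite -scalemxAl EE // (negPf ba) scaler0.
Qed.

Lemma replica_mul phi psi : replica phi *m replica psi = replica (fun a => phi a * psi a).
Proof.
rewrite mulmx_sumr; apply: eq_big_seq => a sa.
by rewrite -scalemxAr replica_idem // scalerA mulrC.
Qed.

Lemma replica1 : replica (fun=> 1) = 1%:M.
Proof.
by have [_ E1 _ _ _] := xE; rewrite -E1; apply: eq_bigr => a _; rewrite scale1r.
Qed.

Lemma replica_eq phi psi : {in s, phi =1 psi} -> replica phi = replica psi.
Proof. by move=> h; apply: eq_big_seq => a sa; rewrite h. Qed.

Lemma replica_comm phi y : x *m y = y *m x -> replica phi *m y = y *m replica phi.
Proof.
have [_ _ _ _ EC] := xE; move=> xy; rewrite mulmx_suml mulmx_sumr.
by apply: eq_bigr => a _; rewrite -scalemxAl -scalemxAr EC.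
Qed.

Lemma spectral_nilp : exists m, (x - replica id) ^+ m = 0.
Proof.
have [us E1 EE [m hm] EC] := xE; exists m.
rewrite -[LHS]mulmx1 -E1 mulmx_sumr big1_seq // => a /andP[_ sa].
rewrite -(hm a sa); elim: m {hm} => // m IHm.
have c : E a *m x = x *m E a by apply: EC.
rewrite !exprSr -!mulmxE -!mulmxA.
have -> : (x - replica id) *m E a = E a *m (x - a%:M).
  by rewrite mulmxBl replica_idem // mulmxBr c mul_mx_scalar.
by rewrite mulmxA IHm -!mulmxA mulmxBr mulmxBl c mul_mx_scalar mul_scalar_mx.
Qed.

(** Only the eigenvalues contribute to the pairing of x with a replica. *)
Lemma mxtrace_replica phi : \tr (x *m replica phi) = \sum_(a <- s) phi a * a * \tr (E a).
Proof.
have [us E1 EE [m hm] EC] := xE.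
rewrite mulmx_sumr raddf_sum; apply: eq_big_seq => a sa /=.
rewrite -scalemxAr mxtraceZ -mulrA; congr (_ * _); apply/eqP; rewrite -subr_eq0.
rewrite -mxtraceZ -raddfB /= -mul_scalar_mx -mulmxBl; apply/eqP.
have c : E a *m x = x *m E a by apply: EC.
have cE : E a *m (x - a%:M) = (x - a%:M) *m E a.
  by rewrite mulmxBr mulmxBl c mul_mx_scalar mul_scalar_mx.
apply: (@mxtrace_nilp _ _ _ m.+1).
suff -> : ((x - a%:M) *m E a) ^+ m.+1 = (x - a%:M) ^+ m.+1 *m E a.
  by rewrite exprS -mulmxE -mulmxA hm // mulmx0.
elim: (m) => [|j IHj]; first by rewrite !expr1.
rewrite exprS IHj [in RHS]exprS -!mulmxE -!mulmxA; congr (_ *m _).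
have cX : E a *m (x - a%:M) ^+ j.+1 = (x - a%:M) ^+ j.+1 *m E a by exact: commrX cE.
by rewrite mulmxA cX -mulmxA EE // eqxx.
Qed.

End SpectralTheory.

End Spectral.

Section Exponential.
Variables (k : closedFieldType).
Hypothesis char0 : [pchar k] =i pred0.

Lemma big_triangle (V : nmodType) (F : nat -> nat -> V) K :
  (forall i j, (K <= i + j)%N -> F i j = 0) ->
  \sum_(m < K) \sum_(i < m.+1) F i (m - i)%N = \sum_(i < K) \sum_(j < K) F i j.
Proof.
move=> F0; transitivity (\sum_(m < K) \sum_(i < K | (i <= m)%N) F i (m - i)%N).
  apply: eq_bigr => m _; have le_mK : (m.+1 <= K)%N by [].
  by rewrite (big_ord_widen K (fun i => F i (m - i)%N) le_mK).
rewrite (exchange_big_dep xpredT) //=; apply: eq_bigr => i _.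
rewrite -(big_mkord (fun m => i <= m)%N (fun m => F i (m - i)%N)).
rewrite -[RHS](big_mkord xpredT (F i)).
rewrite [RHS](@big_cat_nat _ _ _ (K - i)%N) ?leq_subr //= [X in _ = _ + X]big_nat_cond.
rewrite [X in _ = _ + X]big1 ?addr0 => [|j]; last first.
  by rewrite andbT => /andP[h _]; apply: F0; rewrite -leq_subLR.
rewrite (@big_cat_nat _ _ _ i) ?(ltnW (ltn_ord i)) //=.
rewrite big_nat_cond big1 ?add0r => [|j /andP[/andP[_ ji]]]; last by rewrite leqNgt ji.
rewrite -{1}[val i]add0n big_addn; apply: eq_big => [j|j _]; first by rewrite leq_addl.
by rewrite addnK.
Qed.

(** The sum stops at n since only matrices with x ^+ n = 0 are exponentiated. *)
Definition expm n (x : 'M[k]_n) : 'M[k]_n := \sum_(i < n.+1) (i`!%:R)^-1 *: x ^+ i.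

Lemma expm_widen n (x : 'M[k]_n) K : x ^+ n = 0 -> (n < K)%N ->
  expm x = \sum_(i < K) (i`!%:R)^-1 *: x ^+ i.
Proof.
move=> xn lt_nK; rewrite /expm (big_ord_widen K (fun i => (i`!%:R)^-1 *: x ^+ i) lt_nK).
rewrite [RHS](bigID (fun i : 'I_K => (i < n.+1)%N)) /= [X in _ = _ + X]big1 ?addr0 // => i.
by rewrite -leqNgt => /ltnW h; rewrite -(subnK h) exprD xn mulr0 scaler0.
Qed.

Lemma fact_nz i : (i`!%:R : k) != 0.
Proof. by move/pcharf0P: char0 => ->; rewrite -lt0n fact_gt0. Qed.

Lemma nilpD n (x y : 'M[k]_n) : x *m y = y *m x -> x ^+ n = 0 -> y ^+ n = 0 -> (x + y) ^+ n = 0.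
Proof.
move=> xy xn yn; apply: (@nilp_expn _ _ _ (n + n)).
rewrite exprDn_comm //; apply: big1 => i _; case: (leqP n i) => h.
  by rewrite -[in y ^+ _](subnK h) exprD yn mulr0 mulr0 mul0rn.
have le : (n <= n + n - i)%N by lia.
by rewrite -(subnK le) exprD xn mulr0 mul0r mul0rn.
Qed.

Lemma expmD n (x y : 'M[k]_n) : x *m y = y *m x -> x ^+ n = 0 -> y ^+ n = 0 ->
  expm (x + y) = expm x *m expm y.
Proof.
move=> xy xn yn; pose K := (n + n).+1.
have lt_nK : (n < K)%N by rewrite ltnS leq_addr.
rewrite !(expm_widen (K := K)) ?nilpD //.
pose F i j := ((j`!%:R)^-1 *: x ^+ j) *m ((i`!%:R)^-1 *: y ^+ i).
rewrite mulmx_suml; under [RHS]eq_bigr do rewrite mulmx_sumr.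
rewrite exchange_big -(@big_triangle _ F K) /=; last first.
  move=> i j h; rewrite /F; case: (leqP n i) => hi.
    by rewrite -[in y ^+ _](subnK hi) exprD yn mulr0 scaler0 mulmx0.
  have le : (n <= j)%N by rewrite /K in h; lia.
  by rewrite -(subnK le) exprD xn mulr0 scaler0 mul0mx.
apply: eq_bigr => m _; rewrite exprDn_comm // scaler_sumr; apply: eq_bigr => i _.
rewrite /F -scalemxAl -scalemxAr scalerA -scaler_nat scalerA; congr (_ *: _).
have le : (i <= m)%N by rewrite -ltnS.
have nzC : ('C(m, i)%:R : k) != 0 by move/pcharf0P: char0 => ->; rewrite -lt0n bin_gt0.
by rewrite -(bin_fact le) !natrM !invfM mulrAC mulVf // mul1r mulrC.
Qed.

Lemma expm0 n : expm (0 : 'M[k]_n) = 1%:M.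
Proof.
rewrite /expm big_ord_recl expr0 invr1 scale1r big1 ?addr0 // => i _.
by rewrite exprS mul0r scaler0.
Qed.

Lemma nilpN n (x : 'M[k]_n) : x ^+ n = 0 -> (- x) ^+ n = 0.
Proof. by move=> xn; rewrite exprNn xn mulr0. Qed.

Lemma exprZmx n (x : 'M[k]_n) c m : (c *: x) ^+ m = c ^+ m *: x ^+ m.
Proof.
elim: m => [|m IHm]; first by rewrite !expr0 scale1r.
by rewrite !exprS IHm -mulmxE -scalemxAl -scalemxAr scalerA.
Qed.

Lemma nilpZ n (x : 'M[k]_n) c : x ^+ n = 0 -> (c *: x) ^+ n = 0.
Proof. by move=> xn; rewrite exprZmx xn scaler0. Qed.

Lemma expmK n (x : 'M[k]_n) : x ^+ n = 0 -> expm x *m expm (- x) = 1%:M.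
Proof.
move=> xn; rewrite -expmD ?nilpN ?subrr ?expm0 //.
by rewrite mulmxN mulNmx.
Qed.

Lemma expm_unit n (x : 'M[k]_n) : x ^+ n = 0 -> expm x \in unitmx.
Proof. by move=> /expmK /mulmx1_unit[]. Qed.

Lemma expm_inv n (x : 'M[k]_n) : x ^+ n = 0 -> invmx (expm x) = expm (- x).
Proof.
move=> xn; apply: (can_inj (mulKmx (expm_unit xn))).
by rewrite expmK // mulmxV // expm_unit.
Qed.

(** [exp (ad x)] is the product of the commuting exponentials of left
    multiplication by [x] and right multiplication by [- x]. *)
Lemma conj_expm n (x y : 'M[k]_n) : x ^+ n = 0 -> exists K, forall L, (K <= L)%N ->
  Defs.conj (expm x) y = \sum_(i < L) (i`!%:R)^-1 *: iter i (lie x) y.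
Proof.
move=> xn; pose LX : 'M[k]_(n * n) := lin_mx (mulmx x : 'M[k]_n -> 'M[k]_n).
pose RX : 'M[k]_(n * n) := lin_mx (mulmxr x : 'M[k]_n -> 'M[k]_n).
have LXE z i : mxvec z *m LX ^+ i = mxvec (x ^+ i *m z).
  elim: i z => [|i IHi] z; first by rewrite !expr0 mulmx1 mul1mx.
  by rewrite exprS mulmxA mul_vec_lin IHi exprSr /= mulmxA.
have RXE z i : mxvec z *m RX ^+ i = mxvec (z *m x ^+ i).
  elim: i z => [|i IHi] z; first by rewrite !expr0 !mulmx1.
  by rewrite exprS mulmxA mul_vec_lin IHi exprS /= mulmxA.
have DXE z i : mxvec z *m (LX - RX) ^+ i = mxvec (iter i (lie x) z).
  elim: i z => [|i IHi] z; first by rewrite expr0 mulmx1.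
  by rewrite exprS mulmxA mulmxBr !mul_vec_lin -linearB /= IHi -iterSr.
have ext (P Q : 'M[k]_(n * n)) : (forall z, mxvec z *m P = mxvec z *m Q) -> P = Q.
  by move=> h; apply/row_matrixP => i; rewrite !rowE -[delta_mx 0 i]vec_mxK h.
have LRC : LX *m RX = RX *m LX.
  by apply: ext => z; rewrite !mulmxA !mul_vec_lin /= mulmxA.
have LX0 : LX ^+ (n * n) = 0.
  by apply: (@nilp_expn _ _ _ n); apply: ext => z; rewrite LXE xn mul0mx mulmx0 linear0.
have RX0 : RX ^+ (n * n) = 0.
  by apply: (@nilp_expn _ _ _ n); apply: ext => z; rewrite RXE xn mulmx0 mulmx0 linear0.
have DX0 : (LX - RX) ^+ (n * n) = 0.
  by apply: nilpD; rewrite ?nilpN // mulmxN mulNmx LRC.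
pose K := maxn n.+1 (n * n).+1; exists K => L le_KL.
have lnL : (n < L)%N by apply: leq_trans le_KL; rewrite leq_maxl.
have lnnL : (n * n < L)%N by apply: leq_trans le_KL; rewrite leq_maxr.
have expE (P : 'M[k]_(n * n)) (F : 'M[k]_n -> nat -> 'M[k]_n) : P ^+ (n * n) = 0 ->
    (forall z i, mxvec z *m P ^+ i = mxvec (F z i)) ->
    forall z, mxvec z *m expm P = mxvec (\sum_(i < L) (i`!%:R)^-1 *: F z i).
  move=> P0 PE z; rewrite (expm_widen P0 lnnL) mulmx_sumr linear_sum.
  by apply: eq_bigr => i _; rewrite -scalemxAr PE linearZ.
have e : expm LX = expm (LX - RX) *m expm RX.
  by rewrite -expmD ?subrK // mulmxBl mulmxBr LRC.
have := congr1 (fun P => mxvec y *m P) e; rewrite mulmxA.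
rewrite (expE LX (fun z i => x ^+ i *m z)) // (expE _ (fun z i => iter i (lie x) z)) //.
rewrite (expE RX (fun z i => z *m x ^+ i)) // => /(can_inj mxvecK).
set S := \sum_(i < L) _ *: iter _ _ _ => E.
have e1 : expm x *m y = S *m expm x.
  rewrite (expm_widen xn lnL) mulmx_suml mulmx_sumr.
  transitivity (\sum_(i < L) (i`!%:R)^-1 *: (x ^+ i *m y)).
    by apply: eq_bigr => i _; rewrite -scalemxAl.
  by rewrite E; apply: eq_bigr => i _; rewrite -scalemxAr.
by rewrite /Defs.conj e1 mulmxK ?expm_unit.
Qed.

End Exponential.

(** * One-parameter unipotent subgroups *)

Section UnipotentCurves.
Variables (k : closedFieldType) (n : nat).
Hypothesis char0 : [pchar k] =i pred0.
Local Notation M := 'M[k]_n.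
Local Notation N := (n * n)%N.
Local Notation A := {mpoly k[N]}.
Implicit Types (f p q : A) (x y g a u : M) (H K : set M).

Section Curve.
Variable x : M.
Hypothesis xn : x ^+ n = 0.

Definition expm_coord (i : 'I_N) : {poly k} := \poly_(j < n.+1) (mxvec (x ^+ j) 0 i / j`!%:R).

Lemma coef_expm_coord i j : (expm_coord i)`_j = mxvec (x ^+ j) 0 i / j`!%:R.
Proof.
rewrite coef_poly; case: ltnP => // /ltnW le_nj.
by rewrite -(subnK le_nj) exprD xn mulr0 linear0 mxE mul0r.
Qed.

(** The polynomial s |-> f (exp (s x)). *)
Definition along_expm (f : A) : {poly k} := mmap polyC expm_coord f.

Lemma along_expmE f s : (along_expm f).[s] = mxeval f (expm (s *: x)).
Proof.
elim/mpoly_alg_ind: f => [c|i|f p|f p].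
- by rewrite /along_expm mmapC hornerC mxevalC.
- rewrite /along_expm mmapX mmap1U mxevalX /expm_coord horner_poly /expm linear_sum summxE.
  apply: eq_bigr => j _; rewrite linearZ /= mxE exprZmx linearZ /= mxE.
  by rewrite [RHS]mulrC [s ^+ j * _]mulrC mulrAC.
- by rewrite /along_expm rmorphD hornerD mxevalD => -> ->.
- by rewrite /along_expm rmorphM hornerM mxevalM => -> ->.
Qed.

Lemma deriv_along_expm f : (along_expm f)^`() = along_expm (Dx x f).
Proof.
have chain := @mderiv_chain k n {poly k} (mmap polyC expm_coord) (@deriv k) (@derivD k) (@derivM k).
rewrite /along_expm chain => [|c]; last by rewrite /= mmapC derivC.
rewrite /Dx raddf_sum; apply: eq_bigr => j _ /=; rewrite [RHS]rmorphM /=; congr (_ * _).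
rewrite mmapX mmap1U; apply/polyP => i; rewrite coef_deriv coef_expm_coord.
have ll : scalar (fun g : M => mxvec (g *m x) 0 j) by apply: scalar_entry.
rewrite /lform raddf_sum coef_sum.
transitivity (mxvec (x ^+ i *m x) 0 j / i`!%:R).
  rewrite mulmxE -exprSr -[LHS]mulr_natr factS natrM invfM -mulrA mulrAC mulVf ?mul1r //.
  by rewrite char0_natf_eq0.
rewrite (scalar_coord (x ^+ i) ll) mulr_suml; apply: eq_bigr => l _.
by rewrite /= mmapZ mmapX mmap1U coefCM coef_expm_coord [RHS]mulrCA mulrA.
Qed.

(** All derivatives at 0 of a function vanishing on H vanish along s |-> exp (s
    x). *)
Lemma expm_Lie H : closed_subgroup H -> tangent1 H x -> H (expm x).
Proof.
move=> gH hx; have [[_ H1 _ _] [_ HC]] := gH; apply: HC; first exact: expm_unit.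
move=> f hf; rewrite -[x in expm x]scale1r -along_expmE.
suff -> : along_expm f = 0 by rewrite horner0.
have van m : vanishes_on H (iter m (Dx x) f).
  by elim: m => //= m IHm; apply: vanish_Dx => //; case: gH.
have it m : (along_expm f)^`(m) = along_expm (iter m (Dx x) f).
  by elim: m => [|m IHm] //; rewrite derivnS IHm deriv_along_expm.
apply/polyP => m; rewrite coef0; have := congr1 (fun p : {poly k} => p.[0]) (it m).
rewrite along_expmE scale0r expm0 (van m) // horner_coef0 coef_derivn addn0 ffactnn.
by move/eqP; rewrite -mulr_natr mulf_eq0 (negPf (fact_nz char0 m)) orbF => /eqP.
Qed.

(** A polynomial in s that vanishes at the natural numbers is zero. *)
Lemma tangent_expm H : (forall m : nat, H (expm (m%:R *: x))) -> tangent1 H x.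
Proof.
move=> hH f hf; have p0 : along_expm f = 0.
  apply/eqP; apply: contraT => p0.
  have := @max_poly_roots _ (along_expm f) [seq i%:R | i <- iota 0 (size (along_expm f))] p0.
  rewrite size_map size_iota ltnn; apply; last first.
    by rewrite map_inj_uniq ?iota_uniq //; exact: natr_inj0.
  by apply/allP => _ /mapP[i _ ->]; rewrite rootE along_expmE hf.
have := deriv_along_expm f; rewrite p0 deriv0 => /(congr1 (fun p : {poly k} => p.[0])).
by rewrite horner0 along_expmE scale0r expm0 mxeval_Dx mul1mx.
Qed.

Lemma expm_natmul m : expm (m%:R *: x) = expm x ^+ m.
Proof.
elim: m => [|m IHm]; first by rewrite scale0r expm0.
rewrite -natr1 scalerDl scale1r expmD ?nilpZ // ?IHm ?exprSr //.
by rewrite -scalemxAl -scalemxAr.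
Qed.

Lemma arc_expm : arc (fun s => expm ((s - 1) *: x)).
Proof.
move=> f; exists (along_expm f \Po ('X - 1)), 0%N => s _.
by rewrite horner_comp hornerXsubC along_expmE expr0 mulr1.
Qed.

Lemma expm_eq1 : (forall s, expm (s *: x) = 1%:M) -> x = 0.
Proof.
move=> h; apply/eqP; rewrite -(can_eq mxvecK) linear0; apply/eqP/rowP => i; rewrite mxE.
have e : expm_coord i = (mxvec (1%:M : M) 0 i)%:P.
  apply/eqP; rewrite -subr_eq0; apply/eqP/(poly0_nz char0) => s _.
  have := along_expmE 'X_i s; rewrite /along_expm mmapX mmap1U h mxevalX => e.
  by rewrite hornerD hornerN hornerC e subrr.
have := congr1 (fun p : {poly k} => p`_1) e; rewrite coef_expm_coord coefC /=.
by rewrite expr1 divr1.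
Qed.

End Curve.

End UnipotentCurves.

(** Multiplying 1 + X + y (w X + c) by an exponential of - c y removes the
    leading error term c y. *)
Lemma log_step (R : comNzRingType) (X a w c r : R) :
  let y := X * a in let T := 1 + X + y * (w * X + c) in let z := - c * y in
  T * (1 + z + z ^+ 2 * r) =
  1 + X + X * y * (w - c * (1 + a * (w * X + c)) + T * (a * (c ^+ 2 * r))).
Proof.
move=> y T z; set v := w * X + c.
have eT : T = 1 + X + y * (w * X) - z.
  by rewrite /T /z mulNr opprK mulrDr addrA [c * y]mulrC.
have e2 : T * z = z + X * (1 + a * v) * z.
  have -> : T = 1 + X * (1 + a * v) by rewrite [in RHS]mulrDr mulr1 mulrA addrA.
  by rewrite mulrDl mul1r.
have -> : T * (1 + z + z ^+ 2 * r) =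
    1 + X + y * (w * X) + X * (1 + a * v) * z + T * (z ^+ 2 * r).
  by rewrite mulrDr mulrDr mulr1 e2 {1}eT addrA subrK.
rewrite [X * y * (_ + _ + _)]mulrDr [X * y * (_ + _)]mulrDr -!addrA; do 2 congr (_ + _).
congr (_ + _); first by rewrite mulrA mulrC mulrA.
congr (_ + _).
  rewrite mulrN /z mulNr mulrN; congr (- _); rewrite -!mulrA; congr (_ * _).
  by rewrite mulrA mulrC [(1 + a * v) * c]mulrC /y -mulrA.
have -> : z ^+ 2 = X * y * (a * c ^+ 2).
  have -> : z ^+ 2 = c ^+ 2 * (X * y * a).
    by rewrite /z exprMn sqrrN [y ^+ 2]expr2 {2}/y [y * _]mulrA [y * X]mulrC.
  by rewrite mulrC -[LHS]mulrA.
by rewrite [X * y * (a * _)]mulrA -!mulrA !(mulrCA T).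
Qed.

(** The logarithm of a unipotent matrix, by successive approximation in the
    commutative algebra of polynomials in u. The clause on S locates it in any
    algebra, with or without unit, that contains u. *)
Lemma unipotent_log (k : closedFieldType) (char0 : [pchar k] =i pred0) n (u : 'M[k]_n) :
  u ^+ n = 0 -> exists x,
  [/\ x ^+ n = 0, expm x = 1%:M + u & forall S : 'M[k]_n -> Prop,
    (forall a b, S a -> S b -> S (a + b)) -> (forall c a, S a -> S (c *: a)) ->
    (forall a b, S a -> S b -> S (a *m b)) -> S u -> S x].
Proof.
case: n u => [|n] u un.
  exists 0; split=> [||S _ SZ _ Su]; try by apply/matrixP => -[].
  by rewrite -(scale0r u); apply: SZ.
have [h [hX hD hM hZ h1]] : exists h : {poly k} -> 'M[k]_n.+1, [/\ h 'X = u,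
    forall p q, h (p + q) = h p + h q, forall p q, h (p * q) = h p *m h q,
    forall c p, h (c *: p) = c *: h p & h 1 = 1%:M].
  exists (horner_mx u); split=> [|p q|p q|c p|].
  - exact: horner_mx_X.
  - exact: rmorphD.
  - exact: rmorphM.
  - exact: linearZ.
  - exact: rmorph1.
have h0 : h 0 = 0 by rewrite -(scale0r 0) hZ scale0r.
have hE p m : h (p ^+ m) = h p ^+ m by elim: m => [|m IHm]; rewrite ?expr0 ?h1 // !exprS hM IHm.
have nil q : h ('X * q) ^+ n.+1 = 0.
  by rewrite -hE exprMn hM hE hX un mul0mx.
pose e (z : {poly k}) := \sum_(i < n.+2) (i`!%:R)^-1 *: z ^+ i.
have he z : h (e z) = expm (h z).
  by rewrite /e (big_morph h hD h0); apply: eq_bigr => i _; rewrite hZ hE.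
have er z : exists r, e z = 1 + z + z ^+ 2 * r.
  exists (\sum_(i < n) (i.+2`!%:R)^-1 *: z ^+ i).
  rewrite /e 2!big_ord_recl !expr0 expr1 fact0 invr1 !scale1r addrA; congr (_ + _).
  by rewrite mulr_sumr; apply: eq_bigr => i _; rewrite -scalerAr -exprD.
have approx j : exists q w : {poly k}, expm (h ('X * q)) = h (1 + 'X + 'X^(j.+1) * w).
  elim: j => [|j [q [w IHj]]].
    by exists 0, (-1); rewrite mulr0 h0 expm0 expr1 mulrN1 addrK h1.
  elim/poly_ind: w IHj => [IHj|w c _ IHj].
    by exists q, 0; rewrite IHj !mulr0.
  pose z := - c%:P * ('X * 'X^j); have [r rE] := er z.
  have := log_step 'X 'X^j w c%:P r; cbv zeta; rewrite -/z => step.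
  exists (q - c%:P * 'X^j); eexists.
  have -> : 'X * (q - c%:P * 'X^j) = 'X * q + z.
    by rewrite mulrBr /z mulNr [c%:P * ('X * _)]mulrCA.
  rewrite hD expmD //; last 2 first.
  - by rewrite -!hM mulrC.
  - by rewrite /z mulrCA nil.
  by rewrite IHj -he rE -hM exprS step -!exprS.
have [q [w E0]] := approx n.
have E : expm (h ('X * q)) = 1%:M + u.
  by rewrite E0 hD hM hE hX un mul0mx addr0 hD h1 hX.
exists (h ('X * q)); split=> // S SD SZ SM Su.
elim/poly_ind: q {E E0} => [|q c IHq]; first by rewrite mulr0 h0 -(scale0r u); apply: SZ.
rewrite mulrDr mulrA hD; apply: SD; first by rewrite hM hX; apply: SM.
by rewrite mulrC mul_polyC hZ hX; apply: SZ.
Qed.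

Section UnipotentElements.
Variables (k : closedFieldType) (n : nat).
Hypothesis char0 : [pchar k] =i pred0.

(** The logarithm x of g is tangent to H since exp (m x) = g^m lies in H for
    every natural number m. *)
Lemma unipotent_Lie (H : set 'M[k]_n) g : closed_subgroup H -> H g -> (g - 1%:M) ^+ n = 0 ->
  exists x, [/\ tangent1 H x, x ^+ n = 0, expm x = g & forall S : 'M[k]_n -> Prop,
    (forall a b, S a -> S b -> S (a + b)) -> (forall c a, S a -> S (c *: a)) ->
    (forall a b, S a -> S b -> S (a *m b)) -> S (g - 1%:M) -> S x].
Proof.
move=> [[HU H1 HM HV] _] Hg un; have [x [xn xE xS]] := unipotent_log char0 un.
exists x; split=> //; last by rewrite xE addrC subrK.
apply: (tangent_expm char0 xn) => m; rewrite (expm_natmul char0 xn) xE addrC subrK.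
by elim: m => [|m IHm]; rewrite ?expr0 // exprS; apply: HM.
Qed.

End UnipotentElements.

(** * Weight components of polynomial functions *)

Section EigenComponents.
Variables (k : fieldType) (W : lmodType k) (D : W -> W) (I : W -> Prop).
Hypotheses (DD : forall u v, D (u + v) = D u + D v) (DZ : forall c u, D (c *: u) = c *: D u).
Hypotheses (ID : forall u v, I u -> I v -> I (u + v)) (IZ : forall c u, I u -> I (c *: u)).
Hypothesis ISt : forall u, I u -> I (D u).

Definition shift a u := D u - a *: u.

Lemma shiftD a u v : shift a (u + v) = shift a u + shift a v.
Proof. by rewrite /shift DD scalerDr opprD addrACA. Qed.
Lemma shift0 a : shift a 0 = 0.
Proof. by have := DZ 0 0; rewrite /shift !scale0r => ->; rewrite scaler0 subr0. Qed.
Lemma shift_comm a b u : shift a (shift b u) = shift b (shift a u).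
Proof.
have DB v w : D (v - w) = D v - D w by rewrite -!scaleN1r DD DZ.
rewrite /shift !DB !DZ !scalerBr !scalerA !opprB ![_ + (_ - _)]addrA.
rewrite [b * a]mulrC [LHS]addrAC [RHS]addrAC; congr (_ + _); exact: addrAC.
Qed.
Lemma shift_I a u : I u -> I (shift a u).
Proof. by move=> Iu; rewrite /shift -scaleNr; apply: ID; [exact: ISt|exact: IZ]. Qed.

Lemma iter_shiftD a m u v : iter m (shift a) (u + v) = iter m (shift a) u + iter m (shift a) v.
Proof. by elim: m => //= m ->; rewrite shiftD. Qed.
Lemma iter_shift0 a m : iter m (shift a) 0 = 0.
Proof. by elim: m => //= m ->; rewrite shift0. Qed.
Lemma iter_shift_comm a b m u : iter m (shift a) (shift b u) = shift b (iter m (shift a) u).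
Proof. by elim: m => //= m ->; rewrite shift_comm. Qed.

(** On a generalised eigenvector for a, D - b is invertible when b <> a. *)
Lemma shift_inv a b m u : a != b -> iter m (shift a) u = 0 -> I (shift b u) -> I u.
Proof.
move=> ab; elim: m u => [|m IHm] u; first by by move=> /= -> /(IZ 0); rewrite scale0r.
rewrite iterSr => hu Iu; have h1 : I (shift a u).
  by apply: IHm => //; rewrite shift_comm; apply: shift_I.
have e : shift b u - shift a u = (a - b) *: u.
  by rewrite /shift opprB [LHS]addrC addrA subrK scalerBl.
have -> : u = (a - b)^-1 *: (shift b u - shift a u).
  by rewrite e scalerA mulVf ?scale1r // subr_eq0.
by apply: IZ; apply: ID => //; rewrite -scaleN1r; apply: IZ.
Qed.

Lemma iter_shift_inv a b m j u : a != b -> iter m (shift a) u = 0 ->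
  I (iter j (shift b) u) -> I u.
Proof.
move=> ab; elim: j u => // j IHj u hu; rewrite iterSr => /IHj h.
apply: (shift_inv ab hu); apply: h.
by rewrite iter_shift_comm hu shift0.
Qed.

(** A power of D - b removes the component at b and is invertible on the others.
    *)
Lemma eigen_components (t : seq k) (F : k -> W) m : uniq t ->
  (forall a, a \in t -> iter m (shift a) (F a) = 0) ->
  I (\sum_(a <- t) F a) -> forall a, a \in t -> I (F a).
Proof.
elim: t F => // b t IHt F /= /andP[nbt ut] hF; rewrite big_cons => Is.
have ht a : a \in t -> I (F a).
  move=> ta; have ab : a != b by apply: contraNneq nbt => <-.
  apply: (iter_shift_inv (m := m) (j := m) ab); first by apply: hF; rewrite inE ta orbT.
  move: a ta {ab}; apply: IHt => // [a ta|].
    elim: (X in iter X (shift b)) => /= [|j IHj]; first by apply: hF; rewrite inE ta orbT.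
    by rewrite iter_shift_comm IHj shift0.
  have -> : \sum_(a <- t) iter m (shift b) (F a) = iter m (shift b) (F b + \sum_(a <- t) F a).
    rewrite iter_shiftD hF ?mem_head // add0r.
    by rewrite (big_morph _ (iter_shiftD b m) (iter_shift0 b m)).
  by elim: (m) => //= j; apply: shift_I.
move=> a; rewrite inE => /orP[/eqP->|/ht//].
rewrite -[F b](addrK (\sum_(a <- t) F a)) -scaleN1r; apply: ID => //; apply: IZ.
rewrite big_seq; apply: (big_ind I) => [|u v|c ct]; [|exact: ID|exact: ht].
by rewrite -(scale0r (F b + \sum_(a <- t) F a)); apply: IZ.
Qed.

End EigenComponents.

Section Weights.
Variables (k : closedFieldType) (n : nat).
Hypothesis char0 : [pchar k] =i pred0.
Local Notation M := 'M[k]_n.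
Local Notation N := (n * n)%N.
Local Notation A := {mpoly k[N]}.
Implicit Types (f p q : A) (H : set M).
Variables (x : M) (s : seq k) (E : k -> M).
Hypothesis xE : spectral x s E.

(** S contains the weights that occur in polynomial functions. *)
Definition adm_span (S : k -> Prop) := S 0 /\ (forall a, a \in s -> S a) /\
  forall a b, S a -> S b -> S (a + b).

Variable S : k -> Prop.
Hypothesis hS : adm_span S.

(** f is a generalised eigenvector of weight a for x, and transforms accordingly
    under all additive and multiplicative replicas of x. *)
Definition weight_fun a f : Prop := [/\ S a,
  exists m, iter m (shift (@Dx k n x) a) f = 0,
  forall phi : k -> k, (forall b c, S b -> S c -> phi (b + c) = phi b + phi c) ->
     phi 0 = 0 -> Dx (replica s E phi) f = phi a *: f &
  forall psi : k -> k, (forall b c, S b -> S c -> psi (b + c) = psi b * psi c) ->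
     psi 0 = 1 -> forall g, mxeval f (g *m replica s E psi) = psi a * mxeval f g].

Let iter_le a m m' f : (m <= m')%N -> iter m (shift (@Dx k n x) a) f = 0 ->
  iter m' (shift (@Dx k n x) a) f = 0.
Proof.
move=> le h; rewrite -(subnK le) iterD h; exact: (iter_shift0 (DxZ x)).
Qed.

Lemma weight_funD a f p : weight_fun a f -> weight_fun a p -> weight_fun a (f + p).
Proof.
move=> [Sa [m hm] h1 h2] [_ [m' hm'] h1' h2']; split=> // [|phi hphi p0|psi hpsi p0 g].
- exists (maxn m m'); rewrite (iter_shiftD (DxD x)).
  by rewrite (iter_le _ hm) ?leq_maxl // (iter_le _ hm') ?leq_maxr // addr0.
- by rewrite DxD h1 // h1' // scalerDr.
- by rewrite !mxevalD h2 // h2' // mulrDr.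
Qed.

Lemma weight_fun0 a : S a -> weight_fun a 0.
Proof.
move=> Sa; split=> // [|phi _ _|psi _ _ g]; first by exists 0%N.
- by rewrite Dx0 scaler0.
- by rewrite /mxeval !meval0 mulr0.
Qed.

Lemma weight_funM a b f p : weight_fun a f -> weight_fun b p -> weight_fun (a + b) (f * p).
Proof.
have [S0 [_ SD]] := hS.
move=> [Sa [m hm] h1 h2] [Sb [m' hm'] h1' h2']; split=> // [|||psi hpsi p0 g].
- exact: SD.
- exists (m + m')%N.
  have step (u v : A) : shift (@Dx k n x) (a + b) (u * v) =
      shift (@Dx k n x) a u * v + u * shift (@Dx k n x) b v.
    rewrite /shift DxM mulrBl mulrBr scalerDl -scalerAl -scalerAr opprD.
    by rewrite addrACA.
  have h r : forall u v i j, (i + j <= r)%N -> iter i (shift (@Dx k n x) a) u = 0 ->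
      iter j (shift (@Dx k n x) b) v = 0 -> iter r (shift (@Dx k n x) (a + b)) (u * v) = 0.
    elim: r => [|r IHr] u v i j.
      by rewrite leqn0 addn_eq0 => /andP[/eqP-> _] /= -> _; rewrite mul0r.
    case: i => [|i]; first by move=> _ hu _; have -> : u = 0 := hu; rewrite mul0r (iter_shift0 (DxZ x)).
    case: j => [|j]; first by move=> _ _ hv; have -> : v = 0 := hv; rewrite mulr0 (iter_shift0 (DxZ x)).
    rewrite addSn addnS ltnS => le hi hj; rewrite iterSr step (iter_shiftD (DxD x)).
    rewrite (IHr _ _ i j.+1) ?addnS //; last by rewrite -iterSr.
    by rewrite (IHr _ _ i.+1 j) ?addr0 // -iterSr.
  exact: h hm hm'.
- by move=> phi hphi p0; rewrite DxM h1 // h1' // -scalerAl -scalerAr -scalerDl hphi.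
- by rewrite !mxevalM h2 // h2' // hpsi // mulrACA.
Qed.

Lemma weight_fun_const c : weight_fun 0 c%:MP.
Proof.
have [S0 _] := hS; split=> // [|phi _ ->|psi _ -> g].
- by exists 1%N; rewrite /= /shift DxC scale0r subr0.
- by rewrite DxC scale0r.
- by rewrite !mxevalC mul1r.
Qed.

Lemma weight_fun_lform a l : a \in s -> scalar l -> weight_fun a (lform (fun g => l (g *m E a))).
Proof.
have [us E1 EE [m hm] EC] := xE; have [_ [Ss _]] := hS.
move=> sa ll; have lE (y : M) : scalar (fun g => l (g *m y)).
  by move=> c u v; rewrite mulmxDl -scalemxAl ll.
have [lB lZ l0] : [/\ forall u v, l (u - v) = l u - l v, forall c u, l (c *: u) = c * l u & l 0 = 0].
  pose L := HB.pack l (GRing.isLinear.Build _ _ _ _ _ ll) : {scalar M}.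
  have l0 : l 0 = 0 := raddf0 L.
  by split=> // [u v|c u]; [exact: (raddfB L)|rewrite -[c *: u]addr0 ll l0 addr0].
split=> [|||psi hpsi p0 g].
- exact: Ss.
- exists m; have h j : iter j (shift (@Dx k n x) a) (lform (fun g => l (g *m E a))) =
      lform (fun g => l (g *m ((x - a%:M) ^+ j *m E a))).
    elim: j => [|j IHj]; first by apply: lform_eq => g; rewrite expr0 mul1mx.
    rewrite iterS IHj /shift Dx_lform // -lformZ -lform_sub; apply: lform_eq => g.
    rewrite -lZ -lB exprS -mulmxE -mulmxA; congr (l _).
    by rewrite -[(_ - _) *m _ *m _]mulmxA mulmxBl mulmxBr mul_scalar_mx -scalemxAr.
  by rewrite h hm //; apply: big1 => i _; rewrite mulmx0 l0 scale0r.
- move=> phi _ _; rewrite Dx_lform // -lformZ; apply: lform_eq => g.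
  by rewrite -mulmxA (replica_idem xE) // -scalemxAr lZ.
- by rewrite !lformE // -mulmxA (replica_idem xE) // -scalemxAr lZ.
Qed.

(** Linear forms decompose by means of the idempotents E a, and products of
    weight functions are weight functions. *)
Lemma weight_decomposition f : exists (t : seq k) (F : k -> A),
  [/\ uniq t, forall a, a \in t -> weight_fun a (F a) & f = \sum_(a <- t) F a].
Proof.
have [L hL ->] : exists2 L : seq (k * A), (forall w, w \in L -> weight_fun w.1 w.2) &
    f = \sum_(w <- L) w.2.
  elim/mpoly_alg_ind: f => [c|i|f p [L hL ->] [L' hL' ->]|f p [L hL ->] [L' hL' ->]].
  - exists [:: (0, c%:MP)]; last by rewrite big_seq1.
    by move=> w; rewrite inE => /eqP->; exact: weight_fun_const.
  - exists [seq (a, lform (fun g => mxvec (g *m E a) 0 i)) | a <- s].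
      move=> _ /mapP[a sa ->] /=; apply: (weight_fun_lform (l := fun g => mxvec g 0 i)) => //.
      exact: (@scalar_entry k n id).
    rewrite big_map -lform_coord /= /lform exchange_big /=; apply: eq_bigr => j _.
    rewrite -scaler_suml; congr (_ *: _).
    have [_ E1 _ _ _] := xE; rewrite -[X in mxvec X](mulmx1) -E1 mulmx_sumr linear_sum summxE.
    by [].
  - exists (L ++ L'); last by rewrite big_cat.
    by move=> w; rewrite mem_cat => /orP[/hL|/hL'].
  - exists [seq (w.1 + w'.1, w.2 * w'.2) | w <- L, w' <- L'].
      by move=> _ /allpairsP[[w w'] /= [/hL hw /hL' hw' ->]]; apply: weight_funM.
    by rewrite big_allpairs_dep mulr_suml; apply: eq_bigr => w _; rewrite mulr_sumr.
exists (undup [seq w.1 | w <- L]), (fun a => \sum_(w <- L | w.1 == a) w.2); split.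
- exact: undup_uniq.
- move=> a; rewrite mem_undup => /mapP[w wL ->].
  rewrite -big_filter big_seq; apply: (big_ind (weight_fun w.1)).
  + by apply: weight_fun0; case: (hL w wL).
  + by move=> u v; apply: weight_funD.
  + by move=> w'; rewrite mem_filter => /andP[/eqP<- /hL].
- rewrite (exchange_big_dep xpredT) //=; apply: eq_big_seq => w wL.
  rewrite -big_filter; have -> : [seq a <- undup [seq w'.1 | w' <- L] | w.1 == a] = [:: w.1].
    apply: perm_small_eq => //; apply: uniq_perm; rewrite ?filter_uniq ?undup_uniq //.
    move=> a; rewrite mem_filter inE mem_undup eq_sym; case: eqP => //= ->.
    exact: map_f.
  by rewrite big_seq1.
Qed.

Variable H : set M.
Hypotheses (gH : closed_subgroup H) (xH : tangent1 H x).

(** The functions vanishing on H are stable under Dx x, hence under taking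
    weight components. *)
Lemma weight_vanish f : vanishes_on H f -> exists (t : seq k) (F : k -> A),
  [/\ forall a, a \in t -> weight_fun a (F a) /\ vanishes_on H (F a) & f = \sum_(a <- t) F a].
Proof.
move=> hf; have [t [F [ut hF fE]]] := weight_decomposition f.
exists t, F; split=> // a ta; split; first exact: hF.
have [m hm] : exists m, forall a, a \in t -> iter m (shift (@Dx k n x) a) (F a) = 0.
  elim: (t) hF => [|b r IHr] hF; first by exists 0%N.
  have [|m hm] := IHr; first by move=> c cr; apply: hF; rewrite inE cr orbT.
  have [_ [m' hm'] _ _] := hF b (mem_head _ _); exists (maxn m m') => c.
  rewrite inE => /orP[/eqP->|/hm]; first by apply: iter_le hm'; rewrite leq_maxr.
  by apply: iter_le; rewrite leq_maxl.
apply: (@eigen_components k A (@Dx k n x) (vanishes_on H) _ _ _ _ _ t F m ut hm _ a ta).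
- exact: DxD.
- exact: DxZ.
- by move=> u v hu hv y Hy; rewrite mxevalD hu // hv // addr0.
- by move=> c u hu y Hy; rewrite mxevalZ hu // mulr0.
- by move=> u hu; apply: vanish_Dx => //; case: gH.
- by rewrite -fE.
Qed.

(** Chevalley: a replica of x acts by a scalar on each weight component of the
    ideal of H, so it is tangent to H with x. *)
Lemma tangent_replica (phi : k -> k) :
  (forall b c, S b -> S c -> phi (b + c) = phi b + phi c) -> phi 0 = 0 ->
  tangent1 H (replica s E phi).
Proof.
move=> hphi p0 f hf; have [t [F [hF fE]]] := weight_vanish hf.
rewrite /dpoly1 -/(dd _ _ _) -[replica _ _ _]mul1mx -mxeval_Dx fE Dx_sum mxeval_sum.
rewrite big_seq big1 // => a ta; have [[_ _ h _] hv] := hF a ta.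
rewrite h // mxevalZ hv ?mulr0 //; by case: gH => -[].
Qed.

(** The multiplicative counterpart of [tangent_replica]. *)
Lemma group_replica (psi : k -> k) :
  (forall b c, S b -> S c -> psi (b + c) = psi b * psi c) -> psi 0 = 1 ->
  (forall a, a \in s -> psi a != 0) -> H (replica s E psi).
Proof.
move=> hpsi p0 nz; have [[_ H1 _ _] [_ HC]] := gH; apply: HC => [|f hf].
  have h : replica s E psi *m replica s E (fun a => (psi a)^-1) = 1%:M.
    rewrite (replica_mul xE) -(replica1 xE); apply: replica_eq => a sa.
    by rewrite divff // nz.
  by case/mulmx1_unit: h.
have [t [F [hF ->]]] := weight_vanish hf.
rewrite mxeval_sum big_seq big1 // => a ta; have [[_ _ _ h] hv] := hF a ta.
by rewrite -[replica _ _ _]mul1mx h // hv ?mulr0.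
Qed.

End Weights.

(** A minimal family c whose integral combinations contain the a i is free over
    the integers, because a relation would allow one member to be eliminated.
    The coordinates of the a i then inherit their relations. *)
Lemma integral_family (k : fieldType) (char0 : [pchar k] =i pred0) m (a : 'I_m -> k) :
  exists d (c : 'I_d -> k) (v : 'I_m -> 'I_d -> int),
  (forall i, a i = \sum_j c j * (v i j)%:~R) /\
  forall r : 'I_m -> int, \sum_i (r i)%:~R * a i = 0 -> forall j, \sum_i r i * v i j = 0.
Proof.
pose Q d := `[< exists (c : 'I_d -> k) (v : 'I_m -> 'I_d -> int),
  forall i, a i = \sum_j c j * (v i j)%:~R >].
have Q0 : exists d, Q d.
  exists m; apply/asboolP; exists a, (fun i j => (i == j)%:Z) => i.
  rewrite (bigD1 i) //= eqxx mulr1 big1 ?addr0 // => j ji.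
  by rewrite eq_sym (negPf ji) mulr0.
case: (ex_minnP Q0) => d /asboolP[c [v av]] dmin; exists d, c, v; split=> // r hr.
apply: contrapT => /existsNP[j0 rj0].
pose q j := \sum_i r i * v i j.
have qc : \sum_j (q j)%:~R * c j = 0.
  rewrite -[RHS]hr; under [RHS]eq_bigr do rewrite av mulr_sumr.
  rewrite exchange_big; apply: eq_bigr => j _ /=; rewrite rmorph_sum mulr_suml.
  by apply: eq_bigr => i _; rewrite rmorphM /= -mulrA [_ * c j]mulrC.
have intr_eq0 (z : int) : (z%:~R == 0 :> k) = (z == 0).
  by case: z => i; rewrite ?NegzE ?mulrNz ?oppr_eq0 -pmulrn; move/pcharf0P: char0 => ->.
have q0 : q j0 <> 0 := rj0.
clearbody q; case: d c v av dmin j0 q q0 qc {rj0} => [|d] c v av dmin j0; first by case: j0.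
move=> q q0 qc; have nz : ((q j0)%:~R : k) != 0 by rewrite intr_eq0; apply/eqP.
suff : Q d by move/dmin; rewrite ltnn.
apply/asboolP; exists (fun j => c (lift j0 j) / (q j0)%:~R),
  (fun i j => q j0 * v i (lift j0 j) - q (lift j0 j) * v i j0) => i.
have qc0 : c j0 = - \sum_j (q (lift j0 j))%:~R / (q j0)%:~R * c (lift j0 j).
  apply: (mulfI nz); rewrite mulrN mulr_sumr; apply/eqP; rewrite -addr_eq0; apply/eqP.
  rewrite -[RHS]qc (bigD1_ord j0) //=; congr (_ + _); apply: eq_bigr => j _.
  by rewrite mulrA mulrCA divff // mulr1.
rewrite av (bigD1_ord j0) //= {1}qc0 mulNr mulr_suml -sumrN -big_split; apply: eq_bigr => j _ /=.
rewrite rmorphB !rmorphM /= mulrBr addrC; congr (_ - _).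
  by rewrite mulrA divfK.
by rewrite mulrA; congr (_ * _); rewrite [in RHS]mulrC mulrA [in LHS]mulrAC.
Qed.

(** A Laurent polynomial that vanishes away from 0 is zero, and so is its
    derivative at 1. *)
Lemma laurent_deriv (k : closedFieldType) (char0 : [pchar k] =i pred0) (I : eqType) (r : seq I)
  (c : I -> k) (e : I -> int) :
  (forall b, b != 0 -> \sum_(i <- r) c i * b ^ e i = 0) -> \sum_(i <- r) (e i)%:~R * c i = 0.
Proof.
move=> h; pose K := \sum_(i <- r) `|e i|%N.
have KP i : i \in r -> exists m : nat, e i + K%:Z = m%:Z.
  move=> ir; exists (absz (e i + K%:Z)); apply/esym/gez0_abs.
  have : (`|e i| <= K)%N by rewrite /K (big_rem i) //= leq_addr.
  lia.
pose p : {poly k} := \sum_(i <- r) (c i)%:P * 'X^(absz (e i + K%:Z)).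
have p0 : p = 0.
  apply: (poly0_nz char0) => b b0; rewrite /p horner_sum; transitivity ((\sum_(i <- r) c i * b ^ e i) * b ^+ K); last by rewrite h ?mul0r.
  rewrite mulr_suml.
  apply: eq_big_seq => i ir; rewrite hornerCM hornerXn -mulrA; congr (_ * _).
  have [m em] := KP i ir; rewrite em absz_nat -[b ^+ K]/(b ^ K%:Z) -expfzDr // em.
  by [].
have c0 : \sum_(i <- r) c i = 0.
  have := h 1 (oner_neq0 _) => {2}<-; apply: eq_bigr => i _.
  by rewrite exp1rz mulr1.
have : p^`().[1] = 0 by rewrite p0 deriv0 horner0.
rewrite /p raddf_sum horner_sum => e0.
transitivity (\sum_(i <- r) (e i)%:~R * c i + (\sum_(i <- r) c i) * K%:R).
  by rewrite c0 mul0r addr0.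
rewrite mulr_suml -big_split /= -[RHS]e0.
apply: eq_big_seq => i ir; have [m em] := KP i ir.
rewrite /= derivM derivC mul0r add0r derivXn hornerCM hornerMn hornerXn expr1n em absz_nat.
by rewrite mulrC -mulrDr -[K%:R]/(K%:Z%:~R) -rmorphD /= em -pmulrn.
Qed.

Section IntegralReplicas.
Variables (k : closedFieldType) (n : nat).
Hypothesis char0 : [pchar k] =i pred0.
Variables (x : 'M[k]_n) (s : seq k) (E : k -> 'M[k]_n).
Hypothesis xE : spectral x s E.

(** Integral replicas of x: each eigenvalue is replaced by an integer,
    compatibly with the integral relations between eigenvalues. They span the
    semisimple part of x over k, and they are differentials of one-parameter
    subgroups. *)
Lemma integral_replicas : exists d (c : 'I_d -> k) (phi : 'I_d -> k -> int),
  [/\ replica s E id = \sum_j c j *: replica s E (fun a => (phi j a)%:~R),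
      forall r : k -> int, \sum_(a <- s) (r a)%:~R * a = 0 ->
        forall j, \sum_(a <- s) r a * phi j a = 0,
      forall H j, closed_subgroup H -> tangent1 H x ->
        tangent1 H (replica s E (fun a => (phi j a)%:~R)),
      forall (H : set 'M[k]_n) j, (forall b, b != 0 -> H (replica s E (fun a => b ^ phi j a))) ->
        tangent1 H (replica s E (fun a => (phi j a)%:~R)) &
      forall H j b, closed_subgroup H -> tangent1 H x -> b != 0 ->
        H (replica s E (fun a => b ^ phi j a))].
Proof.
have [us _ _ _ _] := xE.
have [d [c [v [av vr]]]] := @integral_family k char0 (size s) (fun i => s`_i).
pose S a := exists r : 'I_(size s) -> int, a = \sum_i (r i)%:~R * s`_i.
pose P j a : int := xget 0 [set z | exists2 r : 'I_(size s) -> int,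
  a = \sum_i (r i)%:~R * s`_i & z = \sum_i r i * v i j].
have PE j (r : 'I_(size s) -> int) : P j (\sum_i (r i)%:~R * s`_i) = \sum_i r i * v i j.
  rewrite /P; case: xgetP => [z _ [r' e ->]|/(_ (\sum_i r i * v i j))]; last by case; exists r.
  apply/eqP; rewrite -subr_eq0 -sumrB; apply/eqP.
  rewrite -[RHS](vr (fun i => r' i - r i) _ j).
    by apply: eq_bigr => i _; rewrite mulrBl.
  by under eq_bigr do rewrite rmorphB mulrBl; rewrite sumrB -e subrr.
have Ps j (i : 'I_(size s)) : P j s`_i = v i j.
  pose r (i' : 'I_(size s)) : int := (i' == i)%:Z.
  have -> : s`_i = \sum_i' (r i')%:~R * s`_i'.
    rewrite (bigD1 i) //= /r eqxx mul1r big1 ?addr0 // => i' ne.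
    by rewrite (negPf ne) mul0r.
  rewrite PE (bigD1 i) //= /r eqxx mul1r big1 ?addr0 // => i' ne.
  by rewrite (negPf ne) mul0r.
have sS a : a \in s -> exists i : 'I_(size s), a = s`_i.
  by move=> sa; have lt := sa; rewrite -index_mem in lt; exists (Ordinal lt); rewrite /= nth_index.
have S_sum a : a \in s -> S a.
  move=> /sS[i ->]; exists (fun i' => (i' == i)%:Z).
  rewrite (bigD1 i) //= eqxx mul1r big1 ?addr0 // => i' ne.
  by rewrite (negPf ne) mul0r.
have PD j a b : S a -> S b -> P j (a + b) = P j a + P j b.
  move=> [r ->] [r' ->]; rewrite !PE -!big_split /=.
  rewrite (eq_bigr (fun i => (r i + r' i)%:~R * s`_i)) => [|i _]; last by rewrite rmorphD mulrDl.
  by rewrite (PE j (fun i => r i + r' i)); apply: eq_bigr => i _; rewrite mulrDl.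
have P0 j : P j 0 = 0.
  have := PE j (fun=> 0); rewrite big1 => [->|i _]; last by rewrite mul0r.
  by rewrite big1 // => i _; rewrite mul0r.
have hS : adm_span s S.
  split; first by exists (fun=> 0); rewrite big1 // => i _; rewrite mul0r.
  split=> // a b [r ->] [r' ->]; exists (fun i => r i + r' i).
  by rewrite -big_split; apply: eq_bigr => i _; rewrite /= rmorphD mulrDl.
exists d, c, P; split.
- rewrite /replica; under [RHS]eq_bigr do rewrite scaler_sumr.
  rewrite exchange_big; apply: eq_big_seq => a /sS[i ->] /=.
  rewrite {1}av scaler_suml; apply: eq_bigr => j _.
  by rewrite scalerA Ps.
- move=> r; rewrite (big_nth 0) big_mkord => hr j; rewrite (big_nth 0) big_mkord.
  by rewrite -[RHS](vr _ hr j); apply: eq_bigr => i _; rewrite Ps.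
- move=> H j gH xH; apply: (tangent_replica xE hS gH xH); last by rewrite P0.
  by move=> a b Sa Sb; rewrite PD // rmorphD.
- move=> H j hH f hf; have [t [F [_ hF fE]]] := weight_decomposition xE hS f.
  rewrite /dpoly1 -/(dd _ _ _) -[replica _ _ _]mul1mx -mxeval_Dx fE Dx_sum mxeval_sum.
  transitivity (\sum_(a <- t) (P j a)%:~R * mxeval (F a) 1%:M).
    apply: eq_big_seq => a ta; have [_ _ h _] := hF a ta.
    rewrite h ?mxevalZ ?P0 // => b b' Sb Sb'; by rewrite PD // rmorphD.
  apply: (laurent_deriv char0) => b b0; rewrite -[RHS](hf _ (hH b b0)) [in RHS]fE mxeval_sum.
  apply: eq_big_seq => a ta; have [_ _ _ h] := hF a ta.
  rewrite -[replica _ _ _ in RHS]mul1mx [RHS](h (fun a => b ^ P j a)) ?P0 ?expr0z 1?mulrC // => b1 b2 S1 S2.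
  by rewrite PD // expfzDr.
- move=> H j b gH xH b0; apply: (group_replica xE hS gH xH) => [a a' Sa Sa'||a sa].
  + by rewrite PD // expfzDr.
  + by rewrite P0.
  + by rewrite expfz_neq0.
Qed.

End IntegralReplicas.

(** * The adjoint action, Engel's theorem and duality *)

Section Adjoint.
Variables (k : closedFieldType) (n : nat).
Local Notation M := 'M[k]_n.
Local Notation N := (n * n)%N.
Local Notation A := {mpoly k[N]}.
Implicit Types (f p : A) (x y z g a b u v w : M) (H : set M).

Lemma conj_linear g : linear (conj g).
Proof. by move=> c x y; rewrite /conj mulmxDr mulmxDl -scalemxAr -scalemxAl. Qed.
HB.instance Definition _ g := GRing.isLinear.Build k M M _ (conj g) (conj_linear g).

Lemma lie_linear x : linear (lie x).
Proof.
move=> c y z; rewrite /lie mulmxDr mulmxDl -scalemxAr -scalemxAl scalerBr opprD.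
by rewrite addrACA.
Qed.
HB.instance Definition _ x := GRing.isLinear.Build k M M _ (lie x) (lie_linear x).

Lemma conj1m x : conj 1%:M x = x.
Proof. by rewrite /conj mul1mx invmx1 mulmx1. Qed.

Lemma conj_id g : g \in unitmx -> conj g 1%:M = 1%:M.
Proof. by move=> ug; rewrite /conj mulmx1 mulmxV. Qed.

Lemma conjM g x y : g \in unitmx -> conj g (x *m y) = conj g x *m conj g y.
Proof. by move=> ug; rewrite /conj !mulmxA mulmxKV. Qed.

Lemma invmxM g a : g \in unitmx -> a \in unitmx -> invmx (g *m a) = invmx a *m invmx g.
Proof.
move=> ug ua; apply: (can_inj (mulKmx (_ : g *m a \in unitmx))).
  by rewrite unitmx_mul ug.
by rewrite mulmxV ?unitmx_mul ?ug // mulmxA mulmxK // mulmxV.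
Qed.

Lemma conj_mul g a x : g \in unitmx -> a \in unitmx -> conj (g *m a) x = conj g (conj a x).
Proof. by move=> ug ua; rewrite /conj invmxM // !mulmxA. Qed.

Lemma conjK g : g \in unitmx -> cancel (conj g) (conj (invmx g)).
Proof. by move=> ug x; rewrite -conj_mul ?unitmx_inv // mulVmx // conj1m. Qed.

Lemma conjVK g : g \in unitmx -> cancel (conj (invmx g)) (conj g).
Proof. by move=> ug x; rewrite -conj_mul ?unitmx_inv // mulmxV // conj1m. Qed.

Lemma conj_lie g x y : g \in unitmx -> conj g (lie x y) = lie (conj g x) (conj g y).
Proof. by move=> ug; rewrite /lie linearB /= !conjM. Qed.

Lemma conj_exp g x m : g \in unitmx -> conj g (x ^+ m) = conj g x ^+ m.
Proof.
move=> ug; elim: m => [|m IHm]; first by rewrite !expr0 conj_id.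
by rewrite !exprS -mulmxE conjM // IHm.
Qed.

Lemma conj_inv g x : g \in unitmx -> x \in unitmx -> conj g (invmx x) = invmx (conj g x).
Proof.
move=> ug ux; apply: (can_inj (mulKmx (_ : conj g x \in unitmx))); first by rewrite conj_unit.
by rewrite -conjM // (mulmxV ux) conj_id // mulmxV // conj_unit.
Qed.

Lemma mxtrace_conj g x : g \in unitmx -> \tr (conj g x) = \tr x.
Proof. by move=> ug; rewrite /conj mxtrace_mulC mulmxA mulVmx // mul1mx. Qed.

Lemma mxtrace_conjl g x y : g \in unitmx -> \tr (conj g x *m y) = \tr (x *m conj (invmx g) y).
Proof. by move=> ug; rewrite -[in RHS](mxtrace_conj _ ug) conjM // conjVK. Qed.

Lemma conj_of_expm g x : g \in unitmx -> conj g (expm x) = expm (conj g x).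
Proof.
by move=> ug; rewrite /expm linear_sum; apply: eq_bigr => i _; rewrite linearZ /= conj_exp.
Qed.

Lemma conj_fix_comm g x : g \in unitmx -> conj g x = x <-> g *m x = x *m g.
Proof.
by move=> ug; split=> [{2}<-|e]; rewrite /conj ?mulmxKV // e mulmxK.
Qed.

Lemma lieC x y : lie x y = - lie y x.
Proof. by rewrite /lie opprB. Qed.
Lemma lieDl x y z : lie (x + y) z = lie x z + lie y z.
Proof. by rewrite lieC [lie z _]linearD /= opprD -!lieC. Qed.
Lemma lieZl c x z : lie (c *: x) z = c *: lie x z.
Proof. by rewrite lieC linearZ /= -scalerN -lieC. Qed.
Lemma lieNl x z : lie (- x) z = - lie x z.
Proof. by rewrite -scaleN1r lieZl scaleN1r. Qed.
Lemma lie0l z : lie 0 z = 0.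
Proof. by rewrite lieC linear0 oppr0. Qed.
Lemma lie_suml I (r : seq I) (F : I -> M) z : lie (\sum_(i <- r) F i) z = \sum_(i <- r) lie (F i) z.
Proof. by apply: (big_morph (fun x => lie x z)) => [x y|]; rewrite ?lieDl ?lie0l. Qed.
Lemma lie_id x : lie x x = 0. Proof. exact: subrr. Qed.
Lemma lie_eq0 x y : lie x y = 0 <-> x *m y = y *m x.
Proof. by split=> [/subr0_eq//|e]; rewrite /lie e subrr. Qed.

Lemma lie_der x y z : lie x (y *m z) = lie x y *m z + y *m lie x z.
Proof. by rewrite /lie mulmxBl mulmxBr !mulmxA addrA subrK. Qed.

Lemma jacobi x y z : lie x (lie y z) = lie (lie x y) z + lie y (lie x z).
Proof.
rewrite [lie y z]/lie linearB /= !lie_der [lie (lie x y) z]/lie [lie y (lie x z)]/lie.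
by rewrite opprD [- (_ *m y) - _]addrC addrACA.
Qed.

Lemma mxtrace_lie x y z : \tr (lie x y *m z) = \tr (x *m lie y z).
Proof.
have tB a b : \tr (a - b) = \tr a - \tr b by rewrite raddfB.
rewrite /lie mulmxBl mulmxBr !tB mulmxA; congr (_ - _).
by rewrite -mulmxA mxtrace_mulC mulmxA.
Qed.

Lemma iter_lie_eq0 x m z : (forall i, (i <= m)%N -> x ^+ i *m z *m x ^+ (m - i) = 0) ->
  iter m (lie x) z = 0.
Proof.
elim: m z => [|m IHm] z h; first by have := h 0%N isT; rewrite expr0 mul1mx mulmx1.
rewrite iterSr; apply: IHm => i le_im.
have h1 := h i (leqW le_im); have h2 := h i.+1 le_im.
rewrite /lie mulmxBr mulmxBl !mulmxA -[X in _ - X]mulmxA.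
have -> : x ^+ i *m x = x ^+ i.+1 by rewrite exprSr.
have -> : x *m x ^+ (m - i) = x ^+ (m.+1 - i) by rewrite subSn // exprS.
by rewrite h1; rewrite subSS in h2; rewrite h2 subrr.
Qed.

Lemma iter_lie_nilp x : x ^+ n = 0 -> forall m z, (n + n <= m)%N -> iter m (lie x) z = 0.
Proof.
move=> xn m z le; apply: iter_lie_eq0 => i le_im; case: (leqP n i) => h.
  by rewrite -(subnK h) exprD xn mulr0 !mul0mx.
have le' : (n <= m - i)%N by lia.
by rewrite -(subnK le') exprD xn mulr0 mulmx0.
Qed.

Lemma ddD_fun f p g v : dd (f + p) g v = dd f g v + dd p g v.
Proof.
by rewrite -big_split; apply: eq_bigr => i _; rewrite mderivD mxevalD mulrDl.
Qed.
Lemma ddM_fun f p g v : dd (f * p) g v = dd f g v * mxeval p g + mxeval f g * dd p g v.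
Proof.
rewrite mulr_suml mulr_sumr -big_split; apply: eq_bigr => i _ /=.
by rewrite mderivM mxevalD !mxevalM mulrDl mulrAC -!mulrA.
Qed.
Lemma ddC_fun c g v : dd (c%:MP : A) g v = 0.
Proof. by apply: big1 => i _; rewrite mderivC /mxeval meval0 mul0r. Qed.
Lemma ddX_fun i g v : dd ('X_i : A) g v = mxvec v 0 i.
Proof.
rewrite /dd (bigD1 i) //= mderivXU eqxx mxevalC mul1r big1 ?addr0 // => j ji.
by rewrite mderivXU eq_sym (negPf ji) mxevalC mul0r.
Qed.

Lemma dd_lform l g v : scalar l -> dd (lform l) g v = l v.
Proof.
move=> ll; rewrite (scalar_coord v ll) /lform.
have dd0 : dd (0 : A) g v = 0 by rewrite -mpolyC0 ddC_fun.
rewrite (big_morph (fun f => dd f g v) (id1 := 0) (op1 := +%R)) //; last first.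
  by move=> f p; rewrite ddD_fun.
apply: eq_bigr => i _.
by rewrite -mul_mpolyC ddM_fun ddC_fun mul0r add0r mxevalC ddX_fun mulrC.
Qed.

Lemma dd_msub c f g v : linear c -> dd (msub c f) g v = dd f (c g) (c v).
Proof.
move=> lc; elim/mpoly_alg_ind: f => [e|i|f p IHf IHp|f p IHf IHp].
- by rewrite /msub comp_mpolyC !ddC_fun.
- by rewrite msub_X ddX_fun dd_lform //; exact: scalar_entry.
- by rewrite /msub comp_mpolyD !ddD_fun IHf IHp.
- rewrite {1}/msub rmorphM /= !ddM_fun -!/(msub _ _) IHf IHp.
  by rewrite !mxeval_msub.
Qed.

Lemma tangent_conj H K a x : a \in unitmx -> (forall y, H y -> K (conj a y)) ->
  tangent1 H x -> tangent1 K (conj a x).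
Proof.
move=> ua HK hx f hf.
rewrite /dpoly1 -/(dd _ _ _) -(conj_id ua) -dd_msub; last exact: conj_linear.
apply: hx => y Hy; rewrite mxeval_msub; last exact: conj_linear.
by apply: hf; apply: HK.
Qed.

Lemma tangent_Ad H a x : subgroup H -> H a -> tangent1 H x -> tangent1 H (conj a x).
Proof.
move=> [HU _ HM HV] Ha; apply: tangent_conj => [|y Hy]; first exact: HU.
by apply: (HM); [apply: (HM)|exact: HV].
Qed.

Lemma tangent_linear H l x : scalar l -> (forall y, H y -> l y = 0) -> tangent1 H x -> l x = 0.
Proof.
move=> ll hl hx; rewrite -(dd_lform 1%:M _ ll); apply: hx => y Hy.
by rewrite lformE ?hl.
Qed.

Lemma tangent_sub H K x : H `<=` K -> tangent1 H x -> tangent1 K x.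
Proof. by move=> HK hx f hf; apply: hx => y /HK; apply: hf. Qed.

Lemma Dx_msub_mul x (c : M -> M) f : linear c -> {morph c : u v / u *m v} ->
  Dx x (msub c f) = msub c (Dx (c x) f).
Proof.
move=> lc cM; elim/mpoly_alg_ind: f => [e|i|f p IHf IHp|f p IHf IHp].
- by rewrite DxC /msub comp_mpolyC DxC comp_mpoly0.
- rewrite msub_X Dx_X Dx_lform ?msub_lform //; try exact: scalar_entry.
  by apply: lform_eq => g; rewrite cM.
- by rewrite {1}/msub comp_mpolyD !DxD /msub comp_mpolyD -!/(msub _ _) IHf IHp.
- rewrite {1}/msub rmorphM /= !DxM -!/(msub _ _) IHf IHp.
  by rewrite {5}/msub comp_mpolyD !rmorphM.
Qed.

End Adjoint.

(** If f vanishes on H, its composite with conjugation by g is flat along K. *)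
Lemma Lie_conj (k : closedFieldType) (char0 : [pchar k] =i pred0) n (K H : set 'M[k]_n) g :
  g \in unitmx -> closed_subgroup K -> zconnected K -> closed_subgroup H ->
  (forall x, tangent1 K x -> tangent1 H (conj g x)) -> forall x, K x -> H (conj g x).
Proof.
move=> ug gK cK gH sub x Kx; have [[HU H1 _ _] [_ HC]] := gH.
have cM : {morph conj g : u v / u *m v} by move=> u v; apply: conjM.
apply: HC => [|f hf]; first by rewrite conj_unit //; case: gK => -[KU _ _ _] _; exact: KU.
rewrite -mxeval_msub; last exact: conj_linear.
apply: (identity_theorem char0 gK cK) Kx => s hs.
have -> : Dxs s (msub (conj g) f) = msub (conj g) (Dxs (map (conj g) s) f).
  elim: s {hs} => //= y s IHs; rewrite IHs Dx_msub_mul //; exact: conj_linear.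
rewrite mxeval_msub; last exact: conj_linear.
rewrite conj_id //; apply: (vanish_Dxs gH hf) H1 => _ /mapP[y ys ->].
by apply: sub; apply: hs.
Qed.

Section Duality.
Variables (F : fieldType) (W : vectType F) (V : {vspace W}) (b : W -> W -> F).
Hypotheses (bl : forall w, scalar (b^~ w)) (br : forall w, scalar (b w)).
Hypothesis nondeg : forall v, v \in V -> (forall w, w \in V -> b v w = 0) -> v = 0.

Lemma riesz (phi : W -> F) : scalar phi -> exists2 v, v \in V & forall w, w \in V -> b v w = phi w.
Proof.
move=> lphi; pose X := vbasis V; pose d := \dim V.
have sumV l (c : 'I_d -> F) : scalar l -> l (\sum_i c i *: X`_i) = \sum_i c i * l X`_i.
  move=> ll; have l0 : l 0 = 0 by have := ll (-1) 0 0; rewrite scaler0 addr0 mulN1r addNr.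
  have lD u v : l (u + v) = l u + l v by rewrite -[u]scale1r ll mul1r scale1r.
  rewrite (big_morph l lD l0); apply: eq_bigr => i _.
  by rewrite -[_ *: _]addr0 ll l0 addr0.
pose B : 'M[F]_d := \matrix_(i, j) b X`_i X`_j.
have BE (c : 'rV_d) j : (c *m B) 0 j = b (\sum_i c 0 i *: X`_i) X`_j.
  by rewrite (sumV (b^~ _)) // mxE; apply: eq_bigr => i _; rewrite mxE.
have memX (c : 'rV_d) : \sum_i c 0 i *: X`_i \in V.
  by apply: memv_suml => i _; rewrite memvZ // vbasis_mem // mem_nth ?size_tuple.
have ker0 (c : 'rV_d) : c *m B = 0 -> c = 0.
  move=> cB; have h : \sum_i c 0 i *: X`_i = 0.
    apply: nondeg => // w wV; rewrite (coord_vbasis wV) (sumV (b _)) // big1 // => j _.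
    by rewrite -BE cB mxE mulr0.
  apply/rowP => i; rewrite mxE.
  have /freeP fX : free X by have /andP[] := vbasisP V.
  exact: (fX (fun i => c 0 i)).
have uB : B \in unitmx.
  rewrite -row_free_unit -kermx_eq0; apply/eqP/row_matrixP => i; rewrite row0.
  by apply: ker0; rewrite -row_mul mulmx_ker row0.
pose c := (\row_j phi X`_j) *m invmx B.
exists (\sum_i c 0 i *: X`_i) => // w wV.
rewrite (coord_vbasis wV) (sumV (b _)) // (sumV phi) //; apply: eq_bigr => j _.
by rewrite -BE /c mulmxKV // mxE.
Qed.

End Duality.

Section Engel.
Variables (k : closedFieldType) (n : nat).
Local Notation M := 'M[k]_n.
Implicit Types (L K U V : {vspace M}).

(** Engel's theorem, for a pair of stable subspaces; the induction passes
    through a maximal proper subalgebra K of L, which is an ideal of codimension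
    1. *)
Lemma engel L V1 V2 : (forall x y, x \in L -> y \in L -> lie x y \in L) ->
  (forall x, x \in L -> x ^+ n = 0) ->
  (forall x v, x \in L -> v \in V1 -> lie x v \in V1) ->
  (forall x v, x \in L -> v \in V2 -> lie x v \in V2) -> ~~ (V2 <= V1)%VS ->
  exists w, [/\ w \in V2, w \notin V1 & forall x, x \in L -> lie x w \in V1].
Proof.
move: {2}(\dim L) (leqnn (\dim L)) => d; elim: d L V1 V2 => [|d IHd] L V1 V2 dL hL nL st1 st2 nV.
  have L0 : L = 0%VS by apply/eqP; rewrite -dimv_eq0 -leqn0.
  have [w w2 w1] := subvPn nV.
  by exists w; split=> // x; rewrite L0 memv0 => /eqP->; rewrite lie0l mem0v.
case: (eqVneq L 0%VS) => [L0|L0].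
  have [w w2 w1] := subvPn nV.
  by exists w; split=> // x; rewrite L0 memv0 => /eqP->; rewrite lie0l mem0v.
pose Q m := `[< exists K, [/\ (K <= L)%VS, (\dim K < \dim L)%N,
  forall x y, x \in K -> y \in K -> lie x y \in K & \dim K = m] >].
have Q0 : exists m, Q m.
  exists 0%N; apply/asboolP; exists 0%VS; split; rewrite ?sub0v ?dimv0 //.
    by rewrite lt0n dimv_eq0.
  by move=> x y; rewrite !memv0 => /eqP-> _; rewrite lie0l.
have Qb m : Q m -> (m <= \dim L)%N by move=> /asboolP[K [_ /ltnW h _ <-]].
case: (ex_maxnP Q0 Qb) => m /asboolP[K [KL dK hK mE]] mmax.
have nLK : ~~ (L <= K)%VS by apply: contraL dK => /dimvS; rewrite -leqNgt.
have IHK := IHd K; have dKd : (\dim K <= d)%N by rewrite -ltnS (leq_trans dK).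
have nK x : x \in K -> x ^+ n = 0 by move/(subvP KL); apply: nL.
have [z [zL zK hz]] : exists z, [/\ z \in L, z \notin K & forall x, x \in K -> lie x z \in K].
  apply: IHK => // x v /(subvP KL) xL vL; exact: hL.
have LE x : x \in L -> exists2 y, y \in K & exists c, x = y + c *: z.
  suff -> : L = (K + <[z]>)%VS.
    by case/memv_addP => u uK [v /vlineP[c ->] ->]; exists u => //; exists c.
  apply/eqP; rewrite eq_sym eqEdim subv_add KL -memvE zL /=; rewrite leqNgt; apply/negP => lt.
  have KzK : (\dim K < \dim (K + <[z]>))%N.
    rewrite ltn_neqAle dimvS ?addvSl // andbT; apply: contraNN zK => /eqP e.
    have /eqP -> : K == (K + <[z]>)%VS by rewrite eqEdim addvSl e leqnn.
    by apply: (subvP (addvSr K <[z]>)); exact: memv_line.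
  suff /mmax : Q (\dim (K + <[z]>)) by rewrite -mE leqNgt KzK.
  apply/asboolP; exists (K + <[z]>)%VS; split=> //.
    by rewrite subv_add KL -memvE.
  move=> _ _ /memv_addP[u uK [_ /vlineP[c ->] ->]] /memv_addP[v vK [_ /vlineP[c' ->] ->]].
  apply: (subvP (addvSl K <[z]>)); rewrite linearD /= !lieDl !linearZ /= !lieZl lie_id.
  rewrite !scaler0 addr0 rpredD //; last by rewrite memvZ // hz.
  by apply: rpredD; [exact: hK|apply: memvZ; rewrite lieC rpredN hz].
have [U hU] : exists U, forall w, w \in U <-> (w \in V2 /\ forall x, x \in K -> lie x w \in V1).
  apply: vspace_of_pred; first by split=> [|x _]; rewrite ?linear0 mem0v.
  move=> a x y [x2 hx] [y2 hy]; split=> [|u uK]; first by rewrite rpredD ?memvZ.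
  by rewrite linearD linearZ /= rpredD ?memvZ ?hx ?hy.
have zU w : w \in U -> lie z w \in U.
  move=> /hU[w2 hw]; apply/hU; split; first exact: st2.
  move=> x xK; rewrite jacobi rpredD //; first by apply: hw; exact: hz.
  by apply: st1 => //; apply: hw.
have [w [w2 w1 hw]] : exists w, [/\ w \in V2, w \notin V1 & forall x, x \in K -> lie x w \in V1].
  by apply: IHK => // x v /(subvP KL); [exact: st1|exact: st2].
have wU i : iter i (lie z) w \in U by elim: i => [|i IHi] /=; [apply/hU|exact: zU].
have ex0 : exists i, iter i (lie z) w \in V1.
  by exists (n + n)%N; rewrite iter_lie_nilp ?mem0v ?leqnn //; exact: nL.
case: (ex_minnP ex0) => -[|i] hi imin; first by rewrite /= (negPf w1) in hi.
exists (iter i (lie z) w); have /hU[wi2 wiK] := wU i; split=> //.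
  by apply/negP => /imin; rewrite ltnn.
move=> x /LE[y yK [c ->]]; rewrite lieDl lieZl.
by apply: rpredD; [exact: wiK|exact: memvZ].
Qed.

End Engel.

(** * Nilpotency criteria and the trace form *)

Section Nilpotency.
Variables (k : closedFieldType) (n : nat).
Hypothesis char0 : [pchar k] =i pred0.
Local Notation M := 'M[k]_n.
Implicit Types (x : M).

Lemma char0_intr_eq0 (z : int) : (z%:~R == 0 :> k) = (z == 0).
Proof.
by case: z => i; rewrite ?NegzE ?mulrNz ?oppr_eq0 -pmulrn (char0_natf_eq0 char0).
Qed.

Lemma spectral_nilp0 x s E : spectral x s E -> replica s E id = 0 -> x ^+ n = 0.
Proof. by move=> xE e; have [m] := spectral_nilp xE; rewrite e subr0; apply: nilp_expn. Qed.

Lemma spectral_rank x s E a : spectral x s E -> a \in s -> \tr (E a) = (\rank (E a))%:R.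
Proof. by case=> _ _ EE _ _ sa; rewrite mxtrace_idem // EE // eqxx. Qed.

Lemma replica_ind x s E b : spectral x s E -> b \in s -> replica s E (fun a => (a == b)%:R) = E b.
Proof.
case=> us _ _ _ _ sb; rewrite /replica (bigD1_seq b) //= eqxx scale1r big1 ?addr0 //.
by move=> a /negPf->; rewrite scale0r.
Qed.

Lemma mxtrace_spectral x s E b : spectral x s E -> b \in s -> \tr (x *m E b) = b * (\rank (E b))%:R.
Proof.
move=> xE sb; rewrite -(spectral_rank xE sb) -[in LHS](replica_ind xE sb) (mxtrace_replica xE).
have [us _ _ _ _] := xE; rewrite (bigD1_seq b) //= eqxx mul1r big1 ?addr0 //.
by move=> a /negPf->; rewrite !mul0r.
Qed.

Lemma nilp_of_traces x s E : spectral x s E -> (forall b, b \in s -> \tr (x *m E b) = 0) ->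
  x ^+ n = 0.
Proof.
move=> xE h; apply: (spectral_nilp0 xE); rewrite /replica big_seq big1 // => b sb.
have /eqP := h b sb; rewrite (mxtrace_spectral xE sb) mulf_eq0 (char0_natf_eq0 char0) mxrank_eq0.
by case/orP => /eqP->; rewrite ?scale0r ?scaler0.
Qed.

(** A commutator that commutes with one of its entries is nilpotent, because it
    is orthogonal to its own spectral idempotents. *)
Lemma jacobson (u v : M) : lie u v *m v = v *m lie u v -> lie u v ^+ n = 0.
Proof.
move=> c; have [s [E xE]] := spectral_exists (lie u v); apply: (nilp_of_traces xE) => b sb.
have [_ _ _ _ EC] := xE; have e : lie v (E b) = 0 by apply/lie_eq0; rewrite EC.
by rewrite mxtrace_lie e mulmx0 mxtrace0.
Qed.

Lemma mxtrace_mul_nilp (u v : M) : u *m v = v *m u -> v ^+ n = 0 -> \tr (u *m v) = 0.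
Proof.
by move=> c vn; apply: (@mxtrace_nilp _ _ _ n); rewrite mulmxE exprMn_comm // vn mulr0.
Qed.

Lemma avoid_nat (l : seq k) : exists m : nat, m%:R \notin l.
Proof.
pose r := [seq i%:R : k | i <- iota 0 (size l).+1].
have ur : uniq r by rewrite map_inj_uniq ?iota_uniq //; exact: natr_inj0.
apply: contrapT => h; have sub : {subset r <= l}.
  by move=> _ /mapP[i _ ->]; apply: contrapT => /negP hi; apply: h; exists i.
by have := uniq_leq_size ur sub; rewrite size_map size_iota ltnn.
Qed.

(** Among the points y' + m y0, for natural numbers m, only finitely many are
    zeros of some member of the family. *)
Lemma avoid (W : zmodType) (Y : W -> Prop) (I : eqType) (r : seq I) (F : I -> W -> k) :
  (exists y, Y y) -> (forall u v, Y u -> Y v -> Y (u + v)) ->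
  (forall i u v, F i (u + v) = F i u + F i v) ->
  (forall i, i \in r -> exists2 y, Y y & F i y != 0) ->
  exists2 y, Y y & forall i, i \in r -> F i y != 0.
Proof.
move=> Y0 YD FD; elim: r => [|i r IHr] hr; first by have [y] := Y0; exists y.
have [|y0 Yy0 h0] := IHr; first by move=> j jr; apply: hr; rewrite inE jr orbT.
have [y' Yy' h'] := hr i (mem_head _ _).
have FM j y m : F j (y *+ m) = F j y * m%:R.
  have F0 : F j 0 = 0 by apply: (addrI (F j 0)); rewrite -FD !addr0.
  by elim: m => [|m IHm]; rewrite ?mulr0n ?F0 ?mulr0 // mulrSr FD IHm -natr1 mulrDr mulr1.
case: (eqVneq (F i y0) 0) => [e|ne]; last first.
  by exists y0 => // j; rewrite inE => /orP[/eqP->|/h0].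
have [m hm] := avoid_nat [seq - F j y' / F j y0 | j <- r].
exists (y' + y0 *+ m) => [|j].
  elim: (m) => [|m' IHm]; first by rewrite addr0.
  by rewrite mulrSr addrA; apply: YD.
rewrite inE FD FM => /orP[/eqP->|jr]; first by rewrite e mul0r addr0.
apply: contraNneq hm => e0; apply/mapP; exists j => //.
apply: (mulIf (h0 j jr)); rewrite divfK ?h0 //; apply/eqP.
by rewrite -addr_eq0 addrC [_ * F j y0]mulrC e0.
Qed.

End Nilpotency.

Section TraceForm.
Variables (k : closedFieldType) (n : nat).
Hypothesis char0 : [pchar k] =i pred0.
Local Notation M := 'M[k]_n.
Implicit Types (x y z u v w : M).
Variable G : set M.
Hypothesis sG : almost_simple G.
Local Notation g := (Lie G).

Lemma asG_closed : closed_subgroup G. Proof. by case: sG. Qed.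
Lemma asG_con : zconnected G. Proof. by case: sG. Qed.
Lemma asG_unit x : G x -> x \in unitmx. Proof. by case: asG_closed => -[h _ _ _] _; exact: h. Qed.
Lemma asG_mul x y : G x -> G y -> G (x *m y). Proof. by case: asG_closed => -[_ _ h _] _; exact: h. Qed.
Lemma asG_inv x : G x -> G (invmx x). Proof. by case: asG_closed => -[_ _ _ h] _; exact: h. Qed.
Lemma asG1 : G 1%:M. Proof. by case: asG_closed => -[]. Qed.

Lemma lie_in x y : x \in g -> y \in g -> lie x y \in g.
Proof. by move=> /LieP hx /LieP hy; apply/LieP/tangent_lie => //; case: asG_closed. Qed.
Lemma conj_in a x : G a -> x \in g -> conj a x \in g.
Proof. by move=> Ga /LieP hx; apply/LieP/tangent_Ad => //; case: asG_closed. Qed.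
Lemma expm_in x : x \in g -> x ^+ n = 0 -> G (expm x).
Proof. by move=> /LieP hx xn; apply: expm_Lie => //; exact: asG_closed. Qed.

(** The exponentials of Z form a commutative subgroup, normal in G and swept out
    by arcs. *)
Lemma abelian_nilp_trivial (Z : {vspace M}) : (Z <= g)%VS -> (forall x, x \in Z -> x ^+ n = 0) ->
  (forall x y, x \in Z -> y \in Z -> lie x y = 0) ->
  (forall a x, G a -> x \in Z -> conj a x \in Z) -> Z = 0%VS.
Proof.
move=> Zg nZ cZ aZ; pose K : set M := [set expm z | z in [set z | z \in Z]].
have cE x y : x \in Z -> y \in Z -> expm x *m expm y = expm (x + y).
  by move=> xZ yZ; rewrite expmD ?nZ //; apply/lie_eq0/cZ.
have K1 : K 1%:M by exists 0; rewrite ?expm0 //= mem0v.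
have KG : K `<=` G by move=> _ [z /= zZ <-]; apply: expm_in; [exact: (subvP Zg)|exact: nZ].
have e : K = [set 1%:M].
  apply: (almost_simple_trivial char0 sG).
  - split=> // [x /KG/asG_unit//|_ _ [x /= xZ <-] [y /= yZ <-]|_ [x /= xZ <-]].
      by rewrite cE //; exists (x + y) => //=; rewrite rpredD.
    by rewrite expm_inv ?nZ //; exists (- x) => //=; rewrite rpredN.
  - split=> // a _ Ga [x /= xZ <-]; exists (conj a x) => /=; first exact: aZ.
    by rewrite conj_of_expm //; exact: asG_unit.
  - by move=> _ _ [x /= xZ <-] [y /= yZ <-]; rewrite !cE // addrC.
  - move=> _ [x /= xZ <-]; exists (fun s => expm ((s - 1) *: x)), 1, 2.
    split; rewrite ?oner_neq0 ?(char0_natf_eq0 char0) //; first by apply: arc_expm; rewrite ?nZ.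
      by rewrite subrr scale0r expm0.
    split; first by rewrite -[2]natr1 addrK scale1r.
    by move=> s _; exists ((s - 1) *: x) => //=; rewrite memvZ.
apply/eqP; rewrite -subv0; apply/subvP => z zZ; rewrite memv0; apply/eqP.
apply: (expm_eq1 char0 (nZ _ zZ)) => s.
have : K (expm (s *: z)) by exists (s *: z) => //=; rewrite memvZ.
by rewrite e.
Qed.

(** The radical of the trace form consists of nilpotent matrices; by Engel's
    theorem its centre is nonzero unless it vanishes, and exponentiates to a
    normal commutative subgroup. *)
Lemma trace_nondeg x : x \in g -> (forall y, y \in g -> \tr (x *m y) = 0) -> x = 0.
Proof.
have [R hR] : exists R : {vspace M}, forall x, x \in R <-> (x \in g /\ forall y, y \in g -> \tr (x *m y) = 0).
  apply: vspace_of_pred; first by split=> [|y _]; rewrite ?mem0v // mul0mx mxtrace0.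
  move=> c u v [ug hu] [vg hv]; split=> [|y yg]; first by rewrite rpredD ?memvZ.
  by rewrite mulmxDl -scalemxAl mxtraceD mxtraceZ hu // hv // mulr0 addr0.
have Rg : (R <= g)%VS by apply/subvP => u /hR[].
have nR u : u \in R -> u ^+ n = 0.
  move=> /hR[ug hu]; have [s [E xE]] := spectral_exists u.
  have [d [c [phi [e rel tan _ _]]]] := integral_replicas char0 xE.
  apply: (spectral_nilp0 xE); rewrite e big1 // => j _.
  suff -> : replica s E (fun a => (phi j a)%:~R) = 0 by rewrite scaler0.
  have tj : replica s E (fun a => (phi j a)%:~R) \in g.
    by apply/LieP/tan; [exact: asG_closed|apply/LieP].
  (* The pairing of u with its integral replica is a relation between the
     eigenvalues of u; applied to the replica, it makes a sum of squares vanish.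
     *)
  have /rel/(_ j)/eqP : \sum_(a <- s) (phi j a * (\rank (E a))%:Z)%:~R * a = 0.
    rewrite -[RHS](hu _ tj) (mxtrace_replica xE); apply: eq_big_seq => a sa.
    by rewrite (spectral_rank xE sa) rmorphM /= mulrAC.
  rewrite psumr_eq0 => [/allP h|a _]; last by rewrite mulrAC mulr_ge0 // -expr2 sqr_ge0.
  rewrite /replica big_seq big1 // => a sa; have := h a sa; rewrite !mulf_eq0.
  case/orP => [/orP[]|] => [/eqP->||/eqP->]; rewrite ?scale0r //.
  by rewrite eqz_nat mxrank_eq0 => /eqP->; rewrite scaler0.
have lR u v : u \in R -> v \in g -> lie u v \in R.
  move=> /hR[ug hu] vg; apply/hR; split=> [|y yg]; first exact: lie_in.
  by rewrite mxtrace_lie hu // lie_in.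
move=> xg hx; have xR : x \in R by apply/hR.
suff R0 : R = 0%VS by move: xR; rewrite R0 memv0 => /eqP.
have [Z hZ] : exists Z : {vspace M}, forall x, x \in Z <-> (x \in R /\ forall y, y \in R -> lie y x = 0).
  apply: vspace_of_pred; first by split=> [|y _]; rewrite ?mem0v // linear0.
  move=> c u v [ug hu] [vg hv]; split=> [|y yg]; first by rewrite rpredD ?memvZ.
  by rewrite linearD linearZ /= hu // hv // scaler0 addr0.
have aR a u : G a -> u \in R -> conj a u \in R.
  move=> Ga /hR[ug hu]; apply/hR; split=> [|y yg]; first exact: conj_in.
  by rewrite mxtrace_conjl ?asG_unit // hu //; apply: conj_in => //; exact: asG_inv.
have Z0 : Z = 0%VS.
  apply: abelian_nilp_trivial => [|z /hZ[/nR//]|y z /hZ[yR _] /hZ[_ ->]//|a z Ga /hZ[zR hz]].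
    by apply/subvP => z /hZ[/(subvP Rg)].
  apply/hZ; split=> [|y yR]; first exact: aR.
  rewrite -[y](conjVK (asG_unit Ga)) -conj_lie ?asG_unit // hz ?linear0 //.
  by apply: aR => //; exact: asG_inv.
apply/eqP; apply: contraT => nR0.
have [] := @engel k n R 0%VS R _ nR.
- by move=> u v uR /(subvP Rg); apply: lR.
- by move=> u v _; rewrite memv0 => /eqP->; rewrite linear0 mem0v.
- by move=> u v uR /(subvP Rg); apply: lR.
- by rewrite subv0.
- move=> z [zR /negP z0 hz]; exfalso; apply: z0; rewrite -Z0; apply/hZ; split=> // y yR.
  by apply/eqP; rewrite -memv0 hz.
Qed.

Lemma riesz_trace (phi : M -> k) : scalar phi ->
  exists2 v, v \in g & forall w, w \in g -> \tr (v *m w) = phi w.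
Proof.
move=> lphi; apply: (riesz (b := fun v w => \tr (v *m w))) => //.
- by move=> w c u v; rewrite mulmxDl -scalemxAl mxtraceD mxtraceZ.
- by move=> w c u v; rewrite mulmxDr -scalemxAr mxtraceD mxtraceZ.
- exact: trace_nondeg.
Qed.

End TraceForm.

(** * Weights of the maximal torus *)

(** Conjugation by tg0 puts the torus in diagonal form; these coordinates are
    written [hat] below. *)
Record tordata (k : closedFieldType) (n : nat) := TorData {
  tG : set 'M[k]_n;
  tT : set 'M[k]_n;
  tg0 : 'M[k]_n;
  tchar0 : [pchar k] =i pred0;
  tas : almost_simple tG;
  tmax : maximal_torus tG tT;
  tunit : tg0 \in unitmx;
  tdiag : forall s, tT s -> is_diag_mx (conj tg0 s)
}.

#[global] Hint Resolve tunit tas tmax tchar0 : core.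

Section Torus.
Variables (k : closedFieldType) (n : nat).
Local Notation M := 'M[k]_n.
Implicit Types (x y z u v w tau : M).
Variable D : tordata k n.
Local Notation G := (tG D).
Local Notation T := (tT D).
Local Notation g0 := (tg0 D).
Local Notation hat := (conj g0).
Local Notation g := (Lie G).
Local Notation t := (Lie T).
Local Notation char0 := (tchar0 D).
Local Notation sG := (tas D).
Local Notation mT := (tmax D).
Local Notation ug0 := (tunit D).
Local Notation dT := (@tdiag k n D).

Lemma mT_sub : T `<=` G. Proof. by case: (mT). Qed.
Lemma mT_closed : closed_subgroup T. Proof. by case: (mT) => _ []. Qed.
Lemma mT_con : zconnected T. Proof. by case: (mT) => _ []. Qed.
Lemma mT_unit s : T s -> s \in unitmx. Proof. by move/mT_sub/(asG_unit sG). Qed.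
Lemma mT_mul x y : T x -> T y -> T (x *m y). Proof. by case: mT_closed => -[_ _ h _] _; exact: h. Qed.
Lemma mT_inv x : T x -> T (invmx x). Proof. by case: mT_closed => -[_ _ _ h] _; exact: h. Qed.
Lemma mT1 : T 1%:M. Proof. by case: mT_closed => -[]. Qed.
Lemma t_sub tau : tau \in t -> tau \in g.
Proof. by move=> /LieP h; apply/LieP/(tangent_sub mT_sub). Qed.

Lemma hat_inj : injective hat. Proof. exact: can_inj (conjK ug0). Qed.
Lemma hatP x y : hat x = hat y -> x = y. Proof. exact: hat_inj. Qed.

Lemma diag_lie tau : tau \in t -> is_diag_mx (hat tau).
Proof.
move=> /LieP h; apply/is_diag_mxP => i j ij.
apply: (tangent_linear (l := fun y => hat y i j)) h => [c u v|y Ty].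
  by rewrite linearP !mxE.
by have /is_diag_mxP := dT Ty; apply.
Qed.

Lemma diag_mulmx (d x : M) i j : is_diag_mx d -> (d *m x) i j = d i i * x i j.
Proof.
move=> /is_diag_mxP hd; rewrite mxE (bigD1 i) //= big1 ?addr0 // => l li.
by rewrite hd ?mul0r // eq_sym.
Qed.
Lemma mulmx_diag (d x : M) i j : is_diag_mx d -> (x *m d) i j = x i j * d j j.
Proof.
move=> /is_diag_mxP hd; rewrite mxE (bigD1 j) //= big1 ?addr0 // => l li.
by rewrite hd ?mulr0.
Qed.

Lemma hatZ c x i j : hat (c *: x) i j = c * hat x i j. Proof. by rewrite linearZ mxE. Qed.
Lemma hatD x y i j : hat (x + y) i j = hat x i j + hat y i j. Proof. by rewrite linearD mxE. Qed.
Lemma hatN x i j : hat (- x) i j = - hat x i j. Proof. by rewrite linearN mxE. Qed.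
Lemma hat0 i j : hat 0 i j = 0. Proof. by rewrite linear0 mxE. Qed.
Lemma hat_sum I (r : seq I) (F : I -> M) i j : hat (\sum_(l <- r) F l) i j = \sum_(l <- r) hat (F l) i j.
Proof. by rewrite linear_sum summxE. Qed.
Lemma mx_subE x y i j : (x - y) i j = x i j - y i j. Proof. by rewrite !mxE. Qed.

Lemma hat_lie d x i j : is_diag_mx (hat d) ->
  hat (lie d x) i j = (hat d i i - hat d j j) * hat x i j.
Proof.
move=> hd; rewrite conj_lie // /lie mx_subE (diag_mulmx _ _ _ hd) (mulmx_diag _ _ _ hd).
by rewrite mulrBl [hat x i j * _]mulrC.
Qed.

Lemma t_comm tau tau' : tau \in t -> tau' \in t -> lie tau tau' = 0.
Proof.
move=> h h'; apply: hatP; apply/matrixP => i j; rewrite hat_lie ?diag_lie // hat0.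
by have [->|ij] := eqVneq i j; rewrite ?subrr ?mul0r // (is_diag_mxP (diag_lie h')) ?mulr0.
Qed.

(** The value of a weight, extended to all matrices by a projection onto Lie T.
    *)
Definition ev (a : cartan_dual T) tau : k := a (vsproj t tau).

Lemma ev_scalar a : scalar (ev a).
Proof. by move=> c u v; rewrite /ev !linearP. Qed.
HB.instance Definition _ a := GRing.isLinear.Build k M k _ (ev a) (ev_scalar a).

Lemma evE a (h : cartan T) : ev a (vsval h) = a h.
Proof. by rewrite /ev vsvalK. Qed.

Lemma ev_eq a b : (forall tau, tau \in t -> ev a tau = ev b tau) -> a = b.
Proof. by move=> h; apply/lfunP => u; rewrite -!evE h // subvsP. Qed.

Lemma evD a b tau : ev (a + b) tau = ev a tau + ev b tau. Proof. by rewrite /ev lfunE. Qed.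
Lemma evN a tau : ev (- a) tau = - ev a tau. Proof. by rewrite /ev opp_lfunE. Qed.
Lemma evB a b tau : ev (a - b) tau = ev a tau - ev b tau. Proof. by rewrite evD evN. Qed.
Lemma ev0 tau : ev 0 tau = 0. Proof. by rewrite /ev lfunE. Qed.
Lemma evZ c a tau : ev (c *: a) tau = c * ev a tau. Proof. by rewrite /ev lfunE. Qed.

Lemma mkev (l : M -> k) : scalar l -> exists a, forall tau, tau \in t -> ev a tau = l tau.
Proof.
move=> ll; have lin : linear (fun h : cartan T => l (vsval h) : k^o).
  by move=> c u v; rewrite linearP ll.
pose f := HB.pack (fun h : cartan T => l (vsval h) : k^o)
  (GRing.isLinear.Build _ _ _ _ _ lin) : {linear cartan T -> k^o}.
by exists (linfun f) => tau ht; rewrite /ev lfunE /= vsprojK.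
Qed.

(** In coordinates where T is diagonal, the matrix units are weight vectors. *)
Lemma wt_ex : exists wt : 'I_n -> 'I_n -> cartan_dual T, forall i j tau, tau \in t ->
  ev (wt i j) tau = hat tau i i - hat tau j j.
Proof.
have h (p : 'I_n * 'I_n) : exists a, forall tau, tau \in t ->
    ev a tau = hat tau p.1 p.1 - hat tau p.2 p.2.
  apply: mkev => c u v; rewrite linearP !mxE mulrBr opprD addrACA //.
have [f hf] := choice h.
by exists (fun i j => f (i, j)) => i j; exact: hf (i, j).
Qed.
Definition wt := sval (cid wt_ex).
Lemma wtE i j tau : tau \in t -> ev (wt i j) tau = hat tau i i - hat tau j j.
Proof. exact: (svalP (cid wt_ex)). Qed.

(** Weight spaces of the adjoint action of Lie T. For a root they are the root
    spaces of the group, see [root_space_gsp] and [gsp_root_space]. *)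
Definition gsp a x := x \in g /\ forall tau, tau \in t -> lie tau x = ev a tau *: x.

Lemma gsp_in a x : gsp a x -> x \in g. Proof. by case. Qed.
Lemma gsp_lie a x tau : gsp a x -> tau \in t -> lie tau x = ev a tau *: x.
Proof. by case=> _; apply. Qed.
Lemma gspD a x y : gsp a x -> gsp a y -> gsp a (x + y).
Proof.
by move=> [xg hx] [yg hy]; split=> [|tau ht]; rewrite ?rpredD // linearD /= hx // hy // scalerDr.
Qed.
Lemma gspZ a c x : gsp a x -> gsp a (c *: x).
Proof.
move=> [xg hx]; split=> [|tau ht]; rewrite ?memvZ // linearZ /= hx //.
by rewrite !scalerA mulrC.
Qed.
Lemma gsp_0 a : gsp a 0.
Proof. by split=> [|tau ht]; rewrite ?mem0v // linear0 scaler0. Qed.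
Lemma gspN a x : gsp a x -> gsp a (- x).
Proof. by rewrite -scaleN1r; exact: gspZ. Qed.
Lemma gspB a x y : gsp a x -> gsp a y -> gsp a (x - y).
Proof. by move=> hx /gspN; exact: gspD. Qed.

Lemma gsp_lieD a b x y : gsp a x -> gsp b y -> gsp (a + b) (lie x y).
Proof.
move=> [xg hx] [yg hy]; split=> [|tau ht]; first exact: (lie_in sG).
by rewrite jacobi (hx tau ht) (hy tau ht) lieZl linearZ /= -scalerDl evD.
Qed.

Lemma gsp_orth a b x y : gsp a x -> gsp b y -> a + b != 0 -> \tr (x *m y) = 0.
Proof.
move=> [xg hx] [yg hy] ab; apply: contrapT => nz; move/eqP: ab; apply; apply: ev_eq => tau ht.
rewrite ev0 evD; have := mxtrace_lie x tau y; rewrite lieC hx // hy // mulNmx -scalemxAl -scalemxAr.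
rewrite raddfN /= !mxtraceZ => e; have /eqP : (ev a tau + ev b tau) * \tr (x *m y) = 0.
  by rewrite mulrDl -e addrN.
by rewrite mulf_eq0 => /orP[/eqP//|/eqP].
Qed.

(** The component of weight a. *)
Definition pr a x : M := conj (invmx g0) (\matrix_(i, j) if wt i j == a then hat x i j else 0).

Lemma hat_pr a x i j : hat (pr a x) i j = if wt i j == a then hat x i j else 0.
Proof. by rewrite /pr conjVK // mxE. Qed.

Lemma pr_linear a : linear (pr a).
Proof.
move=> c u v; apply: hatP; apply/matrixP => i j.
by rewrite hatD hatZ !hat_pr hatD hatZ; case: ifP; rewrite ?mulr0 ?addr0.
Qed.
HB.instance Definition _ a := GRing.isLinear.Build k M M _ (pr a) (pr_linear a).

Lemma lie_pr a x tau : tau \in t -> lie tau (pr a x) = ev a tau *: pr a x.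
Proof.
move=> ht; apply: hatP; apply/matrixP => i j; rewrite hat_lie ?diag_lie // hatZ hat_pr.
by case: eqP => [<-|_]; rewrite ?mulr0 // wtE.
Qed.

Lemma pr_lie a x tau : tau \in t -> pr a (lie tau x) = ev a tau *: pr a x.
Proof.
move=> ht; apply: hatP; apply/matrixP => i j; rewrite hatZ !hat_pr hat_lie ?diag_lie //.
by case: eqP => [<-|_]; rewrite ?mulr0 // wtE.
Qed.

Lemma pr_pr a b x : pr a (pr b x) = if a == b then pr b x else 0.
Proof.
apply: hatP; apply/matrixP => i j; rewrite !hat_pr.
case: (eqVneq a b) => [->|ab]; first by rewrite hat_pr; case: eqP.
by rewrite hat0; case: (wt i j =P a) => // ->; rewrite (negPf ab).
Qed.

Definition wts : seq (cartan_dual T) := undup [seq wt p.1 p.2 | p <- enum {: 'I_n * 'I_n}].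

Lemma wts_uniq : uniq wts. Proof. exact: undup_uniq. Qed.
Lemma mem_wts i j : wt i j \in wts.
Proof. by rewrite mem_undup; apply/mapP; exists (i, j); rewrite ?mem_enum. Qed.

Lemma sum_pr x : \sum_(a <- wts) pr a x = x.
Proof.
apply: hatP; apply/matrixP => i j; rewrite hat_sum.
under eq_bigr do rewrite hat_pr eq_sym.
by rewrite (bigD1_seq (wt i j)) ?mem_wts ?wts_uniq //= eqxx big1 ?addr0 // => a /negPf->.
Qed.

Lemma pr_notin a x : a \notin wts -> pr a x = 0.
Proof.
move=> h; apply: hatP; apply/matrixP => i j; rewrite hat_pr hat0; case: eqP => // e.
by rewrite -e mem_wts in h.
Qed.

Lemma regular_ex : exists2 tau, tau \in t & forall a b, a \in wts -> b \in wts -> a != b ->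
  ev a tau != ev b tau.
Proof.
pose r := [seq p <- [seq (a, b) | a <- wts, b <- wts] | p.1 != p.2].
have [||p u v|p|tau ht hr] := avoid char0 (Y := fun tau => tau \in t) (r := r)
    (F := fun p tau => ev (p.1 - p.2) tau).
- by exists 0; rewrite mem0v.
- by move=> u v; apply: rpredD.
- by rewrite linearD.
- rewrite mem_filter => /andP[/eqP ne _]; apply: contrapT => h; apply: ne.
  apply: ev_eq => tau ht; apply/eqP; rewrite -subr_eq0 -evB; apply: contrapT => /negP e; apply: h.
  by exists tau.
- exists tau => // a b aw bw ab; rewrite -subr_eq0 -evB.
  by apply: (hr (a, b)); rewrite mem_filter /= ab; apply/allpairsP; exists (a, b).
Qed.

(** An element of Lie T that separates the finitely many weights has the
    components of x as eigenvectors, for distinct eigenvalues. *)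
Lemma pr_stable (I : M -> Prop) x : (forall u v, I u -> I v -> I (u + v)) ->
  (forall c u, I u -> I (c *: u)) -> (forall tau u, tau \in t -> I u -> I (lie tau u)) ->
  I x -> forall a, I (pr a x).
Proof.
move=> ID IZ It Ix a; have [tau ht hr] := regular_ex.
case: (boolP (a \in wts)) => [aw|/pr_notin->]; last by rewrite -(scale0r x); apply: IZ.
pose F c := \sum_(b <- wts | ev b tau == c) pr b x.
have FE b : b \in wts -> F (ev b tau) = pr b x.
  move=> bw; rewrite /F -big_filter.
  have -> : [seq c <- wts | ev c tau == ev b tau] = [:: b].
    apply: perm_small_eq => //; apply: uniq_perm; rewrite ?filter_uniq ?wts_uniq // => c.
    rewrite mem_filter inE; case: (eqVneq c b) => [->|cb]; first by rewrite eqxx.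
    by case: (boolP (c \in wts)) => cw; rewrite ?andbF // andbT; apply/negbTE/hr.
  by rewrite big_seq1.
pose s := [seq ev b tau | b <- wts].
rewrite -FE //; apply: (@eigen_components k M (lie tau) I _ _ ID IZ _ s F 1) => //.
- by move=> u v; rewrite linearD.
- by move=> c u; rewrite linearZ.
- by move=> u; apply: It.
- rewrite map_inj_in_uniq ?wts_uniq // => b c bw cw e; apply/eqP/negPn/negP => bc.
  by have := hr b c bw cw bc; rewrite e eqxx.
- by move=> _ /mapP[b bw ->] /=; rewrite FE // /shift lie_pr ?subrr.
- rewrite big_map (eq_big_seq (fun b => pr b x)) ?sum_pr // => b bw; exact: FE.
- exact: map_f.
Qed.

Lemma pr_gsp a x : x \in g -> gsp a (pr a x).
Proof.
move=> xg; split=> [|tau ht]; last exact: lie_pr.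
apply: (pr_stable (I := fun x => x \in g)) => //.
- by move=> u v; apply: rpredD.
- by move=> c u; apply: memvZ.
- by move=> tau u /t_sub; apply: (lie_in (tas D)).
Qed.

Lemma gsp_pr a x : gsp a x -> pr a x = x.
Proof.
move=> hx; rewrite -[RHS]sum_pr; case: (boolP (a \in wts)) => aw; last first.
  have z b : pr b x = 0.
    apply/eqP; apply: contraNT aw => nz.
    have e : a = b; last by rewrite e; apply: contraNT nz => /pr_notin->.
    apply: ev_eq => tau ht; have := pr_lie b x ht; rewrite (gsp_lie hx) // linearZ /=.
    by move/eqP; rewrite -subr_eq0 -scalerBl scaler_eq0 (negPf nz) orbF subr_eq0 => /eqP.
  by rewrite z big1.
rewrite (bigD1_seq a) ?wts_uniq //= big1 ?addr0 // => b ba; apply/eqP; apply: contraNT ba => nz.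
apply/eqP; apply: ev_eq => tau ht; have := pr_lie b x ht; rewrite (gsp_lie hx) // linearZ /=.
by move/eqP; rewrite -subr_eq0 -scalerBl scaler_eq0 (negPf nz) orbF subr_eq0 => /eqP.
Qed.

End Torus.

(** * The centraliser of the maximal torus *)

Section CartanAlgebra.
Variables (k : closedFieldType) (n : nat).
Local Notation M := 'M[k]_n.
Implicit Types (x y z u v w tau : M).
Variable D : tordata k n.
Local Notation G := (tG D).
Local Notation T := (tT D).
Local Notation g0 := (tg0 D).
Local Notation hat := (conj g0).
Local Notation g := (Lie G).
Local Notation t := (Lie T).
Local Notation char0 := (tchar0 D).
Local Notation sG := (tas D).
Local Notation mT := (tmax D).
Local Notation ug0 := (tunit D).
Local Notation dT := (@tdiag k n D).
Local Notation hatP := (@hatP k n D).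

Lemma mx_scaleE (c : k) x i j : (c *: x) i j = c * x i j. Proof. by rewrite mxE. Qed.

Definition dmx (f : 'I_n -> k) : M := conj (invmx g0) (diag_mx (\row_i f i)).

Lemma hat_dmx f i j : hat (dmx f) i j = f i *+ (i == j).
Proof. by rewrite /dmx conjVK // !mxE. Qed.

Lemma dmxP tau : is_diag_mx (hat tau) -> tau = dmx (fun i => hat tau i i).
Proof.
move=> hd; apply: hatP; apply/matrixP => i j; rewrite hat_dmx.
by case: (eqVneq i j) => [->//|ij]; rewrite (is_diag_mxP hd).
Qed.

Lemma dmx_diag f : is_diag_mx (hat (dmx f)).
Proof. by rewrite /dmx conjVK // diag_mx_is_diag. Qed.

Lemma dmx_hat f i : hat (dmx f) i i = f i. Proof. by rewrite hat_dmx eqxx. Qed.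

Lemma dmxE f h : f =1 h -> dmx f = dmx h.
Proof. by move=> e; congr dmx; apply/funext. Qed.

Lemma diag_hat_inj x y : is_diag_mx (hat x) -> is_diag_mx (hat y) ->
  (forall i, hat x i i = hat y i i) -> x = y.
Proof. by move=> hx hy e; rewrite (dmxP hx) (dmxP hy); apply: dmxE. Qed.

Lemma hat_mul_diag x y i : is_diag_mx (hat x) -> hat (x *m y) i i = hat x i i * hat y i i.
Proof. by move=> hx; rewrite conjM // (diag_mulmx _ _ _ hx). Qed.

Lemma dmx_mul f h : dmx f *m dmx h = dmx (fun i => f i * h i).
Proof.
apply: diag_hat_inj => [||i]; last by rewrite hat_mul_diag ?dmx_diag // !dmx_hat.
  apply/is_diag_mxP => i j ij; rewrite conjM // (diag_mulmx _ _ _ (dmx_diag f)).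
  by rewrite (is_diag_mxP (dmx_diag h)) ?mulr0.
exact: dmx_diag.
Qed.

(** The spectral idempotents of a diagonal element. *)
Definition dspec tau := undup [seq hat tau i i | i : 'I_n].
Definition didem tau c := dmx (fun i => (hat tau i i == c)%:R).

Lemma mem_dspec tau i : hat tau i i \in dspec tau.
Proof. by rewrite mem_undup; apply/mapP; exists i; rewrite ?mem_enum. Qed.

Lemma didem_sum tau (f : k -> k) :
  \sum_(c <- dspec tau) f c *: didem tau c = dmx (fun i => f (hat tau i i)).
Proof.
apply: hatP; apply/matrixP => i j; rewrite hat_sum hat_dmx.
rewrite (bigD1_seq (hat tau i i)) ?mem_dspec ?undup_uniq //= hatZ hat_dmx eqxx big1 => [|c cd].
  by rewrite addr0 mulrnAr mulr1.
by rewrite hatZ hat_dmx eq_sym (negPf cd) mul0rn mulr0.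
Qed.

Lemma didem_spectral tau : is_diag_mx (hat tau) -> spectral tau (dspec tau) (didem tau).
Proof.
move=> hd; split.
- exact: undup_uniq.
- have := didem_sum tau (fun=> 1); under eq_bigr do rewrite scale1r.
  move=> ->; apply: diag_hat_inj => [||i]; rewrite ?dmx_diag // ?dmx_hat ?conj_id //.
  by rewrite mxE eqxx.
- move=> a b _ _; rewrite /didem dmx_mul; case: (eqVneq a b) => [->|ab].
    by apply: dmxE => i; rewrite -natrM mulnb andbb.
  apply: diag_hat_inj => [||i]; rewrite ?dmx_diag ?linear0 // ?dmx_hat.
    exact: mx0_is_diag.
  by rewrite [RHS]mxE; case: (hat tau i i =P a) => [->|_]; rewrite ?mul0r // (negPf ab) mulr0.
- exists 1%N => a _; rewrite expr1; apply: hatP; apply/matrixP => i j.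
  have -> : tau - a%:M = dmx (fun i => hat tau i i - a).
    apply: diag_hat_inj => [||l]; rewrite ?dmx_diag // ?dmx_hat ?linearB /=.
      apply/is_diag_mxP => l m lm; rewrite mx_subE (is_diag_mxP hd) // -scalemx1 linearZ /= conj_id //.
      by rewrite !mxE (negPf (_ : l != m)) // mulr0 subr0.
    by rewrite mx_subE -scalemx1 linearZ /= conj_id // !mxE eqxx mulr1.
  rewrite dmx_mul hat0 hat_dmx; case: (eqVneq (hat tau i i) a) => [->|_].
    by rewrite subrr mul0r mul0rn.
  by rewrite mulr0 mul0rn.
- move=> y e c; apply: hatP; apply/matrixP => i j.
  rewrite [hat (_ *m y)]conjM // [hat (y *m _)]conjM // (diag_mulmx _ _ _ (dmx_diag (fun i => (hat tau i i == c)%:R))).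
  rewrite (mulmx_diag _ _ _ (dmx_diag (fun i => (hat tau i i == c)%:R))) !dmx_hat.
  have /eqP : (hat tau i i - hat tau j j) * hat y i j = 0.
    by rewrite -hat_lie // /lie e subrr hat0.
  rewrite mulf_eq0 subr_eq0 => /orP[/eqP->|/eqP->]; first exact: mulrC.
  by rewrite mulr0 mul0r.
Qed.

Lemma replica_didem tau phi : replica (dspec tau) (didem tau) phi = dmx (fun i => phi (hat tau i i)).
Proof. exact: didem_sum. Qed.

(** The eigenvalues of tau are integers, so that the exponents d define a
    multiplicative replica of it. *)
Lemma integral_torus tau (d : 'I_n -> int) b : tau \in t ->
  (forall i, hat tau i i = (d i)%:~R) -> b != 0 -> T (dmx (fun i => b ^ d i)).
Proof.
move=> ht hd b0; pose S (a : k) := exists z : int, a = z%:~R.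
pose P (a : k) : int := xget 0 [set z : int | a = z%:~R].
have PE (z : int) : P z%:~R = z.
  rewrite /P; case: xgetP => [w _ /= /eqP|/(_ z)]; last by case.
  by rewrite -subr_eq0 -rmorphB /= (char0_intr_eq0 char0) subr_eq0 => /eqP.
have hS : adm_span (dspec tau) S.
  split; first by exists 0.
  split; last by move=> _ _ [z ->] [w ->]; exists (z + w); rewrite rmorphD.
  by move=> a; rewrite mem_undup => /mapP[i _ ->]; exists (d i).
have -> : dmx (fun i => b ^ d i) = replica (dspec tau) (didem tau) (fun a => b ^ P a).
  by rewrite replica_didem; apply: dmxE => i; rewrite hd PE.
have tT : tangent1 T tau by apply/LieP.
apply: (group_replica (didem_spectral (diag_lie ht)) hS (mT_closed D) tT) => [_ _ [z ->] [w ->]||a _].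
- by rewrite -rmorphD !PE expfzDr.
- by rewrite -[0 : k]/(0%:~R) PE.
- by rewrite expfz_neq0.
Qed.

Lemma idem_diagonalizable (e : M) : e *m e = e -> diagonalizable e.
Proof.
case: n e => [|m] e ee.
  by exists 1%:M; [exact: unitmx1|apply/is_diag_mxP => -[]].
apply/diagonalizableP; exists [:: 0; 1]; first by rewrite /= inE eq_sym oner_eq0.
rewrite big_cons big_seq1 mxminpoly_min // rmorphM /= !rmorphB /= horner_mx_X !horner_mx_C.
have -> : (0 : k)%:M = 0 :> 'M[k]_m.+1 by apply/matrixP => i j; rewrite !mxE mul0rn.
by rewrite subr0 mulrBr -mulmxE ee mulmx1 subrr.
Qed.

Lemma arc_replica t0 (s : seq k) (E : k -> M) (phi : k -> int) :
  arc (fun c : k => t0 *m replica s E (fun a => c ^ phi a)).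
Proof.
apply: (arc_poly (m := \sum_(a <- s) absz (phi a))) => i l.
exists (\sum_(a <- s) ((t0 *m E a) i l)%:P *
  'X^(absz ((\sum_(a <- s) absz (phi a))%N%:Z + phi a))) => z z0.
rewrite horner_sum /replica mulmx_sumr summxE mulr_sumr; apply: eq_big_seq => a sa.
rewrite hornerCM hornerXn -scalemxAr mx_scaleE [RHS]mulrA [RHS]mulrC; congr (_ * _).
rewrite -[z ^+ (\sum_(_ <- s) _)]/(z ^ (Posz _)) -expfzDr // -[LHS]/(z ^ (Posz _)) gez0_abs //.
have : (absz (phi a) <= \sum_(a <- s) absz (phi a))%N by rewrite [leqRHS](big_rem a) //= leq_addr.
lia.
Qed.

(** The semisimple part of an element commuting with T is tangent to T: by
    maximality, T contains the one-parameter subgroups of its integral replicas,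
    since they generate a torus together with T. *)
Lemma ss_part x : x \in g -> (forall tau, tau \in t -> lie tau x = 0) ->
  exists tau, [/\ tau \in t, (x - tau) ^+ n = 0 & forall y, lie x y = 0 -> lie tau y = 0].
Proof.
move=> xg cx; have [s [E xE]] := spectral_exists x.
have [us E1 EE _ EC] := xE.
have [d [c [phi [e _ _ htan hgrp]]]] := integral_replicas char0 xE.
have rC psi y : lie x y = 0 -> lie (replica s E psi) y = 0.
  by move=> /lie_eq0 h; apply/lie_eq0; rewrite (replica_comm xE).
exists (replica s E id); split; last by move=> y; exact: rC.
  2: by have [m] := spectral_nilp xE; exact: nilp_expn.
rewrite e; apply: rpred_sum => j _; apply: memvZ; apply/LieP/htan => b b0.
pose R b := replica s E (fun a => b ^ phi j a).
have cTx y : T y -> y *m x = x *m y.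
  move=> Ty; have cu u : tangent1 T u -> u *m x = x *m u.
    by move=> /LieP ut; apply/lie_eq0; exact: cx.
  by have := commute_Lie char0 (mT_closed D) (@mT_con _ _ D) cu; apply.
have RT b' y : T y -> y *m R b' = R b' *m y.
  by move=> Ty; apply/esym/(replica_comm xE)/esym/cTx.
have RM b1 b2 : R b1 *m R b2 = R (b1 * b2).
  by rewrite (replica_mul xE); apply: replica_eq => a _; rewrite expfzMl.
have R1 : R 1 = 1%:M.
  by rewrite -(replica1 xE); apply: replica_eq => a _; rewrite exp1rz.
have RG b' : b' != 0 -> G (R b').
  by move=> nz; apply: hgrp => //; [exact: asG_closed|apply/LieP].
pose K : set M := [set y | exists t0 b', [/\ T t0, b' != 0 & y = t0 *m R b']].
have KG : K `<=` G by move=> _ [t0 [b' [Tt nz ->]]]; apply: (asG_mul sG); [exact: mT_sub|exact: RG].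
have KT : T `<=` K by move=> y Ty; exists y, 1; rewrite R1 mulmx1 oner_neq0.
have Ri b' : b' != 0 -> invmx (R b') = R b'^-1.
  move=> nz; have uR : R b' \in unitmx by apply: (asG_unit sG); exact: RG.
  by apply: (can_inj (mulKmx uR)); rewrite mulmxV // RM divff.
have KU : K `<=` [set y | y \in unitmx] by move=> y /KG/(asG_unit sG).
have gK : subgroup K.
  split=> // [|_ _ [t1 [b1 [T1 n1 ->]]] [t2 [b2 [T2 n2 ->]]]|_ [t1 [b1 [T1 n1 ->]]]].
  - exact: KT (mT1 D).
  - exists (t1 *m t2), (b1 * b2); rewrite mulf_neq0 // -RM; split=> //; first exact: mT_mul.
    by rewrite -!mulmxA; congr (_ *m _); rewrite !mulmxA (RT b1 t2 T2).
  - have uR : R b1 \in unitmx by apply: (asG_unit sG); exact: RG.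
    exists (invmx t1), b1^-1; split; rewrite ?invr_neq0 //; first exact: mT_inv.
    by rewrite invmxM ?mT_unit ?(mT_unit T1) // Ri // (RT _ _ (mT_inv T1)).
(* T and the idempotents of x commute, and are diagonalised simultaneously. *)
have [As [hAs AsT AsE]] : exists As : seq M, [/\ codiagonalizable As,
    forall y, T y -> y \in <<As>>%VS & forall a, a \in s -> E a \in As].
  have [C hC] : exists C : {vspace M}, forall y, y \in C <->
      (is_diag_mx (hat y) /\ forall a, a \in s -> E a *m y = y *m E a).
    apply: vspace_of_pred; first by rewrite linear0 mx0_is_diag; split=> // a _; rewrite mulmx0 mul0mx.
    move=> b1 u v [du cu] [dv cv]; split=> [|a sa].
      apply/is_diag_mxP => i l il; rewrite hatD hatZ (is_diag_mxP du) // (is_diag_mxP dv) //.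
      by rewrite mulr0 addr0.
    by rewrite mulmxDr mulmxDl -scalemxAr -scalemxAl cu // cv.
  have bC y : y \in (vbasis C : seq M) -> y \in C by apply: vbasis_mem.
  exists ([seq E a | a <- s] ++ vbasis C); split.
  - apply/codiagonalizableP; split=> [u v|u]; rewrite ?mem_cat.
      case/orP => [/mapP[a sa ->]|/bC/hC[du cu]] /orP[/mapP[b1 sb ->]|/bC/hC[dv cv]]; rewrite /comm_mx.
      + by rewrite !EE // eq_sym; case: eqP => // ->.
      + exact: cv.
      + by rewrite cu.
      + apply: hatP; rewrite !conjM //; apply/matrixP => i l.
        rewrite (diag_mulmx _ _ _ du) (mulmx_diag _ _ _ du).
        have [->|il] := eqVneq i l; first by rewrite mulrC.
        by rewrite (is_diag_mxP dv) // mulr0 mul0r.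
    case/orP => [/mapP[a sa ->]|/bC/hC[du _]].
      by apply: idem_diagonalizable; rewrite EE // eqxx.
    exists g0; first exact: ug0.
    by apply/(similar_diagP u ug0) => i l; exact: (is_diag_mxP du).
  - move=> y Ty; rewrite span_cat; apply: (subvP (addvSr _ _)).
    rewrite (span_basis (vbasisP C)); apply/hC; split; first exact: (dT Ty).
    move=> a sa; apply: EC; apply/esym; exact: cTx.
  - by move=> a sa; rewrite mem_cat map_f.
have [P uP /allP hP] := hAs.
have diagAs y : y \in <<As>>%VS -> is_diag_mx (conj P y).
  move=> h; rewrite (coord_span (X := in_tuple As) h) linear_sum; apply/is_diag_mxP => i l il.
  rewrite summxE big1 // => j' _; rewrite linearZ mxE.
  have /(similar_diagP _ uP)-> := hP _ (mem_nth 0 (ltn_ord j')) => //.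
  by rewrite mulr0.
have dK y : K y -> is_diag_mx (conj P y).
  move=> [t0 [b' [Tt _ ->]]]; have dt := diagAs _ (AsT _ Tt).
  have dR : is_diag_mx (conj P (R b')).
    apply: diagAs; rewrite /R /replica big_seq; apply: rpred_sum => a sa.
    by apply: memvZ; apply/memv_span/AsE.
  apply/is_diag_mxP => i l il; rewrite conjM // (diag_mulmx _ _ _ dt).
  by rewrite (is_diag_mxP dR) // mulr0.
suff <- : zclosure K = T by apply: zclosure_sub => //; exists 1%:M, b; rewrite mul1mx; split=> //; exact: mT1.
have [_ _ maxT] := mT; apply: maxT.
- by apply: zclosure_min => //; case: (asG_closed sG).
- split.
  + by split; [exact: zclosure_subgroup|exact: zclosure_closed].
  + apply: (zconnected_arcs char0 (mT_closed D).2 (@mT_con _ _ D)) => //; first by exists 1%:M; exact: mT1.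
    move=> _ [t0 [b' [Tt nz ->]]]; exists (fun c => t0 *m R c), 1, b'.
    split; rewrite ?oner_neq0 ?R1 ?mulmx1 //; last by split=> // z z0; exists t0, z.
    exact: arc_replica.
  + exists P => // y Ky; apply/is_diag_mxP => i l il.
    apply: (zclosure_pfun (K := K) (u := fun y => conj P y i l)) Ky; first exact: pmap_conj.
    by move=> z /dK/is_diag_mxP->.
- by move=> y /KT; apply: zclosure_sub.
Qed.

Lemma diag_nilp x : is_diag_mx (hat x) -> x ^+ n = 0 -> x = 0.
Proof.
move=> hd x0; rewrite (dmxP hd); apply: diag_hat_inj; rewrite ?dmx_diag ?linear0 ?mx0_is_diag // => i.
rewrite dmx_hat; have : forall m, hat (x ^+ m) i i = hat x i i ^+ m.
  elim=> [|m IHm]; first by rewrite !expr0 conj_id // mxE eqxx.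
  by rewrite !exprS -mulmxE hat_mul_diag // IHm.
by move/(_ n); rewrite x0 hat0 => /esym/eqP; rewrite expf_eq0 => /andP[_ /eqP->]; rewrite [RHS]mxE.
Qed.

Lemma orth_gsp0 x : gsp (D := D) 0 x -> (forall y, gsp (D := D) 0 y -> \tr (x *m y) = 0) -> x = 0.
Proof.
move=> hx h; apply: (trace_nondeg char0 sG) => [|y yg]; first exact: gsp_in hx.
rewrite -(sum_pr D y) mulmx_sumr raddf_sum big1 // => a _ /=.
have [->|a0] := eqVneq a 0; first by apply: h; exact: pr_gsp.
by apply: (gsp_orth hx (pr_gsp a yg)); rewrite add0r.
Qed.

(** By [ss_part] an element of weight 0 is the sum of one of Lie T and a
    nilpotent one. The nilpotent ones are closed under sums, hence orthogonal to
    everything of weight 0, hence zero. *)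
Lemma gsp0P x : gsp (D := D) 0 x <-> x \in t.
Proof.
split; last first.
  by move=> xt; split=> [|tau ht]; [exact: t_sub|rewrite ev0 scale0r (@t_comm _ _ D)].
have jd y : gsp (D := D) 0 y -> exists tau nu, [/\ tau \in t, nu ^+ n = 0, gsp (D := D) 0 nu & y = tau + nu].
  move=> [yg hy]; have [|tau [ht nu _]] := ss_part yg; first by move=> tau ht; rewrite hy // ev0 scale0r.
  exists tau, (y - tau); split=> //; last by rewrite addrC subrK.
  split=> [|tau' ht']; first by rewrite rpredB // t_sub.
  by rewrite linearB /= hy // (@t_comm _ _ D) // ev0 !scale0r subrr.
have tn tau nu : tau \in t -> gsp (D := D) 0 nu -> nu ^+ n = 0 -> \tr (tau *m nu) = 0.
  move=> ht [_ hn] nn; apply: mxtrace_mul_nilp => //.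
  by apply/lie_eq0; rewrite hn // ev0 scale0r.
have nD u v : gsp (D := D) 0 u -> gsp (D := D) 0 v -> u ^+ n = 0 -> v ^+ n = 0 -> (u + v) ^+ n = 0.
  move=> hu hv un vn; have [tau [nu [ht nn hn e]]] := jd _ (gspD hu hv).
  suff -> : u + v = nu by [].
  suff : tau = 0 by rewrite e => ->; rewrite add0r.
  have sp := didem_spectral (diag_lie ht).
  have cE w c : gsp (D := D) 0 w -> w *m didem tau c = didem tau c *m w.
    have [_ _ _ _ EC] := sp; move=> [_ hw]; rewrite EC //; apply/lie_eq0.
    by rewrite hw // ev0 scale0r.
  have tE w c : gsp (D := D) 0 w -> w ^+ n = 0 -> \tr (w *m didem tau c) = 0.
    by move=> hw wn; rewrite mxtrace_mulC mxtrace_mul_nilp //; apply/esym/cE.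
  have tn0 : tau ^+ n = 0.
    apply: (nilp_of_traces char0 sp) => c _; have := tE _ c hu un.
    have := tE _ c hv vn => e1 e2.
    transitivity (\tr ((u + v - nu) *m didem tau c)); first by rewrite e addrK.
    by rewrite mulmxBl mulmxDl raddfB raddfD /= e1 e2 tE // addr0 subr0.
  exact: (diag_nilp (diag_lie ht)).
move=> hx; have [tau [nu [ht nn hn ->]]] := jd x hx.
suff -> : nu = 0 by rewrite addr0.
apply: orth_gsp0 => // y hy; have [tau' [mu [ht' mn hm ->]]] := jd y hy.
rewrite mulmxDr mxtraceD [X in X + _]mxtrace_mulC (tn _ _ ht' hn nn) add0r.
have sq w : w ^+ n = 0 -> \tr (w *m w) = 0.
  by move=> wn; apply: mxtrace_mul_nilp.
have := sq _ (nD _ _ hn hm nn mn); rewrite mulmxDl !mulmxDr !mxtraceD sq // sq // add0r addr0.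
rewrite [X in _ + X]mxtrace_mulC -mulr2n => /eqP; rewrite -mulr_natr mulf_eq0.
by rewrite (char0_natf_eq0 char0) orbF => /eqP.
Qed.
End CartanAlgebra.

(** * Roots, coroots and sl2-triples *)

Lemma iter_mulmx (k : closedFieldType) n (x v : 'M[k]_n) m : iter m (mulmx x) v = x ^+ m *m v.
Proof.
elim: m => [|m IHm]; first by rewrite expr0 mul1mx.
by rewrite iterS IHm exprS -mulmxE mulmxA.
Qed.

Section SL2Modules.
Variables (k : closedFieldType) (W : lmodType k).
Hypothesis char0 : [pchar k] =i pred0.
Variables (E F H : {linear W -> W}).
Hypothesis EF : forall w, E (F w) = F (E w) + H w.
Hypothesis HF : forall w, H (F w) = F (H w) - 2 *: F w.

Lemma sl2_weight c v i : H v = c *: v -> H (iter i F v) = (c - (2 * i)%:R) *: iter i F v.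
Proof.
move=> hv; elim: i => [|i IHi]; first by rewrite muln0 subr0.
rewrite iterS HF IHi linearZ /= -scalerBl; congr (_ *: _).
rewrite (_ : (2 * i.+1 = 2 * i + 2)%N) ?natrD ?opprD ?addrA //; lia.
Qed.

Lemma sl2_raise c v i : H v = c *: v -> E v = 0 ->
  E (iter i.+1 F v) = (i.+1%:R * c - (i * i.+1)%:R) *: iter i F v.
Proof.
move=> hv ev; elim: i => [|i IHi].
  by rewrite /= EF ev linear0 add0r hv mul1r subr0.
rewrite iterS EF IHi linearZ /= -iterS (sl2_weight _ hv) -scalerDl; congr (_ *: _).
rewrite -[in RHS]natr1 mulrDl mul1r addrACA -opprD -natrD; congr (_ - _%:R); lia.
Qed.

(** With N + 1 minimal such that F^(N+1) v = 0, applying E gives (N + 1) (c - N)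
    = 0. *)
Lemma sl2_primitive c v : v != 0 -> H v = c *: v -> E v = 0 -> (exists m, iter m F v = 0) ->
  exists N : nat, [/\ c = N%:R, forall i, (i <= N)%N -> iter i F v != 0 & iter N.+1 F v = 0].
Proof.
move=> v0 hv ev [m0 hm0]; have ex0 : exists m, iter m F v == 0 by exists m0; apply/eqP.
case: (ex_minnP ex0) => -[|N] hN mN; first by rewrite /= (negPf v0) in hN.
have nz : iter N F v != 0 by apply/negP => /mN; rewrite ltnn.
exists N; split; last exact/eqP.
  have /eqP := sl2_raise N hv ev; rewrite (eqP hN) linear0 eq_sym scaler_eq0 (negPf nz) orbF.
  rewrite subr_eq0 mulnC natrM => /eqP/mulfI-> //.
  by rewrite (char0_natf_eq0 char0).
by move=> i iN; apply/negP => /mN; rewrite ltnNge iN.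
Qed.

Lemma sl2_raise_neq0 (N : nat) v i : v != 0 -> H v = N%:R *: v -> E v = 0 -> (i < N)%N ->
  (exists m, iter m F v = 0) -> E (iter i.+1 F v) != 0.
Proof.
move=> v0 hv ev iN hm; have [N' [/(natr_inj0 char0) e nz _]] := sl2_primitive v0 hv ev hm.
rewrite (sl2_raise _ hv ev) scaler_eq0 negb_or nz -?e 1?ltnW // andbT.
rewrite -natrM subr_eq0; apply/eqP => /(natr_inj0 char0); nia.
Qed.

End SL2Modules.

Section Roots.
Variables (k : closedFieldType) (n : nat).
Local Notation M := 'M[k]_n.
Implicit Types (x y z u v w tau : M).
Variable D : tordata k n.
Local Notation G := (tG D).
Local Notation T := (tT D).
Local Notation g0 := (tg0 D).
Local Notation hat := (conj g0).
Local Notation g := (Lie G).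
Local Notation t := (Lie T).
Local Notation char0 := (tchar0 D).
Local Notation sG := (tas D).
Local Notation ug0 := (tunit D).
Local Notation hatP := (@hatP k n D).
Local Notation gsp := (@gsp k n D).
Local Notation ev := (@ev k n D).
Local Notation pr := (@pr k n D).
Local Notation wt := (wt D).
Local Notation wts := (wts D).
Local Notation dmx := (dmx D).
Local Notation dspec := (dspec D).
Local Notation didem := (didem D).
Local Notation diag_hat_inj := (@diag_hat_inj k n D).

Definition root a := a != 0 /\ exists2 x, x != 0 & gsp a x.

Lemma ev_neq0 (a : cartan_dual T) : a != 0 -> exists2 tau, tau \in t & ev a tau = 1.
Proof.
move=> a0; have [tau ht nz] : exists2 tau, tau \in t & ev a tau != 0.
  apply: contrapT => h; move/eqP: a0; apply; apply: ev_eq => tau ht.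
  by rewrite ev0; apply/eqP/negPn/negP => nz; apply: h; exists tau.
by exists ((ev a tau)^-1 *: tau); rewrite ?memvZ // linearZ /= mulVf.
Qed.

Lemma gsp_nilp a x : a != 0 -> gsp a x -> x ^+ n = 0.
Proof.
move=> a0 hx; have [tau ht e] := ev_neq0 a0.
have xE : lie tau x = x by rewrite (gsp_lie hx) // e scale1r.
by rewrite -xE; apply: (jacobson char0); rewrite xE.
Qed.

Lemma gsp_dual a x : gsp a x -> x != 0 -> exists2 y, gsp (- a) y & \tr (x *m y) != 0.
Proof.
move=> hx x0; apply: contrapT => h; move/eqP: x0; apply.
apply: (trace_nondeg char0 sG) => [|y yg]; first exact: gsp_in hx.
rewrite -(sum_pr D y) mulmx_sumr raddf_sum big1 // => b _ /=.
have [e|nz] := eqVneq (a + b) 0; last exact: (gsp_orth hx (pr_gsp b yg)).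
apply/eqP/negPn/negP => nz; apply: h; exists (pr b y) => //.
by rewrite -(addr0_eq e); exact: pr_gsp.
Qed.

Lemma gsp_t tau : tau \in t -> gsp 0 tau. Proof. by move/gsp0P. Qed.

Lemma t_orth a x tau : a != 0 -> gsp a x -> tau \in t -> \tr (tau *m x) = 0.
Proof. by move=> a0 hx ht; apply: (gsp_orth (gsp_t ht) hx); rewrite add0r. Qed.

Lemma t_nondeg tau : tau \in t -> (forall tau', tau' \in t -> \tr (tau *m tau') = 0) -> tau = 0.
Proof. by move=> ht h; apply: (orth_gsp0 (gsp_t ht)) => y /gsp0P; exact: h. Qed.

Lemma riesz_t (phi : M -> k) : scalar phi ->
  exists2 v, v \in t & forall w, w \in t -> \tr (v *m w) = phi w.
Proof.
move=> lphi; apply: (riesz (b := fun v w => \tr (v *m w))) => //.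
- by move=> w c u v; rewrite mulmxDl -scalemxAl mxtraceD mxtraceZ.
- by move=> w c u v; rewrite mulmxDr -scalemxAr mxtraceD mxtraceZ.
- exact: t_nondeg.
Qed.

Lemma exp2_eq1 (z : int) : (2 : k) ^ z = 1 -> z = 0.
Proof.
have h (m : nat) : (2 : k) ^+ m = 1 -> m = 0%N.
  rewrite -natrX -[RHS]/(1%:R) => /(natr_inj0 char0) /eqP.
  by rewrite -[1%N](expn0 2) eqn_exp2l // => /eqP.
case: z => m; first by move/h ->.
by rewrite -[2 ^ _]/((2 ^+ m.+1)^-1) => /(congr1 GRing.inv); rewrite invrK invr1 => /h.
Qed.

(** The adjoint action of Lie T is faithful: otherwise the integral replicas of
    an element of the kernel generate a central torus. *)
Lemma t_faithful tau : tau \in t -> (forall x, x \in g -> lie tau x = 0) -> tau = 0.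
Proof.
move=> ht h; have sp := didem_spectral (diag_lie ht).
have [d [c [phi [e _ _ _ hgrp]]]] := integral_replicas char0 sp.
rewrite (dmxP (diag_lie ht)) -(replica_didem D tau id) e big1 // => j _.
pose R (b : k) := replica (dspec tau) (didem tau) (fun a => b ^ phi j a).
have RT b : b != 0 -> T (R b).
  by move=> nz; apply: hgrp => //; [exact: mT_closed|apply/LieP].
have Rc b x : G x -> x *m R b = R b *m x.
  apply: (commute_Lie char0 (asG_closed sG) (asG_con sG)) => u /LieP ug.
  by apply/esym/(replica_comm sp)/lie_eq0; exact: h.
have R1 : R 1 = 1%:M by rewrite -(replica1 sp); apply: replica_eq => a _; rewrite exp1rz.
have RM b1 b2 : R b1 *m R b2 = R (b1 * b2).
  by rewrite (replica_mul sp); apply: replica_eq => a _; rewrite expfzMl.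
pose K : set M := [set y | exists2 b, b != 0 & y = R b].
have KG : K `<=` G by move=> _ [b nz ->]; apply: mT_sub; exact: RT.
have K1 : K = [set 1%:M].
  apply: (almost_simple_trivial char0 sG).
  - split=> [y /KG/(asG_unit sG)//||_ _ [b1 n1 ->] [b2 n2 ->]|_ [b nz ->]].
    + by exists 1; rewrite ?oner_neq0.
    + by exists (b1 * b2); rewrite ?mulf_neq0.
    + exists b^-1; rewrite ?invr_neq0 //.
      apply: (can_inj (mulKmx (mT_unit (RT _ nz)))).
      by rewrite mulmxV ?(mT_unit (RT _ nz)) // RM divff.
  - split=> // a _ Ga [b nz ->]; exists b => //.
    by apply/(conj_fix_comm _ (asG_unit sG Ga)); rewrite Rc.
  - by move=> _ _ [b1 n1 ->] [b2 n2 ->]; rewrite !RM mulrC.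
  - move=> _ [b nz ->]; exists R, 1, b; split; rewrite ?oner_neq0 //.
      have := arc_replica 1%:M (dspec tau) (didem tau) (phi j).
      by congr arc; apply/funext => b'; rewrite mul1mx.
    by split=> // b' nz'; exists b'.
have n2 : (2 : k) != 0 by rewrite (char0_natf_eq0 char0).
have : K (R 2) by exists 2.
rewrite K1 /R replica_didem => e2.
have phi0 i : phi j (hat tau i i) = 0.
  apply: exp2_eq1; have := congr1 (fun x => hat x i i) e2.
  by rewrite dmx_hat conj_id // [1%:M _ _]mxE eqxx.
rewrite replica_didem (_ : dmx _ = 0) ?scaler0 //.
apply: diag_hat_inj; rewrite ?dmx_diag ?linear0 ?mx0_is_diag // => i.
by rewrite dmx_hat phi0 [RHS]mxE.
Qed.

Lemma t_roots tau : tau \in t -> (forall a, root a -> ev a tau = 0) -> tau = 0.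
Proof.
move=> ht h; apply: t_faithful => // x xg; rewrite -(sum_pr D x) linear_sum big1 // => a _ /=.
rewrite (gsp_lie (pr_gsp a xg)) //; have [->|a0] := eqVneq a 0; first by rewrite ev0 scale0r.
have [->|nz] := eqVneq (pr a x) 0; first by rewrite scaler0.
by rewrite h ?scale0r //; split=> //; exists (pr a x) => //; exact: pr_gsp.
Qed.

Lemma root_wts a : root a -> a \in wts.
Proof.
move=> [_ [x x0 hx]]; apply: contraNT x0 => h.
by rewrite -(gsp_pr hx) pr_notin.
Qed.

Lemma rootN a : root a -> root (- a).
Proof.
move=> [a0 [x x0 hx]]; split; first by rewrite oppr_eq0.
have [y hy nz] := gsp_dual hx x0; exists y => //.
by apply: contraNneq nz => ->; rewrite mulmx0 mxtrace0.
Qed.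

Lemma tr_lie_t a e f tau : gsp a e -> gsp (- a) f -> tau \in t ->
  \tr (lie e f *m tau) = ev a tau * \tr (e *m f).
Proof.
move=> he hf ht; rewrite mxtrace_lie lieC (gsp_lie hf ht) evN scaleNr opprK.
by rewrite -scalemxAr mxtraceZ.
Qed.

Lemma lie_opp_in_t a e f : gsp a e -> gsp (- a) f -> lie e f \in t.
Proof. by move=> he hf; apply/gsp0P; rewrite -(subrr a); exact: gsp_lieD. Qed.

Definition is_coroot a h := [/\ h \in t, ev a h = 2 &
  exists2 c, c != 0 & forall tau, tau \in t -> \tr (h *m tau) = c * ev a tau].

(** [lie e f] is a nonzero element of Lie T proportional to the dual of a. If a
    vanished on it, it would commute with e and f and be nilpotent, by
    [jacobson]. *)
Lemma sl2_ex a e : a != 0 -> gsp a e -> e != 0 ->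
  exists2 f, gsp (- a) f & is_coroot a (lie e f).
Proof.
move=> a0 he e0; have [f0 hf0 nz] := gsp_dual he e0.
have Ht := lie_opp_in_t he hf0; have HE := fun tau => @tr_lie_t a e f0 tau he hf0.
have nH : ev a (lie e f0) != 0.
  apply/negP => /eqP H0; have H00 : lie e f0 = 0.
    apply: (diag_nilp (diag_lie Ht)); apply: (jacobson char0); apply/lie_eq0.
    by rewrite (gsp_lie hf0) // evN H0 oppr0 scale0r.
  have [tau ht e1] := ev_neq0 a0; have := HE tau ht.
  by rewrite H00 mul0mx mxtrace0 e1 mul1r => /esym/eqP; rewrite (negPf nz).
pose c := 2 / ev a (lie e f0); have c0 : c != 0.
  by rewrite mulf_neq0 ?invr_neq0 // (char0_natf_eq0 char0).
exists (c *: f0); first exact: gspZ.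
rewrite linearZ /=; split; first exact: memvZ.
  by rewrite linearZ /= divfK.
exists (c * \tr (e *m f0)); first exact: mulf_neq0.
by move=> tau ht; rewrite -scalemxAl mxtraceZ HE // mulrA mulrAC.
Qed.

(** The coroot of a, viewed in Lie T; it is independent of the root vectors. *)
Definition cr (a : cartan_dual T) : M := xget 0 (is_coroot a).

Lemma is_coroot_uniq a h h' : is_coroot a h -> is_coroot a h' -> h = h'.
Proof.
move=> [ht h2 [c c0 hc]] [ht' h2' [c' c0' hc']].
have e : c' *: h - c *: h' = 0.
  apply: t_nondeg => [|tau htau]; first by rewrite rpredB ?memvZ.
  by rewrite mulmxBl raddfB /= -!scalemxAl !mxtraceZ hc // hc' // mulrCA subrr.
have : ev a (c' *: h - c *: h') = 0 by rewrite e linear0.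
rewrite linearB !linearZ /= h2 h2' -mulrBl => /eqP; rewrite mulf_eq0 (char0_natf_eq0 char0) orbF.
rewrite subr_eq0 => /eqP ec; move: e; rewrite ec -scalerBr => /eqP.
by rewrite scaler_eq0 (negPf c0) /= subr_eq0 => /eqP.
Qed.

Lemma crE a h : is_coroot a h -> h = cr a.
Proof.
move=> hh; rewrite /cr; case: xgetP => [h' _ hh'|/(_ h)//]; exact: is_coroot_uniq hh hh'.
Qed.

Lemma crP a : root a -> is_coroot a (cr a).
Proof. by move=> [a0 [e e0 he]]; have [f hf hc] := sl2_ex a0 he e0; rewrite -(crE hc). Qed.

Lemma cr_t a : root a -> cr a \in t. Proof. by move/crP => []. Qed.
Lemma ev_cr a : root a -> ev a (cr a) = 2. Proof. by move/crP => []. Qed.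

Lemma sl2 a e : root a -> gsp a e -> e != 0 ->
  exists f, [/\ gsp (- a) f, lie e f = cr a & f != 0].
Proof.
move=> ra he e0; have [f hf hc] := sl2_ex (proj1 ra) he e0; exists f; split=> //.
  exact: crE.
apply/negP => /eqP f0; have [_ /eqP] := hc; rewrite f0 !linear0 eq_sym.
by rewrite (char0_natf_eq0 char0).
Qed.

Lemma crN a : root a -> cr (- a) = - cr a.
Proof.
move=> ra; apply/esym/crE; have [ht h2 [c c0 hc]] := crP ra; split; first by rewrite rpredN.
  by rewrite evN linearN /= opprK.
exists c => // tau htau; rewrite mulNmx raddfN /= hc // evN.
by rewrite mulrN.
Qed.

(** The lattice of differentials of cocharacters of T, see [integral_torus]. Its
    elements grade all matrices by integers. *)
Definition intg y := y \in t /\ exists d : 'I_n -> int, forall i, hat y i i = (d i)%:~R.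

Lemma intgD y y' : intg y -> intg y' -> intg (y + y').
Proof.
move=> [ht [d hd]] [ht' [d' hd']]; split; first exact: rpredD.
by exists (fun i => d i + d' i) => i; rewrite hatD hd hd' rmorphD.
Qed.
Lemma intg0 : intg 0.
Proof. by split; [exact: mem0v|exists (fun=> 0) => i; rewrite hat0]. Qed.
Lemma intgZ (z : int) y : intg y -> intg (z%:~R *: y).
Proof.
move=> [ht [d hd]]; split; first exact: memvZ.
by exists (fun i => z * d i) => i; rewrite hatZ hd rmorphM.
Qed.
Lemma intgN y : intg y -> intg (- y).
Proof. by move/(intgZ (-1)); rewrite scaleN1r. Qed.

Lemma gsp_wt a x : gsp a x -> x != 0 -> exists i j, a = wt i j.
Proof.
move=> hx x0; apply: contrapT => h; move/eqP: x0; apply; apply: hatP; apply/matrixP => i j.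
rewrite -(gsp_pr hx) hat_pr hat0; case: eqP => // e; case: h; by exists i, j.
Qed.

Lemma ev_int a y : root a -> intg y -> exists z : int, ev a y = z%:~R.
Proof.
move=> [_ [x x0 hx]] [ht [d hd]]; have [i [j ->]] := gsp_wt hx x0.
by exists (d i - d j); rewrite wtE // !hd rmorphB.
Qed.

Lemma sl2_lie e f h : lie e f = h -> forall w, lie e (lie f w) = lie f (lie e w) + lie h w.
Proof. by move=> <- w; rewrite jacobi addrC. Qed.

Lemma sl2_lieh a f h : h \in t -> ev a h = 2 -> gsp (- a) f ->
  forall w, lie h (lie f w) = lie f (lie h w) - 2 *: lie f w.
Proof.
move=> ht h2 hf w; rewrite jacobi (gsp_lie hf ht) evN h2 lieZl.
by rewrite scaleNr addrC.
Qed.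

(** The representation restricts to an sl2-module; an eigenvector of h, raised
    until E kills it, becomes primitive. *)
Lemma sl2_integral E F h : h \in t -> E ^+ n = 0 -> F ^+ n = 0 -> lie h E = 2 *: E ->
  lie h F = - 2 *: F -> lie E F = h -> intg h.
Proof.
move=> ht En Fn hE hF EF; split=> //.
suff H i : exists z : int, hat h i i = z%:~R.
  by have [d hd] := @choice _ _ (fun i (z : int) => hat h i i = z%:~R) H; exists d.
pose v : M := invmx g0 *m delta_mx i i.
have v0 : v != 0.
  apply/negP => /eqP e; have : g0 *m v = 0 by rewrite e mulmx0.
  rewrite /v (mulKVmx ug0); move/matrixP/(_ i i); rewrite !mxE !eqxx => /eqP.
  by rewrite oner_eq0.
pose c := hat h i i; have hv : h *m v = c *: v.
  have hE' : h = invmx g0 *m hat h *m g0 by rewrite -{1}[h](conjK ug0) {1}/conj invmxK.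
  rewrite {1}hE' /v -!mulmxA (mulKVmx ug0) scalemxAr; congr (_ *m _).
  rewrite !mulmxA -[g0 *m h *m invmx g0]/(hat h).
  apply/matrixP => a b; rewrite (diag_mulmx _ _ _ (diag_lie ht)) mx_scaleE.
  have -> : (delta_mx i i : M) a b = ((a == i) && (b == i))%:R by rewrite mxE.
  by case: (a =P i) => [->|_] //=; rewrite !mulr0.
have ex0 : exists m, iter m (mulmx E) v == 0 by exists n; rewrite iter_mulmx En mul0mx.
case: (ex_minnP ex0) => -[|j] hj mj; first by rewrite /= (negPf v0) in hj.
have nz : iter j (mulmx E) v != 0 by apply/negP => /mj; rewrite ltnn.
have hw m : h *m iter m (mulmx E) v = (c + (2 * m)%:R) *: iter m (mulmx E) v.
  elim: m => [|m IHm]; first by rewrite muln0 addr0.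
  have e1 u : h *m (E *m u) = E *m (h *m u) + 2 *: (E *m u).
    by rewrite !mulmxA scalemxAl -mulmxDl -hE /lie addrC subrK.
  rewrite iterS e1 IHm -scalemxAr -scalerDl -addrA; congr ((_ + _) *: _).
  by rewrite -natrD; congr (_%:R); lia.
have EF' (w : M) : mulmx E (mulmx F w) = mulmx F (mulmx E w) + mulmx h w.
  by rewrite /= !mulmxA -mulmxDl -EF /lie addrC subrK.
have HF' (w : M) : mulmx h (mulmx F w) = mulmx F (mulmx h w) - 2 *: mulmx F w.
  have e : h *m F = F *m h + - 2 *: F by rewrite -hF /lie addrC subrK.
  by rewrite /= mulmxA e mulmxDl -mulmxA -scalemxAl scaleNr.
have [|N [e _ _]] := sl2_primitive char0 EF' HF' nz (hw j) (eqP hj).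
  exists n; change (iter n (mulmx F) (iter j (mulmx E) v) = 0).
  by rewrite (iter_mulmx F) Fn mul0mx.
exists (N%:Z - (2 * j)%:Z); rewrite rmorphB /= -/c.
by apply/eqP; rewrite eq_sym subr_eq; apply/eqP/esym.
Qed.

Lemma cr_intg a : root a -> intg (cr a).
Proof.
move=> ra; have [a0 [e e0 he]] := ra; have [f [hf ef f0]] := sl2 ra he e0.
have en := gsp_nilp a0 he; have fn : f ^+ n = 0 by apply: (gsp_nilp _ hf); rewrite oppr_eq0.
have ct := cr_t ra; apply: (sl2_integral ct en fn _ _ ef).
  by rewrite (gsp_lie he ct) ev_cr.
by rewrite (gsp_lie hf ct) evN ev_cr.
Qed.

End Roots.

(** * Root strings and reflections *)

Section RootStrings.
Variables (k : closedFieldType) (n : nat).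
Local Notation M := 'M[k]_n.
Implicit Types (x y z u v w tau : M).
Variable D : tordata k n.
Local Notation G := (tG D).
Local Notation T := (tT D).
Local Notation t := (Lie T).
Local Notation char0 := (tchar0 D).
Local Notation sG := (tas D).
Local Notation gsp := (@gsp k n D).
Local Notation ev := (@ev k n D).
Local Notation root := (@root k n D).
Local Notation cr := (@cr k n D).

Definition triple a e f := [/\ root a, gsp a e, gsp (- a) f & lie e f = cr a].

Lemma tripleN a e f : triple a e f -> triple (- a) f e.
Proof.
by move=> [ra he hf ef]; split; rewrite ?opprK ?crN -?ef 1?lieC //; exact: rootN.
Qed.

Lemma triple_of a e : root a -> gsp a e -> e != 0 -> exists f, triple a e f.
Proof. by move=> ra he e0; have [f [hf ef _]] := sl2 ra he e0; exists f. Qed.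

Lemma triple_ex a : root a -> exists e f, triple a e f.
Proof. by move=> ra; have [_ [e e0 he]] := ra; exists e; apply: triple_of. Qed.

Lemma triple_nilp a e f : triple a e f -> e ^+ n = 0 /\ f ^+ n = 0.
Proof.
move=> [[a0 _] he hf _]; split; first exact: gsp_nilp he.
by apply: (gsp_nilp _ hf); rewrite oppr_eq0.
Qed.

Lemma triple_neq0 a e f : triple a e f -> e != 0 /\ f != 0.
Proof.
have h0 b u v : triple b u v -> u != 0.
  move=> [rb _ _ uv]; apply/negP => /eqP u0; have := ev_cr rb.
  by rewrite -uv u0 lie0l linear0 => /esym/eqP; rewrite (char0_natf_eq0 char0).
by move=> h; split; [exact: h0 h|exact: h0 (tripleN h)].
Qed.

Lemma gsp_iter a b x y i : gsp a x -> gsp b y -> gsp (b + a *+ i) (iter i (lie x) y).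
Proof.
move=> hx hy; elim: i => [|i IHi]; first by rewrite addr0.
by rewrite iterS mulrS addrCA; exact: gsp_lieD.
Qed.

Lemma triple_top a e f b x : triple a e f -> gsp b x -> x != 0 ->
  exists i, [/\ iter i (lie e) x != 0, gsp (b + a *+ i) (iter i (lie e) x) &
     lie e (iter i (lie e) x) = 0].
Proof.
move=> tr hx x0; have [en _] := triple_nilp tr.
have ex0 : exists m, iter m (lie e) x == 0 by exists (n + n)%N; rewrite iter_lie_nilp.
case: (ex_minnP ex0) => -[|m] hm mm; first by rewrite /= (negPf x0) in hm.
exists m; split; last exact/eqP.
  by apply/negP => /mm; rewrite ltnn.
by case: tr => _ he _ _; exact: gsp_iter.
Qed.

Lemma triple_primitive a e f b x : triple a e f -> gsp b x -> x != 0 -> lie e x = 0 ->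
  exists N : nat, [/\ ev b (cr a) = N%:R, forall i, (i <= N)%N -> iter i (lie f) x != 0 &
    forall i, (i < N)%N -> lie e (iter i.+1 (lie f) x) != 0].
Proof.
move=> tr hx x0 ex; have [_ fn] := triple_nilp tr; have [ra he hf ef] := tr.
have hv := gsp_lie hx (cr_t ra); have EF := sl2_lie ef.
have HF := sl2_lieh (cr_t ra) (ev_cr ra) hf.
have hm : exists m, iter m (lie f) x = 0 by exists (n + n)%N; rewrite iter_lie_nilp.
have [N [eN nz _]] := sl2_primitive char0 EF HF x0 hv ex hm.
exists N; split=> // i iN; rewrite eN in hv.
exact: (sl2_raise_neq0 char0 EF HF x0 hv ex iN hm).
Qed.

Lemma natrN_eq (m p : nat) : (m%:R : k) = - p%:R -> m = 0%N /\ p = 0%N.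
Proof.
by move/eqP; rewrite -addr_eq0 -natrD (char0_natf_eq0 char0) addn_eq0 => /andP[/eqP-> /eqP->].
Qed.

(** On vectors of negative weight the raising operator is injective. *)
Lemma triple_raise a e f b x (m : nat) : triple a e f -> gsp b x -> x != 0 ->
  ev b (cr a) = - m.+1%:R -> lie e x != 0.
Proof.
move=> tr hx x0 em; apply/negP => /eqP ex.
by have [N [eN _ _]] := triple_primitive tr hx x0 ex; rewrite em in eN; case: (natrN_eq (esym eN)).
Qed.

Lemma triple_lower a e f b x (m : nat) : triple a e f -> gsp b x -> x != 0 ->
  ev b (cr a) = m.+1%:R -> lie f x != 0.
Proof.
move=> tr hx x0 em; apply: (triple_raise (m := m) (tripleN tr) hx x0).
by have [ra _ _ _] := tr; rewrite crN // linearN /= em.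
Qed.

(** Correcting x by a multiple of e, one may assume that it is orthogonal to f
    and hence killed by lie f; but the weight of such a vector is not positive.
    *)
Lemma dim1 a e x : root a -> gsp a e -> e != 0 -> gsp a x -> exists c, x = c *: e.
Proof.
move=> ra he e0 hx; have [f tr] := triple_of ra he e0; have [_ _ hf ef] := tr.
have nz : \tr (e *m f) != 0.
  have [a0 _] := ra; have [tau ht e1] := ev_neq0 a0.
  have := tr_lie_t he hf ht; rewrite ef e1 mul1r => <-.
  by have [_ _ [c c0 ->]] := crP ra; rewrite // e1 mulr1.
pose c := \tr (x *m f) / \tr (e *m f); exists c; apply/eqP; rewrite -subr_eq0; apply: contraT => x0.
have hx' : gsp a (x - c *: e) by apply: gspB => //; exact: gspZ.
have h0 : lie (x - c *: e) f = 0.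
  apply: (t_nondeg (lie_opp_in_t hx' hf)) => tau ht; rewrite (tr_lie_t hx' hf ht).
  by rewrite mulmxBl raddfB /= -scalemxAl mxtraceZ divfK // subrr mulr0.
have := triple_primitive (tripleN tr) hx' x0; rewrite lieC h0 oppr0 => /(_ erefl)[N [eN _ _]].
by move: eN; rewrite crN // linearN /= ev_cr // => /esym /(natrN_eq (p := 2))[].
Qed.

Lemma ev_mulrn a m tau : ev (a *+ m) tau = ev a tau * m%:R.
Proof. by elim: m => [|m IHm]; rewrite ?mulr0n ?ev0 ?mulr0 // mulrS evD IHm -natr1 mulrDr mulr1 addrC. Qed.

(** The f-string from a multiple of a passes through the root space of a, that
    is through the multiples of e, which lie e kills too early. *)
Lemma nonmult a j : root a -> (1 < j)%N -> ~ root (a *+ j).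
Proof.
move=> ra j1 [_ [x x0 hx]]; have [e [f tr]] := triple_ex ra.
have [i [v0 hv ev0]] := triple_top tr hx x0; have [e0 f0] := triple_neq0 tr.
have [_ he hf _] := tr; move: hv v0 ev0; set v := iter i (lie e) x; rewrite -mulrnDr => hv v0 ev0.
have [N [eN nz rz]] := triple_primitive tr hv v0 ev0.
have {}eN : N = (2 * (j + i))%N.
  by apply: (natr_inj0 char0); rewrite -eN ev_mulrn ev_cr // natrM.
case: j j1 hx hv eN => [|[|j]] // _ hx hv eN.
have hw : gsp a (iter (j + i).+1 (lie f) v).
  have := gsp_iter (j + i).+1 hf hv; rewrite (_ : (j.+2 + i = 1 + (j + i).+1)%N); last by lia.
  by rewrite mulrnDr mulNrn addrK mulr1n.
have [c wE] := dim1 ra he e0 hw.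
have := rz (j + i)%N; rewrite wE linearZ /= lie_id scaler0 eqxx eN => h.
by have : false by apply: h; lia.
Qed.

(** Otherwise x is a highest weight vector for the sl2-triple, and the string
    through a + b, which contains the line of x, would have to stop there. *)
Lemma bracket_neq0 a b e x : root a -> root b -> root (a + b) -> gsp a e -> e != 0 -> gsp b x -> x != 0 ->
  lie e x != 0.
Proof.
move=> ra rb rab he e0 hx x0; apply/negP => /eqP ex.
have [f tr] := triple_of ra he e0; have [_ _ hf _] := tr.
have [m [em _ _]] := triple_primitive tr hx x0 ex.
have [_ [y y0 hy]] := rab.
have ey : ev (a + b) (cr a) = m.+2%:R by rewrite evD ev_cr // em -natrD.
have fy0 := triple_lower tr hy y0 ey.
have hfy : gsp b (lie f y) by have := gsp_lieD hf hy; rewrite addrA addNr add0r.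
have [c fyE] := dim1 rb hx x0 hfy.
have [j [v0 hv ev]] := triple_top tr hy y0; move: hv v0 ev; set v := iter j (lie e) y => hv v0 ev.
have [N [eN nz rz]] := triple_primitive tr hv v0 ev.
have {}eN : N = (m.+2 + 2 * j)%N.
  by apply: (natr_inj0 char0); rewrite -eN evD ev_mulrn ey ev_cr // natrD natrM.
have hw : gsp (a + b) (iter j (lie f) v).
  by have := gsp_iter j hf hv; rewrite mulNrn addrK.
have [d wE] := dim1 rab hy y0 hw.
have := rz j; rewrite iterS wE linearZ /= fyE !linearZ /= ex !scaler0 eqxx eN => h.
by have : false by apply: h; lia.
Qed.

Lemma conj_exp_lie (x y : M) : x ^+ n = 0 -> lie x (lie x (lie x y)) = 0 ->
  conj (expm x) y = y + lie x y + 2^-1 *: lie x (lie x y).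
Proof.
move=> xn h; have [K hK] := conj_expm char0 y xn; rewrite (hK (3 + K)%N) ?leq_addl //.
rewrite big_split_ord /= [X in _ + X]big1 ?addr0 => [|i _].
  rewrite !big_ord_recl big_ord0 /= addr0 /bump /= !fact0 /= invr1 !scale1r addrA.
  by [].
have -> : lie x (lie x (lie x (iter (0 + i) (lie x) y))) = iter i (lie x) (lie x (lie x (lie x y))).
  by rewrite add0n -!iterSr.
have it0 j : iter j (lie x) 0 = 0 by elim: j => //= j ->; rewrite linear0.
by rewrite /= h it0 scaler0.
Qed.

Lemma conj_exp_lie1 (x y : M) : x ^+ n = 0 -> lie x (lie x y) = 0 ->
  conj (expm x) y = y + lie x y.
Proof. by move=> xn h; rewrite (conj_exp_lie xn) h ?linear0 // ?scaler0 addr0. Qed.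

(** The usual representative in N_G(T) of the reflection in the root. *)
Definition nrefl (e f : M) : M := expm e *m expm (- f) *m expm e.

Lemma nrefl_in a e f : triple a e f -> G (nrefl e f).
Proof.
move=> tr; have [en fn] := triple_nilp tr; have [_ he hf _] := tr.
have ge : G (expm e) by apply: (expm_in char0 sG) en; exact: gsp_in he.
apply: (asG_mul sG) => //; apply: (asG_mul sG) => //.
by apply: (expm_in char0 sG); [rewrite rpredN; exact: gsp_in hf|exact: nilpN].
Qed.

Lemma conj_nrefl a e f x : triple a e f ->
  conj (nrefl e f) x = conj (expm e) (conj (expm (- f)) (conj (expm e) x)).
Proof.
move=> tr; have [en fn] := triple_nilp tr.
have ue := expm_unit char0 en; have uf := expm_unit char0 (nilpN fn).
by rewrite /nrefl conj_mul ?unitmx_mul ?ue ?uf // conj_mul.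
Qed.

Lemma half2 (x : M) : 2^-1 *: (2 *: x) = x.
Proof. by rewrite scalerA mulVf ?scale1r // (char0_natf_eq0 char0). Qed.

Lemma nrefl_act a e f : triple a e f ->
  [/\ forall tau, tau \in t -> conj (nrefl e f) tau = tau - ev a tau *: cr a,
      conj (nrefl e f) e = - f & conj (nrefl e f) f = - e].
Proof.
move=> tr; have [en fn] := triple_nilp tr; have [ra he hf ef] := tr.
have ct := cr_t ra; have nfn := nilpN fn.
have two u : 2 *: u = u + u :> M by rewrite scaler_nat mulr2n.
have ab (u v X : M) : u + ((X - u) - (v + X)) = - v.
  by rewrite addrA [u + _]addrC subrK opprD addrCA subrr addr0.
have ac (u X : M) : u + (X - u) = X by rewrite addrC subrK.
have eh : lie e (cr a) = - (2 *: e) by rewrite lieC (gsp_lie he) // ev_cr.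
have fh : lie f (cr a) = 2 *: f by rewrite lieC (gsp_lie hf) // evN ev_cr // scaleNr opprK.
have fe : lie f e = - cr a by rewrite lieC ef.
have Ee : conj (expm e) e = e by rewrite conj_exp_lie1 ?lie_id ?linear0 ?addr0.
have Eh : conj (expm e) (cr a) = cr a - e - e.
  rewrite (conj_exp_lie1 en) eh; first by rewrite two opprD addrA.
  by rewrite linearN linearZ /= lie_id scaler0 oppr0.
have Ef : conj (expm e) f = f + (cr a - e).
  rewrite (conj_exp_lie en) ef eh; first by rewrite scalerN half2 addrA.
  by rewrite linearN linearZ /= lie_id scaler0 oppr0.
have Fe : conj (expm (- f)) e = e + (cr a - f).
  rewrite (conj_exp_lie nfn) [lie (- f) e]lieNl fe opprK [lie (- f) (cr a)]lieNl fh; first by rewrite scalerN half2 addrA.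
  by rewrite lieNl linearN linearZ /= lie_id scaler0 !oppr0.
have lff : lie (- f) f = 0 by rewrite lieNl lie_id oppr0.
have Ff : conj (expm (- f)) f = f by rewrite (conj_exp_lie1 nfn) lff ?linear0 ?addr0.
have Fh : conj (expm (- f)) (cr a) = cr a - f - f.
  rewrite (conj_exp_lie1 nfn) [lie (- f) (cr a)]lieNl fh; first by rewrite two opprD addrA.
  by rewrite linearN linearZ /= lff scaler0 oppr0.
have key : conj (expm e) (e + (cr a - f)) = - f.
  by rewrite linearD linearB /= Ee Eh Ef ab.
have keyF : conj (expm (- f)) (f + (cr a - e)) = - e.
  by rewrite linearD linearB /= Ff Fh Fe ab.
split.
- move=> tau ht; rewrite (conj_nrefl _ tr).
  have et : lie e tau = - (ev a tau *: e) by rewrite lieC (gsp_lie he).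
  have ft : lie f tau = ev a tau *: f by rewrite lieC (gsp_lie hf) // evN scaleNr opprK.
  have Et : conj (expm e) tau = tau - ev a tau *: e.
    by rewrite (conj_exp_lie1 en) et // linearN linearZ /= lie_id scaler0 oppr0.
  have Ft : conj (expm (- f)) tau = tau - ev a tau *: f.
    by rewrite (conj_exp_lie1 nfn) [lie (- f) tau]lieNl ft // linearN linearZ /= lff scaler0 oppr0.
  rewrite Et linearB linearZ /= Ft Fe -addrA -opprD -scalerDr addrCA ac.
  rewrite linearB linearZ linearD /= Et Ee Eh -addrA -opprD -scalerDr.
  by rewrite [e + (cr a - e - e)]ac ac.
- by rewrite (conj_nrefl _ tr) Ee Fe key.
- by rewrite (conj_nrefl _ tr) Ef keyF linearN /= Ee.
Qed.

End RootStrings.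

(** * The normaliser of the torus and its action on the roots *)

Section Normaliser.
Variables (k : closedFieldType) (n : nat).
Local Notation M := 'M[k]_n.
Implicit Types (x y z u v w tau : M).
Variable D : tordata k n.
Local Notation G := (tG D).
Local Notation T := (tT D).
Local Notation t := (Lie T).
Local Notation char0 := (tchar0 D).
Local Notation sG := (tas D).
Local Notation ug0 := (tunit D).
Local Notation gsp := (@gsp k n D).
Local Notation ev := (@ev k n D).
Local Notation root := (@root k n D).
Local Notation cr := (@cr k n D).
Local Notation triple := (@triple k n D).
Local Notation norm := (normalizer G T).

Lemma norm_unit w : norm w -> w \in unitmx. Proof. by case=> /(asG_unit sG). Qed.

Lemma norm_inv w : norm w -> norm (invmx w).
Proof.
move=> hw; have uw := norm_unit hw; have [Gw h] := hw; split; first exact: (asG_inv sG).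
by move=> y; rewrite [T (conj _ y)]h conjVK.
Qed.

Lemma norm_mul w w' : norm w -> norm w' -> norm (w *m w').
Proof.
move=> hw hw'; have uw := norm_unit hw; have uw' := norm_unit hw'.
have [Gw h] := hw; have [Gw' h'] := hw'; split; first exact: (asG_mul sG).
by move=> y; rewrite h' h conj_mul.
Qed.

Lemma norm_t w tau : norm w -> tau \in t -> conj w tau \in t.
Proof.
move=> hw /LieP ht; apply/LieP; apply: (tangent_conj (norm_unit hw) _ ht) => y.
by have [_ h] := hw; rewrite h.
Qed.

Lemma T_fix s tau : T s -> tau \in t -> conj s tau = tau.
Proof.
move=> Ts ht; apply/(conj_fix_comm _ (mT_unit Ts)).
apply: (commute_Lie char0 (mT_closed D) (@mT_con _ _ D) _ Ts) => u /LieP hu.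
by apply/lie_eq0; exact: (@t_comm _ _ D).
Qed.

Lemma T_comm s s' : T s -> T s' -> s *m s' = s' *m s.
Proof.
move=> Ts Ts'; apply: (commute_Lie char0 (mT_closed D) (@mT_con _ _ D) _ Ts) => u /LieP hu.
by apply/esym/(conj_fix_comm _ (mT_unit Ts')); exact: T_fix.
Qed.

Lemma norm_T s : T s -> norm s.
Proof.
move=> Ts; split=> [|y]; first exact: mT_sub.
split=> Ty; first by apply: mT_mul; [exact: mT_mul|exact: mT_inv].
rewrite -(conjK (mT_unit Ts) y); apply: mT_mul; [apply: mT_mul => //; exact: mT_inv|].
by apply: mT_inv; exact: mT_inv.
Qed.

Lemma norm1 : norm 1%:M. Proof. exact: norm_T (mT1 D). Qed.

(** Both w and its inverse preserve Lie T, by dimension. *)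
Lemma normP w : G w -> (forall tau, tau \in t -> conj w tau \in t) -> norm w.
Proof.
move=> Gw h; have uw := asG_unit sG Gw.
pose c := linfun (conj w : M -> M).
have cE x : c x = conj w x by rewrite lfunE.
have ct : (c @: t = t)%VS.
  apply/eqP; rewrite eqEdim; apply/andP; split.
    by apply/subvP => _ /memv_imgP[y yt ->]; rewrite cE h.
  rewrite limg_dim_eq //; apply/eqP; rewrite -subv0; apply/subvP => y /memv_capP[_].
  by rewrite memv_ker cE memv0 => /eqP e; rewrite -(conjK uw y) e linear0.
have h' tau : tau \in t -> conj (invmx w) tau \in t.
  by rewrite -{1}ct => /memv_imgP[y yt ->]; rewrite cE conjK.
have sub a : a \in unitmx -> (forall tau, tau \in t -> conj a tau \in t) -> forall y, T y -> T (conj a y).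
  move=> ua ha; apply: (Lie_conj char0 ua (mT_closed D) (@mT_con _ _ D) (mT_closed D)) => x.
  by move=> /LieP/ha/LieP.
split=> // y; split; first exact: sub.
by move/(sub _ _ h'); rewrite unitmx_inv conjK //; exact.
Qed.

Lemma nact_ex w (a : cartan_dual T) : exists b, forall tau, tau \in t -> ev b tau = ev a (conj (invmx w) tau).
Proof. by apply: mkev => c u v; rewrite !linearP. Qed.
(** The action of N_G(T) on the weights. *)
Definition nact w a := sval (cid (nact_ex w a)).
Lemma nactE w a tau : tau \in t -> ev (nact w a) tau = ev a (conj (invmx w) tau).
Proof. exact: (svalP (cid (nact_ex w a))). Qed.

Lemma nactD w a b : nact w (a + b) = nact w a + nact w b.
Proof. by apply: ev_eq => tau ht; rewrite evD !nactE // evD. Qed.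
Lemma nactN w a : nact w (- a) = - nact w a.
Proof. by apply: ev_eq => tau ht; rewrite evN !nactE // evN. Qed.
Lemma nact0 w : nact w 0 = 0.
Proof. by apply: ev_eq => tau ht; rewrite nactE // !ev0. Qed.
Lemma nact_mul w w' a : norm w -> norm w' -> nact (w *m w') a = nact w (nact w' a).
Proof.
move=> hw hw'; apply: ev_eq => tau ht; rewrite !nactE //; last exact: norm_t (norm_inv hw) ht.
by rewrite invmxM ?norm_unit // conj_mul // unitmx_inv norm_unit.
Qed.
Lemma nact_T s a : T s -> nact s a = a.
Proof. by move=> Ts; apply: ev_eq => tau ht; rewrite nactE // T_fix //; exact: mT_inv. Qed.
Lemma nactK w a : norm w -> nact (invmx w) (nact w a) = a.
Proof.
move=> hw; rewrite -nact_mul //; last exact: norm_inv.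
by rewrite mulVmx ?norm_unit // nact_T //; exact: mT1.
Qed.
Lemma nactVK w a : norm w -> nact w (nact (invmx w) a) = a.
Proof. by move=> /norm_inv/(nactK a); rewrite invmxK. Qed.

Lemma gsp_nact w a x : norm w -> gsp a x -> gsp (nact w a) (conj w x).
Proof.
move=> hw [xg hx]; have uw := norm_unit hw; split=> [|tau ht].
  by apply: (conj_in sG) => //; case: hw.
rewrite -{1}(conjVK uw tau) -conj_lie // hx ?linearZ /= ?nactE //.
exact: norm_t (norm_inv hw) ht.
Qed.

Lemma conj_neq0 w x : w \in unitmx -> x != 0 -> conj w x != 0.
Proof. by move=> uw; apply: contraNN => /eqP e; rewrite -(conjK uw x) e linear0. Qed.

Lemma root_nact w a : norm w -> root a -> root (nact w a).
Proof.
move=> hw [a0 [x x0 hx]]; split.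
  by apply: contraNN a0 => /eqP e; rewrite -(nactK a hw) e nact0.
by exists (conj w x); [exact: conj_neq0 (norm_unit hw) x0|exact: gsp_nact].
Qed.

Lemma cr_nact w a : norm w -> root a -> cr (nact w a) = conj w (cr a).
Proof.
move=> hw ra; have uw := norm_unit hw; apply/esym/crE; have [ht h2 [c c0 hc]] := crP ra.
split; first exact: norm_t hw ht.
  by rewrite nactE ?conjK //; exact: norm_t hw ht.
exists c => // tau htau; rewrite mxtrace_conjl // hc ?nactE //.
exact: norm_t (norm_inv hw) htau.
Qed.

Lemma nrefl_norm a e f : triple a e f -> norm (nrefl e f).
Proof.
move=> tr; have [h _ _] := nrefl_act tr; have [ra _ _ _] := tr.
apply: normP; first exact: nrefl_in tr.
by move=> tau ht; rewrite h // rpredB ?memvZ ?cr_t.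
Qed.

Lemma conj_nreflV a e f tau : triple a e f -> tau \in t ->
  conj (invmx (nrefl e f)) tau = tau - ev a tau *: cr a.
Proof.
move=> tr ht; have [h _ _] := nrefl_act tr; have [ra _ _ _] := tr.
have uw := norm_unit (nrefl_norm tr); have ct := cr_t ra.
apply: (can_inj (conjK uw)); rewrite conjVK // linearB linearZ /= !h // ev_cr //.
have -> : cr a - 2 *: cr a = - cr a by rewrite -{1}[cr a]scale1r -scalerBl opprD addrA subrr add0r scaleN1r.
by rewrite scalerN opprK subrK.
Qed.

Lemma nact_nrefl a e f b : triple a e f -> nact (nrefl e f) b = b - ev b (cr a) *: a.
Proof.
move=> tr; apply: ev_eq => tau ht; rewrite nactE // (conj_nreflV tr) // linearB linearZ /=.
by rewrite evB evZ mulrC.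
Qed.

Lemma refl_root a b : root a -> root b -> root (b - ev b (cr a) *: a).
Proof.
move=> ra rb; have [e [f tr]] := triple_ex ra.
by rewrite -(nact_nrefl b tr); apply: root_nact => //; exact: nrefl_norm tr.
Qed.

Lemma scale_natr_w (m : nat) (a : cartan_dual T) : m%:R *: a = a *+ m.
Proof. exact: scaler_nat. Qed.

Lemma string_root a b (m i : nat) : root a -> root b -> b != a -> ev b (cr a) = m%:R ->
  (i <= m)%N -> root (b - a *+ i).
Proof.
move=> ra rb ba em; have half j : (2 * j <= m.+1)%N -> root (b - a *+ j).
  elim: j => [|j IHj] hj; first by rewrite subr0.
  have rj : root (b - a *+ j) by apply: IHj; lia.
  have [_ [x x0 hx]] := rj; have [e [f tr]] := triple_ex ra; have [_ _ hf _] := tr.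
  have ej : ev (b - a *+ j) (cr a) = (m - (2 * j).+1).+1%:R.
    rewrite evB ev_mulrn em ev_cr // -natrM -natrB; last by lia.
    by congr (_%:R); lia.
  have fx0 := triple_lower tr hx x0 ej.
  split; last exists (lie f x) => //.
    rewrite subr_eq0; apply/negP => /eqP e1; case: j {hj rj hx ej IHj} e1 => [|j] e1.
      by rewrite e1 mulr1n eqxx in ba.
    by apply: (@nonmult _ _ D a j.+2 ra); rewrite // -e1.
  by have := gsp_lieD hf hx; rewrite addrC mulrSr opprD addrA.
move=> im; case: (leqP (2 * i) m.+1) => hi; first exact: half.
have rj : root (b - a *+ (m - i)) by apply: half; lia.
have := refl_root ra rj; rewrite evB ev_mulrn ev_cr // em -natrM -natrB; last by lia.
rewrite scale_natr_w -addrA -opprD -mulrnDr; congr (root (b - a *+ _)); lia.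
Qed.

Lemma string_root_up a b (m i : nat) : root a -> root b -> b != - a -> ev b (cr a) = - m%:R ->
  (i <= m)%N -> root (b + a *+ i).
Proof.
move=> ra rb ba em im; have := @string_root (- a) b m i (rootN ra) rb ba.
rewrite crN // linearN /= em opprK mulNrn opprK; exact.
Qed.

(** The trace form takes positive integral values on cr a, as it sums the
    squares of integral eigenvalues. *)
Lemma cr_norm a : root a -> exists2 N : nat, (0 < N)%N &
  forall tau, tau \in t -> 2 * \tr (cr a *m tau) = N%:R * ev a tau.
Proof.
move=> ra; have [ht h2 [c c0 hc]] := crP ra; have [_ [d hd]] := cr_intg ra.
have e2 : \tr (cr a *m cr a) = (\sum_i (absz (d i) * absz (d i))%N)%:R.
  rewrite -(mxtrace_conj _ ug0) natr_sum; apply: eq_bigr => i _.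
  rewrite hat_mul_diag ?diag_lie // hd -rmorphM /=.
  have -> : d i * d i = (absz (d i) * absz (d i))%N%:Z; last by [].
  by rewrite PoszM !abszE -normrM ger0_norm // -expr2 sqr_ge0.
exists (\sum_i (absz (d i) * absz (d i)))%N.
  rewrite lt0n; apply/negP => /eqP e0; have := hc _ ht; rewrite h2 e2 e0 => /esym/eqP.
  by rewrite mulf_eq0 (negPf c0) (char0_natf_eq0 char0).
by move=> tau htau; rewrite -e2 !hc // h2 mulrCA mulrA.
Qed.

End Normaliser.

(** * Gradings by integral elements of the torus *)

Section Grading.
Variables (k : closedFieldType) (n : nat).
Local Notation M := 'M[k]_n.
Implicit Types (x y z u v w tau : M).
Variable D : tordata k n.
Local Notation G := (tG D).
Local Notation T := (tT D).
Local Notation g0 := (tg0 D).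
Local Notation hat := (conj g0).
Local Notation g := (Lie G).
Local Notation char0 := (tchar0 D).
Local Notation sG := (tas D).
Local Notation dT := (@tdiag k n D).
Local Notation hatP := (@hatP k n D).
Local Notation gsp := (@gsp k n D).
Local Notation ev := (@ev k n D).
Local Notation pr := (@pr k n D).
Local Notation wt := (wt D).
Local Notation intg := (@intg k n D).

Lemma intr_inj0 : injective (fun z : int => z%:~R : k).
Proof.
move=> a b /eqP; rewrite -subr_eq0 -rmorphB /= (char0_intr_eq0 char0) subr_eq0.
by move/eqP.
Qed.

Variable y : M.
Hypothesis hy : intg y.

Definition dg (i : 'I_n) : int := xget 0 [set c : int | hat y i i = c%:~R].

Lemma dgE i : hat y i i = (dg i)%:~R.
Proof.
have [_ [d hd]] := hy; rewrite /dg; case: xgetP => [c _ //|/(_ (d i))]; last by case.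
Qed.

(** y grades the space of matrices through its integral eigenvalues dg; x has
    components in degrees at least m only. *)
Definition raises (m : int) x : Prop := forall i j, hat x i j != 0 -> m <= dg i - dg j.

Lemma raises_le m m' x : m' <= m -> raises m x -> raises m' x.
Proof. by move=> le h i j /h; apply: le_trans. Qed.
Lemma raises0 m : raises m 0.
Proof. by move=> i j; rewrite hat0 eqxx. Qed.
Lemma raisesD m x x' : raises m x -> raises m x' -> raises m (x + x').
Proof.
move=> hx hx' i j; rewrite hatD => nz; case: (eqVneq (hat x i j) 0) => [e|]; last exact: hx.
by apply: hx'; rewrite e add0r in nz.
Qed.
Lemma raisesZ m c x : raises m x -> raises m (c *: x).
Proof. by move=> hx i j; rewrite hatZ mulf_eq0 negb_or => /andP[_]; exact: hx. Qed.
Lemma raisesN m x : raises m x -> raises m (- x).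
Proof. by rewrite -scaleN1r; exact: raisesZ. Qed.
Lemma raisesB m x x' : raises m x -> raises m x' -> raises m (x - x').
Proof. by move=> hx /raisesN; exact: raisesD. Qed.
Lemma raises_sum m I (r : seq I) (F : I -> M) :
  (forall i, raises m (F i)) -> raises m (\sum_(i <- r) F i).
Proof. by move=> h; apply: (big_ind (raises m)) => //; [exact: raises0|exact: raisesD]. Qed.
Lemma raises1 : raises 0 1%:M.
Proof.
move=> i j; case: (eqVneq i j) => [->|ij]; first by rewrite subrr.
by rewrite conj_id // mxE (negPf ij) eqxx.
Qed.
Lemma raisesM m m' x x' : raises m x -> raises m' x' -> raises (m + m') (x *m x').
Proof.
move=> hx hx' i j; rewrite conjM // mxE => nz.
have [l nl] : exists l, hat x i l * hat x' l j != 0.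
  apply: contrapT => h; move/eqP: nz; apply; rewrite big1 // => l _.
  by apply/eqP/negPn/negP => nl; apply: h; exists l.
move: nl; rewrite mulf_eq0 negb_or => /andP[/hx h1 /hx' h2]; lia.
Qed.

(** The eigenvalues of y being bounded, there are no nonzero components of large
    degree. *)
Lemma raises_bound : exists b : nat, forall x, raises b%:Z x -> x = 0.
Proof.
exists (\sum_i absz (dg i) + \sum_i absz (dg i)).+1%N => x hx; apply: hatP; apply/matrixP => i j.
rewrite hat0; apply/eqP/negPn/negP => /hx.
have : (absz (dg i) <= \sum_i absz (dg i))%N by rewrite (bigD1 i) //= leq_addr.
have : (absz (dg j) <= \sum_i absz (dg i))%N by rewrite (bigD1 j) //= leq_addr.
lia.
Qed.

Lemma raises_exp (m : nat) x i : raises m%:Z x -> raises (m * i)%N%:Z (x ^+ i).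
Proof.
move=> hx; elim: i => [|i IHi]; first by rewrite muln0 expr0; exact: raises1.
by rewrite mulnS PoszD exprS -mulmxE; exact: raisesM.
Qed.

Lemma raises_nilp x : raises 1 x -> x ^+ n = 0.
Proof.
move=> hx; have [b hb] := raises_bound; apply: (@nilp_expn _ _ _ b); apply: hb.
by have := @raises_exp 1 x b hx; rewrite mul1n.
Qed.

Lemma raises_expm m x : 1 <= m -> raises m x -> raises m (expm x - 1%:M).
Proof.
move=> m1 hx; rewrite /expm big_ord_recl /= expr0 invr1 scale1r addrC addKr.
apply: raises_sum => i; apply: raisesZ; rewrite /bump /= add1n exprS -mulmxE.
rewrite -[m]addr0; apply: raisesM => //; elim: (val i) => [|j IHj]; first exact: raises1.
by rewrite exprS -mulmxE -[0]addr0; apply: raisesM => //; apply: raises_le hx; lia.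
Qed.

Lemma raises_conjT s m x : T s -> raises m x -> raises m (conj s x).
Proof.
move=> Ts hx i j; have ds := dT Ts; have us := mT_unit Ts.
have -> : hat (conj s x) = hat s *m hat x *m invmx (hat s).
  by rewrite /conj -conj_inv // -!conjM.
have dv : is_diag_mx (invmx (hat s)) by rewrite -conj_inv //; apply: dT; exact: mT_inv.
rewrite (mulmx_diag _ _ _ dv) (diag_mulmx _ _ _ ds) !mulf_eq0 !negb_or.
by move=> /andP[/andP[_ h] _]; exact: hx.
Qed.

Lemma raises_diag x : is_diag_mx (hat x) -> raises 0 x.
Proof.
move=> /is_diag_mxP h i j; case: (eqVneq i j) => [->|ij]; first by rewrite subrr.
by rewrite h // eqxx.
Qed.

Lemma ev_wt_dg i j : ev (wt i j) y = (dg i - dg j)%:~R.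
Proof. by have [ht _] := hy; rewrite wtE // !dgE rmorphB. Qed.

Lemma gsp_raises a x (m : int) : gsp a x -> ev a y = m%:~R -> raises m x.
Proof.
move=> hx em i j; rewrite -(gsp_pr hx) hat_pr; case: (wt i j =P a) => [e _|_]; last by rewrite eqxx.
by move: em; rewrite -e ev_wt_dg => /intr_inj0->.
Qed.

Lemma raises_gsp a x (m p : int) : gsp a x -> x != 0 -> ev a y = m%:~R -> raises p x -> p <= m.
Proof.
move=> hx x0 em hp; have [i [j nz]] : exists i j, hat x i j != 0.
  apply: contrapT => h; move/eqP: x0; apply; apply: hatP; apply/matrixP => i j; rewrite hat0.
  by apply/eqP/negPn/negP => nz; apply: h; exists i, j.
have := nz; rewrite -(gsp_pr hx) hat_pr; case: (wt i j =P a) => [e _|_]; last by rewrite eqxx.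
by have := hp i j nz; move: em; rewrite -e ev_wt_dg => /intr_inj0->.
Qed.

Lemma raises_pr m a x : raises m x -> raises m (pr a x).
Proof. by move=> hx i j; rewrite hat_pr; case: ifP => _; [exact: hx|rewrite eqxx]. Qed.

(** The component of degree 0. *)
Definition dp x : M := conj (invmx g0) (\matrix_(i, j) if dg i == dg j then hat x i j else 0).
Lemma hat_dp x i j : hat (dp x) i j = if dg i == dg j then hat x i j else 0.
Proof. by rewrite /dp conjVK // mxE. Qed.

Lemma dp_linear : linear dp.
Proof.
move=> c u v; apply: hatP; apply/matrixP => i j.
by rewrite hatD hatZ !hat_dp hatD hatZ; case: ifP; rewrite ?mulr0 ?addr0.
Qed.
HB.instance Definition _ := GRing.isLinear.Build k M M _ dp dp_linear.

Lemma dp_raises x : raises 1 x -> dp x = 0.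
Proof.
move=> hx; apply: hatP; apply/matrixP => i j; rewrite hat_dp hat0; case: eqP => // e.
by apply/eqP/negPn/negP => /hx; rewrite e subrr.
Qed.

Lemma dp_diag x : is_diag_mx (hat x) -> dp x = x.
Proof.
move=> /is_diag_mxP h; apply: hatP; apply/matrixP => i j; rewrite hat_dp.
by case: eqP => // ne; rewrite h //; apply: contra_notN ne => /eqP/val_inj->.
Qed.

Lemma sub_dp_raises x : raises 0 x -> raises 1 (x - dp x).
Proof.
move=> hx i j; rewrite hatD hatN hat_dp; case: (dg i =P dg j) => [_|ne]; first by rewrite subrr eqxx.
rewrite subr0 => /hx; lia.
Qed.

(** For regular y and m = 1, the unipotent radical of the Borel subgroup [Bgr].
    *)
Definition Ugr (m : int) : set M := [set u | G u /\ raises m (u - 1%:M)].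

Lemma Ugr_exp m u : 1 <= m -> Ugr m u -> exists x, [/\ x \in g, raises m x, x ^+ n = 0 & expm x = u].
Proof.
move=> m1 [Gu ru]; have un := raises_nilp (raises_le m1 ru).
have [x [hx xn xE xS]] := unipotent_Lie char0 (asG_closed sG) Gu un.
exists x; split=> //; first exact/LieP.
apply: (xS (raises m)) => // [a b|c a|a b]; [exact: raisesD|exact: raisesZ|].
by move=> ha hb; apply: (raises_le _ (raisesM ha hb)); lia.
Qed.

Lemma exp_Ugr m x : 1 <= m -> x \in g -> raises m x -> Ugr m (expm x).
Proof.
move=> m1 xg hx; split; last exact: raises_expm.
by apply: (expm_in char0 sG) => //; apply: raises_nilp; exact: raises_le hx.
Qed.

Lemma Ugr_raises0 m u : 1 <= m -> Ugr m u -> raises 0 u.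
Proof.
move=> m1 [_ h]; rewrite -[u](subrK 1%:M); apply: raisesD; last exact: raises1.
by apply: raises_le h; lia.
Qed.

Lemma Ugr_subgroup m : 1 <= m -> subgroup (Ugr m).
Proof.
move=> m1; split=> [u [Gu _]||u v hu hv|u hu].
- exact: (asG_unit sG).
- by split; [exact: (asG1 sG)|rewrite subrr; exact: raises0].
- have [[Gu ru] [Gv rv]] := (hu, hv); split; first exact: (asG_mul sG).
  have -> : u *m v - 1%:M = (u - 1%:M) *m v + (v - 1%:M).
    by rewrite mulmxBl mul1mx addrA subrK.
  by apply: raisesD => //; rewrite -[m]addr0; apply: raisesM => //; exact: Ugr_raises0 hv.
- have [x [xg rx xn <-]] := Ugr_exp m1 hu; rewrite (expm_inv char0) //.
  by apply: exp_Ugr => //; [rewrite rpredN|exact: raisesN].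
Qed.

Lemma Ugr_conjT m s u : T s -> Ugr m u -> Ugr m (conj s u).
Proof.
move=> Ts [Gu ru]; have Gs := mT_sub Ts; split.
  by apply: (asG_mul sG); [exact: (asG_mul sG)|exact: (asG_inv sG)].
have -> : conj s u - 1%:M = conj s (u - 1%:M) by rewrite linearB /= conj_id // (mT_unit Ts).
exact: raises_conjT.
Qed.

Definition Bgr : set M := [set b | exists s u, [/\ T s, Ugr 1 u & b = s *m u]].

Lemma Bgr_sub : Bgr `<=` G.
Proof. by move=> _ [s [u [Ts [Gu _] ->]]]; apply: (asG_mul sG) => //; exact: mT_sub. Qed.

Lemma T_Bgr : T `<=` Bgr.
Proof.
move=> s Ts; exists s, 1%:M; rewrite mulmx1; split=> //.
by have [_ h _ _] := Ugr_subgroup (lexx 1).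
Qed.

Lemma U_Bgr : Ugr 1 `<=` Bgr.
Proof. by move=> u hu; exists 1%:M, u; rewrite mul1mx; split=> //; exact: mT1. Qed.

Lemma Bgr_subgroup : subgroup Bgr.
Proof.
have [UU U1 UM UV] := Ugr_subgroup (lexx 1).
split=> [b /Bgr_sub/(asG_unit sG)//||_ _ [s [u [Ts hu ->]]] [s' [u' [Ts' hu' ->]]]|_ [s [u [Ts hu ->]]]].
- exact: T_Bgr (mT1 D).
- exists (s *m s'), (conj (invmx s') u *m u'); split; first exact: mT_mul.
    by apply: UM => //; apply: Ugr_conjT => //; exact: mT_inv.
  rewrite /conj invmxK !mulmxA; congr (_ *m _ *m _).
  by rewrite (mulmxK (mT_unit Ts')).
- exists (invmx s), (conj s (invmx u)); split; first exact: mT_inv.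
    by apply: Ugr_conjT => //; apply: UV.
  by rewrite invmxM ?(mT_unit Ts) ?UU // /conj !mulmxA (mulVmx (mT_unit Ts)) mul1mx.
Qed.

Lemma Bgr_dp s u : T s -> Ugr 1 u -> raises 0 (s *m u) /\ dp (s *m u) = s.
Proof.
move=> Ts hu; have rs := raises_diag (dT Ts); split.
  by rewrite -[0]addr0; apply: raisesM => //; exact: Ugr_raises0 hu.
have -> : s *m u = s + s *m (u - 1%:M) by rewrite mulmxBr mulmx1 addrC subrK.
rewrite linearD /= dp_diag ?(dT Ts) // dp_raises ?addr0 //.
by rewrite -[1]add0r; apply: raisesM => //; case: hu.
Qed.

Lemma pmap_dp : pmap dp.
Proof.
have h : pmap (fun x => \matrix_(i, j) if dg i == dg j then hat x i j else 0).
  move=> i j; have hc := pmap_conj g0 i j; case e : (dg i == dg j).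
    by apply: (pfun_ext _ hc) => x; rewrite mxE e.
  by apply: (pfun_ext _ (@pfunC k n 0)) => x; rewrite mxE e.
exact: (@pmap_comp k n _ _ h (pmap_conj (invmx g0))).
Qed.

Lemma arc_mull a c : arc c -> arc (fun s => a *m c s : M).
Proof.
move=> hc f; have [p [e pE]] := hc (msub (mulmx a) f); exists p, e => s s0.
by rewrite -pE // mxeval_msub.
Qed.

(** The degree 0 part of an element of the closure lies in T, which is closed;
    the adjugate shows that it is invertible. *)
Lemma Bgr_zclosure : zclosure Bgr = Bgr.
Proof.
have BU : Bgr `<=` [set x | x \in unitmx] by move=> b /Bgr_sub/(asG_unit sG).
apply/seteqP; split; last exact: zclosure_sub.
move=> x Bx; have ux : x \in unitmx by case: Bx.
have [gG cG] := asG_closed sG.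
have Gx : G x by apply: (zclosure_min cG Bgr_sub).
have rx : raises 0 x.
  move=> i j; apply: contraNT; rewrite -ltNge subr_lt0 => lt; apply/eqP.
  apply: (zclosure_pfun (K := Bgr) (u := fun x => hat x i j)) Bx; first exact: pmap_conj.
  move=> _ [s [u [Ts hu ->]]]; apply/eqP/negPn/negP => nz.
  by have [r0 _] := Bgr_dp Ts hu; have := r0 i j nz; lia.
have dd : dp (\adj x) *m dp x = (\det x)%:M.
  apply: (zclosure_pmap (K := Bgr) (c := fun x => dp (\adj x) *m dp x) (d := fun x => (\det x)%:M)) Bx.
  - apply: pmapM; last exact: pmap_dp.
    exact: (@pmap_comp k n (fun x => \adj x) dp (pmap_adj (@pmap_id k n)) pmap_dp).
  - move=> i j; have hz := pfunM (pfun_det (@pmap_id k n)) (@pfunC k n ((1%:M : M) i j)).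
    by apply: (pfun_ext _ hz) => z; rewrite !mxE mulr_natr.
  move=> b Bb; have ub := BU _ Bb; have [s [u [Ts hu bE]]] := Bb.
  have -> : \adj b = \det b *: invmx b.
    by rewrite /invmx ub scalerA mulfV ?scale1r // -unitfE -unitmxE.
  have [_ _ _ BV] := Bgr_subgroup; have := BV _ Bb; rewrite bE => Bv.
  have eV : invmx (s *m u) = invmx s *m conj s (invmx u).
    have [UU _ _ _] := Ugr_subgroup (lexx 1).
    by rewrite invmxM ?(mT_unit Ts) ?UU // /conj !mulmxA (mulVmx (mT_unit Ts)) mul1mx.
  have hv : Ugr 1 (conj s (invmx u)).
    by apply: Ugr_conjT => //; have [_ _ _ UV] := Ugr_subgroup (lexx 1); apply: UV.
  rewrite linearZ /= -bE [in dp (invmx _)]bE eV (Bgr_dp (mT_inv Ts) hv).2 bE (Bgr_dp Ts hu).2.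
  by rewrite -scalemxAl (mulVmx (mT_unit Ts)) scalemx1.
have udp : dp x \in unitmx.
  have d0 : \det x != 0 by rewrite -unitfE -unitmxE.
  have /mulmx1_unit[] // : ((\det x)^-1 *: dp (\adj x)) *m dp x = 1%:M.
  by rewrite -scalemxAl dd scale_scalar_mx mulVf.
have Td : T (dp x).
  apply: (zclosed_preim (mT_closed D).2 pmap_dp _ Bx udp) => _ [s [u [Ts hu ->]]].
  by rewrite (Bgr_dp Ts hu).2.
exists (dp x), (invmx (dp x) *m x); split=> //; last by rewrite mulKVmx.
split; first by apply: (asG_mul sG) => //; apply: (asG_inv sG); exact: mT_sub.
have -> : invmx (dp x) *m x - 1%:M = invmx (dp x) *m (x - dp x) by rewrite mulmxBr mulVmx.
rewrite -[1]add0r; apply: raisesM; last exact: sub_dp_raises.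
by apply: raises_diag; apply: dT; exact: mT_inv.
Qed.

Lemma Bgr_closed : closed_subgroup Bgr.
Proof. by split; [exact: Bgr_subgroup|rewrite -Bgr_zclosure; exact: zclosure_closed]. Qed.

Lemma Bgr_connected : zconnected Bgr.
Proof.
rewrite -Bgr_zclosure; apply: (zconnected_arcs char0 (mT_closed D).2 (@mT_con _ _ D)).
- by exists 1%:M; exact: mT1.
- by move=> b /Bgr_sub/(asG_unit sG).
- exact: T_Bgr.
move=> _ [s [u [Ts hu ->]]]; have [x [xg rx xn xE]] := Ugr_exp (lexx 1) hu.
exists (fun c => s *m expm ((c - 1) *: x)), 1, 2; split; rewrite ?oner_neq0 ?(char0_natf_eq0 char0) //.
- by apply: arc_mull; exact: arc_expm.
- by rewrite subrr scale0r expm0 mulmx1.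
split=> [|c c0]; first by rewrite -[2]natr1 addrK scale1r xE.
exists s, (expm ((c - 1) *: x)); split=> //.
by apply: exp_Ugr => //; [exact: memvZ|exact: raisesZ].
Qed.

Lemma commutator_sub1 (u v : M) : u \in unitmx -> v \in unitmx ->
  u *m v *m invmx u *m invmx v - 1%:M = (u *m v - v *m u) *m (invmx u *m invmx v).
Proof.
move=> uu uv; rewrite mulmxBl !mulmxA; congr (_ - _).
by rewrite (mulmxK uu) mulmxV.
Qed.

Lemma generated_min (A H : set M) : subgroup H -> A `<=` H -> generated A `<=` H.
Proof. by move=> gH AH x; apply. Qed.

Lemma Bgr_raises0 b : Bgr b -> raises 0 b.
Proof. by move=> [s [u [Ts hu ->]]]; case: (Bgr_dp Ts hu). Qed.

Lemma derived_Bgr : derived Bgr `<=` Ugr 1.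
Proof.
apply: generated_min; first exact: Ugr_subgroup.
move=> _ [b [b' [Bb Bb' ->]]]; have [BU _ BM BV] := Bgr_subgroup.
have GB c : Bgr c -> G c by exact: Bgr_sub.
split.
  by do 2?[apply: (asG_mul sG)]; rewrite ?GB //; try exact: GB (BM _ _ Bb Bb'); exact: GB (BV _ _).
rewrite commutator_sub1 ?BU // -[1]addr0; apply: raisesM; last first.
  by apply: Bgr_raises0; apply: BM; exact: BV.
have [s [u [Ts hu bE]]] := Bb; have [s' [u' [Ts' hu' bE']]] := Bb'.
have h c c' r v r' v' : T r -> T r' -> Ugr 1 v -> Ugr 1 v' -> c = r *m v -> c' = r' *m v' ->
    raises 1 (c *m c' - r *m r').
  move=> Tr Tr' hv hv' -> ->.
  have -> : r *m v *m (r' *m v') - r *m r' = r *m (v - 1%:M) *m (r' *m v') + r *m (r' *m (v' - 1%:M)).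
    by rewrite [r' *m (_ - _)]mulmxBr [r *m (v - _)]mulmxBr !mulmx1 mulmxBl mulmxBr addrA subrK.
  apply: raisesD.
    rewrite -[1]addr0; apply: raisesM; last by case: (Bgr_dp Tr' hv').
    by rewrite -[1]add0r; apply: raisesM; [exact: raises_diag (dT Tr)|case: hv].
  rewrite -[1]add0r; apply: raisesM; first exact: raises_diag (dT Tr).
  by rewrite -[1]add0r; apply: raisesM; [exact: raises_diag (dT Tr')|case: hv'].
have -> : b *m b' - b' *m b = (b *m b' - s *m s') - (b' *m b - s' *m s).
  by rewrite (T_comm Ts Ts') opprB addrA subrK.
by apply: raisesB; [exact: (h _ _ _ _ _ _ Ts Ts' hu hu')|exact: (h _ _ _ _ _ _ Ts' Ts hu' hu)].
Qed.

(** u v u^-1 v^-1 - 1 is, up to a unit, the bracket of u - 1 and v - 1. *)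
Lemma derived_Ugr m : 1 <= m -> derived (Ugr m) `<=` Ugr (m + 1).
Proof.
move=> m1; have m2 : 1 <= m + 1 by lia.
apply: generated_min; first exact: Ugr_subgroup.
move=> _ [b [b' [Bb Bb' ->]]]; have [BU _ BM BV] := Ugr_subgroup m1.
split.
  have := BM _ _ (BM _ _ (BM _ _ Bb Bb') (BV _ Bb)) (BV _ Bb').
  by case.
rewrite commutator_sub1 ?BU // -[m + 1]addr0; apply: raisesM; last first.
  by apply: (Ugr_raises0 m1); apply: BM; exact: BV.
have -> : b *m b' - b' *m b = (b - 1%:M) *m (b' - 1%:M) - (b' - 1%:M) *m (b - 1%:M).
  have lie1 u : lie u 1%:M = 0 by rewrite /lie mulmx1 mul1mx subrr.
  rewrite -/(lie b b') -/(lie (b - 1%:M) (b' - 1%:M)) linearB /= lie1 subr0.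
  by rewrite [RHS]lieC [lie b' _]linearB /= lie1 subr0 -lieC.
have [[_ r] [_ r']] := (Bb, Bb').
by apply: (@raises_le (m + m)); [lia|apply: raisesB; apply: raisesM].
Qed.

Lemma derived_mono (A H : set M) : A `<=` H -> derived A `<=` derived H.
Proof.
move=> AH x hx K gK hK; apply: hx => // _ [u [v [Au Av ->]]]; apply: hK.
by exists u, v; split=> //; exact: AH.
Qed.

Lemma Bgr_solvable : solvable_group Bgr.
Proof.
have [b hb] := raises_bound; exists b.+1; apply/seteqP; split.
  have h m : iter m.+1 (@derived k n) Bgr `<=` Ugr m.+1%:Z.
    elim: m => [|m IHm]; first exact: derived_Bgr.
    apply: (subset_trans (derived_mono IHm)); have -> : m.+2%:Z = m.+1%:Z + 1 by lia.
    by apply: derived_Ugr; lia.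
  move=> x /h [_ hx]; apply/eqP; rewrite -subr_eq0; apply/eqP/hb.
  by apply: raises_le hx; lia.
by move=> _ ->; move=> K [_ K1 _ _] _.
Qed.

End Grading.

(** * Borel subgroups and positive roots *)

Section Borel.
Variables (k : closedFieldType) (n : nat).
Local Notation M := 'M[k]_n.
Implicit Types (x y z u v w tau : M).
Variable D : tordata k n.
Local Notation G := (tG D).
Local Notation T := (tT D).
Local Notation g0 := (tg0 D).
Local Notation hat := (conj g0).
Local Notation g := (Lie G).
Local Notation t := (Lie T).
Local Notation char0 := (tchar0 D).
Local Notation gsp := (@gsp k n D).
Local Notation ev := (@ev k n D).
Local Notation pr := (@pr k n D).
Local Notation wts := (wts D).
Local Notation root := (@root k n D).
Local Notation cr := (@cr k n D).
Local Notation intg := (@intg k n D).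
Local Notation triple := (@triple k n D).
Local Notation norm := (normalizer G T).
Local Notation raises := (raises D).
Local Notation Bgr := (Bgr D).

Definition kpos (c : k) := exists m : nat, c = m.+1%:R.

Lemma kpos_int (z : int) : kpos z%:~R <-> 0 < z.
Proof.
split=> [[m e]|]; first by have /(@intr_inj0 _ _ D)-> : z%:~R = (m.+1%:Z)%:~R :> k.
by case: z => [[|m]|m] // _; exists m.
Qed.
Lemma kpos_neq0 c : kpos c -> c != 0.
Proof. by case=> m ->; rewrite (char0_natf_eq0 char0). Qed.
Lemma kpos_divl (p : nat) (z : int) : kpos (p%:R * z%:~R) -> kpos z%:~R.
Proof.
rewrite -[p%:R]/(p%:Z%:~R) -rmorphM /= => /kpos_int h; apply/kpos_int; nia.
Qed.

Lemma kpos_cases (a : cartan_dual T) y : root a -> intg y ->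
  [\/ kpos (ev a y), ev a y = 0 | kpos (- ev a y)].
Proof.
move=> ra hy; have [z ->] := ev_int ra hy; rewrite -rmorphN /=.
have [h|h|->] := ltgtP z 0; last by constructor 2.
  by constructor 3; apply/kpos_int; rewrite oppr_gt0.
by constructor 1; apply/kpos_int.
Qed.

Definition regular y := forall a, root a -> ev a y != 0.

Lemma regular_cases a y : root a -> intg y -> regular y -> kpos (ev a y) \/ kpos (ev (- a) y).
Proof.
move=> ra hy ry; rewrite evN; case: (kpos_cases ra hy) => [|e|]; [by left| |by right].
by have := ry a ra; rewrite e eqxx.
Qed.

Lemma Lie_Bgr y x : intg y -> regular y -> x \in Lie (Bgr y) <-> x \in g /\ raises y 0 x.
Proof.
move=> hy ry; split=> [/LieP hx|[xg rx]].
  split; first by apply/LieP; exact: tangent_sub (@Bgr_sub _ _ D y) hx.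
  move=> i j; apply: contraNT; rewrite -ltNge subr_lt0 => lt; apply/eqP.
  apply: (tangent_linear (l := fun x => hat x i j)) hx => [c u v|b Bb].
    by rewrite hatD hatZ.
  by apply/eqP/negPn/negP => /(Bgr_raises0 Bb) h; lia.
rewrite -(sum_pr D x); apply: memv_suml => a _; apply/LieP.
have ha := pr_gsp a xg; have [a0|a0] := eqVneq a 0.
  by rewrite a0 in ha *; apply: (tangent_sub (@T_Bgr _ _ D y)); apply/LieP/gsp0P.
have [->|nz] := eqVneq (pr a x) 0; first by apply/LieP; exact: mem0v.
have ra : root a by split=> //; exists (pr a x).
have rp : raises y 0 (pr a x) by exact: raises_pr.
have [z ez] := ev_int ra hy.
have z0 : 0 < z.
  have := raises_gsp hy ha nz ez rp; rewrite le_eqVlt => /orP[/eqP e|//].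
  by have := ry a ra; rewrite ez -e eqxx.
have r1 : raises y 1 (pr a x) by apply: (raises_le _ (gsp_raises hy ha ez)); lia.
apply: (tangent_expm char0 (raises_nilp r1)) => m.
by apply: U_Bgr; apply: exp_Ugr => //; [exact: memvZ (gsp_in ha)|exact: raisesZ].
Qed.

Lemma Lie_Bgr_root y a x : intg y -> regular y -> root a -> gsp a x -> x != 0 ->
  x \in Lie (Bgr y) <-> kpos (ev a y).
Proof.
move=> hy ry ra hx x0; have [z ez] := ev_int ra hy; rewrite Lie_Bgr // ez; split.
  move=> [_ rx]; apply/kpos_int; have := raises_gsp hy hx x0 ez rx; rewrite le_eqVlt.
  by case/orP => // /eqP e; have := ry a ra; rewrite ez -e eqxx.
move/kpos_int => z0; split; first exact: gsp_in hx.
by apply: (raises_le _ (gsp_raises hy hx ez)); lia.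
Qed.

Lemma derived_subgroup (H : set M) : subgroup H -> subgroup (derived H) /\ derived H `<=` H.
Proof.
move=> gH; have [HU H1 HM HV] := gH; have sub : derived H `<=` H.
  apply: generated_min => // _ [x [y [Hx Hy ->]]].
  by apply: (HM); [apply: (HM); [exact: HM|exact: HV]|exact: HV].
split=> //; split=> [x /sub/HU//|K [_ K1 _ _] _//|x y hx hy K gK AK|x hx K gK AK].
  by have [_ _ KM _] := gK; apply: KM; [exact: hx|exact: hy].
by have [_ _ _ KV] := gK; apply: KV; exact: hx.
Qed.

(** The two representatives of the reflection given by (e, f) and by (2 e, f /
    2) differ by an element z with Ad(z) e = 4 e; commutators with z put the
    root subgroups into the derived group. *)
Lemma no_opposite a e f (H : set M) : triple a e f -> subgroup H ->
  (forall s, H (expm (s *: e)) /\ H (expm (s *: f))) -> ~ solvable_group H.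
Proof.
move=> tr gH hH [m]; have [en fn] := triple_nilp tr; have [e0 _] := triple_neq0 tr.
pose P (K : set M) := subgroup K /\ forall s, K (expm (s *: e)) /\ K (expm (s *: f)).
suff PD K : P K -> P (derived K).
  have {}PD : P (iter m (@derived k n) H) by elim: (m) => [|i IHi] //=; apply: PD.
  move=> E; move: PD; rewrite E => -[_ h]; move/eqP: e0; apply.
  by apply: (expm_eq1 char0 en) => s; case: (h s).
move=> [gK hK]; have [KU K1 KM KV] := gK; split; first by case: (derived_subgroup gK).
have [ra he hf ef] := tr.
have n2 : (2 : k) != 0 by rewrite (char0_natf_eq0 char0).
have tr2 : triple a (2 *: e) (2^-1 *: f).
  by split=> //; [exact: gspZ|exact: gspZ|rewrite lieZl linearZ /= scalerA divff // scale1r].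
have nK c : triple a (c *: e) (c^-1 *: f) -> K (nrefl (c *: e) (c^-1 *: f)).
  move=> _; have [he1 _] := hK c; have [_ hf1] := hK (- c^-1).
  by rewrite /nrefl -scaleNr; apply: (KM) => //; apply: (KM).
have n1 : K (nrefl e f) by have := nK 1; rewrite invr1 !scale1r; exact.
(* Ad(z) multiplies e by 4 and f by its inverse. *)
pose w1 := nrefl e f; pose w2 := nrefl (2 *: e) (2^-1 *: f); pose z := w2 *m invmx w1.
have Kz : K z by apply: (KM); [exact: nK|exact: (KV)].
have [_ e1 f1] := nrefl_act tr; have [_ e2 f2] := nrefl_act tr2.
have u1 : w1 \in unitmx by exact: KU.
have u2 : w2 \in unitmx by apply: KU; exact: nK.
have uz : z \in unitmx by exact: KU.
have {}e1 : conj (invmx w1) f = - e.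
  by rewrite -[e](conjK u1) e1 linearN opprK.
have {}f1 : conj (invmx w1) e = - f by rewrite -[f](conjK u1) f1 linearN opprK.
have ze : conj z e = 4 *: e.
  rewrite conj_mul ?unitmx_inv // f1 linearN /=.
  have -> : f = 2 *: (2^-1 *: f) by rewrite scalerA divff // scale1r.
  by rewrite linearZ /= f2 scalerN opprK scalerA -natrM.
have zf : conj z f = 4^-1 *: f.
  rewrite conj_mul ?unitmx_inv // e1 linearN /=.
  have -> : e = 2^-1 *: (2 *: e) by rewrite scalerA mulVf // scale1r.
  by rewrite linearZ /= e2 scalerN opprK scalerA -invfM -natrM.
have comm x c s : x ^+ n = 0 -> (forall s, K (expm (s *: x))) -> conj z x = c *: x -> c - 1 != 0 ->
    derived K (expm (s *: x)).
  move=> xn Kx zx c1; pose r := s / (c - 1).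
  have rn : (r *: x) ^+ n = 0 by exact: nilpZ.
  have -> : expm (s *: x) = z *m expm (r *: x) *m invmx z *m invmx (expm (r *: x)).
    have -> : z *m expm (r *: x) *m invmx z = conj z (expm (r *: x)) by [].
    rewrite conj_of_expm // linearZ /= zx (expm_inv char0) // -(expmD char0); first last.
    - exact: nilpN.
    - by apply/nilpZ/nilpZ.
    - by rewrite mulmxN mulNmx scalerA -!scalemxAl -!scalemxAr !scalerA [r * c * r]mulrC.
    by rewrite scalerA -scalerBl -{2}[r]mulr1 -mulrBr divfK.
  by move=> L gL; apply; exists z, (expm (r *: x)).
move=> s; split.
  apply: (comm e 4) => // [s'|]; first by case: (hK s').
  by rewrite -[4]/(3.+1%:R) -natr1 addrK (char0_natf_eq0 char0).
apply: (comm f 4^-1) => // [s'|]; first by case: (hK s').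
rewrite subr_eq0; apply/negP => /eqP/(canRL (@invrK _)); rewrite invr1.
by move/(natr_inj0 char0 (x2 := 1)).
Qed.

Variable B : set M.
Hypotheses (borelB : borel G B) (sTB : T `<=` B).

Let Bcl : closed_subgroup B. Proof. by case: borelB => _ []. Qed.
Let BG : B `<=` G. Proof. by case: borelB. Qed.

Definition bpos a := root a /\ forall x, gsp a x -> x \in Lie B.

Lemma LieB_sub x : x \in Lie B -> x \in g.
Proof. by move=> /LieP h; apply/LieP; exact: tangent_sub BG h. Qed.
Lemma t_LieB tau : tau \in t -> tau \in Lie B.
Proof. by move=> /LieP h; apply/LieP; exact: tangent_sub sTB h. Qed.
Lemma lie_LieB x z : x \in Lie B -> z \in Lie B -> lie x z \in Lie B.
Proof. by move=> /LieP hx /LieP hz; apply/LieP; apply: tangent_lie => //; case: Bcl. Qed.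

Lemma pr_LieB a x : x \in Lie B -> pr a x \in Lie B.
Proof.
move=> xB; apply: (@pr_stable _ _ D (fun x => x \in Lie B)) => //.
- by move=> u v; exact: rpredD.
- by move=> c u; exact: memvZ.
- by move=> tau u /t_LieB; exact: lie_LieB.
Qed.

Lemma bpos_of a x : root a -> gsp a x -> x != 0 -> x \in Lie B -> bpos a.
Proof.
move=> ra hx x0 xB; split=> // z hz; have [c ->] := dim1 ra hx x0 hz; exact: memvZ.
Qed.

Lemma bpos_add a b : bpos a -> bpos b -> root (a + b) -> bpos (a + b).
Proof.
move=> [ra ha] [rb hb] rab; have [_ [x x0 hx]] := ra; have [_ [z z0 hz]] := rb.
apply: (bpos_of rab (gsp_lieD hx hz)); first exact: bracket_neq0 hx x0 hz z0.
by apply: lie_LieB; [exact: ha|exact: hb].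
Qed.

Lemma bposN a : bpos a -> ~ bpos (- a).
Proof.
move=> [ra ha] [_ ha']; have [e [f tr]] := triple_ex ra; have [_ he hf _] := tr.
have [en fn] := triple_nilp tr.
have sB : solvable_group B by case: borelB => _ [].
apply: (no_opposite tr _ _ sB); first by case: Bcl.
move=> s; split; apply: (expm_Lie char0); rewrite ?nilpZ //.
  by apply/LieP/memvZ/ha.
by apply/LieP/memvZ/ha'.
Qed.

Lemma bpos_string a b (m i : nat) : bpos a -> bpos b -> ev b (cr a) = - m%:R -> (i <= m)%N ->
  bpos (b + a *+ i).
Proof.
move=> ha hb em; have [ra _] := ha; have [rb _] := hb.
have ba : b != - a by apply/negP => /eqP e; move: hb; rewrite e; exact: bposN.
elim: i => [|i IHi] im; first by rewrite addr0.
rewrite mulrSr addrA; apply: bpos_add => //; first by apply: IHi; lia.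
by rewrite -addrA -mulrSr; exact: string_root_up ra rb ba em im.
Qed.

Definition bposb a : bool := `[< bpos a >].
Definition Bposs : seq (cartan_dual T) := [seq a <- wts | bposb a].
Lemma mem_Bposs a : (a \in Bposs) = bposb a.
Proof.
rewrite mem_filter andbC; case: (boolP (a \in wts)) => // h.
by apply/esym/negbTE; apply: contraNN h => /asboolP[/root_wts].
Qed.

Lemma sum_sub_le (I : eqType) (s1 s2 : seq I) (F : I -> int) : uniq s1 -> uniq s2 ->
  {subset s1 <= s2} -> (forall i, i \in s2 -> 0 <= F i) ->
  \sum_(i <- s1) F i <= \sum_(i <- s2) F i.
Proof.
move=> u1 u2 sub F0; rewrite [leRHS](bigID (fun i => i \in s1)) /=.
rewrite -[X in _ <= X + _]big_filter.
have pe : perm_eq [seq i <- s2 | i \in s1] s1.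
  apply: uniq_perm; rewrite ?filter_uniq // => i; rewrite mem_filter.
  by case: (boolP (i \in s1)) => //= /sub.
by rewrite (perm_big _ pe) /= lerDl big_seq_cond sumr_ge0 // => i /andP[/F0].
Qed.

(** The reflection in a maps the positive roots with negative Cartan integer to
    positive roots with the opposite one, and a itself contributes 2. *)
Lemma sum_cartan_ge2 a (f : cartan_dual T -> int) : bpos a ->
  (forall b, b \in Bposs -> ev b (cr a) = (f b)%:~R) -> 2 <= \sum_(b <- Bposs) f b.
Proof.
move=> ha hf; have [ra _] := ha; have uB : uniq Bposs by rewrite filter_uniq // wts_uniq.
pose s b := b + a *+ absz (f b).
pose neg := [seq b <- Bposs | f b < 0].
have inB b : b \in Bposs -> bpos b by rewrite mem_Bposs => /asboolP.
have mB b : bpos b -> b \in Bposs by move=> h; rewrite mem_Bposs; apply/asboolP.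
have negE b : b \in neg -> b \in Bposs /\ ev b (cr a) = - (absz (f b))%:R.
  rewrite mem_filter => /andP[lt bB]; split=> //; rewrite hf // -[RHS]/(- (absz (f b))%:Z%:~R).
  by rewrite -rmorphN /= lez0_abs ?opprK // ltW.
have sB b : b \in neg -> s b \in Bposs.
  by move=> /negE[bB e]; apply/mB/(bpos_string ha (inB _ bB) e).
have fs b : b \in neg -> f (s b) = - f b.
  move=> bn; have [bB e] := negE b bn; apply: (@intr_inj0 _ _ D); rewrite -hf ?sB //.
  rewrite evD ev_mulrn e ev_cr // mulr_natl mulr2n rmorphN /= -hf // e opprK.
  by rewrite addrA addNr add0r.
have fa : f a = 2 by apply: (@intr_inj0 _ _ D); rewrite -hf ?mB // ev_cr.
have as_ : a \notin [seq s b | b <- neg].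
  apply/mapP => -[b bn e]; have := fs b bn; rewrite -e fa => fb.
  have [bB _] := negE b bn; have e2 : absz (f b) = 2%N by lia.
  move: e; rewrite /s e2 mulr2n addrA => /eqP; rewrite -subr_eq subrr eq_sym addr_eq0 => /eqP eb.
  by have := inB b bB; rewrite eb; exact: bposN.
have us : uniq (a :: [seq s b | b <- neg]).
  rewrite /= as_ /= map_inj_in_uniq; first exact: filter_uniq.
  move=> b b' bn bn' e.
  have : f (s b) = f (s b') by rewrite e.
  rewrite !fs // => /oppr_inj ef; move: e; rewrite /s ef; exact: addIr.
rewrite (bigID (fun b => f b < 0)) /= -big_filter -/neg -[X in _ + X]big_filter.
have le : \sum_(b <- a :: [seq s b | b <- neg]) f b <= \sum_(b <- [seq b <- Bposs | ~~ (f b < 0)]) f b.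
  apply: sum_sub_le => //; first by rewrite filter_uniq.
    move=> b; rewrite inE mem_filter => /orP[/eqP->|/mapP[b' bn ->]].
      by rewrite fa mB.
    by rewrite fs // sB // oppr_lt0 -leNgt; move: bn; rewrite mem_filter => /andP[/ltW->].
  by move=> b; rewrite mem_filter -leNgt => /andP[].
rewrite big_cons fa big_map (eq_big_seq (fun b => - f b)) in le; last exact: fs.
by rewrite sumrN in le; move: le; set A := \sum_(b <- neg) f b; set C := \sum_(b <- _) f b; lia.
Qed.

Lemma nrm_ex : exists N : cartan_dual T -> nat, forall a, root a -> (0 < N a)%N /\
  forall tau, tau \in t -> 2 * \tr (cr a *m tau) = (N a)%:R * ev a tau.
Proof.
have [|N hN] := @choice _ _ (fun a N => root a -> (0 < N)%N /\
    forall tau, tau \in t -> 2 * \tr (cr a *m tau) = N%:R * ev a tau); last by exists N.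
by move=> a; case: (pselect (root a)) => [/cr_norm[N N0 hN]|nr]; [exists N|exists 0%N].
Qed.

(** The sum of the elements dual to the positive roots, cleared of denominators,
    is positive on all of them. It is canonical, hence fixed by the elements of
    the normaliser that preserve the positive roots. *)
Lemma positive_ex : exists y, [/\ intg y, forall a, bpos a -> kpos (ev a y) &
  forall w, norm w -> (forall a, bpos a <-> bpos (nact w a)) -> conj w y = y].
Proof.
have [N hN] := nrm_ex; pose P := \prod_(b <- Bposs) N b.
pose c b : nat := (P %/ N b)%N.
have inB b : b \in Bposs -> bpos b by rewrite mem_Bposs => /asboolP.
have cN b : b \in Bposs -> (c b * N b = P)%N.
  by move=> bB; apply: divnK; rewrite /P (big_rem b) //= dvdn_mulr.
have P0 : (0 < P)%N.
  rewrite /P big_seq; apply: (big_ind (fun m => 0 < m)%N) => //= [m m'|b /inB[rb _]]; first by rewrite muln_gt0 => -> ->.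
  by case: (hN b rb).
pose y := \sum_(b <- Bposs) (c b)%:R *: cr b.
have yt : y \in t by rewrite /y big_seq; apply: rpred_sum => b /inB[rb _]; rewrite memvZ ?cr_t.
have tr2 tau : tau \in t -> 2 * \tr (y *m tau) = P%:R * \sum_(b <- Bposs) ev b tau.
  move=> ht; rewrite mulmx_suml raddf_sum !mulr_sumr; apply: eq_big_seq => b bB /=.
  have [rb _] := inB b bB; rewrite -scalemxAl mxtraceZ mulrCA; have [_ ->] := hN b rb => //.
  by rewrite mulrA -natrM cN.
have hy : intg y.
  rewrite /y big_seq; apply: (big_ind intg) => [||b /inB[rb _]]; [exact: intg0|exact: intgD|].
  exact: (intgZ (c b)%:Z (cr_intg rb)).
exists y; split=> //.
  move=> a ha; have [ra _] := ha; have [z ez] := ev_int ra hy; rewrite ez.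
  have [f hf] : exists f : cartan_dual T -> int, forall b, b \in Bposs -> ev b (cr a) = (f b)%:~R.
    have [|f hf] := @choice _ _ (fun b (z : int) => b \in Bposs -> ev b (cr a) = z%:~R); last by exists f.
    move=> b; case: (boolP (b \in Bposs)) => [/inB[rb _]|_]; last by exists 0.
    by have [z' e] := ev_int rb (cr_intg ra); exists z'.
  have h2 := sum_cartan_ge2 ha hf; have [_ ea] := hN a ra.
  apply: (@kpos_divl (N a)); rewrite -ez -ea // mxtrace_mulC tr2 ?cr_t //.
  rewrite (eq_big_seq (fun b => (f b)%:~R)) // -rmorph_sum /= -[P%:R]/(P%:Z%:~R) -rmorphM /=.
  by apply/kpos_int; apply: mulr_gt0 => //; apply: lt_le_trans h2.
move=> w hw hP; have uw := norm_unit hw; apply/eqP; rewrite -subr_eq0; apply/eqP.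
have ct : conj w y \in t by exact: norm_t hw yt.
apply: (@t_nondeg _ _ D) => [|tau ht]; first by apply: rpredB.
apply: (@mulfI _ 2); first by rewrite (char0_natf_eq0 char0).
have ht' : conj (invmx w) tau \in t by exact: norm_t (norm_inv hw) ht.
rewrite mulr0 mulmxBl raddfB /= mulrBr mxtrace_conjl // !tr2 // -mulrBr.
suff -> : \sum_(b <- Bposs) ev b (conj (invmx w) tau) = \sum_(b <- Bposs) ev b tau by rewrite subrr mulr0.
transitivity (\sum_(b <- [seq nact w b | b <- Bposs]) ev b tau).
  by rewrite big_map; apply: eq_bigr => b _; rewrite nactE.
apply: perm_big; apply: uniq_perm; rewrite ?filter_uniq ?wts_uniq //.
  rewrite map_inj_in_uniq ?filter_uniq ?wts_uniq // => b b' _ _ e.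
  by rewrite -(nactK b hw) e nactK.
move=> b; rewrite mem_Bposs; apply/idP/asboolP => [/mapP[b' /inB hb' ->]|hb]; first exact: (hP _).1.
apply/mapP; exists (nact (invmx w) b); last by rewrite nactVK.
by rewrite mem_Bposs; apply/asboolP/(hP _).2; rewrite nactVK.
Qed.

End Borel.

(** * Density of products and centralisers of regular elements *)

Section Density.
Variables (k : closedFieldType) (n : nat).
Local Notation M := 'M[k]_n.
Implicit Types (x y z u v w : M).
Hypothesis char0 : [pchar k] =i pred0.

Lemma DxsB s (f p : {mpoly k[n * n]}) : Dxs s (f - p) = Dxs s f - Dxs s p.
Proof. by elim: s => //= x s ->; rewrite DxB. Qed.

Lemma Dxs_msub_mull s a (f : {mpoly k[n * n]}) :
  Dxs s (msub (mulmx a) f) = msub (mulmx a) (Dxs s f).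
Proof. by elim: s => //= x s ->; rewrite Dx_msub_mull. Qed.

(** By [identity_theorem] it suffices to evaluate derivatives at the identity
    along words of elements of Lie H. These can be sorted, up to shorter words,
    so that the letters from Lie V precede those from Lie K. *)
Lemma dense_product (H V K : set M) (f : {mpoly k[n * n]}) :
  closed_subgroup H -> zconnected H -> closed_subgroup V -> closed_subgroup K ->
  V `<=` H -> K `<=` H ->
  (forall x, tangent1 H x -> exists2 v, tangent1 V v & tangent1 K (x - v)) ->
  (forall v w, V v -> K w -> mxeval f (v *m w) = 0) -> vanishes_on H f.
Proof.
move=> gH cH gV gK VH KH dec hf; apply: (identity_theorem char0 gH cH).
have subV := tangent_sub VH; have subK := tangent_sub KH.
pose inA (A : set M) (s : seq M) := forall x, x \in s -> tangent1 A x.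
have inC A x s : inA A (x :: s) <-> tangent1 A x /\ inA A s.
  split=> [h|[hx hs] y]; last by rewrite inE => /orP[/eqP->|/hs].
  by split=> [|y ys]; apply: h; rewrite inE ?eqxx ?ys ?orbT.
have inCat A s s' : inA A (s ++ s') <-> inA A s /\ inA A s'.
  split=> [h|[hs hs'] y]; last by rewrite mem_cat => /orP[/hs|/hs'].
  by split=> y ys; apply: h; rewrite mem_cat ys ?orbT.
pose P s := mxeval (Dxs s f) 1%:M = 0.
have sorted p q : inA V p -> inA K q -> P (p ++ q).
  move=> hp hq; rewrite /P /Dxs foldr_cat; have [[_ V1 _ _] _] := gV.
  apply: (vanish_Dxs gV) hp _ V1 => v Vv.
  rewrite -[v]mulmx1 -mxeval_msub //= -Dxs_msub_mull; have [[_ K1 _ _] _] := gK.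
  by apply: (vanish_Dxs gK) hq _ K1 => w Kw; rewrite mxeval_msub // hf.
suff main N : (forall s, inA H s -> (size s < N)%N -> P s) ->
    forall m p s q, size s = m -> inA V p -> inA H s -> inA K q ->
      (size (p ++ s ++ q) <= N)%N -> P (p ++ s ++ q).
  have h N : forall s, inA H s -> (size s < N)%N -> P s.
    elim: N => // N IHN s hs le; rewrite -[s]cats0 -[s ++ _]cat0s.
    by apply: (main N IHN (size s)) => //; rewrite cat0s cats0.
  by move=> s hs; exact: (h (size s).+1).
move=> IHN; have swap b s p q : tangent1 H b -> inA H p -> inA H s -> inA H q ->
    (size (p ++ b :: s ++ q) <= N)%N -> P (p ++ s ++ b :: q) -> P (p ++ b :: s ++ q).
  move=> hb; elim: s p => [|c s IHs] p hp hs hq le hP //.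
  have [hc hs'] := (inC H c s).1 hs.
  have short : P (p ++ lie b c :: s ++ q).
    apply: IHN; last by move: le; rewrite !size_cat /= !size_cat; lia.
    apply/inCat; split=> //; apply/inC; split; first by apply: tangent_lie => //; case: gH.
    by apply/inCat.
  have {}IHs : P (rcons p c ++ b :: s ++ q).
    apply: IHs => //; last by rewrite cat_rcons.
    - by rewrite -cats1; apply/inCat; split=> //; apply/inC.
    - by move: le; rewrite -cats1 !size_cat /= !size_cat; lia.
  move: short IHs; rewrite /P cat_rcons /Dxs !foldr_cat /= -Dx_lie -/(Dxs p _).
  rewrite -[Dxs p (_ - _)]/(Dxs p (_ - _)) DxsB mxevalB => /eqP; rewrite subr_eq0 => /eqP e.
  by move=> h; exact: etrans e h.
elim=> [|m IHm] p s q; first by case: s => // _ hp _ hq _; exact: sorted.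
case: s => // x s [sz] hp /inC[hx hs] hq le; have [v hv hw] := dec x hx.
have h1 : P (p ++ v :: s ++ q).
  rewrite -cat_rcons; apply: IHm => //; first by rewrite -cats1; apply/inCat; split=> //; apply/inC.
  by move: le; rewrite cat_rcons !size_cat /= !size_cat; lia.
have h2 : P (p ++ (x - v) :: s ++ q).
  apply: swap => //; [exact: subK|by move=> y /hp/subV|by move=> y /hq/subK| |].
  by move: le; rewrite !size_cat /= !size_cat.
  apply: IHm => //; first by apply/inC.
  by move: le; rewrite !size_cat /=; lia.
have PE z r : P (p ++ z :: r) = (mxeval (Dxs p (Dx z (Dxs r f))) 1%:M = 0).
  by rewrite /P /Dxs foldr_cat.
move: h1 h2; rewrite /= !PE => h1 h2.
by rewrite -[x](subrK v) Dx_addl DxsD mxevalD h2 h1 addr0.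
Qed.

End Density.

Section BigCell.
Variables (k : closedFieldType) (n : nat).
Local Notation M := 'M[k]_n.
Implicit Types (x y z u v w tau : M).
Variable D : tordata k n.
Local Notation G := (tG D).
Local Notation g := (Lie G).
Local Notation char0 := (tchar0 D).
Local Notation sG := (tas D).
Local Notation ev := (@ev k n D).
Local Notation pr := (@pr k n D).
Local Notation wts := (wts D).
Local Notation root := (@root k n D).
Local Notation cr := (@cr k n D).
Local Notation intg := (@intg k n D).
Local Notation Bgr := (Bgr D).

Lemma regular_intg_ex : exists2 z, intg z & regular D z.
Proof.
have [||a u v|a|z hz hr] := avoid char0 (Y := intg) (r := [seq a <- wts | `[< root a >]])
    (F := fun a u => ev a u).
- by exists 0; exact: intg0.
- exact: intgD.
- by rewrite linearD.
- rewrite mem_filter => /andP[/asboolP ra _]; exists (cr a); first exact: cr_intg.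
  by rewrite ev_cr // (char0_natf_eq0 char0).
by exists z => // a ra; apply: hr; rewrite mem_filter root_wts // andbT; apply/asboolP.
Qed.

(** A large multiple of an integral element can be perturbed into a regular one
    without changing the signs of the roots that do not vanish on it. *)
Lemma perturb y z : intg y -> intg z -> regular D z -> exists y', [/\ intg y', regular D y',
  forall a, root a -> kpos (ev a y) -> kpos (ev a y') &
  forall a, root a -> ev a y = 0 -> ev a y' = ev a z].
Proof.
move=> hy hz rz.
have [|f hf] := @choice _ _ (fun a (m : int) => root a -> ev a z = m%:~R).
  move=> a; case: (pselect (root a)) => [ra|]; last by exists 0.
  by have [m e] := ev_int ra hz; exists m.
pose K := (\sum_(a <- wts) absz (f a)).+1.
have lef a : root a -> (absz (f a) < K)%N.
  by move=> ra; rewrite /K (bigD1_seq a) ?wts_uniq ?root_wts //= ltnS leq_addr.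
have eE a : ev a (K%:Z%:~R *: y + z) = K%:R * ev a y + ev a z by rewrite linearD linearZ.
have hpos a : root a -> kpos (ev a y) -> kpos (ev a (K%:Z%:~R *: y + z)).
  move=> ra [m e]; rewrite eE e hf // -natrM -[_%:R]/((K * m.+1)%N%:Z%:~R) -rmorphD /=.
  by apply/(kpos_int D); have := lef a ra; have := leq_pmulr K (ltn0Sn m); lia.
exists (K%:Z%:~R *: y + z); split=> //; first by apply: intgD => //; exact: intgZ.
  move=> a ra; case: (kpos_cases ra hy) => [h|h|h].
  - by apply: (kpos_neq0 D); exact: hpos.
  - by rewrite eE h mulr0 add0r; exact: rz.
  - rewrite -oppr_eq0 -evN; apply: (kpos_neq0 D); apply: hpos; first exact: rootN.
    by rewrite evN.
by move=> a ra h; rewrite eE h mulr0 add0r.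
Qed.

Variable y : M.
Hypotheses (hy : intg y) (ry : regular D y).

Lemma tangent_split x : x \in g -> exists2 v, v \in Lie (Bgr (- y)) & x - v \in Lie (Bgr y).
Proof.
move=> xg; rewrite -(sum_pr D x).
apply: (big_ind (fun x => exists2 v, v \in Lie (Bgr (- y)) & x - v \in Lie (Bgr y))).
- by exists 0; rewrite ?subr0; exact: mem0v.
- move=> u u' [v hv hu] [v' hv' hu']; exists (v + v'); first exact: memvD.
  have -> : u + u' - (v + v') = (u - v) + (u' - v') by rewrite opprD addrACA.
  exact: (memvD hu hu').
move=> a _; have ha := pr_gsp a xg; have hNy := intgN hy.
have rNy : regular D (- y) by move=> b rb; rewrite linearN oppr_eq0; exact: ry.
have [->|nz] := eqVneq (pr a x) 0; first by exists 0; rewrite ?subr0; exact: mem0v.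
have [a0|a0] := eqVneq a 0.
  exists 0; first exact: mem0v.
  rewrite subr0 a0 in ha *; apply/LieP; apply: (tangent_sub (@T_Bgr _ _ D y)).
  by apply/LieP/gsp0P.
have ra : root a by split=> //; exists (pr a x).
case: (regular_cases ra hy ry) => h.
  by exists 0; [exact: mem0v|rewrite subr0; apply/(Lie_Bgr_root hy ry ra ha nz)].
exists (pr a x); last by rewrite subrr mem0v.
by apply/(Lie_Bgr_root hNy rNy ra ha nz); rewrite linearN -evN.
Qed.

(** The opposite Borel subgroups multiply to a dense subset. *)
Lemma big_cell f : (forall u b, Bgr (- y) u -> Bgr y b -> mxeval f (u *m b) = 0) -> vanishes_on G f.
Proof.
have [[gG cG] zG] := (asG_closed sG, asG_con sG).
apply: (dense_product char0) => //; try by [exact: Bgr_closed|exact: Bgr_sub|exact: Bgr_closed (intgN hy)].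
by move=> x /LieP/tangent_split[v /LieP hv /LieP hx]; exists v.
Qed.

End BigCell.

Section Centraliser.
Variables (k : closedFieldType) (n : nat).
Local Notation M := 'M[k]_n.
Implicit Types (x y z u v w tau : M).
Variable D : tordata k n.
Local Notation G := (tG D).
Local Notation T := (tT D).
Local Notation g0 := (tg0 D).
Local Notation hat := (conj g0).
Local Notation char0 := (tchar0 D).
Local Notation sG := (tas D).
Local Notation dT := (@tdiag k n D).
Local Notation hatP := (@hatP k n D).
Local Notation dmx := (dmx D).
Local Notation intg := (@intg k n D).
Local Notation raises := (raises D).
Local Notation Ugr := (Ugr D).
Local Notation dg := (dg D).
Local Notation dp := (dp D).

Variable y : M.
Hypotheses (hy : intg y) (ry : regular D y).

(** Projections onto the parts of degree at least, or equal to, d. *)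
Definition qge (d : int) : M := dmx (fun i => (d <= dg y i)%R%:R).
Definition peq (d : int) : M := dmx (fun i => (dg y i == d)%:R).

Lemma hat_dmxl f x i j : hat (dmx f *m x) i j = f i * hat x i j.
Proof. by rewrite conjM // (diag_mulmx _ _ _ (dmx_diag D f)) dmx_hat. Qed.
Lemma hat_dmxr f x i j : hat (x *m dmx f) i j = hat x i j * f j.
Proof. by rewrite conjM // (mulmx_diag _ _ _ (dmx_diag D f)) dmx_hat. Qed.

Lemma raises_q d x : raises y 0 x -> qge d *m x *m qge d = x *m qge d.
Proof.
move=> hx; apply: hatP; apply/matrixP => i j; rewrite !hat_dmxr hat_dmxl.
have [->|nz] := eqVneq (hat x i j) 0; first by rewrite mulr0.
case: (lerP d (dg y j)) => [le|_]; last by rewrite !mulr0.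
by rewrite (_ : d <= dg y i) ?mul1r //; have := hx i j nz; lia.
Qed.

Lemma dgN i : dg (- y) i = - dg y i.
Proof. by apply: (intr_inj0 D); rewrite rmorphN /= -(dgE hy) -(dgE (intgN hy)) hatN. Qed.

Lemma lowers_q d x : raises (- y) 0 x -> qge d *m x *m qge d = qge d *m x.
Proof.
move=> hx; apply: hatP; apply/matrixP => i j; rewrite hat_dmxr !hat_dmxl.
have [->|nz] := eqVneq (hat x i j) 0; first by rewrite mulr0 mul0r.
case: (lerP d (dg y i)) => [le|_]; last by rewrite !mul0r.
by rewrite (_ : d <= dg y j) ?mulr1 //; have := hx i j nz; rewrite !dgN; lia.
Qed.

Lemma raises_p d x : raises y 1 (x - 1%:M) -> peq d *m x *m qge d = peq d.
Proof.
move=> hx; rewrite -[x](subrK 1%:M) mulmxDr mulmxDl mulmx1 dmx_mul.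
rewrite (_ : peq d *m (x - 1%:M) *m qge d = 0).
  rewrite add0r; apply: dmxE => i; case: (dg y i =P d) => [->|]; last by rewrite mul0r.
  by rewrite lexx mulr1.
apply: hatP; apply/matrixP => i j; rewrite hat_dmxr hat_dmxl hat0.
have [->|nz] := eqVneq (hat (x - 1%:M) i j) 0; first by rewrite mulr0 mul0r.
case: (dg y i =P d) => [e|_]; last by rewrite !mul0r.
by rewrite (_ : d <= dg y j = false) ?mulr0 //; apply/negP => le; have := hx i j nz; lia.
Qed.

Lemma lowers_p d x : raises (- y) 1 (x - 1%:M) -> qge d *m x *m peq d = peq d.
Proof.
move=> hx; rewrite -[x](subrK 1%:M) mulmxDr mulmxDl mulmx1 dmx_mul.
rewrite (_ : qge d *m (x - 1%:M) *m peq d = 0).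
  rewrite add0r; apply: dmxE => i; case: (dg y i =P d) => [->|]; last by rewrite mulr0.
  by rewrite lexx mulr1.
apply: hatP; apply/matrixP => i j; rewrite hat_dmxr hat_dmxl hat0.
have [->|nz] := eqVneq (hat (x - 1%:M) i j) 0; first by rewrite mulr0 mul0r.
case: (dg y j =P d) => [e|_]; last by rewrite !mulr0.
rewrite (_ : d <= dg y i = false) ?mul0r //; apply/negP => le.
by have := hx i j nz; rewrite !dgN; lia.
Qed.

(** The block of x on the part of degree at least d, completed by the identity;
    its determinant is a generalised minor. *)
Definition mge d x : M := qge d *m x *m qge d + (1%:M - qge d).

Lemma qge_idem d : qge d *m qge d = qge d.
Proof. by rewrite dmx_mul; apply: dmxE => i; rewrite -natrM mulnb andbb. Qed.

Lemma peq_qge d : peq d *m qge d = peq d.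
Proof.
rewrite dmx_mul; apply: dmxE => i; case: (dg y i =P d) => [->|_]; last by rewrite mul0r.
by rewrite lexx mulr1.
Qed.
Lemma qge_peq d : qge d *m peq d = peq d.
Proof. by rewrite -{2}peq_qge !dmx_mul; apply: dmxE => i; rewrite mulrC. Qed.

Lemma dmx_commq d x : dp y x = x -> qge d *m x = x *m qge d.
Proof.
move=> e; apply: hatP; apply/matrixP => i j; rewrite hat_dmxr hat_dmxl -e hat_dp.
by case: eqP => [->|_]; rewrite ?mulr0 ?mul0r // mulrC.
Qed.
Lemma dmx_commp d x : dp y x = x -> peq d *m x = x *m peq d.
Proof.
move=> e; apply: hatP; apply/matrixP => i j; rewrite hat_dmxr hat_dmxl -e hat_dp.
by case: (dg y i =P dg y j) => [->|_]; rewrite ?mulr0 ?mul0r // mulrC.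
Qed.

Definition lowuni v := [/\ v \in unitmx, raises (- y) 1 (v - 1%:M) & raises (- y) 1 (invmx v - 1%:M)].
Definition uppuni u := [/\ u \in unitmx, raises y 1 (u - 1%:M) & raises y 1 (invmx u - 1%:M)].

Lemma raises_uni y' u : raises y' 1 (u - 1%:M) -> raises y' 0 u.
Proof.
move=> h; rewrite -[u](subrK 1%:M); apply: raisesD; last exact: raises1.
by apply: raises_le h.
Qed.

(** On the part of degree at least d, upper unipotent factors are block
    triangular on one side and lower ones on the other; neither changes the
    corner block of the inverse. *)
Lemma mge_inv d v l u : lowuni v -> uppuni u -> l \in unitmx -> dp y l = l ->
  mge d (v *m l *m u) \in unitmx /\
  peq d *m invmx (mge d (v *m l *m u)) *m peq d = peq d *m invmx l.
Proof.
move=> [vU v1 v2] [uU u1 u2] lU ll.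
have [v1' v2' u1' u2'] := And4 (raises_uni v1) (raises_uni v2) (raises_uni u1) (raises_uni u2).
have ql := dmx_commq d ll; have pl := dmx_commp d ll.
have qlV : qge d *m invmx l = invmx l *m qge d.
  apply: (can_inj (mulKmx lU)); rewrite mulmxA -ql -mulmxA mulmxV // mulmx1.
  by rewrite mulmxA mulmxV // mul1mx.
have plV : peq d *m invmx l = invmx l *m peq d.
  apply: (can_inj (mulKmx lU)); rewrite mulmxA -pl -mulmxA mulmxV // mulmx1.
  by rewrite mulmxA mulmxV // mul1mx.
set q := qge d; have qq : q *m q = q by exact: qge_idem.
have q1 : q *m (1%:M - q) = 0 by rewrite mulmxBr mulmx1 qq subrr.
have q1' : (1%:M - q) *m q = 0 by rewrite mulmxBl mul1mx qq subrr.
pose m' := (q *m invmx u *m q) *m invmx l *m (q *m invmx v *m q) + (1%:M - q).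
have mE : mge d (v *m l *m u) = (q *m v *m q) *m l *m (q *m u *m q) + (1%:M - q).
  rewrite /mge -/q (lowers_q d v1') (raises_q d u1'); congr (_ + _).
  by rewrite !mulmxA.
have mm : mge d (v *m l *m u) *m m' = 1%:M.
  have e1 : (q *m v *m q) *m l *m (q *m u *m q) *m ((q *m invmx u *m q) *m invmx l *m (q *m invmx v *m q)) = q.
    have uu : q *m u *m q *m (q *m invmx u *m q) = q.
      rewrite (raises_q d u1') (raises_q d u2') mulmxA.
      rewrite -[u *m q *m invmx u *m q]mulmxA -[u *m q *m _]mulmxA.
      by rewrite [q *m (_ *m q)]mulmxA (raises_q d u2') mulmxA mulmxV // mul1mx.
    have vv : q *m v *m q *m (q *m invmx v *m q) = q.
      rewrite (lowers_q d v1') (lowers_q d v2') mulmxA (lowers_q d v1').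
      by rewrite -mulmxA mulmxV // mulmx1.
    transitivity ((q *m v *m q) *m l *m (q *m u *m q *m (q *m invmx u *m q)) *m invmx l *m (q *m invmx v *m q)).
      by rewrite !mulmxA.
    rewrite uu -[(_ *m l) *m q]mulmxA -ql -[_ *m (q *m l) *m _]mulmxA -[(q *m l) *m _]mulmxA.
    by rewrite mulmxV // mulmx1 -[q *m v *m q *m q]mulmxA qq vv.
  have e2 (a : M) : a *m (q *m u *m q) *m (1%:M - q) = 0.
    by rewrite -[a *m _ *m _]mulmxA -[q *m u *m q *m _]mulmxA q1 !mulmx0.
  have e3 a b : (1%:M - q) *m (q *m a *m q *m b *m (q *m invmx v *m q)) = 0.
    have -> : q *m a *m q *m b *m (q *m invmx v *m q) = q *m (a *m q *m b *m (q *m invmx v *m q)).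
      by rewrite !mulmxA.
    by rewrite [LHS]mulmxA q1' mul0mx.
  have e4 : (1%:M - q) *m (1%:M - q) = 1%:M - q by rewrite mulmxBr mulmx1 q1' subr0.
  have e5 : q + (1%:M - q) = 1%:M by rewrite addrC subrK.
  rewrite mE /m'; move: (1%:M - q) e2 e3 e4 e5 => r e2 e3 e4 e5.
  by rewrite mulmxDl !mulmxDr e1 e2 e3 e4 addr0 add0r.
have mU : mge d (v *m l *m u) \in unitmx by case: (mulmx1_unit mm).
have -> : invmx (mge d (v *m l *m u)) = m'.
  by apply: (can_inj (mulKmx mU)); rewrite mulmxV.
split=> //; have p0 : peq d *m (1%:M - q) = 0 by rewrite mulmxBr mulmx1 peq_qge subrr.
have pA : peq d *m (q *m invmx u *m q) = peq d.
  have pq : peq d *m q = peq d by exact: peq_qge.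
  by rewrite [LHS]mulmxA [peq d *m _]mulmxA pq (raises_p d u2).
have Cp : q *m invmx v *m q *m peq d = peq d by rewrite -mulmxA qge_peq (lowers_p d v2).
have pp : peq d *m peq d = peq d by rewrite dmx_mul; apply: dmxE => i; rewrite -natrM mulnb andbb.
rewrite /m' {mm m'}; move: (1%:M - q) p0 (q *m invmx u *m q) pA (q *m invmx v *m q) Cp => r p0 A pA C Cp.
move: (peq d) p0 pA Cp pp plV => p p0 pA Cp pp plV.
by rewrite mulmxDr p0 addr0 -!mulmxA Cp !mulmxA pA plV -mulmxA pp.
Qed.

Definition degs : seq int := undup [seq dg y i | i <- enum 'I_n].

Lemma sum_peq : \sum_(d <- degs) peq d = 1%:M.
Proof.
apply: hatP; apply/matrixP => i j; rewrite hat_sum conj_id // mxE.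
rewrite (bigD1_seq (dg y i)) ?undup_uniq //=; last by rewrite mem_undup map_f ?mem_enum.
rewrite hat_dmx eqxx big1 ?addr0 // => d nd.
by rewrite hat_dmx eq_sym (negPf nd) mul0rn.
Qed.

Lemma uppuni_U u : Ugr y 1 u -> uppuni u.
Proof.
move=> hu; have [UU _ _ UV] := @Ugr_subgroup _ _ D y 1 (lexx 1).
by split; [exact: UU|case: hu|case: (UV _ hu)].
Qed.

Lemma lowuni_U u : Ugr (- y) 1 u -> lowuni u.
Proof.
move=> hu; have [UU _ _ UV] := @Ugr_subgroup _ _ D (- y) 1 (lexx 1).
by split; [exact: UU|case: hu|case: (UV _ hu)].
Qed.

(** On the dense big cell U^- T U, blocks of the inverses of the matrices [mge]
    compute the inverse of the factor in T, as a rational function c. An element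
    commuting with y has degree 0, so that c is defined at it, with value its
    inverse; thus c takes it into the closed set T. *)
Lemma regular_centraliser q0 : G q0 -> conj q0 y = y -> T q0.
Proof.
move=> Gq qy; have uq := asG_unit sG Gq.
have uni1 : uppuni 1%:M /\ lowuni 1%:M.
  by split; (split; rewrite ?invmx1 ?unitmx1 // subrr; exact: raises0).
have dq : dp y q0 = q0.
  apply: hatP; apply/matrixP => i j; rewrite hat_dp; case: eqP => // ne.
  have [ht _] := hy; have := hat_lie q0 i j (diag_lie ht).
  have -> : lie y q0 = 0 by apply/lie_eq0/esym/(conj_fix_comm y uq).
  rewrite hat0 !(dgE hy) -rmorphB => /esym/eqP; rewrite mulf_eq0 (char0_intr_eq0 char0) subr_eq0.
  by case/orP => /eqP.
pose dt x := \prod_(d <- degs) \det (mge d x).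
pose c x : M := \sum_(d <- degs) peq d *m invmx (mge d x) *m peq d.
have cE v l u : lowuni v -> uppuni u -> l \in unitmx -> dp y l = l ->
    dt (v *m l *m u) != 0 /\ c (v *m l *m u) = invmx l.
  move=> hv hu ul hl; split.
    rewrite prodf_seq_neq0; apply/allP => d _ /=; rewrite -unitfE.
    by case: (mge_inv d hv hu ul hl).
  rewrite /c (eq_bigr (fun d => peq d *m invmx l)) => [|d _].
    by rewrite -mulmx_suml sum_peq mul1mx.
  by case: (mge_inv d hv hu ul hl).
have pm d : pmap (mge d).
  by apply: pmapD; [apply: pmapM; [apply: pmapM; [exact: pmapC|exact: pmap_id]|exact: pmapC]|exact: pmapC].
have pdt : pfun dt by apply: pfun_prod => d; apply: pfun_det; exact: pm.
have [UT _ _ VT] : subgroup T by case: (mT_closed D).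
have uqV : invmx q0 \in unitmx by rewrite unitmx_inv.
suff Tq : T (invmx q0) by rewrite -[q0]invmxK; exact: VT.
have [_ [_ cT]] := mT_closed D; apply: cT => // f hf.
have [||||i j|w [e [[p pE] we]]] := @pullback_fun k n M (@pfun k n) [set x | dt x != 0] c dt _ _ _ _ _ f.
- exact: pfunC.
- exact: pfunD.
- exact: pfunM.
- exact: pdt.
- pose b d x : M := (\prod_(d' <- rem d degs) \det (mge d' x)) *: (peq d *m \adj (mge d x) *m peq d).
  have pb : pmap (fun x => \sum_(d <- degs) b d x).
    apply: pmap_sum => d; apply: pmapZ; first by apply: pfun_prod => d'; apply: pfun_det; exact: pm.
    by apply: pmapM; [apply: pmapM; [exact: pmapC|exact: pmap_adj]|exact: pmapC].
  exists (fun x => (\sum_(d <- degs) b d x) i j); first exact: pb.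
  move=> x /= dx; rewrite /c !summxE mulr_sumr; apply: eq_big_seq => d dd.
  have dE : dt x = \det (mge d x) * \prod_(d' <- rem d degs) \det (mge d' x) by rewrite /dt (big_rem d).
  have d0 : \det (mge d x) != 0 by move: dx; rewrite dE mulf_eq0 negb_or => /andP[].
  rewrite /b /invmx unitmxE unitfE d0 -scalemxAr -scalemxAl !mx_scaleE dE mulrA.
  by rewrite -[_ * _ / _]mulrAC mulfV // mul1r.
have [r rE] := pdt; have h : vanishes_on G (p * r).
  apply: (big_cell hy ry) => _ _ [s' [v [Ts' hv ->]]] [s [u [Ts hu ->]]].
  have hv' : Ugr (- y) 1 (conj s' v) by apply: Ugr_conjT => //; exact: intgN.
  have us' := UT _ Ts'; have us := UT _ Ts; have uss : s' *m s \in unitmx by rewrite unitmx_mul us'.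
  have dss : dp y (s' *m s) = s' *m s by apply: dp_diag => //; apply: dT; exact: mT_mul.
  have xE : s' *m v *m (s *m u) = conj s' v *m (s' *m s) *m u.
    by rewrite /conj !mulmxA (mulmxKV us').
  have [d0 cc] := cE _ _ _ (lowuni_U hv') (uppuni_U hu) uss dss.
  rewrite mxevalM pE xE we //= cc hf ?mul0r //.
  by apply: VT; exact: mT_mul.
have [d0 cc] : dt (1%:M *m q0 *m 1%:M) != 0 /\ c (1%:M *m q0 *m 1%:M) = invmx q0.
  by apply: cE => //; case: uni1.
rewrite mul1mx mulmx1 in d0 cc; have := h _ Gq; rewrite mxevalM pE rE we //= cc.
move/eqP; rewrite !mulf_eq0 (negPf d0) orbF expf_eq0 (negPf d0) andbF orbF.
by move/eqP.
Qed.

End Centraliser.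

(** * The Bruhat decomposition *)

Section Bruhat.
Variables (k : closedFieldType) (n : nat).
Local Notation M := 'M[k]_n.
Implicit Types (x y z u v w tau : M).
Variable D : tordata k n.
Local Notation G := (tG D).
Local Notation T := (tT D).
Local Notation g0 := (tg0 D).
Local Notation hat := (conj g0).
Local Notation g := (Lie G).
Local Notation t := (Lie T).
Local Notation char0 := (tchar0 D).
Local Notation sG := (tas D).
Local Notation ug0 := (tunit D).
Local Notation hatP := (@hatP k n D).
Local Notation gsp := (@gsp k n D).
Local Notation ev := (@ev k n D).
Local Notation pr := (@pr k n D).
Local Notation wts := (wts D).
Local Notation root := (@root k n D).
Local Notation intg := (@intg k n D).
Local Notation norm := (normalizer G T).
Local Notation raises := (raises D).
Local Notation Ugr := (Ugr D).

Lemma raises_expm2 y (m : int) z : 1 <= m -> raises y m z -> raises y (m + 1) (expm z - 1%:M - z).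
Proof.
move=> m1 hz; have zn : z ^+ n = 0 by apply: (@raises_nilp _ _ D y); apply: raises_le hz.
rewrite (@expm_widen k n z n.+2) // big_ord_recl big_ord_recl /= expr0 invr1 scale1r.
rewrite scale1r expr1 [1 + (z + _)]addrA [1 + z + _]addrC.
set S := \sum_(i < n) _; have -> : S + (1 + z) - 1%:M - z = S.
  by rewrite -[_ - z]addrA -opprD -[1]/(1%:M : M) addrK.
rewrite {}/S; apply: raises_sum => i; apply: raisesZ; rewrite /bump /= !add1n exprS -mulmxE exprS -mulmxE.
apply: (@raises_le _ _ D y (m + (m + 0))); first lia.
apply: raisesM => //; apply: raisesM => //.
elim: (val i) => [|j IHj]; first exact: raises1.
by rewrite exprS -mulmxE -[0]addr0; apply: raisesM => //; apply: raises_le hz; lia.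
Qed.

Section Regular.
Variable y : M.
Hypotheses (hy : intg y) (ry : regular D y).

Lemma raises_pr0 x : x \in g -> raises y 0 x -> raises y 1 (x - pr 0 x).
Proof.
move=> xg rx; rewrite -(sum_pr D (x - pr 0 x)); apply: raises_sum => a.
rewrite linearB /= pr_pr; have [->|a0] := eqVneq a 0; first by rewrite subrr; exact: raises0.
have ha := pr_gsp a xg; rewrite subr0.
have [->|nz] := eqVneq (pr a x) 0; first exact: raises0.
have ra : root a by split=> //; exists (pr a x).
have [z ez] := ev_int ra hy.
have := raises_gsp hy ha nz ez (@raises_pr _ _ D y 0 a x rx); rewrite le_eqVlt => /orP[/eqP e|lt].
  by have := ry ra; rewrite ez -e eqxx.
by apply: (raises_le _ (gsp_raises hy ha ez)); lia.
Qed.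

Lemma pr0_t x : x \in g -> pr 0 x \in t.
Proof. by move=> xg; apply/gsp0P; exact: pr_gsp. Qed.

Lemma raises1_pr0 x : raises y 1 x -> pr 0 x = 0.
Proof.
move=> hx; apply: hatP; apply/matrixP => i j; rewrite hat_pr hat0; case: eqP => // e.
apply/eqP/negPn/negP => /hx; have := ev_wt_dg hy i j.
by rewrite e ev0 => /esym/eqP; rewrite (char0_intr_eq0 char0) => /eqP->.
Qed.

Lemma tr_raises tau x : tau \in t -> raises y 1 x -> \tr (tau *m x) = 0.
Proof.
move=> ht hx; rewrite -(mxtrace_conj _ ug0) conjM // /mxtrace big1 // => i _.
rewrite (diag_mulmx _ _ _ (diag_lie ht)); apply/eqP; rewrite mulf_eq0; apply/orP; right.
by apply/negPn/negP => /hx; rewrite subrr.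
Qed.

Lemma conj_U_raises u x : Ugr y 1 u -> raises y 0 x -> raises y 1 (conj u x - x).
Proof.
move=> hu rx; have [UU _ _ UV] := @Ugr_subgroup _ _ D y 1 (lexx 1).
have -> : conj u x - x = ((u - 1%:M) *m x - x *m (u - 1%:M)) *m invmx u.
  have -> : (u - 1%:M) *m x - x *m (u - 1%:M) = u *m x - x *m u.
    by rewrite mulmxBl mulmxBr mulmx1 mul1mx opprB addrA subrK.
  rewrite mulmxBl.
  by rewrite -[x *m u *m _]mulmxA mulmxV ?UU // mulmx1.
rewrite -[1]addr0; apply: raisesM; last exact: (Ugr_raises0 (lexx 1) (UV _ hu)).
have [_ ru] := hu; apply: raisesB; first by rewrite -[1]addr0; apply: raisesM.
by rewrite -[1]add0r; apply: raisesM.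
Qed.

(** A regular element of the torus is conjugate under U to any element of Lie B
    having it as its torus part: correct one degree at a time. *)
Lemma conj_regular x : x \in g -> raises y 0 x -> regular D (pr 0 x) ->
  exists2 u, Ugr y 1 u & conj u x = pr 0 x.
Proof.
move=> xg rx rt; set tau := pr 0 x; have ht : tau \in t by exact: pr0_t.
have [UU U1 UM UV] := @Ugr_subgroup _ _ D y 1 (lexx 1).
have step (m : nat) : exists2 u, Ugr y 1 u & raises y m.+1%:Z (conj u x - tau).
  elim: m => [|m [u hu hm]]; first by exists 1%:M; rewrite ?conj1m //; exact: raises_pr0.
  have uu := UU _ hu; have Gu : G u by case: hu.
  set x1 := conj u x - tau; have x1g : x1 \in g by apply: memvB; [exact: (conj_in sG)|case: (gsp_t ht)].
  pose z := \sum_(a <- wts | a != 0) (ev a tau)^-1 *: pr a x1.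
  have zg : z \in g by apply: rpred_sum => a _; rewrite memvZ //; case: (pr_gsp a x1g).
  have rz : raises y m.+1%:Z z.
    by rewrite /z -big_filter; apply: raises_sum => a; apply: raisesZ; exact: raises_pr.
  have lz : lie tau z = x1.
    rewrite /z linear_sum -[RHS](sum_pr D) [RHS](bigID (fun a => a != 0)) /= [X in _ = _ + X]big1.
      rewrite addr0; apply: eq_bigr => a a0; rewrite linearZ /= lie_pr // scalerA.
      have [->|nz] := eqVneq (pr a x1) 0; first by rewrite !scaler0.
      by rewrite mulVf ?scale1r //; apply: rt; split=> //; exists (pr a x1) => //; exact: pr_gsp.
    move=> a /negPn/eqP->; apply: raises1_pr0; apply: raises_le hm; lia.
  have he : Ugr y 1 (expm z) by apply: exp_Ugr => //; apply: raises_le rz; lia.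
  exists (expm z *m u); first exact: UM.
  rewrite conj_mul ?UU //; have -> : conj u x = tau + x1 by rewrite addrC subrK.
  have -> : conj (expm z) (tau + x1) - tau =
      (expm z *m (tau + x1) - tau *m expm z) *m invmx (expm z).
    by rewrite mulmxBl -[tau *m _ *m _]mulmxA mulmxV ?UU // mulmx1.
  rewrite -[m.+2%:Z]addr0; apply: raisesM; last exact: (Ugr_raises0 (lexx 1) (UV _ he)).
  have r0 : raises y 0 tau by apply: raises_diag; exact: diag_lie.
  have r2 := @raises_expm2 y m.+1%:Z z isT rz.
  set e := expm z - 1%:M - z in r2; have eE : expm z = 1%:M + (z + e).
    by rewrite /e [z + _]addrC subrK addrC subrK.
  have -> : expm z *m (tau + x1) - tau *m expm z = (z + e) *m x1 + (e *m tau - tau *m e).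
    rewrite eE mulmxDl mul1mx [tau *m (1%:M + _)]mulmxDr mulmx1 [tau *m (z + e)]mulmxDr.
    rewrite [(z + e) *m (tau + x1)]mulmxDr [(z + e) *m tau]mulmxDl.
    have -> : tau *m z = x1 + z *m tau by rewrite -lz subrK.
    have A (a x' q r s S : M) : a + x' + (q + r + S) - (a + (x' + q + s)) = S + (r - s).
      rewrite -[x' + q + s]addrA [a + (x' + _)]addrA opprD addrACA subrr add0r.
      by rewrite -[q + r + S]addrA opprD addrACA subrr add0r addrAC addrC.
    exact: A.
  have rze : raises y m.+1%:Z (z + e) by apply: raisesD => //; apply: raises_le r2; lia.
  apply: raisesD; first by apply: (raises_le _ (raisesM rze hm)); lia.
  have -> : m.+2%:Z = m.+1%:Z + 1 by lia.
  apply: raisesB; first by rewrite -[m.+1%:Z + 1]addr0; apply: raisesM.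
  by rewrite -[m.+1%:Z + 1]add0r; apply: raisesM.
have [b hb] := @raises_bound _ _ D y; have [u hu hm] := step b; exists u => //.
by apply/subr0_eq/hb; apply: raises_le hm; lia.
Qed.

Lemma commute_regular tau x : tau \in t -> regular D tau -> x \in g -> lie tau x = 0 -> x \in t.
Proof.
move=> ht rt xg l0; apply/gsp0P; rewrite -(sum_pr D x).
apply: (big_ind (gsp 0)) => [||a _]; [exact: gsp_0|exact: gspD|].
have [->|a0] := eqVneq a 0; first exact: pr_gsp.
have [->|nz] := eqVneq (pr a x) 0; first exact: gsp_0.
have ra : root a by split=> //; exists (pr a x) => //; exact: pr_gsp.
have := pr_lie a x ht; rewrite l0 linear0 => /esym/eqP; rewrite scaler_eq0 (negPf nz) orbF.
by rewrite (negPf (rt _ ra)).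
Qed.

Let b x := x \in g /\ raises y 0 x.

(** A component of negative degree would pair nontrivially with the opposite
    root space. *)
Lemma orth_Lie_U v : v \in g ->
  (forall x, x \in g -> raises y 1 x -> \tr (v *m x) = 0) -> raises y 0 v.
Proof.
move=> vg hv; rewrite -(sum_pr D v); apply: raises_sum => a.
have ha := pr_gsp a vg; have [->|nz] := eqVneq (pr a v) 0; first exact: raises0.
have [a0|a0] := eqVneq a 0.
  by apply: raises_diag; apply: diag_lie; rewrite a0; exact: pr0_t.
have ra : root a by split=> //; exists (pr a v).
have [z ez] := ev_int ra hy; have [le|lt] := leP 0 z.
  exact: (raises_le le (gsp_raises hy ha ez)).
have [f hf nf] := gsp_dual ha nz; case/eqP: nf.
have ef : ev (- a) y = (- z)%:~R by rewrite evN ez rmorphN.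
have rf : raises y 1 f by apply: (raises_le _ (gsp_raises hy hf ef)); lia.
rewrite -(hv f (gsp_in hf) rf) -[in RHS](sum_pr D v) mulmx_suml raddf_sum /=.
case: (boolP (a \in wts)) => aw; last by rewrite (pr_notin v aw) eqxx in nz.
rewrite (bigD1_seq a) ?wts_uniq //= big1 ?addr0 // => c ca.
by apply: (gsp_orth (pr_gsp c vg) hf); rewrite subr_eq0.
Qed.

(** Modulo positive degrees, the powers of tau - z are those of tau. *)
Lemma torus_not_nilp tau z : tau \in t -> raises y 1 z -> (tau - z) ^+ n = 0 -> tau = 0.
Proof.
move=> ht rz e; apply: (@diag_nilp _ _ D); first exact: diag_lie.
have r0 : raises y 0 tau by apply: raises_diag; exact: diag_lie.
have rp m : raises y 0 (tau ^+ m).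
  elim: m => [|m IHm]; first exact: raises1.
  by rewrite exprS -mulmxE -[0]addr0; apply: raisesM.
have h m : raises y 1 (tau ^+ m - (tau - z) ^+ m).
  elim: m => [|m IHm]; first by rewrite subrr; exact: raises0.
  rewrite !exprS -!mulmxE mulmxBl opprB addrA addrAC -mulmxBr.
  have rz0 : raises y 0 z by apply: raises_le rz.
  apply: raisesD; first by rewrite -[1]add0r; apply: raisesM.
  rewrite -[1]addr0; apply: raisesM => //; rewrite -[_ ^+ m](subKr (tau ^+ m)).
  by apply: raisesB => //; apply: raises_le IHm.
have hn := h n; rewrite e subr0 in hn.
apply: hatP; apply/matrixP => i j; rewrite hat0; apply/eqP/negPn/negP => nz.
have := hn i j nz; have [ij|ij] := eqVneq i j; first by rewrite ij subrr.
have hm m : hat (tau ^+ m) i j = 0.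
  elim: m => [|m IHm]; first by rewrite expr0 conj_id // mxE (negPf ij).
  by rewrite exprS -mulmxE conjM // (diag_mulmx _ _ _ (diag_lie ht)) IHm mulr0.
by rewrite hm eqxx in nz.
Qed.

(** By duality: otherwise tau lies in Lie U + Ad(q) Lie U, the orthogonal of Lie
    B :&: Ad(q) Lie B, so that tau differs by an element of Lie U from a
    nilpotent matrix. *)
Lemma bruhat_tr q tau : G q -> tau \in t -> tau != 0 ->
  exists v, [/\ b v, b (conj (invmx q) v) & \tr (tau *m v) != 0].
Proof.
move=> Gq ht t0; have uq := asG_unit sG Gq; have tg : tau \in g by case: (gsp_t ht).
have [u hu] : exists u : {vspace M}, forall x, x \in u <-> (x \in g /\ raises y 1 x).
  apply: vspace_of_pred; first by split; [exact: mem0v|exact: raises0].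
  move=> c x x' [xg rx] [xg' rx']; split; first by rewrite rpredD ?memvZ.
  by apply: raisesD => //; exact: raisesZ.
pose uq_ := (linfun (conj q : M -> M) @: u)%VS.
(* If tau = z + z' with z' nilpotent, then tau - z is nilpotent. *)
have nW : tau \notin (u + uq_)%VS.
  apply: contraNN t0 => /memv_addP[z /hu[zg rz] [_ /memv_imgP[z' /hu[zg' rz'] ->] e]].
  apply/eqP; apply: (torus_not_nilp ht rz); rewrite e addrAC subrr add0r lfunE /=.
  by rewrite -conj_exp // (raises_nilp rz') linear0.
have [phi [phi0 phit]] := separating_form nW.
have [v vg hv] := riesz_trace char0 sG (phi := phi) (linearP phi).
have hvu x : x \in g -> raises y 1 x -> \tr (v *m x) = 0.
  by move=> xg rx; rewrite hv // phi0 //; apply: (subvP (addvSl u uq_)); apply/hu.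
exists v; split; first by split=> //; exact: orth_Lie_U.
- have vg' : conj (invmx q) v \in g by apply: (conj_in sG) => //; exact: (asG_inv sG).
  split=> //; apply: orth_Lie_U => // x xg rx.
  rewrite mxtrace_conjl ?unitmx_inv // invmxK hv ?(conj_in sG) // phi0 //.
  apply: (subvP (addvSr u uq_)); apply/memv_imgP; exists x; last by rewrite lfunE.
  exact/hu.
- by rewrite mxtrace_mulC hv.
Qed.

(** Some x in Lie B :&: Ad(q) Lie B has regular torus parts on both sides, by
    [bruhat_tr]. Conjugating x under U to these torus parts turns q into an
    element carrying one regular element of Lie T to another, hence normalising
    T. *)
Theorem bruhat q : G q -> exists u w u', [/\ Ugr y 1 u, norm w, Ugr y 1 u' & q = u *m w *m u'].
Proof.
move=> Gq; have uq := asG_unit sG Gq; have GV := asG_inv sG Gq.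
pose Y x := b x /\ b (conj (invmx q) x).
pose F (p : cartan_dual T * bool) x := ev p.1 (pr 0 (if p.2 then x else conj (invmx q) x)).
pose r := [seq (a, c) | a <- [seq a <- wts | `[< root a >]], c <- [:: true; false]].
have [v vt vE] : exists2 v : cartan_dual T -> M, forall a, root a -> v a \in t /\ v a != 0 &
    forall a, root a -> forall x, x \in g -> ev a (pr 0 x) = \tr (v a *m x).
  have [|v hv] := @choice _ _ (fun a v => root a -> [/\ v \in t, v != 0 &
      forall x, x \in g -> ev a (pr 0 x) = \tr (v *m x)]).
    move=> a; case: (pselect (root a)) => [ra|]; last by exists 0.
    have [v vt ve] := @riesz_t _ _ D (ev a) (ev_scalar a); exists v => _; split=> //.
      apply/eqP => v0; have [a0 _] := ra; have [tau ht e1] := ev_neq0 a0.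
      by have := ve tau ht; rewrite v0 mul0mx mxtrace0 e1 => /esym/eqP; rewrite oner_eq0.
    move=> x xg; rewrite -ve ?pr0_t // -[in RHS](sum_pr D x) mulmx_sumr raddf_sum /=.
    have hc c : c != 0 -> \tr (v *m pr c x) = 0.
      by move=> c0; apply: (t_orth c0 (pr_gsp c xg) vt).
    case: (boolP (0 \in wts)) => h0; last first.
      rewrite (pr_notin x h0) mulmx0 mxtrace0 big_seq big1 // => c cw; apply: hc.
      by apply: contraNneq h0 => <-.
    by rewrite (bigD1_seq 0) ?wts_uniq //= big1 ?addr0.
  by exists v => a ra; case: (hv a ra).
have [||p x x'|p|x [[xg rx] [xg' rx']] hr] := avoid char0 (Y := Y) (r := r) (F := F).
- exists 0; split; split; rewrite ?linear0 ?mem0v //; exact: raises0.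
- move=> x x' [[h1 h2] [h3 h4]] [[h1' h2'] [h3' h4']]; split; split; rewrite ?linearD; try exact: memvD.
    exact: raisesD.
  exact: raisesD.
- by rewrite /F; case: (p.2); rewrite !linearD.
- case/allpairsP => -[a c] /= []; rewrite mem_filter => /andP[/asboolP ra _] _ ->.
  have [at0 a0] := vt a ra; case: c.
    have [x [bx bx' nz]] := bruhat_tr Gq at0 a0; exists x => //.
    by rewrite /F /= vE //; case: bx.
  have [x [bx bx' nz]] := bruhat_tr GV at0 a0; rewrite invmxK in bx'.
  exists (conj q x); first by split=> //; rewrite conjK.
  by rewrite /F /= conjK // vE //; case: bx.
have reg1 : regular D (pr 0 x).
  move=> a ra; apply: (hr (a, true)); apply/allpairsP; exists (a, true) => /=; split=> //.
  by rewrite mem_filter root_wts // andbT; apply/asboolP.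
have reg2 : regular D (pr 0 (conj (invmx q) x)).
  move=> a ra; apply: (hr (a, false)); apply/allpairsP; exists (a, false) => /=; split=> //.
  by rewrite mem_filter root_wts // andbT; apply/asboolP.
have [u1 hu1 e1] := conj_regular xg rx reg1; have [u2 hu2 e2] := conj_regular xg' rx' reg2.
have [UU _ _ UV] := @Ugr_subgroup _ _ D y 1 (lexx 1).
have [uu1 uu2] := (UU _ hu1, UU _ hu2); have [Gu1 Gu2] : G u1 /\ G u2 by case: hu1; case: hu2.
pose w := u1 *m q *m invmx u2; have Gw : G w.
  by apply: (asG_mul sG); [exact: (asG_mul sG)|exact: (asG_inv sG)].
have we : conj w (pr 0 (conj (invmx q) x)) = pr 0 x.
  by rewrite -e2 !conj_mul ?unitmx_mul ?uu1 ?uq ?unitmx_inv // conjK // conjVK.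
exists (invmx u1), w, u2; split; [exact: UV| |by []|].
  apply: normP => // tau ht; apply: (commute_regular (pr0_t xg) reg1).
    by apply: (conj_in sG) => //; case: (gsp_t ht).
  by rewrite -we -conj_lie ?(asG_unit sG Gw) // (@t_comm _ _ D) ?linear0 ?pr0_t.
by rewrite /w !mulmxA mulVmx // mul1mx mulmxKV.
Qed.

(** The torus parts of Ad(w) tau, for tau in Lie T, are seen through pairing
    with the regular element y, whose transform by w they determine; and y has
    centraliser T. *)
Lemma bruhat_uniq u w w' u' : Ugr y 1 u -> Ugr y 1 u' -> norm w -> norm w' ->
  u *m w = w' *m u' -> T (w' *m invmx w).
Proof.
move=> hu hu' hw hw' e; have [UU _ _ _] := @Ugr_subgroup _ _ D y 1 (lexx 1).
have [uu uu' uw uw'] := And4 (UU _ hu) (UU _ hu') (norm_unit hw) (norm_unit hw').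
have [yt _] := hy; have rt tau : tau \in t -> raises y 0 tau by move=> ht; apply: raises_diag; exact: diag_lie.
have h tau : tau \in t -> \tr (conj (invmx w) y *m tau) = \tr (conj (invmx w') y *m tau).
  move=> ht; rewrite !mxtrace_conjl ?unitmx_inv // !invmxK.
  have wt_ := norm_t hw ht; have c1 : conj (invmx w') y \in t by apply: norm_t yt; exact: norm_inv.
  have r1 := tr_raises yt (conj_U_raises hu (rt _ wt_)).
  have r2 := tr_raises c1 (conj_U_raises hu' (rt _ ht)).
  move: r1 r2; rewrite !mulmxBr !raddfB /= => /subr0_eq <- /subr0_eq.
  rewrite !mxtrace_conjl ?unitmx_inv // !invmxK => <-.
  by rewrite -!conj_mul // e.
have eq : conj (invmx w) y = conj (invmx w') y.
  apply/subr0_eq; apply: (@t_nondeg _ _ D) => [|tau ht].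
    by rewrite rpredB //; apply: norm_t yt; exact: norm_inv.
  by rewrite mulmxBl raddfB /= h // subrr.
apply: (regular_centraliser hy ry); first by apply: (asG_mul sG); [case: hw'|apply: (asG_inv sG); case: hw].
by rewrite conj_mul ?unitmx_inv // eq conjVK.
Qed.

End Regular.
End Bruhat.

(** * Positive systems and the Weyl group *)

Section Positive.
Variables (k : closedFieldType) (n : nat).
Local Notation M := 'M[k]_n.
Implicit Types (x y z u v w tau : M).
Variable D : tordata k n.
Local Notation G := (tG D).
Local Notation T := (tT D).
Local Notation char0 := (tchar0 D).
Local Notation ev := (@ev k n D).
Local Notation pr := (@pr k n D).
Local Notation root := (@root k n D).
Local Notation cr := (@cr k n D).
Local Notation intg := (@intg k n D).
Local Notation triple := (@triple k n D).
Local Notation norm := (normalizer G T).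
Local Notation Bgr := (Bgr D).
Local Notation regular := (regular D).
Variable B : set M.
Hypotheses (borelB : borel G B) (sTB : T `<=` B).
Local Notation bpos := (@bpos k n D B).
Local Notation bposb := (@bposb k n D B).
Local Notation Bposs := (@Bposs k n D B).
Local Notation bposN := (bposN borelB).

(** [Bgr y] is connected and solvable and contains B, as the Lie algebras show.
    *)
Lemma borel_Bgr y : intg y -> regular y -> (forall a, bpos a -> kpos (ev a y)) -> B = Bgr y.
Proof.
move=> hy ry hp; have [BG [Bcl Bcon Bsol] Bmax] := borelB.
apply/esym/Bmax; first exact: Bgr_sub.
  by split; [exact: Bgr_closed|exact: Bgr_connected|exact: Bgr_solvable].
suff h x : x \in Lie B -> x \in Lie (Bgr y).
  by apply: (Lie_subgroup char0 Bcl Bcon (@Bgr_closed _ _ D y)) => x /LieP/h/LieP.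
move=> xB.
have xg := LieB_sub borelB xB; rewrite -(sum_pr D x); apply: memv_suml => a _.
have ha := pr_gsp a xg; have hB : pr a x \in Lie B by exact: pr_LieB borelB sTB _ _ xB.
have [a0|a0] := eqVneq a 0.
  by rewrite a0 in ha *; apply/LieP; apply: (tangent_sub (@T_Bgr _ _ D y)); apply/LieP/gsp0P.
have [->|nz] := eqVneq (pr a x) 0; first exact: mem0v.
have ra : root a by split=> //; exists (pr a x).
by apply/(Lie_Bgr_root hy ry ra ha nz); apply: hp; exact: bpos_of ra ha nz hB.
Qed.

Lemma bposP y a : intg y -> regular y -> (forall a, bpos a -> kpos (ev a y)) ->
  bpos a <-> root a /\ kpos (ev a y).
Proof.
move=> hy ry hp; split=> [ha|[ra ka]]; first by split; [case: ha|exact: hp].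
split=> // x hx; have [->|nz] := eqVneq x 0; first exact: mem0v.
by rewrite (borel_Bgr hy ry hp); apply/(Lie_Bgr_root hy ry ra hx nz).
Qed.

Lemma borel_grading : exists y, [/\ intg y, regular y,
  forall a, bpos a <-> root a /\ kpos (ev a y), B = Bgr y &
  forall w, norm w -> (forall a, bpos a <-> bpos (nact w a)) -> conj w y = y].
Proof.
have [y [hy hp hw]] := positive_ex borelB; have [z hz rz] := regular_intg_ex D.
have [y' [hy' ry' h1 _]] := perturb hy hz rz.
have hp' a : bpos a -> kpos (ev a y') by move=> ha; apply: h1; [case: ha|exact: hp].
have bP := bposP _ hy' ry' hp'.
have ry : regular y.
  move=> a ra; case: (regular_cases ra hy' ry') => ka.
    by apply: (kpos_neq0 D); apply: hp; apply/bP.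
  rewrite -oppr_eq0 -evN; apply: (kpos_neq0 D); apply: hp; apply/bP; split=> //.
  exact: rootN.
by exists y; split=> //; [move=> a; exact: bposP|exact: borel_Bgr].
Qed.

Lemma bpos_total a : root a -> bpos a \/ bpos (- a).
Proof.
move=> ra; have [y [hy ry bP _ _]] := borel_grading.
case: (regular_cases ra hy ry) => ka; [left|right]; apply/bP; split=> //; exact: rootN.
Qed.

Lemma bpos_nact_iff w : norm w -> (forall a, bpos a -> bpos (nact w a)) ->
  forall a, bpos a <-> bpos (nact w a).
Proof.
move=> hw h a; split=> [/h//|ha]; have ra : root a.
  by rewrite -(nactK a hw); apply: root_nact (norm_inv hw) _; case: ha.
by case: (bpos_total ra) => // /h; rewrite nactN => /bposN; rewrite opprK.
Qed.

(** The Weyl group acts freely on the positive systems: w fixes the canonical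
    regular element y. *)
Lemma norm_pos_T w : norm w -> (forall a, bpos a -> bpos (nact w a)) -> T w.
Proof.
move=> hw h; have [y [hy ry _ _ yw]] := borel_grading.
apply: (regular_centraliser hy ry); first by case: hw.
by apply: yw => //; exact: bpos_nact_iff.
Qed.

Lemma nact_id_T w : norm w -> (forall a, root a -> nact w a = a) -> T w.
Proof. by move=> hw h; apply: norm_pos_T => // a ha; rewrite h //; case: ha. Qed.

Definition bsimple a := bpos a /\ ~ exists b c, [/\ bpos b, bpos c & a = b + c].

Definition refl a b : cartan_dual T := b - ev b (cr a) *: a.
Lemma reflE a e f b : triple a e f -> nact (nrefl e f) b = refl a b.
Proof. by move=> tr; rewrite (nact_nrefl b tr). Qed.
Lemma refl_self a : root a -> refl a a = - a.
Proof. by move=> ra; rewrite /refl ev_cr // -[2]/(2%:R) scale_natr_w mulr2n opprD addrA subrr add0r. Qed.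
Lemma reflK a b : root a -> refl a (refl a b) = b.
Proof.
move=> ra; have [e [f tr]] := triple_ex ra; rewrite /refl evB evZ ev_cr //.
by rewrite mulr_natr mulr2n opprD addrA subrr add0r scaleNr opprK subrK.
Qed.

(** The a-string from b to its reflection consists of roots; the first negative
    one would exhibit a as a sum of positive roots. *)
Lemma refl_bpos a b : bsimple a -> bpos b -> b != a -> bpos (refl a b).
Proof.
move=> [ha nd] hb ba; have [[ra _] [rb _]] := (ha, hb).
have [z ez] := ev_int rb (cr_intg ra); rewrite /refl.
case: z ez => m ez.
  have em : ev b (cr a) = m%:R by [].
  rewrite em scale_natr_w; suff h i : (i <= m)%N -> bpos (b - a *+ i) by exact: h.
  elim: i => [|i IHi] im; first by rewrite subr0.
  have hi : bpos (b - a *+ i) by apply: IHi; lia.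
  have ri : root (b - a *+ i.+1) by exact: string_root ra rb ba em im.
  case: (bpos_total ri) => // hN; case: nd; exists (b - a *+ i), (- (b - a *+ i.+1)); split=> //.
  by rewrite opprB addrC addrA subrK mulrS addrK.
have em : ev b (cr a) = - m.+1%:R by rewrite ez NegzE rmorphN.
rewrite em scaleNr opprK scale_natr_w.
exact: (bpos_string borelB ha hb em (leqnn _)).
Qed.

(** If a = b + c is a sum of positive roots, then w makes b or c negative; these
    are lower for the grading by y. *)
Lemma simple_neg w a : norm w -> bpos a -> bpos (- nact w a) ->
  exists2 c, bsimple c & bpos (- nact w c).
Proof.
move=> hw ha hN; have [y [hy ry bP _ _]] := borel_grading.
have [m em] : exists m : nat, ev a y = m.+1%:R by case/bP: ha.
elim/ltn_ind: m a em ha hN => m IHm a em ha hN.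
case: (pselect (exists b c, [/\ bpos b, bpos c & a = b + c])) => [[b [c [hb hc e]]]|nd]; last by exists a.
have [[p ep] [q eq]] : kpos (ev b y) /\ kpos (ev c y) by case/bP: hb => _ ?; case/bP: hc.
have pq : m = (p + q).+1.
  apply: succn_inj; apply: (natr_inj0 char0); rewrite -em e evD ep eq -natrD.
  by congr (_%:R); lia.
have rb : root (nact w b) by apply: root_nact => //; case: hb.
have rc : root (nact w c) by apply: root_nact => //; case: hc.
case: (bpos_total rb) => hb'; last by apply: (IHm p _ b ep hb hb'); lia.
case: (bpos_total rc) => hc'; last by apply: (IHm q _ c eq hc hc'); lia.
have hs : bpos (nact w a).
  by rewrite e nactD; apply: bpos_add => //; rewrite -nactD -e; apply: root_nact => //; case: ha.
by case: (bposN hs).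
Qed.

Definition inversions w := [seq b <- Bposs | bposb (- nact w b)].
Lemma mem_inversions w b : b \in inversions w <-> bpos b /\ bpos (- nact w b).
Proof.
rewrite mem_filter mem_Bposs; split=> [/andP[/asboolP h1 /asboolP h2]|[h1 h2]] //.
by apply/andP; split; apply/asboolP.
Qed.

(** The simple reflection in a permutes the positive roots other than a. *)
Lemma inversions_refl w a e f : norm w -> bsimple a -> triple a e f -> bpos (- nact w a) ->
  (size (inversions (w *m nrefl e f)) < size (inversions w))%N.
Proof.
move=> hw sa tr hN; have [ha _] := sa; have [ra _] := ha.
have hr := nrefl_norm tr; have hE b : nact (w *m nrefl e f) b = nact w (refl a b).
  by rewrite nact_mul // (reflE b tr).
have ne b : b \in inversions (w *m nrefl e f) -> b != a.
  move=> /mem_inversions[_]; rewrite hE => h; apply/negP => /eqP eb; move: h.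
  by rewrite eb refl_self // nactN opprK => /bposN.
have u : uniq (a :: map (refl a) (inversions (w *m nrefl e f))).
  rewrite /=; apply/andP; split; last first.
    rewrite map_inj_in_uniq; first by rewrite filter_uniq // filter_uniq // wts_uniq.
    by move=> b c _ _ /(congr1 (refl a)); rewrite !reflK.
  apply/mapP => -[b /mem_inversions[hb _] /(congr1 (refl a))]; rewrite reflK // refl_self // => eb.
  by move: hb; rewrite -eb; exact: bposN.
rewrite -[X in (X < _)%N](size_map (refl a)); apply: (uniq_leq_size u) => b.
rewrite inE => /orP[/eqP->|/mapP[c hc ->]]; apply/mem_inversions; first by [].
have ca := ne c hc; move/mem_inversions: hc => [hc]; rewrite hE => hc'.
by split=> //; exact: refl_bpos.
Qed.

(** Induction on the number of inversions: an element without inversions lies in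
    T. *)
Lemma weyl_ind (Q : M -> Prop) : (forall s, T s -> Q s) ->
  (forall w a e f, norm w -> bsimple a -> triple a e f -> bpos (- nact w a) ->
    Q (w *m nrefl e f) -> Q w) ->
  forall w, norm w -> Q w.
Proof.
move=> QT QS w hw; have [m le] := ubnP (size (inversions w)).
elim: m w hw le => // m IHm w hw le.
case: (pselect (exists2 a, bpos a & bpos (- nact w a))) => [[a ha hN]|no].
  have [c sc cN] := simple_neg hw ha hN; have [[rc _] _] := sc.
  have [e [f tr]] := triple_ex rc; apply: (QS w c e f) => //.
  apply: IHm; first by apply: norm_mul => //; exact: nrefl_norm tr.
  by have := inversions_refl hw sc tr cN; move: le; rewrite ltnS; lia.
apply: QT; apply: norm_pos_T => // a ha.
have ra : root (nact w a) by apply: root_nact => //; case: ha.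
by case: (bpos_total ra) => // hN; case: no; exists a.
Qed.

End Positive.

(** * The Killing form *)

Section Killing.
Variables (k : closedFieldType) (n : nat).
Local Notation M := 'M[k]_n.
Implicit Types (x y z u v w tau : M).
Variable D : tordata k n.
Local Notation G := (tG D).
Local Notation T := (tT D).
Local Notation g := (Lie G).
Local Notation t := (Lie T).
Local Notation char0 := (tchar0 D).
Local Notation sG := (tas D).
Local Notation ev := (@ev k n D).
Local Notation pr := (@pr k n D).
Local Notation wts := (wts D).
Local Notation root := (@root k n D).
Local Notation cr := (@cr k n D).
Local Notation triple := (@triple k n D).
Local Notation dg := (dg D).

Local Notation X := (vbasis g).
Definition trg (f : M -> M) : k := \sum_(i < \dim g) coord X i (f X`_i).
Definition mxg (f : M -> M) : 'M[k]_(\dim g) := \matrix_(i, j) coord X j (f X`_i).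

Lemma trgE f : trg f = \tr (mxg f).
Proof. by apply: eq_bigr => i _; rewrite mxE. Qed.
Lemma killingE x y : killing G x y = trg (fun z => lie x (lie y z)).
Proof. by []. Qed.

Lemma vbasis_in (i : 'I_(\dim g)) : X`_i \in g.
Proof. by apply: vbasis_mem; rewrite mem_nth // size_tuple. Qed.

Lemma coord_sum w : w \in g -> w = \sum_(i < \dim g) coord X i w *: X`_i.
Proof. exact: coord_vbasis. Qed.

Lemma eq_trg f h : (forall x, x \in g -> f x = h x) -> trg f = trg h.
Proof. by move=> e; apply: eq_bigr => i _; rewrite e // vbasis_in. Qed.

Lemma mxg_mul f h : linear f -> (forall x, x \in g -> h x \in g) ->
  mxg (fun x => f (h x)) = mxg h *m mxg f.
Proof.
move=> lf kh; apply/matrixP => i j; rewrite !mxE.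
pose fl := GRing.isLinear.Build k M M _ f lf; pose F : {linear M -> M} := HB.pack f fl.
rewrite [h X`_i]coord_sum ?kh ?vbasis_in // -[f]/(F : M -> M) !linear_sum.
by apply: eq_bigr => l _; rewrite !linearZ /= !mxE.
Qed.

Lemma trgC f h : linear f -> linear h -> (forall x, x \in g -> f x \in g) ->
  (forall x, x \in g -> h x \in g) -> trg (fun x => f (h x)) = trg (fun x => h (f x)).
Proof. by move=> lf lh kf kh; rewrite !trgE (mxg_mul lf kh) (mxg_mul lh kf) mxtrace_mulC. Qed.

Lemma trgB f h : trg (fun x => f x - h x) = trg f - trg h.
Proof. by rewrite /trg -sumrB; apply: eq_bigr => i _; rewrite linearB. Qed.
Lemma trgZ c f : trg (fun x => c *: f x) = c * trg f.
Proof. by rewrite /trg mulr_sumr; apply: eq_bigr => i _; rewrite linearZ. Qed.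
Lemma trgD f h : trg (fun x => f x + h x) = trg f + trg h.
Proof. by rewrite /trg -big_split; apply: eq_bigr => i _; rewrite linearD. Qed.
Lemma trg_sum I (r : seq I) (F : I -> M -> M) :
  trg (fun x => \sum_(i <- r) F i x) = \sum_(i <- r) trg (F i).
Proof.
elim: r => [|i r IHr].
  by rewrite big_nil /trg big1 // => i _; rewrite big_nil linear0.
rewrite big_cons -IHr -trgD; apply: eq_trg => x _; exact: big_cons.
Qed.

Let lin_lie x : linear (lie x). Proof. exact: linearP. Qed.

Lemma killing_sym x y : x \in g -> y \in g -> killing G x y = killing G y x.
Proof. by move=> xg yg; apply: (@trgC (lie x) (lie y)) => // z; exact: (lie_in sG). Qed.

Lemma killing_lie x y z : x \in g -> y \in g -> z \in g ->
  killing G (lie x y) z = killing G x (lie y z).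
Proof.
move=> xg yg zg; rewrite !killingE.
have jac u v w : lie (lie u v) w = lie u (lie v w) - lie v (lie u w).
  by rewrite [lie u (lie v w)]jacobi addrK.
rewrite (eq_trg (h := fun w => lie x (lie y (lie z w)) - lie y (lie x (lie z w)))); last first.
  by move=> w _; rewrite jac.
rewrite [RHS](eq_trg (h := fun w => lie x (lie y (lie z w)) - lie x (lie z (lie y w)))); last first.
  by move=> w _; rewrite jac linearB.
rewrite (trgB (fun w => lie x (lie y (lie z w)))) (trgB (fun w => lie x (lie y (lie z w)))).
congr (_ - _).
apply: (@trgC (lie y) (fun w => lie x (lie z w))) => //.
- by move=> c u v; rewrite !linearP.
- by move=> w; exact: (lie_in sG).
- by move=> w wg; apply: (lie_in sG) => //; exact: (lie_in sG).
Qed.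

Lemma killingZl c x y : killing G (c *: x) y = c * killing G x y.
Proof. by rewrite !killingE -trgZ; apply: eq_trg => z _; rewrite lieZl. Qed.
Lemma killingZr c x y : killing G x (c *: y) = c * killing G x y.
Proof. by rewrite !killingE -trgZ; apply: eq_trg => z _; rewrite lieZl linearZ. Qed.
Lemma killingDl x x' y : killing G (x + x') y = killing G x y + killing G x' y.
Proof. by rewrite !killingE -trgD; apply: eq_trg => z _; rewrite lieDl. Qed.
Lemma killingDr x y y' : killing G x (y + y') = killing G x y + killing G x y'.
Proof. by rewrite !killingE -trgD; apply: eq_trg => z _; rewrite lieDl linearD. Qed.

Lemma killing_cr a e f tau : triple a e f -> tau \in t ->
  killing G tau (cr a) = ev a tau * killing G e f.
Proof.
move=> [ra he hf <-] ht; have tg := gsp_in (gsp_t ht).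
by rewrite -killing_lie // ?(gsp_in he) ?(gsp_in hf) // (gsp_lie he ht) killingZl.
Qed.

(** On a coroot the Killing form is a sum of squares of integers, weighted by
    the dimensions of the root spaces. *)
Lemma killing_cr_neq0 b : root b -> killing G (cr b) (cr b) != 0.
Proof.
move=> rb; have hc := cr_intg rb; have ht := cr_t rb.
pose z i j : int := dg (cr b) i - dg (cr b) j.
have [|zz hz] := @choice _ _ (fun a (m : int) => a \in wts -> ev a (cr b) = m%:~R).
  move=> a; case: (boolP (a \in wts)) => [|_]; last by exists 0.
  rewrite mem_undup => /mapP[[i j] _ ->] /=.
  by exists (z i j) => _; rewrite (ev_wt_dg hc).
have idem a : exists m : nat, trg (pr a) = m%:R /\ (m = 0%N -> forall x, x \in g -> pr a x = 0).
  have kp x : x \in g -> pr a x \in g by move=> xg; exact: gsp_in (pr_gsp a xg).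
  have lp : linear (pr a) by exact: linearP.
  exists (\rank (mxg (pr a))); split.
    rewrite trgE; apply: mxtrace_idem; rewrite -mxg_mul //; apply/matrixP => i j.
    by rewrite !mxE pr_pr eqxx.
  move/eqP; rewrite mxrank_eq0 => /eqP m0 x xg; rewrite (coord_sum (kp x xg)).
  rewrite big1 // => j _; rewrite {1}(coord_sum xg) linear_sum linear_sum /= big1 ?scale0r // => i _.
  by rewrite !linearZ /=; move/matrixP/(_ i j): m0; rewrite !mxE => ->; rewrite mulr0.
have [|m hm] := @choice _ _ (fun a (m : nat) => trg (pr a) = m%:R /\ (m = 0%N -> forall x, x \in g -> pr a x = 0)).
  exact: idem.
have -> : killing G (cr b) (cr b) = (\sum_(a <- wts) zz a * zz a * (m a)%:Z)%:~R.
  rewrite killingE (eq_trg (h := fun x => \sum_(a <- wts) (ev a (cr b) * ev a (cr b)) *: pr a x)); last first.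
    move=> x xg; rewrite -{1}(sum_pr D x) !linear_sum; apply: eq_bigr => a _ /=.
    by rewrite !lie_pr // linearZ /= lie_pr // scalerA.
  rewrite trg_sum rmorph_sum; apply: eq_big_seq => a aw /=.
  by rewrite trgZ (hm a).1 hz // !rmorphM.
rewrite (char0_intr_eq0 char0); apply/negP => /eqP s0.
have h0 a : a \in wts -> 0 <= zz a * zz a * (m a)%:Z by move=> _; rewrite mulr_ge0 // -expr2 sqr_ge0.
have bw := root_wts rb; move: s0; rewrite (bigD1_seq b) ?wts_uniq //= => /eqP.
rewrite paddr_eq0; [|exact: h0|by rewrite big_seq_cond sumr_ge0 // => a /andP[/h0]].
case/andP => /eqP e _; have z2 : zz b = 2.
  by apply: (intr_inj0 D); rewrite -hz // ev_cr.
move: e; rewrite z2 => e; have m0 : m b = 0%N by lia.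
have [_ [x x0 hx]] := rb; case/eqP: x0.
by rewrite -(gsp_pr hx) (hm b).2 // (gsp_in hx).
Qed.

Lemma killing_cr_ex a : root a -> exists2 c, c != 0 &
  forall tau, tau \in t -> killing G tau (cr a) = c * ev a tau.
Proof.
move=> ra; have [e [f tr]] := triple_ex ra; exists (killing G e f).
  have := killing_cr_neq0 ra; rewrite (killing_cr tr (cr_t ra)) mulf_eq0 negb_or.
  by case/andP.
by move=> tau ht; rewrite (killing_cr tr ht) mulrC.
Qed.

Lemma killing_nondeg tau : tau \in t -> (forall tau', tau' \in t -> killing G tau tau' = 0) -> tau = 0.
Proof.
move=> ht h; apply: (@t_roots _ _ D) => // a ra; have [c c0 e] := killing_cr_ex ra.
by apply: (mulfI c0); rewrite -e // h ?cr_t // mulr0.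
Qed.

Lemma killing_dualP (la : cartan_dual T) tau : tau \in t ->
  killing G (vsval (killing_dual G la)) tau = ev la tau.
Proof.
have [v vt hv] : exists2 v, v \in t & forall w, w \in t -> killing G v w = ev la w.
  apply: (riesz (b := killing G)).
  - by move=> w c u v; rewrite killingDl killingZl.
  - by move=> w c u v; rewrite killingDr killingZr.
  - exact: killing_nondeg.
  - exact: ev_scalar.
move=> ht; rewrite /killing_dual; case: xgetP => [h _ hh|/(_ (vsproj t v))[]].
  by rewrite -[tau](vsprojK ht) hh -evE.
by move=> h' /=; rewrite vsprojK // hv ?subvsP // evE.
Qed.

Lemma dual_formE (la a : cartan_dual T) c : root a -> c != 0 ->
  (forall tau, tau \in t -> killing G tau (cr a) = c * ev a tau) ->
  dual_form G la a = c^-1 * ev la (cr a).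
Proof.
move=> ra c0 hc; rewrite /dual_form -killing_dualP ?cr_t //.
have kt (mu : cartan_dual T) : vsval (killing_dual G mu) \in t by exact: subvsP.
have -> : vsval (killing_dual G a) = c^-1 *: cr a.
  apply/subr0_eq/killing_nondeg => [|tau ht]; first by apply: memvB => //; exact/memvZ/cr_t.
  rewrite killingDl killing_dualP // -scaleN1r !killingZl killing_sym ?hc //.
  - by rewrite mulKf // mulN1r subrr.
  - exact: gsp_in (gsp_t (cr_t ra)).
  - exact: gsp_in (gsp_t ht).
by rewrite killingZr.
Qed.

Lemma dual_form_eq0 (la a : cartan_dual T) : root a -> dual_form G la a = 0 <-> ev la (cr a) = 0.
Proof.
move=> ra; have [c c0 hc] := killing_cr_ex ra; rewrite (dual_formE la ra c0 hc); split.
  by move/eqP; rewrite mulf_eq0 invr_eq0 (negPf c0) => /eqP.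
by move=> ->; rewrite mulr0.
Qed.

(** The Cartan integers do not depend on the invariant form. *)
Lemma dual_form_cartan (la a : cartan_dual T) : root a ->
  2 * dual_form G la a / dual_form G a a = ev la (cr a).
Proof.
move=> ra; have [c c0 hc] := killing_cr_ex ra; rewrite !(dual_formE _ ra c0 hc) ev_cr //.
have n2 : c^-1 * 2 != 0 by rewrite mulf_neq0 ?invr_eq0 // (char0_natf_eq0 char0).
by apply: (canLR (mulfK n2)); rewrite mulrA mulrC [2 * _]mulrC.
Qed.

End Killing.

(** * Root spaces, words and lengths *)

Section RootSpaces.
Variables (k : closedFieldType) (n : nat).
Local Notation M := 'M[k]_n.
Implicit Types (x y z u v w tau : M).
Variable D : tordata k n.
Local Notation G := (tG D).
Local Notation T := (tT D).
Local Notation g0 := (tg0 D).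
Local Notation hat := (conj g0).
Local Notation t := (Lie T).
Local Notation ug0 := (tunit D).
Local Notation dT := (@tdiag k n D).
Local Notation hatP := (@hatP k n D).
Local Notation gsp := (@gsp k n D).
Local Notation ev := (@ev k n D).
Local Notation root := (@root k n D).
Local Notation triple := (@triple k n D).
Local Notation norm := (normalizer G T).

Let A := {mpoly k[n * n]}.
Definition hatp (i : 'I_n) : A := lform (fun x => hat x i i).
Let hat_scalar i : scalar (fun x => hat x i i).
Proof. by move=> c u v; rewrite hatD hatZ. Qed.
Lemma mxeval_hatp i x : mxeval (hatp i) x = hat x i i.
Proof. by rewrite /hatp lformE. Qed.
Lemma dd_hatp i x : dd (hatp i) 1%:M x = hat x i i.
Proof. by rewrite /hatp dd_lform. Qed.
Lemma hat1 i : hat 1%:M i i = 1.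
Proof. by rewrite conj_id // mxE eqxx. Qed.

Lemma prod_hatp (r : seq 'I_n) x : mxeval (\prod_(l <- r) hatp l) x = \prod_(l <- r) hat x l l.
Proof.
elim: r => [|l r IHr]; first by rewrite !big_nil -[1]mpolyC1 mxevalC.
by rewrite !big_cons mxevalM mxeval_hatp IHr.
Qed.
Lemma dd_prod_hatp (r : seq 'I_n) x : dd (\prod_(l <- r) hatp l) 1%:M x = \sum_(l <- r) hat x l l.
Proof.
elim: r => [|l r IHr]; first by rewrite !big_nil -[1]mpolyC1 ddC_fun.
rewrite !big_cons ddM_fun dd_hatp IHr mxeval_hatp prod_hatp hat1 big1 ?mulr1 ?mul1r // => i _.
exact: hat1.
Qed.
Lemma mxeval_exp f m x : mxeval (f ^+ m) x = mxeval f x ^+ m.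
Proof. by elim: m => [|m IHm]; rewrite ?expr0 -?[1]mpolyC1 ?mxevalC // !exprS mxevalM IHm. Qed.
Lemma dd_exp f m x : mxeval f 1%:M = 1 -> dd (f ^+ m) 1%:M x = m%:R * dd f 1%:M x.
Proof.
move=> f1; elim: m => [|m IHm]; first by rewrite expr0 -mpolyC1 ddC_fun mul0r.
by rewrite exprS ddM_fun IHm f1 mxeval_exp f1 expr1n mulr1 mul1r -[m.+1%:R]natr1 mulrDl mul1r addrC.
Qed.
Lemma detp_T s : T s -> \det s = mxeval (\prod_l hatp l) s.
Proof.
move=> Ts; rewrite prod_hatp -det_trig; last exact: is_diag_mx_is_trig (dT Ts).
have d0 : \det g0 != 0 by rewrite -unitfE -unitmxE ug0.
by rewrite /conj !det_mulmx det_inv mulrAC mulfV // mul1r.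
Qed.
Lemma tr_hat x : \tr x = \sum_l hat x l l.
Proof. by rewrite -(mxtrace_conj x ug0). Qed.

Lemma hat_conjT s x i j c : T s -> conj s x = c *: x -> hat s i i * hat x i j = c * hat x i j * hat s j j.
Proof.
move=> Ts e; have us := mT_unit Ts; have ds := dT Ts.
have e1 : s *m x = c *: x *m s by rewrite -e /conj mulmxKV.
have := congr1 (fun x => hat x i j) e1; rewrite !conjM // (diag_mulmx _ _ _ ds) (mulmx_diag _ _ _ ds).
by rewrite hatZ.
Qed.

Lemma hatT_neq0 s i : T s -> hat s i i != 0.
Proof.
move=> Ts; have us := mT_unit Ts; have := hat_mul_diag (invmx s) i (dT Ts).
rewrite mulmxV // hat1 => /esym e; apply: contra_eq_neq e => ->; by rewrite mul0r eq_sym oner_eq0.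
Qed.

(** Differentiating the character at the identity gives back the weight. *)
Lemma root_space_gsp (al : cartan_dual T) x : root_space G al x -> gsp al x.
Proof.
move=> [xg [chi [[_ chi0 chiM] [f [m [rep dal]]] hx]]].
split=> // tau ht; apply: hatP; apply/matrixP => i j; rewrite hat_lie ?diag_lie // hatZ.
have [->|nz] := eqVneq (hat x i j) 0; first by rewrite !mulr0.
congr (_ * _); pose p : A := \prod_l hatp l.
have chi1 : chi 1%:M = 1.
  have T1 := mT1 D; have := chiM _ _ T1 T1; rewrite mulmx1 => /esym/eqP.
  by rewrite -subr_eq0 -{3}[chi _]mulr1 -mulrBr mulf_eq0 (negPf (chi0 _ T1)) /= subr_eq0 => /eqP.
have F0 : vanishes_on T (hatp i * p ^+ m - hatp j * f).
  move=> s Ts; rewrite mxevalB !mxevalM !mxeval_hatp mxeval_exp -detp_T // -(rep _ Ts).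
  have := hat_conjT i j Ts (hx _ Ts); rewrite mulrAC => /(mulIf nz) ->.
  by rewrite mulrA [chi s * _]mulrC subrr.
have p1 : mxeval p 1%:M = 1 by rewrite prod_hatp big1 // => l _; exact: hat1.
have f1 : mxeval f 1%:M = 1 by rewrite -(rep _ (mT1 D)) chi1 det1 expr1n mulr1.
have /LieP/(_ _ F0) := ht; rewrite /dpoly1 -/(dd _ _ _) => e.
have dE : dd f 1%:M tau = dpoly1 f tau by [].
have e2 : hat tau i i + m%:R * \tr tau - (hat tau j j + dd f 1%:M tau) = 0.
  rewrite -[RHS]e -[hatp i * _ - _]/(hatp i * p ^+ m + - (hatp j * f)) ddD_fun.
  rewrite -scaleN1r -mul_mpolyC !ddM_fun ddC_fun mxevalC !dd_hatp !mxeval_hatp !hat1 mxeval_exp p1 f1.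
  by rewrite expr1n dd_exp // dd_prod_hatp -tr_hat !mulr1 !mul1r mul0r add0r mulN1r.
rewrite /ev dal vsprojK // -dE; apply/eqP; rewrite -subr_eq0 -[X in _ == X]e2; apply/eqP.
rewrite !opprD opprK !addrA; rewrite -[_ - dd _ _ _ + _]addrA [- dd _ _ _ + _]addrC !addrA.
by rewrite [_ - hat tau j j + _]addrAC.
Qed.

(** T acts on the line of a root vector through the ratio of two diagonal
    entries. *)
Lemma gsp_root_space (al : cartan_dual T) x : root al -> gsp al x -> root_space G al x.
Proof.
move=> ral hx; have [_ [x0 nz0 hx0]] := ral.
have [i [j nz]] : exists i j, hat x0 i j != 0.
  apply: contrapT => h; case/eqP: nz0; apply: hatP; apply/matrixP => i j; rewrite hat0.
  by apply/eqP/negPn/negP => nz; apply: h; exists i, j.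
have aE tau : tau \in t -> ev al tau = hat tau i i - hat tau j j.
  move=> ht; have := hat_lie x0 i j (diag_lie ht); rewrite (gsp_lie hx0 ht) hatZ.
  by move/(mulIf nz).
split; first exact: gsp_in hx.
exists (fun s => hat s i i / hat s j j); split.
- split=> [|s Ts|s s' Ts Ts'].
  + exists (hatp i * \prod_(l <- rem j (index_enum _)) hatp l), 1%N => s Ts.
    rewrite mxevalM mxeval_hatp expr1 detp_T // (big_rem j) ?mem_index_enum //= mxevalM mxeval_hatp.
    by rewrite mulrA mulfVK // hatT_neq0.
  + by rewrite mulf_neq0 ?invr_eq0 ?hatT_neq0.
  + by rewrite !hat_mul_diag ?dT // invfM mulrACA.
- exists (hatp i * \prod_(l <- rem j (index_enum _)) hatp l), 1%N; split.
    move=> s Ts.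
    rewrite mxevalM mxeval_hatp expr1 detp_T // (big_rem j) ?mem_index_enum //= mxevalM mxeval_hatp.
    by rewrite mulrA mulfVK // hatT_neq0.
  move=> h; rewrite -evE aE ?subvsP // /dpoly1 -/(dd _ _ _) ddM_fun dd_hatp mxeval_hatp hat1 dd_prod_hatp.
  rewrite prod_hatp big1 ?mulr1 => [|l _]; last exact: hat1.
  rewrite !mul1r tr_hat [in RHS](big_rem (r := index_enum _) j) ?mem_index_enum //=.
  by rewrite opprD addrACA subrr addr0.
- move=> s Ts; have hs := gsp_nact (norm_T Ts) hx; rewrite nact_T // in hs.
  have hs0 := gsp_nact (norm_T Ts) hx0; rewrite nact_T // in hs0.
  have [c ec] := dim1 ral hx0 nz0 hs0.
  have cE : c = hat s i i / hat s j j.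
    have := hat_conjT i j Ts ec; rewrite mulrAC => /(mulIf nz) ->.
    by rewrite mulfK // hatT_neq0.
  have [b ->] := dim1 ral hx0 nz0 hx; by rewrite linearZ /= ec cE !scalerA mulrC.
Qed.

Lemma is_rootP (al : cartan_dual T) : is_root G al <-> root al.
Proof.
split=> [[a0 [x x0 /root_space_gsp hx]]|ra]; first by split=> //; exists x.
by have [a0 [x x0 hx]] := ra; split=> //; exists x => //; exact: gsp_root_space.
Qed.

Variable B : set M.
Hypotheses (borelB : borel G B) (sTB : T `<=` B).
Local Notation bpos := (@bpos k n D B).
Local Notation bsimple := (@bsimple k n D B).
Local Notation bposN := (bposN borelB).

Lemma positive_rootP (al : cartan_dual T) : positive_root G B al <-> bpos al.
Proof.
split=> -[].
  by move=> /is_rootP ra h; split=> // x hx; apply: h; exact: gsp_root_space.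
move=> ra h; split; first exact/is_rootP.
by move=> x /root_space_gsp; exact: h.
Qed.

Lemma simple_rootP (al : cartan_dual T) : simple_root G B al <-> bsimple al.
Proof.
split=> -[h1 h2].
  split; first exact/positive_rootP.
  move=> [b [c [hb hc e]]]; apply: h2; exists b, c; split=> //; exact/positive_rootP.
split; first exact/positive_rootP.
by move=> [b [c [/positive_rootP hb /positive_rootP hc e]]]; apply: h2; exists b, c.
Qed.

Lemma coset_eq w w' : norm w -> norm w' -> coset T w = coset T w' <-> T (invmx w *m w').
Proof.
move=> hw hw'; have [uw uw'] := (norm_unit hw, norm_unit hw'); split=> [e|Tw].
  have : coset T w' w' by exists 1%:M; rewrite ?mulmx1 //; exact: mT1.
  by rewrite -e => -[s Ts <-]; rewrite mulKmx.
have eq : w' = w *m (invmx w *m w') by rewrite mulKVmx.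
apply/seteqP; split=> [_ [s Ts <-]|_ [s Ts <-]].
  exists (invmx (invmx w *m w') *m s); first by apply: mT_mul => //; exact: mT_inv.
  by rewrite mulmxA {1}eq mulmxK // (mT_unit Tw).
by exists (invmx w *m w' *m s); [exact: mT_mul|rewrite !mulmxA mulmxV // mul1mx].
Qed.

Lemma coset_mul w w' : norm w' -> setmulmx (coset T w) (coset T w') = coset T (w *m w').
Proof.
move=> hw'; have uw' := norm_unit hw'; apply/seteqP; split.
  move=> _ [_ [_ [[s Ts <-] [s' Ts' <-] ->]]].
  exists (conj (invmx w') s *m s').
    by apply: mT_mul => //; exact: ((norm_inv hw').2 s).1.
  by rewrite /conj invmxK !mulmxA mulmxK.
move=> _ [s Ts <-]; exists w, (w' *m s); split; last by rewrite mulmxA.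
  by exists 1%:M; rewrite ?mulmx1 //; exact: mT1.
by exists s.
Qed.

Lemma simple_reflectionP s : simple_reflection G B T s <->
  exists a e f, [/\ bsimple a, triple a e f & s = coset T (nrefl e f)].
Proof.
split=> [[a [w [/simple_rootP sa hw -> act]]]|[a [e [f [sa tr ->]]]]].
  have [[ra _] _] := sa; have [e [f tr]] := triple_ex ra; exists a, e, f; split=> //.
  have hr := nrefl_norm tr; have hrV := norm_inv hr; apply/esym/coset_eq => //.
  apply: (nact_id_T borelB sTB) => [|b rb]; first exact: norm_mul.
  rewrite nact_mul // -[RHS](nactK b hr) (reflE b tr); congr nact.
  apply: ev_eq => tau ht; rewrite nactE //.
  have ht' : conj (invmx w) tau \in t by exact: norm_t (norm_inv hw) ht.
  rewrite -(vsprojK ht') evE (act b (vsproj t tau)) ?vsprojK // dual_form_cartan //.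
  by rewrite -!evE vsprojK // /refl evB evZ.
have [[ra _] _] := sa.
exists a, (nrefl e f); split=> //; [exact/simple_rootP|exact: nrefl_norm tr|].
move=> la h h' e'; rewrite -[la h']evE e' (conj_nreflV tr) ?subvsP //.
by rewrite linearB linearZ /= dual_form_cartan // !evE mulrC.
Qed.

Lemma has_word_norm m (w : set M) : has_word G B T m w -> exists2 x, norm x & w = coset T x.
Proof.
elim=> [|m' s w' /simple_reflectionP[a [e [f [sa tr ->]]]] _ [x hx ->]].
  exists 1%:M; first exact: norm1.
  apply/seteqP; split=> [s Ts|_ [s Ts <-]]; last by rewrite mul1mx.
  by exists s => //; rewrite mul1mx.
by exists (nrefl e f *m x); [exact: norm_mul (nrefl_norm tr) hx|rewrite coset_mul].
Qed.

Lemma coset_T s : T s -> coset T s = T.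
Proof.
move=> Ts; apply/seteqP; split=> [_ [s' Ts' <-]|s' Ts']; first exact: mT_mul.
exists (invmx s *m s'); first by apply: mT_mul => //; exact: mT_inv.
by rewrite mulKVmx // (mT_unit Ts).
Qed.

Lemma has_word_ex w : norm w -> exists m, has_word G B T m (coset T w).
Proof.
move=> hw; suff h x : norm x -> exists m, has_word G B T m (coset T (invmx x)).
  by have := h _ (norm_inv hw); rewrite invmxK.
move: x; apply: (weyl_ind borelB sTB) => [s Ts|x a e f hx sa tr _ [m hm]].
  by exists 0%N; rewrite coset_T; [exact: has_word0|exact: mT_inv].
exists m.+1; have hr := nrefl_norm tr; have [ux ur] := (norm_unit hx, norm_unit hr).
have -> : coset T (invmx x) = setmulmx (coset T (nrefl e f)) (coset T (invmx (x *m nrefl e f))).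
  rewrite coset_mul; last by apply: norm_inv; exact: norm_mul.
  by rewrite invmxM // mulKVmx.
by apply: has_wordS => //; apply/simple_reflectionP; exists a, e, f.
Qed.

(** Along a word for x there is a first place, from the right, where the image
    of a becomes negative; there the image is the simple root of the letter,
    which can be deleted. *)
Lemma deletion m x a e f : has_word G B T m (coset T x) -> norm x -> bpos a -> triple a e f ->
  bpos (- nact x a) -> exists2 m', (m' < m)%N & has_word G B T m' (coset T (x *m nrefl e f)).
Proof.
move=> hm hx ha tr; have hr := nrefl_norm tr; move Ew : (coset T x) hm => w hm.
elim: hm x Ew hx => [|p s w' hs hp IHp] x Ew hx hN.
  have Tx : T x by rewrite -Ew; exists 1%:M; rewrite ?mulmx1 //; exact: mT1.
  by move: hN; rewrite nact_T // => /(bposN ha).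
have [a' [e' [f' [sa' tr' es]]]] := (simple_reflectionP s).1 hs.
have hr' := nrefl_norm tr'; have [x' hx' ew'] := has_word_norm hp.
have [ra _] := ha; have [ha' _] := sa'; have [ra' _] := ha'.
have Tx : T (invmx (nrefl e' f' *m x') *m x).
  by apply/coset_eq => //; [exact: norm_mul|rewrite Ew es ew' coset_mul].
have [u1 u2 u3 ux] := And4 (norm_unit hr') (norm_unit hx') (norm_unit hr) (norm_unit hx).
have u12 : nrefl e' f' *m x' \in unitmx by rewrite unitmx_mul u1.
have xE : x = nrefl e' f' *m x' *m (invmx (nrefl e' f' *m x') *m x) by rewrite mulKVmx.
have nE b : nact x b = refl a' (nact x' b).
  rewrite xE (nact_mul _ (norm_mul hr' hx') (norm_T Tx)) (nact_T _ Tx).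
  by rewrite nact_mul // (reflE _ tr').
have cE y : norm y -> coset T (x *m y) = coset T (nrefl e' f' *m x' *m y).
  move=> hy; have uy := norm_unit hy.
  apply/esym/coset_eq; [exact: norm_mul (norm_mul _ _) _|exact: norm_mul|].
  rewrite (_ : invmx (nrefl e' f' *m x' *m y) *m (x *m y) = conj (invmx y) (invmx (nrefl e' f' *m x') *m x)).
    exact: ((norm_inv hy).2 _).1.
  by rewrite /conj invmxK [invmx (_ *m y)]invmxM // !mulmxA.
have rxa : root (nact x' a) by exact: root_nact.
case: (bpos_total borelB sTB rxa) => hx'a; last first.
  have [m' lt hw] := IHp x' (esym ew') hx' hx'a; exists m'.+1; first by rewrite ltnS.
  rewrite cE // -mulmxA -coset_mul; last exact: norm_mul.
  by rewrite -es; exact: has_wordS.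
have eqa : nact x' a = a'.
  apply: contrapT => ne; have := refl_bpos borelB sTB sa' hx'a.
  by rewrite -nE => /(_ (introN eqP ne)) /bposN.
exists p => //; have -> // : coset T (x *m nrefl e f) = w'.
rewrite cE // ew'; apply/esym/coset_eq => //; first exact: norm_mul (norm_mul _ _) _.
apply: (nact_id_T borelB sTB) => [|b rb].
  by apply: norm_mul; [exact: norm_inv|exact: norm_mul (norm_mul _ _) _].
have [h1 h2] := (norm_mul hr' hx', norm_inv hx').
rewrite (nact_mul _ h2 (norm_mul h1 hr)) (nact_mul _ h1 hr) (nact_mul _ hr' hx').
rewrite (reflE _ tr') (reflE _ tr) -[RHS](nactK b hx'); congr nact.
rewrite -eqa /refl cr_nact // nactD nactN.
have nZ c d : nact x' (c *: d) = c *: nact x' d.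
  by apply: ev_eq => tau ht; rewrite nactE // !evZ nactE.
have evx d tau : tau \in t -> ev (nact x' d) (conj x' tau) = ev d tau.
  by move=> ht; rewrite nactE ?conjK //; exact: norm_t hx' ht.
rewrite nZ evB evZ !evx ?cr_t // ev_cr // -addrA -opprD -scalerDl.
have -> (c : k) : c + (c - c * 2) = 0.
  by rewrite addrA -[c + c]mulr2n [c * _]mulr_natr subrr.
by rewrite scale0r subr0.
Qed.

Lemma weyl_lengthP (w : set M) : weyl G T w ->
  has_word G B T (weyl_length G B T w) w /\
  forall m, has_word G B T m w -> (weyl_length G B T w <= m)%N.
Proof.
move=> [x hx ->]; have [m0 h0] := has_word_ex hx.
have ex : exists m, `[< has_word G B T m (coset T x) >] by exists m0; apply/asboolP.
case: (ex_minnP ex) => m /asboolP hm hmin; rewrite /weyl_length.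
by case: xgetP => [p _ []//|/(_ m)[]]; split=> // m' h'; apply: hmin; apply/asboolP.
Qed.

Variable L : set M.
Hypotheses (gL : subgroup L) (LG : L `<=` G).

(** Otherwise [deletion] shortens x within its coset. *)
Lemma min_reps_pos x a e f : min_reps G B T L (coset T x) -> norm x -> bpos a -> triple a e f ->
  L (nrefl e f) -> bpos (nact x a).
Proof.
move=> [hw hmin] hx ha tr Lr; have hr := nrefl_norm tr; have [ra _] := ha.
case: (bpos_total borelB sTB (root_nact hx ra)) => // hN.
have [hm _] := weyl_lengthP hw; have [m lt hm'] := deletion hm hx ha tr hN.
have /hmin : weyl L T (coset T (nrefl e f)) by exists (nrefl e f) => //; split=> //; case: hr.
rewrite coset_mul // => le.
have [_ /(_ _ hm') le'] : _ /\ _ := weyl_lengthP (ex_intro2 _ _ _ (norm_mul hx hr) erefl).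
by move: (leq_trans le le') lt; lia.
Qed.

Lemma min_reps_ex x : norm x -> exists y, [/\ L y, norm y & min_reps G B T L (coset T (x *m y))].
Proof.
move=> hx; pose Q m := `[< exists y, [/\ L y, norm y & weyl_length G B T (coset T (x *m y)) = m] >].
have ex : exists m, Q m.
  exists (weyl_length G B T (coset T (x *m 1%:M))); apply/asboolP; exists 1%:M; split=> //.
    by case: gL.
  exact: norm1.
case: (ex_minnP ex) => m /asboolP[y [Ly hy ey]] hmin; exists y; split=> //; split.
  by exists (x *m y) => //; exact: norm_mul.
move=> _ [z [Lz hz] ->]; have nz : norm z by split=> //; exact: LG.
rewrite coset_mul // ey; apply: hmin; apply/asboolP; exists (y *m z); rewrite mulmxA.
by split=> //; [case: gL => _ _ h _; exact: h|exact: norm_mul].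
Qed.

End RootSpaces.

(** * Characteristics of height at most two *)

Section Characteristic.
Variables (k : closedFieldType) (n : nat).
Local Notation M := 'M[k]_n.
Implicit Types (x y z u v w tau : M).
Variable D : tordata k n.
Local Notation G := (tG D).
Local Notation T := (tT D).
Local Notation g0 := (tg0 D).
Local Notation hat := (conj g0).
Local Notation g := (Lie G).
Local Notation t := (Lie T).
Local Notation char0 := (tchar0 D).
Local Notation sG := (tas D).
Local Notation ug0 := (tunit D).
Local Notation hatP := (@hatP k n D).
Local Notation gsp := (@gsp k n D).
Local Notation ev := (@ev k n D).
Local Notation pr := (@pr k n D).
Local Notation wt := (wt D).
Local Notation wts := (wts D).
Local Notation root := (@root k n D).
Local Notation intg := (@intg k n D).
Local Notation norm := (normalizer G T).
Local Notation raises := (raises D).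
Local Notation Ugr := (Ugr D).
Local Notation Bgr := (Bgr D).
Local Notation dg := (dg D).
Local Notation dp := (dp D).
Local Notation regular := (regular D).

Lemma raises_roots y (m : int) x : intg y -> x \in g ->
  (forall a (z : int), pr a x != 0 -> a = 0 \/ root a -> ev a y = z%:~R -> m <= z) -> raises y m x.
Proof.
move=> hy xg h; rewrite -(sum_pr D x); apply: raises_sum => a.
have ha := pr_gsp a xg; have [->|nz] := eqVneq (pr a x) 0; first exact: raises0.
have [a0|a0] := eqVneq a 0.
  have e0 : ev a y = 0%:~R by rewrite a0 ev0.
  by apply: (raises_le _ (gsp_raises hy ha e0)); apply: (h a) => //; left.
have ra : root a by split=> //; exists (pr a x).
have [z ez] := ev_int ra hy; apply: (raises_le _ (gsp_raises hy ha ez)).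
by apply: (h a) => //; right.
Qed.

Lemma raises_component y (m : int) x a (z : int) : intg y -> x \in g -> raises y m x ->
  pr a x != 0 -> ev a y = z%:~R -> m <= z.
Proof.
move=> hy xg rx nz ez; exact: (raises_gsp hy (pr_gsp a xg) nz ez (@raises_pr _ _ D y m a x rx)).
Qed.

Lemma pr_root_or0 a x : x \in g -> pr a x != 0 -> a = 0 \/ root a.
Proof.
move=> xg nz; have [->|a0] := eqVneq a 0; [by left|right].
by split=> //; exists (pr a x) => //; exact: pr_gsp.
Qed.

Variable B : set M.
Hypotheses (borelB : borel G B) (sTB : T `<=` B).
Local Notation bpos := (@bpos k n D B).
Local Notation bsimple := (@bsimple k n D B).

Variable h : M.

Section SL2.
Variables E F : M.
Hypotheses (ht : h \in t) (Eg : E \in g) (Fg : F \in g) (hE : lie h E = 2 *: E) (hF : lie h F = - 2 *: F)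
  (EF : lie E F = h).

Let Fn : F ^+ n = 0.
Proof.
have e : lie h F *m F = F *m lie h F by rewrite hF -scalemxAl -scalemxAr.
have := jacobson char0 e; rewrite hF => /(nilpZ (- 2^-1)).
by rewrite scalerA mulrNN mulVf ?scale1r // (char0_natf_eq0 char0).
Qed.

Let lF w : lie h (lie F w) = lie F (lie h w) - 2 *: lie F w.
Proof. by rewrite jacobi hF lieZl scaleNr addrC. Qed.
Let lE w : lie h (lie E w) = lie E (lie h w) + 2 *: lie E w.
Proof. by rewrite jacobi hE lieZl addrC. Qed.
Let lEF w : lie E (lie F w) = lie F (lie E w) + lie h w.
Proof. by rewrite jacobi EF addrC. Qed.

Lemma sl2_intg : E ^+ n = 0 -> intg h.
Proof. by move=> En; exact: (sl2_integral ht En Fn hE hF EF). Qed.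

Hypothesis E3 : forall x, x \in g -> lie E (lie E (lie E x)) = 0.

(** Lowered until F kills it, a root vector becomes primitive for the opposite
    triple, and E can raise it at most twice. *)
Lemma weight_ge a : root a -> exists z : int, ev a h = z%:~R /\ -2 <= z.
Proof.
move=> [_ [x x0 hx]]; pose c := ev a h; have hc : lie h x = c *: x by exact: gsp_lie hx ht.
have xg := gsp_in hx.
have ex0 : exists m, iter m (lie F) x == 0 by exists (n + n)%N; rewrite iter_lie_nilp // Fn.
case: (ex_minnP ex0) => -[|j] hj mj; first by rewrite /= (negPf x0) in hj.
have nz : iter j (lie F) x != 0 by apply/negP => /mj; rewrite ltnn.
have hw := sl2_weight lF j hc.
pose H' w := - lie h w.
have H'lin : linear H' by move=> b u v; rewrite /H' linearP opprD scalerN.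
pose H'm := GRing.isLinear.Build k M M _ H' H'lin.
pose HH : {linear M -> M} := HB.pack H' H'm.
have EF' w : lie F (lie E w) = lie E (lie F w) + HH w by rewrite /= /H' lEF addrK.
have HF' w : HH (lie E w) = lie E (HH w) - 2 *: lie E w.
  by rewrite /= /H' lE linearN opprD.
have hw' : HH (iter j (lie F) x) = ((2 * j)%:R - c) *: iter j (lie F) x.
  by rewrite /= /H' hw -scaleNr opprB.
have ug : iter j (lie F) x \in g by elim: (j) => // i IHi; rewrite iterS; exact: (lie_in sG).
have [|N [eN nzi _]] := sl2_primitive char0 EF' HF' nz hw' (eqP hj).
  by exists 3; exact: E3.
exists ((2 * j)%:Z - N%:Z); split; first by rewrite rmorphB /= -[N%:~R]eN opprB addrC subrK.
have N2 : (N <= 2)%N.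
  by rewrite leqNgt; apply/negP => N3; have := nzi 3%N N3; rewrite /= E3 ?eqxx.
by lia.
Qed.

Lemma weight_bound a : root a -> exists z : int, [/\ ev a h = z%:~R, -2 <= z & z <= 2].
Proof.
move=> ra; have [z [ez lz]] := weight_ge ra; have [z' [ez' lz']] := weight_ge (rootN ra).
exists z; split=> //; have -> : z = - z'.
  by apply: (intr_inj0 D); rewrite -ez rmorphN /= -ez' evN opprK.
by lia.
Qed.

End SL2.

Section Grading.
Hypotheses (hh : intg h)
  (hb : forall a, root a -> exists z : int, [/\ ev a h = z%:~R, -2 <= z & z <= 2])
  (hdom : forall a, bsimple a -> exists m : nat, ev a h = m%:R).
Variable y : M.
Hypotheses (hy : intg y) (ry : regular y) (bP : forall a, bpos a <-> root a /\ kpos (ev a y))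
  (BE : B = Bgr y).

Lemma bpos_nonneg a : bpos a -> exists m : nat, ev a h = m%:R.
Proof.
move=> ha; have [m em] : exists m : nat, ev a y = m.+1%:R by case/bP: ha.
elim/ltn_ind: m a em ha => m IHm a em ha.
case: (pselect (exists b c, [/\ bpos b, bpos c & a = b + c])) => [[b [c [hb' hc e]]]|nd]; last first.
  by apply: hdom.
have [[p ep] [q eq]] : kpos (ev b y) /\ kpos (ev c y) by case/bP: hb' => _ ?; case/bP: hc.
have pq : m = (p + q).+1.
  apply: succn_inj; apply: (natr_inj0 char0); rewrite -em e evD ep eq -natrD.
  by congr (_%:R); lia.
have [|i ei] := IHm p _ b ep hb'; first by lia.
have [|j ej] := IHm q _ c eq hc; first by lia.
by exists (i + j)%N; rewrite e evD ei ej natrD.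
Qed.

Lemma bpos_degree a : bpos a -> exists2 z : int, ev a h = z%:~R & 0 <= z <= 2.
Proof.
move=> ha; have [ra _] := ha; have [z [ez _ z2]] := hb ra; exists z => //.
have [m em] := bpos_nonneg ha; have e : z = m%:Z by apply: (intr_inj0 D); rewrite -ez em.
by rewrite z2 e.
Qed.

Lemma pos_bpos a (z : int) : root a -> ev a h = z%:~R -> 0 < z -> bpos a.
Proof.
move=> ra ez z0; case: (bpos_total borelB sTB ra) => // ha.
have [z' ez' le] := bpos_degree ha; have e : z' = - z.
  by apply: (intr_inj0 D); rewrite -ez' rmorphN /= -ez evN.
by move: le; rewrite e; lia.
Qed.

Lemma bpos_deg a (z : int) : bpos a -> ev a y = z%:~R -> 0 < z.
Proof. by case/bP => _ ka ez; apply/(kpos_int D); rewrite -ez. Qed.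

Lemma y_raises_h x : x \in g -> raises y 1 x -> raises h 0 x.
Proof.
move=> xg rx; apply: raises_roots => // a z nz [-> |ra] ez.
  by move: ez; rewrite ev0 => /esym/eqP; rewrite (char0_intr_eq0 char0) => /eqP->.
have [z' ez'] := ev_int ra hy; have lz' := raises_component hy xg rx nz ez'.
have ha : bpos a by apply/bP; split=> //; rewrite ez'; apply/(kpos_int D); lia.
have [z2 ez2 /andP[z20 _]] := bpos_degree ha.
by have -> : z = z2 by apply: (intr_inj0 D); rewrite -ez -ez2.
Qed.

Lemma h_raises_y x : x \in g -> raises h 1 x -> raises y 1 x.
Proof.
move=> xg rx; apply: raises_roots => // a z nz ra0 ez.
have [z' ez'] : exists z : int, ev a h = z%:~R.
  by case: ra0 => [->|ra]; [exists 0; rewrite ev0|exact: ev_int].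
have lz' := raises_component hh xg rx nz ez'; case: ra0 => [a0|ra].
  move: ez'; rewrite a0 ev0 => /esym/eqP; rewrite (char0_intr_eq0 char0) => /eqP e.
  by rewrite e in lz'.
have ha : bpos a by apply: (pos_bpos ra ez'); lia.
by have := bpos_deg ha ez; lia.
Qed.

Lemma h_raises3 x : x \in g -> raises h 3 x -> x = 0.
Proof.
move=> xg rx; rewrite -(sum_pr D x) big1 // => a _; apply/eqP/negPn/negP => nz.
case: (pr_root_or0 xg nz) => [a0|ra].
  by have := @raises_component h 3 x a 0 hh xg rx nz; rewrite a0 ev0 => /(_ erefl).
have [z [ez _ z2]] := hb ra.
by have := raises_component hh xg rx nz ez; lia.
Qed.

Lemma lie_raises (i : int) x : lie h x = i%:~R *: x -> raises h i x.
Proof.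
move=> e a b nz; have [htt _] := hh; have := hat_lie x a b (diag_lie htt).
rewrite e hatZ !(dgE hh) -rmorphB => /(mulIf nz)/(intr_inj0 D) ->; exact: lexx.
Qed.

Lemma grade2P x : x \in g -> lie h x = 2 *: x <-> raises h 2 x.
Proof.
move=> xg; have [htt _] := hh; split=> [e|rx]; first exact: (lie_raises (i := 2)).
rewrite -(sum_pr D x) !linear_sum; apply: eq_bigr => a _ /=.
have [->|nz] := eqVneq (pr a x) 0; first by rewrite linear0 scaler0.
rewrite lie_pr //; case: (pr_root_or0 xg nz) => [a0|ra].
  by have := @raises_component h 2 x a 0 hh xg rx nz; rewrite a0 ev0 => /(_ erefl).
have [z [ez _ z2]] := hb ra; have z2' := raises_component hh xg rx nz ez.
by rewrite ez; have -> : z = 2 by lia.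
Qed.

Lemma dp_mul x x' : raises h 0 x -> raises h 0 x' -> dp h (x *m x') = dp h x *m dp h x'.
Proof.
move=> rx rx'; apply: hatP; apply/matrixP => i j; rewrite hat_dp conjM // mxE.
case: eqP => [e|ne]; rewrite conjM // mxE.
  apply: eq_bigr => l _; rewrite !hat_dp -e; case: (dg h i =P dg h l) => [->|ne]; first by rewrite eqxx.
  rewrite mul0r; apply/eqP; rewrite mulf_eq0; apply/orP.
  case: (eqVneq (hat x i l) 0) => [e0|nz]; [by left; apply/eqP|right].
  by apply/negPn/negP => nz'; have := rx i l nz; have := rx' l j nz'; lia.
apply/esym; apply: big1 => l _; rewrite !hat_dp; case: (dg h i =P dg h l) => [e|_]; last by rewrite mul0r.
by case: eqP => [e'|_]; [case: ne; rewrite e|rewrite mulr0].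
Qed.

Lemma dp_exp x m : raises h 0 x -> dp h (x ^+ m) = dp h x ^+ m.
Proof.
move=> rx; have d1 : dp h 1%:M = 1%:M.
  by apply: dp_diag; rewrite conj_id // scalar_mx_is_diag.
have rX i : raises h 0 (x ^+ i).
  elim: i => [|i IHi]; first exact: raises1.
  by rewrite exprS -mulmxE -[0]addr0; apply: raisesM.
by elim: m => [|m IHm]; rewrite ?expr0 ?d1 // !exprS -!mulmxE dp_mul // IHm.
Qed.

Lemma dp_expm x : raises h 0 x -> dp h (expm x) = expm (dp h x).
Proof.
move=> rx; rewrite /expm linear_sum; apply: eq_bigr => i _.
by rewrite linearZ /= dp_exp.
Qed.

Lemma dp_gsp a x : gsp a x -> dp h x = if ev a h == 0 then x else 0.
Proof.
move=> hx; have [->|x0] := eqVneq x 0; first by rewrite linear0; case: ifP.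
apply: hatP; apply/matrixP => i j; rewrite hat_dp -(gsp_pr hx) (fun_if (fun u => hat u i j)) hat_pr hat0.
case: (wt i j =P a) => [<-|_]; last by rewrite !if_same.
by rewrite (ev_wt_dg hh) (char0_intr_eq0 char0) subr_eq0.
Qed.

(** The degree 0 part of log u for the grading by h exponentiates to the factor
    in the Levi subgroup. *)
Lemma levi_split u : Ugr y 1 u -> exists x0 v, [/\ x0 \in g, lie h x0 = 0, raises y 1 x0,
  Ugr h 1 v & u = expm x0 *m v].
Proof.
move=> hu; have [x [xg rx xn xE]] := @Ugr_exp _ _ D y 1 u (lexx 1) hu.
have rh := y_raises_h xg rx.
pose x0 := \sum_(a <- wts) (if ev a h == 0 then pr a x else 0).
have x0E : dp h x = x0.
  rewrite -{1}(sum_pr D x) linear_sum; apply: eq_bigr => a _ /=.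
  exact: (dp_gsp (pr_gsp a xg)).
have x0g : x0 \in g by apply: rpred_sum => a _; case: ifP => _; [case: (pr_gsp a xg)|exact: mem0v].
have rx0 : raises y 1 x0.
  by apply: raises_sum => a; case: ifP => _; [exact: raises_pr|exact: raises0].
have hx0 : lie h x0 = 0.
  have [htt _] := hh; rewrite linear_sum big1 // => a _ /=; case: ifP => [/eqP e|_]; last exact: linear0.
  by rewrite lie_pr // e scale0r.
have rh0 : raises h 0 x0 by exact: y_raises_h.
have n0 : x0 ^+ n = 0 by exact: (@raises_nilp _ _ D y).
have nN : (- x0) ^+ n = 0 by exact: nilpN.
exists x0, (expm (- x0) *m u); split=> //; last by rewrite mulmxA (expmK char0 n0) mul1mx.
have rX z : raises h 0 z -> raises h 0 (expm z).
  move=> rz; apply: raises_sum => i; apply: raisesZ; elim: (val i) => [|j IHj]; first exact: raises1.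
  by rewrite exprS -mulmxE -[0]addr0; apply: raisesM.
have rN : raises h 0 (expm (- x0)) by apply/rX/raisesN.
have rU : raises h 0 u by rewrite -xE; exact: rX.
split; first by apply: (asG_mul sG); [apply: (expm_in char0 sG) => //; rewrite rpredN|case: hu].
have <- : dp h (expm (- x0) *m u) = 1%:M.
  rewrite dp_mul // dp_expm; last exact: raisesN.
  have dd : dp h x0 = x0.
    by rewrite -x0E; apply: hatP; apply/matrixP => i j; rewrite !hat_dp; case: (_ == _).
  by rewrite -xE dp_expm // linearN /= x0E dd -{2}[x0]opprK (expmK char0 nN).
by apply: sub_dp_raises; rewrite -[0]addr0; apply: raisesM.
Qed.

Lemma levi_conj w x0 : norm w -> (forall a, bpos a -> ev a h = 0 -> bpos (nact w a)) ->
  x0 \in g -> lie h x0 = 0 -> raises y 1 x0 -> Ugr y 1 (conj w (expm x0)).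
Proof.
move=> hw hp x0g h0 rx; have uw := norm_unit hw; have [htt _] := hh.
rewrite conj_of_expm //; apply: exp_Ugr => //; first by apply: (conj_in sG) => //; case: hw.
rewrite -(sum_pr D x0) linear_sum; apply: raises_sum => a /=.
have [->|nz] := eqVneq (pr a x0) 0; first by rewrite linear0; exact: raises0.
have ha := pr_gsp a x0g; have ea : ev a h = 0.
  have := pr_lie a x0 htt; rewrite h0 linear0 => /esym/eqP; rewrite scaler_eq0 (negPf nz) orbF.
  by move/eqP.
case: (pr_root_or0 x0g nz) => [a0|ra].
  by have := @raises_component y 1 x0 a 0 hy x0g rx nz; rewrite a0 ev0 => /(_ erefl).
have [z ez] := ev_int ra hy; have lz := raises_component hy x0g rx nz ez.
have hb' : bpos a by apply/bP; split=> //; rewrite ez; apply/(kpos_int D); lia.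
have hwa := hp a hb' ea; have [rwa _] := hwa; have [z' ez'] := ev_int rwa hy.
have lz' := bpos_deg hwa ez'.
by apply: (raises_le _ (gsp_raises hy (gsp_nact hw ha) ez')); lia.
Qed.

Section Parabolic.
Variables (P L : set M).
Hypotheses (gP : closed_subgroup P) (BP : B `<=` P) (PG : P `<=` G)
  (lieP : forall x, x \in Lie P <-> x \in g /\ raises h 0 x).

Lemma P_weights w a (m : nat) : P w -> norm w -> root a -> ev a h = m%:R ->
  exists m' : nat, ev (nact w a) h = m'%:R.
Proof.
move=> Pw hw ra em; have [_ [x x0 hx]] := ra; have xg := gsp_in hx.
have xP : x \in Lie P.
  apply/lieP; split=> //; apply: raises_le (gsp_raises (m := m) hh hx em); lia.
have : conj w x \in Lie P.
  by apply/LieP; apply: tangent_Ad; [case: gP|exact: Pw|exact/LieP].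
case/lieP => _ rw; have hwx := gsp_nact hw hx; have rwa := root_nact hw ra.
have [z ez] := ev_int rwa hh; have wx0 := conj_neq0 (norm_unit hw) x0.
have := raises_gsp hh hwx wx0 ez rw; case: z ez => // i ei _; by exists i.
Qed.

(** By induction on the inversions: an element of the normaliser of T in P
    preserves the sign of roots on h, so that a simple root made negative by it
    vanishes on h. *)
Lemma P_norm_fix w : P w -> norm w -> conj w h = h.
Proof.
move=> Pw hw; have [htt _] := hh.
pose nn a := exists m : nat, ev a h = m%:R.
pose Q w := (forall a, root a -> nn a <-> nn (nact w a)) -> conj w h = h.
suff : Q w.
  apply=> a ra; split=> -[m em]; first exact: P_weights em.
  have PV : P (invmx w) by case: gP => -[_ _ _ PV] _; exact: PV.
  by rewrite -(nactK a hw); apply: (P_weights PV (norm_inv hw) _ em); exact: root_nact.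
move: w {Pw} hw; apply: (weyl_ind borelB sTB) => [s Ts _|w a e f hw sa tr wN IH hQ].
  exact: T_fix Ts htt.
have [ha _] := sa; have [ra _] := ha.
have e0 : ev a h = 0.
  have [m em] := bpos_nonneg ha; have : nn (nact w (- a)) by rewrite nactN; exact: bpos_nonneg.
  case/(hQ _ (rootN ra)) => m'; rewrite evN em => /esym/eqP; rewrite -addr_eq0 -natrD (char0_natf_eq0 char0) addn_eq0.
  by case/andP => _ /eqP->.
have fx : conj (nrefl e f) h = h.
  by have [ft _ _] := nrefl_act tr; rewrite ft // e0 scale0r subr0.
have [uw ur] := (norm_unit hw, norm_unit (nrefl_norm tr)).
rewrite -{1}fx -conj_mul //; apply: IH => b rb.
rewrite nact_mul //; last exact: nrefl_norm tr.
rewrite -hQ; last by apply: root_nact rb; exact: nrefl_norm tr.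
by rewrite /nn nactE // (conj_nreflV tr) // e0 scale0r subr0.
Qed.
End Parabolic.
End Grading.
End Characteristic.

(** * Orbits in the part of degree two: orthogonal representatives *)

Section Orthogonal.
Variables (k : closedFieldType) (n : nat).
Local Notation M := 'M[k]_n.
Implicit Types (x y z u v w tau : M).
Variable D : tordata k n.
Local Notation G := (tG D).
Local Notation T := (tT D).
Local Notation g0 := (tg0 D).
Local Notation hat := (conj g0).
Local Notation g := (Lie G).
Local Notation char0 := (tchar0 D).
Local Notation sG := (tas D).
Local Notation dT := (@tdiag k n D).
Local Notation hatP := (@hatP k n D).
Local Notation gsp := (@gsp k n D).
Local Notation ev := (@ev k n D).
Local Notation pr := (@pr k n D).
Local Notation wts := (wts D).
Local Notation dmx := (dmx D).
Local Notation root := (@root k n D).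
Local Notation cr := (@cr k n D).
Local Notation intg := (@intg k n D).
Local Notation regular := (regular D).

Lemma cartan_sign a b : root a -> root b -> exists N N' : nat, [/\ (0 < N)%N, (0 < N')%N &
  N%:R * ev a (cr b) = N'%:R * ev b (cr a)].
Proof.
move=> ra rb; have [N N0 hN] := cr_norm ra; have [N' N0' hN'] := cr_norm rb.
by exists N, N'; split=> //; rewrite -hN ?cr_t // -hN' ?cr_t // mxtrace_mulC.
Qed.

Lemma cartan_eq0 a b : root a -> root b -> ev a (cr b) = 0 -> ev b (cr a) = 0.
Proof.
move=> ra rb e; have [N [N' [_ N0' ]]] := cartan_sign ra rb; rewrite e mulr0 => /esym/eqP.
by rewrite mulf_eq0 (char0_natf_eq0 char0) -[_ == 0%N]negbK -lt0n N0' => /eqP.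
Qed.

Lemma pr_gsp_if a b x : gsp b x -> pr a x = if a == b then x else 0.
Proof. by move=> hx; rewrite -{1}(gsp_pr hx) pr_pr; case: eqP => // _; exact: gsp_pr. Qed.

Lemma iter_lie_sum (z : M) i I (r : seq I) (F : I -> M) :
  iter i (lie z) (\sum_(j <- r) F j) = \sum_(j <- r) iter i (lie z) (F j).
Proof. by elim: i => // i IHi; rewrite iterS IHi linear_sum. Qed.

Lemma pr_conjT a s x : T s -> x \in g -> pr a (conj s x) = conj s (pr a x).
Proof.
move=> Ts xg; rewrite -{1}(sum_pr D x) !linear_sum /=.
have hs b : gsp b (conj s (pr b x)).
  by have := gsp_nact (norm_T Ts) (pr_gsp b xg); rewrite nact_T.
rewrite (eq_bigr (fun b => if b == a then conj s (pr b x) else 0)) => [|b _]; last first.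
  by rewrite (pr_gsp_if _ (hs b)) eq_sym.
case: (boolP (a \in wts)) => aw.
  rewrite (bigD1_seq a) ?wts_uniq //= eqxx big1 ?addr0 // => b /negPf->.
  by [].
rewrite (pr_notin x aw) linear0 big_seq big1 // => b bw.
by case: eqP => // e; rewrite e (negPf aw) in bw.
Qed.

(** One-parameter subgroups act on root spaces by powers. *)
Lemma torus_act tau b : intg tau -> b != 0 -> exists2 s, T s &
  forall c (z : int) w, gsp c w -> ev c tau = z%:~R -> conj s w = b ^ z *: w.
Proof.
move=> htau b0; have [ht [d hd]] := htau; have Ts := integral_torus ht hd b0.
exists (dmx (fun i => b ^ d i)) => // c z w hw ez; apply: hatP; apply/matrixP => i j.
have us := mT_unit Ts; have dV : is_diag_mx (hat (invmx (dmx (fun i => b ^ d i)))).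
  by apply: dT; exact: mT_inv.
rewrite conjM // [conj g0 (_ *m w)]conjM // (mulmx_diag _ _ _ dV) (diag_mulmx _ _ _ (dT Ts)) hatZ.
have [->|nz] := eqVneq (hat w i j) 0; first by rewrite !mulr0 mul0r.
have := hat_mul_diag (invmx (dmx (fun i => b ^ d i))) j (dT Ts).
rewrite mulmxV // !dmx_hat conj_id // mxE eqxx => e.
have -> : hat (invmx (dmx (fun i => b ^ d i))) j j = b ^ (- d j).
  apply: (mulfI (expfz_neq0 (d j) b0)); by rewrite -e -expfzDr // subrr expr0z.
have -> : z = d i - d j.
  apply: (intr_inj0 D); rewrite -ez rmorphB /= -!hd; have := hat_lie w i j (diag_lie ht).
  by rewrite (gsp_lie hw ht) hatZ => /(mulIf nz).
by rewrite expfzDr // mulrAC.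
Qed.

Variable B : set M.
Hypotheses (borelB : borel G B) (sTB : T `<=` B).
Local Notation bpos := (@bpos k n D B).
Variables h y : M.
Hypotheses (hh : intg h)
  (hb : forall a, root a -> exists z : int, [/\ ev a h = z%:~R, -2 <= z & z <= 2])
  (hdom : forall a, bpos a -> exists m : nat, ev a h = m%:R).
Hypotheses (hy : intg y) (ry : regular y) (bP : forall a, bpos a <-> root a /\ kpos (ev a y)).

(** The weights of g(2). *)
Definition psi a := root a /\ ev a h = 2.

Let hle a (z : int) : root a -> ev a h = z%:~R -> -2 <= z <= 2.
Proof.
by move=> ra ez; have [z' [ez' l u]] := hb ra; rewrite (_ : z = z') ?l ?u //; apply: (intr_inj0 D); rewrite -ez.
Qed.

Lemma psi_pos a : psi a -> bpos a.
Proof.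
move=> [ra e]; case: (bpos_total borelB sTB ra) => // /hdom[m]; rewrite evN e => /eqP.
by rewrite eq_sym -subr_eq0 opprK -[2]/(2%:R) -natrD (char0_natf_eq0 char0) addnC.
Qed.

Lemma psi_add a b : psi a -> psi b -> ~ root (a + b).
Proof.
move=> [_ ea] [_ eb] rab; have := @hle _ 4 rab; rewrite evD ea eb => h4.
by have : is_true (-2 <= (4 : int) <= 2) by apply: h4; rewrite -natrD.
Qed.

(** Roots of the abelian ideal form no obtuse angle, as their sum is no root. *)
Lemma psi_cartan a b : psi a -> psi b -> exists m : nat, ev a (cr b) = m%:R.
Proof.
move=> pa pb; have [[ra ea] [rb eb]] := (pa, pb).
have [[m|m] em] := ev_int ra (cr_intg rb); first by exists m.
have em' : ev a (cr b) = - m.+1%:R by rewrite em NegzE rmorphN.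
have ne : a != - b.
  apply/negP => /eqP e; move/eqP: ea; rewrite e evN eb eq_sym -subr_eq0 opprK -[2]/(2%:R) -natrD.
  by rewrite (char0_natf_eq0 char0).
have := string_root_up rb ra ne em' (ltn0Sn m); rewrite mulr1n => r.
by case: (psi_add pa pb).
Qed.

Lemma psi_sub a b m : psi a -> psi b -> a != b -> ev a (cr b) = m.+1%:R -> root (a - b).
Proof.
move=> [ra _] [rb _] ne em.
by have := string_root rb ra ne em (ltn0Sn m); rewrite mulr1n.
Qed.

(** If c' + d - c is a root, the Cartan integers force d to be long and c short,
    with m = 1; then 2 c - d is in Psi as well and pairs negatively with c' + d
    - c, which is impossible by [psi_cartan]. *)
Lemma nodisturb c c' d m : psi c -> psi c' -> psi d -> ev c' (cr c) = 0 -> d != c ->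
  ev d (cr c) = m.+1%:R -> ~ root (c' + (d - c)).
Proof.
move=> pc pc' pd e0 ne em rz; have [[rc ec] [rc' ec'] [rd ed]] := And3 pc pc' pd.
have rb := psi_sub pd pc ne em.
have pz : psi (c' + (d - c)) by split=> //; rewrite evD evB ec' ed ec subrr addr0.
(* Other values of the Cartan integer contradict the bounds on the roots at h or
   the absence of obtuse angles. *)
have m1 : m = 1%N.
  have [p ep] := psi_cartan pz pc; case: m em => [|[|m]] em //.
    have e12 : (1 : k) - 2 = - 1%:R by rewrite -[2]/(1 + 1) opprD addrA subrr add0r.
    move: ep; rewrite evD evB e0 add0r em ev_cr // e12 => /esym/(natrN_eq D)[_].
    by [].
  have r3 := string_root rc rd ne em (isT : (3 <= m.+3)%N).
  have := @hle _ (- 4) r3; rewrite evB ev_mulrn ed ec => h4.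
  have : is_true (-2 <= (- 4 : int) <= 2); last by [].
  by apply: h4; rewrite rmorphN /= -[2]/(2%:R) -natrM -[(2 * 3)%N]/(2 + 4)%N natrD opprD addrA subrr add0r.
rewrite {}m1 in em; have r2 := string_root rc rd ne em (isT : (2 <= 2)%N).
pose mu := - (d - c *+ 2).
have muE tau : ev mu tau = 2 * ev c tau - ev d tau.
  by rewrite /mu evN evB ev_mulrn opprB mulrC.
have rmu : root mu by exact: rootN.
have pmu : psi mu by split=> //; rewrite muE ec ed mulr2n mulrDl mul1r addrK.
have ec0 : ev c (cr c') = 0 by exact: cartan_eq0 rc' rc e0.
have [p ep] := psi_cartan pmu pc'; have [q eq] := psi_cartan pd pc'.
rewrite muE ec0 mulr0 add0r eq in ep; have [p0 q0] := natrN_eq D (esym ep).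
have emu : ev mu (cr c') = 0 by rewrite muE ec0 eq q0 mulr0 subrr.
have ec'mu : ev c' (cr mu) = 0 by exact: cartan_eq0 rmu rc' emu.
have eb : ev (d - c) (cr c) = 0 by rewrite evB em ev_cr // subrr.
have ecb : ev c (cr (d - c)) = 0 by exact: cartan_eq0 rb rc eb.
have emub : ev mu (cr (d - c)) = - 2.
  by rewrite muE; have := ev_cr rb; rewrite evB ecb subr0 => ->; rewrite mulr0 add0r.
have [r er] := psi_cartan pz pmu; rewrite evD ec'mu add0r in er.
have [N [N' [N0 N0' ]]] := cartan_sign rb rmu; rewrite er emub mulrN -[2]/(2%:R) -!natrM.
by case/(natrN_eq D) => _ /eqP; rewrite muln_eq0 orbF -[_ == 0%N]negbK -lt0n N0'.
Qed.

Definition deg a : nat := xget 0%N [set m | ev a y = m%:R].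
Lemma degE a : bpos a -> ev a y = (deg a)%:R.
Proof.
by case/bP => _ [m em]; rewrite /deg; case: xgetP => [p _ //|/(_ m.+1)[]].
Qed.
Lemma deg_uniq a m : ev a y = m%:R -> deg a = m.
Proof.
move=> e; rewrite /deg; case: xgetP => [p _ /=|/(_ m)[]//].
by rewrite e => /(natr_inj0 char0).
Qed.

Definition deg2 x := x \in g /\ lie h x = 2 *: x.

Lemma deg2_psi x a : deg2 x -> pr a x != 0 -> psi a.
Proof.
move=> [xg e] nz; have [ht _] := hh; have ea : ev a h = 2.
  have := pr_lie a x ht; rewrite e linearZ /= => /eqP; rewrite -subr_eq0 -scalerBl scaler_eq0 (negPf nz) orbF.
  by rewrite subr_eq0 => /eqP.
split=> //; case: (pr_root_or0 xg nz) => // a0.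
by move/eqP: ea; rewrite a0 ev0 eq_sym (char0_natf_eq0 char0).
Qed.

Variable A : set M.
Hypotheses (AT : T `<=` A) (AM : forall a b, A a -> A b -> A (a *m b))
  (AU : A `<=` [set a | a \in unitmx])
  (AE : forall b z, bpos b -> ev b h = 0 -> gsp b z -> A (expm z)).

Let arith1 (p q i : nat) : (p < q)%N -> (0 < i)%N -> (p + (q - p) * i <= q)%N -> i = 1%N.
Proof. nia. Qed.
Let arith2 (p q r i : nat) : (p < q)%N -> (0 < i)%N -> (r + (q - p) * i <= q)%N -> (r < q)%N.
Proof. nia. Qed.

(** The exponential of a root vector of d - c kills the component at d using
    that at c. By [nodisturb], the components at the other roots below d are not
    moved to any root of Psi, and components at or above d are moved beyond d.
    *)
Lemma kill_root x c d m : deg2 x -> psi c -> psi d -> pr c x != 0 -> d != c ->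
  ev d (cr c) = m.+1%:R -> (deg c < deg d)%N ->
  (forall c', c' != c -> pr c' x != 0 -> (deg c' < deg d)%N -> ev c' (cr c) = 0) ->
  exists a, [/\ A a, deg2 (conj a x) & forall b, psi b -> (deg b <= deg d)%N ->
    pr b (conj a x) = if b == d then 0 else pr b x].
Proof.
move=> dx pc pd nz ne em lt orth; have [xg ex] := dx; have [ht _] := hh.
have [[rc ec] [rd ed]] := (pc, pd); have rb := psi_sub pd pc ne em.
have [bc bd] := (psi_pos pc, psi_pos pd).
have eby : ev (d - c) y = (deg d - deg c)%N%:R by rewrite evB !degE // natrB // ltnW.
have bb : bpos (d - c).
  by apply/bP; split=> //; exists (deg d - deg c).-1; rewrite eby prednK // subn_gt0.
have ebh : ev (d - c) h = 0 by rewrite evB ec ed subrr.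
have [_ [z0 z00 hz0]] := rb; have hc := pr_gsp c xg.
have dcE : d - c + c = d by rewrite subrK.
have hl : gsp d (lie z0 (pr c x)) by rewrite -dcE; exact: gsp_lieD.
have l0 : lie z0 (pr c x) != 0 by apply: bracket_neq0 hz0 z00 hc nz; rewrite ?dcE.
have [b eb] := dim1 rd hl l0 (pr_gsp d xg).
have [z hz lz] : exists2 z, gsp (d - c) z & lie z (pr c x) = - pr d x.
  by exists (- b *: z0); [exact: gspZ|rewrite lieZl scaleNr -eb].
have zn : z ^+ n = 0 by have [b0 _] := rb; exact: gsp_nilp hz.
have Az : A (expm z) by exact: AE hz.
have uz : expm z \in unitmx by exact: AU.
have cg : conj (expm z) x \in g.
  by apply: (conj_in sG) => //; apply: (expm_in char0 sG) => //; exact: gsp_in hz.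
have fixh : conj (expm z) h = h.
  have l0h : lie z h = 0 by rewrite lieC (gsp_lie hz ht) ebh scale0r oppr0.
  by rewrite (conj_exp_lie1 D zn) l0h ?linear0 ?addr0.
exists (expm z); split=> //.
  by split=> //; rewrite -{1}fixh -conj_lie // ex linearZ.
have comp i a e' : psi e' -> (deg e' <= deg d)%N -> (0 < i)%N ->
    pr e' (iter i (lie z) (pr a x)) = if [&& a == c, i == 1%N & e' == d] then - pr d x else 0.
  move=> pe le i0; have [a0|nza] := eqVneq (pr a x) 0.
    have -> : iter i (lie z) (pr a x) = 0 by rewrite a0; elim: (i) => //= j ->; rewrite linear0.
    rewrite linear0; case: (a =P c) => // e; move: nz; rewrite -e a0 eqxx.
    by [].
  have pa := deg2_psi dx nza; have ba := psi_pos pa.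
  rewrite (pr_gsp_if e' (gsp_iter i hz (pr_gsp a xg))); case: (e' =P a + (d - c) *+ i) => [ee|ee]; last first.
    case: (a =P c) => //= ac; case: (i =P 1%N) => //= i1; case: (e' =P d) => // ed'.
    by case: ee; rewrite ed' ac i1 mulr1n addrC dcE.
  have dE : deg e' = (deg a + (deg d - deg c) * i)%N.
    by apply: deg_uniq; rewrite ee evD ev_mulrn eby degE // natrD natrM.
  case: (a =P c) => [ac|ac] /=.
    have i1 : i = 1%N by move: le; rewrite dE ac; exact: (arith1 lt i0).
    by rewrite i1 eqxx /= ee i1 ac mulr1n addrC dcE eqxx lz.
  have lta : (deg a < deg d)%N by move: le; rewrite dE; exact: (arith2 lt i0).
  have oa := orth a (introN eqP ac) nza lta.
  have nr := nodisturb pc pa pd oa ne em.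
  have l1 : lie z (pr a x) = 0.
    apply/eqP/negPn/negP => nl; have hg := gsp_lieD hz (pr_gsp a xg); apply: nr.
    rewrite addrC; split; last by exists (lie z (pr a x)).
    apply/negP => /eqP e; have [_ ea2] := pa; move/(congr1 (fun c => ev c h)): e.
    by rewrite evD ebh ea2 add0r ev0 => /eqP; rewrite (char0_natf_eq0 char0).
  case: i i0 {ee dE} => // i _; rewrite iterSr l1.
  by elim: i => //= j ->; rewrite linear0.
have it1 w : lie z w = iter 1 (lie z) w by [].
move=> e' pe le; have [K hK] := conj_expm char0 x zn.
rewrite (hK (2 + K)%N) ?leq_addl // linear_sum /= big_split_ord /= [X in _ + X]big1 ?addr0.
  rewrite !big_ord_recl big_ord0 /= addr0 !fact0 invr1 !scale1r.
  have i1 : pr e' (lie z x) = if e' == d then - pr d x else 0.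
    rewrite -{1}(sum_pr D x) !linear_sum /= (bigD1_seq c) ?wts_uniq ?root_wts //=.
    rewrite [X in _ + X]big1 ?addr0 => [|a ac].
      rewrite it1; apply: (etrans (comp 1%N c e' pe le isT)).
      by rewrite !eqxx !andTb.
    rewrite it1; apply: (etrans (comp 1%N a e' pe le isT)).
    by rewrite (negPf ac) andFb.
  by rewrite i1; case: (e' =P d) => [->|_]; rewrite ?subrr ?addr0.
have high i : pr e' (iter i.+2 (lie z) x) = 0.
  rewrite -(sum_pr D x) iter_lie_sum linear_sum big1 // => a _ /=.
  by apply: (etrans (comp i.+2 a e' pe le isT)); rewrite andbF.
have it2 i w : lie z (lie z (iter (0 + i) (lie z) w)) = iter i.+2 (lie z) w by [].
by move=> i _; rewrite linearZ /= it2 high scaler0.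
Qed.

Let A1 : A 1%:M. Proof. exact: AT (mT1 D). Qed.

Definition orthogonal_below x d := forall a b, a != b -> pr a x != 0 -> pr b x != 0 ->
  (deg a < d)%N -> (deg b < d)%N -> ev a (cr b) = 0.

(** The components in degree d that are not orthogonal to the lower ones are
    killed one by one. *)
Lemma orthogonal_step x d (r : seq (cartan_dual T)) : deg2 x -> orthogonal_below x d ->
  exists a, [/\ A a, deg2 (conj a x),
    forall b, psi b -> (deg b < d)%N -> pr b (conj a x) = pr b x &
    forall c, c \in r -> psi c -> deg c = d -> pr c (conj a x) != 0 ->
      forall b, psi b -> (deg b < d)%N -> pr b x != 0 -> ev c (cr b) = 0].
Proof.
move=> dx ox; elim: r => [|c r [a [Aa da low high]]].
  by exists 1%:M; rewrite conj1m; split.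
have ua : a \in unitmx by exact: AU.
pose bad b := [/\ psi b, (deg b < d)%N, pr b x != 0 & ev c (cr b) <> 0].
case: (pselect [/\ psi c, deg c = d, pr c (conj a x) != 0 & exists b, bad b]); last first.
  move=> good; exists a; split=> // c'; rewrite inE => /orP[/eqP->|]; last exact: high.
  move=> pc dc nz b pb db nb; apply: contrapT => ne; apply: good; split=> //.
  by exists b; split.
move=> [pc dc nz [b [pb db nb ne]]]; have [[|m] em] := psi_cartan pc pb; first by case: ne.
have cb : c != b by apply/negP => /eqP e; move: db; rewrite -e dc ltnn.
have nb' : pr b (conj a x) != 0 by rewrite low.
have lt : (deg b < deg c)%N by rewrite dc.
have [|a' [Aa' da' ha']] := kill_root da pb pc nb' cb em lt.
  move=> b' b'b nb2 db2; have pb' := deg2_psi da nb2; rewrite dc in db2.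
  have nb2' : pr b' x != 0 by rewrite -(low b' pb' db2).
  exact: (ox b' b b'b nb2' nb db2 db).
have ua' : a' \in unitmx by exact: AU.
exists (a' *m a); rewrite conj_mul //; split=> // [|e pe de|c'].
- exact: AM.
- rewrite ha' //; last by rewrite dc ltnW.
  rewrite low //; case: (e =P c) => // ec; by move: de; rewrite ec dc ltnn.
rewrite inE => /orP[/eqP->|cr'] pc' dc'; rewrite ha' ?dc ?dc' //; first by rewrite eqxx eqxx.
by case: (c' =P c) => [_|_]; [rewrite eqxx|exact: high].
Qed.

(** Two roots of Psi in the same degree are orthogonal, since otherwise their
    difference would be a root of degree 0. *)
Lemma orthogonal_ex x : deg2 x -> exists a, [/\ A a, deg2 (conj a x) &
  forall b c, b != c -> pr b (conj a x) != 0 -> pr c (conj a x) != 0 -> ev b (cr c) = 0].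
Proof.
move=> dx; suff H d : exists a, [/\ A a, deg2 (conj a x) & orthogonal_below (conj a x) d].
  have [a [Aa da oa]] := H (\sum_(c <- wts) deg c).+1; exists a; split=> // b c bc nb nc.
  have lt e : pr e (conj a x) != 0 -> (deg e < (\sum_(c <- wts) deg c).+1)%N.
    move=> ne; have [re _] := deg2_psi da ne.
    by rewrite ltnS (bigD1_seq e) ?wts_uniq ?root_wts //= leq_addr.
  by apply: oa => //; exact: lt.
elim: d => [|d [a [Aa da oa]]].
  by exists 1%:M; rewrite conj1m; split.
have ua : a \in unitmx by exact: AU.
have [a' [Aa' da' low high]] := orthogonal_step wts da oa; have ua' : a' \in unitmx by exact: AU.
exists (a' *m a); rewrite (conj_mul _ ua' ua); split; [exact: AM|exact: da'|].
have top b c : psi b -> psi c -> pr b (conj a' (conj a x)) != 0 -> pr c (conj a' (conj a x)) != 0 ->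
    deg b = d -> (deg c < d)%N -> ev b (cr c) = 0.
  move=> pb pc nb nc db dc; have bw : b \in wts by case: pb => /root_wts.
  have nc' : pr c (conj a x) != 0 by rewrite -(low c pc dc).
  exact: (high b bw pb db nb c pc dc nc').
move=> b c bc nb nc; have [pb pc] := (deg2_psi da' nb, deg2_psi da' nc).
have [[rb _] [rc _]] := (pb, pc).
rewrite !ltnS leq_eqVlt => /orP[/eqP db|db]; rewrite leq_eqVlt => /orP[/eqP dc|dc].
- have [[|m] em] := psi_cartan pb pc; first exact: em.
  have rbc := psi_sub pb pc bc em; have := ry rbc.
  by rewrite evB !degE ?db ?dc ?subrr ?eqxx //; exact: psi_pos.
- exact: (top b c pb pc nb nc db dc).
- exact: (cartan_eq0 rc rb (top c b pc pb nc nb dc db)).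
- have nb' : pr b (conj a x) != 0 by rewrite -(low b pb db).
  have nc' : pr c (conj a x) != 0 by rewrite -(low c pc dc).
  exact: (oa b c bc nb' nc' db dc).
Qed.

Lemma sqrt_ex (c : k) : exists b, b ^+ 2 = c.
Proof.
have [b eb] := @solve_monicpoly k 2 (fun i => if i == 0%N then c else 0) isT.
by exists b; rewrite eb !big_ord_recl big_ord0 /= expr0 mulr1 mul0r !addr0.
Qed.

Variable e_ : cartan_dual T -> M.
Hypothesis he : forall a, root a -> e_ a != 0 /\ gsp a (e_ a).

(** The one-parameter subgroup of the coroot of c acts on the component at c by
    squares and fixes the components orthogonal to it. *)
Lemma normalise x (r : seq (cartan_dual T)) : deg2 x -> uniq r ->
  (forall b, b \in r -> pr b x != 0) ->
  (forall b c, b != c -> pr b x != 0 -> pr c x != 0 -> ev b (cr c) = 0) ->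
  exists2 s, T s & forall b, pr b (conj s x) = if b \in r then e_ b else pr b x.
Proof.
move=> dx; have [xg _] := dx; elim: r => [|c r IHr] /=.
  by move=> _ _ _; exists 1%:M; [exact: mT1|move=> b; rewrite conj1m].
move=> /andP[cr' ur] hr orth; have [|s Ts hs] := IHr ur _ orth.
  by move=> b br; apply: hr; rewrite inE br orbT.
have nc : pr c x != 0 by apply: hr; rewrite mem_head.
have [rc _] := deg2_psi dx nc; have [ec0 hec] := he rc.
have [q eq] := dim1 rc hec ec0 (pr_gsp c xg).
have q0 : q != 0 by apply/negP => /eqP z; move: nc; rewrite eq z scale0r eqxx.
have [p ep] := sqrt_ex q^-1; have p0 : p != 0.
  by apply/negP => /eqP z; move/eqP: ep; rewrite z expr0n eq_sym invr_eq0 (negPf q0).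
have [s' Ts' hs'] := torus_act (cr_intg rc) p0.
have [us us'] := (mT_unit Ts, mT_unit Ts').
have sg : conj s x \in g by apply: (conj_in sG) => //; exact: mT_sub.
exists (s' *m s); first exact: mT_mul.
move=> b; rewrite conj_mul // pr_conjT // hs inE; case: (b =P c) => [->|bc] /=.
  rewrite (negPf cr') (hs' c 2 _ (pr_gsp c xg)); last by rewrite ev_cr.
  by rewrite -[p ^ 2]/(p ^+ 2) ep eq scalerA mulVf // scale1r.
have [b0|nb] := eqVneq (pr b x) 0.
  by case: ifP => br; [move: (hr b); rewrite inE br orbT b0 eqxx => /(_ isT)|rewrite b0 linear0].
have eb : ev b (cr c) = 0%:~R by apply: orth => //; apply/eqP.
have hg : gsp b (if b \in r then e_ b else pr b x).
  case: ifP => _; last exact: pr_gsp.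
  by have [rb _] := deg2_psi dx nb; case: (he rb).
by rewrite (hs' b 0 _ hg eb) expr0z scale1r.
Qed.

Lemma orthogonal_rep x : deg2 x -> exists a (r : seq (cartan_dual T)),
  [/\ A a, uniq r, forall b, b \in r -> psi b,
    forall b c, b \in r -> c \in r -> b != c -> ev b (cr c) = 0 &
    conj a x = \sum_(b <- r) e_ b].
Proof.
move=> dx; have [a [Aa da oa]] := orthogonal_ex dx; have ua : a \in unitmx by exact: AU.
pose r := [seq b <- wts | pr b (conj a x) != 0].
have rE b : (b \in r) = (pr b (conj a x) != 0).
  rewrite mem_filter; case: (boolP (b \in wts)) => bw; rewrite ?andbT // andbF.
  by rewrite pr_notin // eqxx.
have ur : uniq r by rewrite filter_uniq // wts_uniq.
have [|s Ts hs] := normalise da ur _ oa; first by move=> b; rewrite rE.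
have us := mT_unit Ts.
exists (s *m a), r; split=> //.
- by apply: AM => //; exact: AT.
- by move=> b; rewrite rE; exact: deg2_psi.
- by move=> b c; rewrite !rE => nb nc bc; exact: oa.
rewrite conj_mul // -[LHS](sum_pr D) big_filter [RHS]big_mkcond /=; apply: eq_bigr => b _.
by rewrite hs rE; case: eqP.
Qed.

End Orthogonal.

(** * Orbits in the part of degree two: uniqueness *)

Section Uniqueness.
Variables (k : closedFieldType) (n : nat).
Local Notation M := 'M[k]_n.
Implicit Types (x y z u v w tau : M).
Variable D : tordata k n.
Local Notation G := (tG D).
Local Notation T := (tT D).
Local Notation g := (Lie G).
Local Notation t := (Lie T).
Local Notation char0 := (tchar0 D).
Local Notation sG := (tas D).
Local Notation gsp := (@gsp k n D).
Local Notation ev := (@ev k n D).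
Local Notation root := (@root k n D).
Local Notation cr := (@cr k n D).
Local Notation intg := (@intg k n D).
Local Notation triple := (@triple k n D).
Local Notation norm := (normalizer G T).
Local Notation raises := (raises D).
Local Notation Ugr := (Ugr D).
Local Notation Bgr := (Bgr D).
Local Notation regular := (regular D).
Variable B : set M.
Hypotheses (borelB : borel G B) (sTB : T `<=` B).
Local Notation bpos := (@bpos k n D B).
Local Notation bsimple := (@bsimple k n D B).
Variables h y : M.
Hypotheses (hh : intg h)
  (hb : forall a, root a -> exists z : int, [/\ ev a h = z%:~R, -2 <= z & z <= 2])
  (hdomS : forall a, bsimple a -> exists m : nat, ev a h = m%:R).
Hypotheses (hy : intg y) (ry : regular y) (bP : forall a, bpos a <-> root a /\ kpos (ev a y))
  (BE : B = Bgr y).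
Local Notation psi := (@psi k n D h).

Variables e_ f_ : cartan_dual T -> M.
Hypothesis tr : forall a, root a -> triple a (e_ a) (f_ a).

Section OneSet.
Variable S : seq (cartan_dual T).
Hypotheses (uS : uniq S) (pS : forall a, a \in S -> psi a)
  (oS : forall a b, a \in S -> b \in S -> a != b -> ev a (cr b) = 0).
Let E := \sum_(a <- S) e_ a.
Let F := \sum_(a <- S) f_ a.
Let he a : a \in S -> gsp a (e_ a). Proof. by move=> /pS[/tr[]]. Qed.
Let hf a : a \in S -> gsp (- a) (f_ a). Proof. by move=> /pS[/tr[]]. Qed.
Let wE (c : cartan_dual T -> k) := \sum_(a <- S) c a *: e_ a.
Let wF (c : cartan_dual T -> k) := \sum_(a <- S) c a *: f_ a.
Let wH (c : cartan_dual T -> k) := \sum_(a <- S) c a *: cr a.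

Let opp_psi_add a b : psi a -> psi b -> ~ root (- a - b).
Proof. by move=> pa pb; rewrite -opprD => /rootN; rewrite opprK; exact: (psi_add hb pa pb). Qed.

Let gsp_root0 a x : gsp a x -> ~ root a -> a != 0 -> x = 0.
Proof.
move=> hx nr a0; apply/eqP/negPn/negP => x0; apply: nr; split=> //; by exists x.
Qed.

Let ee a b : a \in S -> b \in S -> lie (e_ a) (e_ b) = 0.
Proof.
move=> aS bS; have [pa pb] := (pS aS, pS bS); apply: (gsp_root0 (gsp_lieD (he aS) (he bS))).
  exact: (psi_add hb pa pb).
apply/negP => /eqP e; have [[_ ea] [_ eb]] := (pa, pb); move/(congr1 (fun c => ev c h)): e.
by rewrite evD ea eb ev0 -[2]/(2%:R) -natrD => /eqP; rewrite (char0_natf_eq0 char0).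
Qed.

Let ff a b : a \in S -> b \in S -> lie (f_ a) (f_ b) = 0.
Proof.
move=> aS bS; have [pa pb] := (pS aS, pS bS); apply: (gsp_root0 (gsp_lieD (hf aS) (hf bS))).
  exact: opp_psi_add.
apply/negP => /eqP e; have [[_ ea] [_ eb]] := (pa, pb); move/(congr1 (fun c => ev c h)): e.
rewrite evB evN ea eb ev0 -opprD -[2]/(2%:R) -natrD => /eqP.
by rewrite oppr_eq0 (char0_natf_eq0 char0).
Qed.

Let ef a b : a \in S -> b \in S -> lie (e_ a) (f_ b) = if a == b then cr a else 0.
Proof.
move=> aS bS; case: (a =P b) => [<-|/eqP ab]; first by have [/tr[]] := pS aS.
have [pa pb] := (pS aS, pS bS); have [[ra _] [rb _]] := (pa, pb).
apply: (gsp_root0 (gsp_lieD (he aS) (hf bS))); last by rewrite subr_eq0.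
move=> r; have := refl_root rb r; rewrite evB ev_cr // oS // sub0r scaleNr opprK.
rewrite -[2]/(2%:R) scale_natr_w mulr2n addrA subrK; exact: (psi_add hb pa pb).
Qed.

Let sum_if (c : cartan_dual T -> k) a (v : cartan_dual T -> M) : a \in S ->
  \sum_(b <- S) c b *: (if b == a then v b else 0) = c a *: v a.
Proof.
move=> aS; rewrite (bigD1_seq a) //= eqxx big1 ?addr0 // => b /negPf->.
by rewrite scaler0.
Qed.

Let l_ee c : lie E (wE c) = 0.
Proof.
rewrite lie_suml big_seq big1 // => a aS; rewrite linear_sum big_seq big1 // => b bS.
by rewrite linearZ /= ee // scaler0.
Qed.
Let l_ff c : lie F (wF c) = 0.
Proof.
rewrite lie_suml big_seq big1 // => a aS; rewrite linear_sum big_seq big1 // => b bS.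
by rewrite linearZ /= ff // scaler0.
Qed.
Let l_ef c : lie E (wF c) = wH c.
Proof.
rewrite lie_suml /wH; apply: eq_big_seq => a aS; rewrite linear_sum /=.
rewrite -(sum_if c cr aS); apply: eq_big_seq => b bS; rewrite linearZ /= ef // eq_sym.
by case: eqP => // ->.
Qed.
Let l_eh c : lie E (wH c) = - (2 *: wE c).
Proof.
rewrite lie_suml /wE scaler_sumr -sumrN; apply: eq_big_seq => a aS; rewrite linear_sum /=.
rewrite (eq_big_seq (fun b => c b *: (if b == a then - (2 *: e_ b) else 0))) => [|b bS].
  by rewrite sum_if // scalerN scalerA mulrC -scalerA.
have [rb _] := pS bS; rewrite linearZ /= lieC (gsp_lie (he aS) (cr_t rb)).
by case: (b =P a) => [->|/eqP ba]; [rewrite ev_cr //; case: (pS aS)|rewrite oS 1?eq_sym // scale0r oppr0].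
Qed.
Let l_fh c : lie F (wH c) = 2 *: wF c.
Proof.
rewrite lie_suml /wF scaler_sumr; apply: eq_big_seq => a aS; rewrite linear_sum /=.
rewrite (eq_big_seq (fun b => c b *: (if b == a then 2 *: f_ b else 0))) => [|b bS].
  by rewrite sum_if // scalerA mulrC -scalerA.
have [rb _] := pS bS; rewrite linearZ /= lieC (gsp_lie (hf aS) (cr_t rb)) evN scaleNr opprK.
by case: (b =P a) => [->|/eqP ba]; [rewrite ev_cr //; case: (pS aS)|rewrite oS 1?eq_sym // scale0r].
Qed.
Let l_et tau : tau \in t -> lie E tau = - wE (fun a => ev a tau).
Proof.
move=> ht; rewrite lie_suml /wE -sumrN; apply: eq_big_seq => a aS.
by rewrite lieC (gsp_lie (he aS) ht).
Qed.
Let l_ft tau : tau \in t -> lie F tau = wF (fun a => ev a tau).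
Proof.
move=> ht; rewrite lie_suml /wF; apply: eq_big_seq => a aS.
by rewrite lieC (gsp_lie (hf aS) ht) evN scaleNr opprK.
Qed.

Lemma orth_E_raises : E \in g /\ raises h 2 E.
Proof.
split; first by rewrite /E big_seq; apply: rpred_sum => a aS; exact: gsp_in (he aS).
rewrite /E big_seq; apply: (big_ind (raises h 2)) => [||a aS]; [exact: raises0|exact: raisesD|].
by apply: (gsp_raises hh (he aS)); case: (pS aS).
Qed.
Lemma orth_F_raises : F \in g /\ raises (- h) 2 F.
Proof.
split; first by rewrite /F big_seq; apply: rpred_sum => a aS; exact: gsp_in (hf aS).
rewrite /F big_seq; apply: (big_ind (raises (- h) 2)) => [||a aS]; [exact: raises0|exact: raisesD|].
by apply: (gsp_raises (intgN hh) (hf aS)); rewrite evN linearN opprK; case: (pS aS).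
Qed.
Lemma orth_E_nilp : E ^+ n = 0.
Proof. by apply: (@raises_nilp _ _ D h); apply: raises_le (proj2 orth_E_raises). Qed.
Lemma orth_F_nilp : F ^+ n = 0.
Proof. by apply: (@raises_nilp _ _ D (- h)); apply: raises_le (proj2 orth_F_raises). Qed.

(** The representative of the product of the reflections in the roots of S. *)
Definition orth_refl := expm F *m expm (- E) *m expm F.

(** As the sl2-triples of orthogonal roots of Psi commute, conjugation is
    computed on the spans of the e_a, f_a and coroots. *)
Lemma orth_refl_act tau : tau \in t -> conj orth_refl tau = tau - \sum_(a <- S) ev a tau *: cr a.
Proof.
move=> ht; set c := fun a => ev a tau.
have [En Fn] := (orth_E_nilp, orth_F_nilp); have NEn := nilpN En.
have [uF uE] := (expm_unit char0 Fn, expm_unit char0 NEn).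
have Ft : conj (expm F) tau = tau + wF c.
  have l1 : lie F tau = wF c by exact: l_ft.
  by rewrite (conj_exp_lie1 D Fn) l1 // l_ff.
have Et : conj (expm (- E)) tau = tau + wE c.
  have l1 : lie (- E) tau = wE c by rewrite lieNl l_et // opprK.
  have l2 : lie (- E) (wE c) = 0 by rewrite lieNl l_ee oppr0.
  by rewrite (conj_exp_lie1 D NEn) l1 // l2.
have EF : conj (expm (- E)) (wF c) = wF c - wH c - wE c.
  have l1 : lie (- E) (wF c) = - wH c by rewrite lieNl l_ef.
  have l2 : lie (- E) (- wH c) = - (2 *: wE c) by rewrite lieNl linearN /= opprK l_eh.
  rewrite (conj_exp_lie D NEn) l1 l2; first by rewrite scalerN half2.
  by rewrite lieNl linearN linearZ /= l_ee scaler0 !oppr0.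
have FF : conj (expm F) (wF c) = wF c by rewrite (conj_exp_lie1 D Fn) l_ff ?linear0 // addr0.
have FH : conj (expm F) (wH c) = wH c + 2 *: wF c.
  by rewrite (conj_exp_lie1 D Fn) l_fh // linearZ /= l_ff scaler0.
rewrite /orth_refl !conj_mul ?unitmx_mul ?uF ?uE // Ft linearD /= Et EF.
have -> : tau + wE c + (wF c - wH c - wE c) = tau + (wF c - wH c).
  by rewrite -addrA; congr (_ + _); rewrite addrC subrK.
rewrite linearD linearB /= Ft FF FH scaler_nat mulr2n opprD -/(wH c) -addrA; congr (_ + _).
by rewrite opprD !addrA addrAC addrK addrAC subrr add0r.
Qed.

Lemma orth_refl_norm : norm orth_refl.
Proof.
have [Eg _] := orth_E_raises; have [Fg _] := orth_F_raises.
have [En Fn] := (orth_E_nilp, orth_F_nilp).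
apply: normP => [|tau ht].
  apply: (asG_mul sG); last exact: (expm_in char0 sG).
  apply: (asG_mul sG); first exact: (expm_in char0 sG).
  by apply: (expm_in char0 sG); [rewrite rpredN|exact: nilpN].
rewrite orth_refl_act //; apply: memvB => //; rewrite big_seq; apply: memv_suml => a aS.
by apply/memvZ/cr_t; case: (pS aS).
Qed.

Lemma orth_expE : expm (- E) = expm (- F) *m orth_refl *m expm (- F).
Proof.
have Fn := orth_F_nilp; have NFn := nilpN Fn.
rewrite /orth_refl !mulmxA -{2}[F]opprK (expmK char0 NFn) mul1mx -mulmxA.
by rewrite (expmK char0 Fn) mulmx1.
Qed.

End OneSet.

Section TwoSets.
Variables S S' : seq (cartan_dual T).
Hypotheses (uS : uniq S) (pS : forall a, a \in S -> psi a)
  (oS : forall a b, a \in S -> b \in S -> a != b -> ev a (cr b) = 0).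
Hypotheses (uS' : uniq S') (pS' : forall a, a \in S' -> psi a).
Hypothesis eqS : forall tau, tau \in t ->
  \sum_(a <- S) ev a tau *: cr a = \sum_(a <- S') ev a tau *: cr a.

Lemma two_expansion c tau : c \in S -> tau \in t ->
  2 * ev c tau = \sum_(b <- S') ev c (cr b) * ev b tau.
Proof.
move=> cS ht; have := congr1 (ev c) (eqS ht); rewrite !linear_sum /=.
rewrite (bigD1_seq c) //= big1_seq ?addr0 => [|a /andP[ac aS]].
  rewrite linearZ /= ev_cr; last by case: (pS cS).
  rewrite mulrC => ->; apply: eq_bigr => b _.
  by rewrite linearZ /= mulrC.
by rewrite linearZ /= oS 1?eq_sym // mulr0.
Qed.

Lemma two_sum c : c \in S -> \sum_(b <- S') ev c (cr b) = 2.
Proof.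
move=> cS; have [ht _] := hh; have := two_expansion cS ht.
have [_ ->] := pS cS; rewrite (eq_big_seq (fun b => ev c (cr b) * 2)) => [|b bS'].
  rewrite -mulr_suml => /mulIf-> //.
  by rewrite (char0_natf_eq0 char0).
by have [_ ->] := pS' bS'.
Qed.
End TwoSets.

(** If c in S is not in S', its Cartan integers with S' sum to 2 by evaluation
    at h, and each of them is 0 or belongs to a root b of S' with b(cr c) = 1.
    Evaluating 2 c at its coroot then gives 4 = 2. *)
Lemma orth_subset S S' : uniq S -> (forall a, a \in S -> psi a) ->
  (forall a b, a \in S -> b \in S -> a != b -> ev a (cr b) = 0) ->
  uniq S' -> (forall a, a \in S' -> psi a) ->
  (forall a b, a \in S' -> b \in S' -> a != b -> ev a (cr b) = 0) ->
  (forall tau, tau \in t -> \sum_(a <- S) ev a tau *: cr a = \sum_(a <- S') ev a tau *: cr a) ->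
  {subset S <= S'}.
Proof.
move=> uS pS oS uS' pS' oS' eqS c cS; apply: contrapT => /negP cS'.
have [[rc ec] ht] : psi c /\ h \in t by split; [exact: pS|case: hh].
have s2 := two_sum uS pS oS pS' eqS cS.
have eqS' tau : tau \in t -> \sum_(a <- S') ev a tau *: cr a = \sum_(a <- S) ev a tau *: cr a.
  by move=> ht'; rewrite eqS.
(* The integers b(cr a), a in S, are natural numbers with sum 2. So b(cr c) is 1
   unless it is 0, or 2, in which case b = c. *)
have key b : b \in S' -> ev c (cr b) * ev b (cr c) = ev c (cr b).
  move=> bS'; have [rb _] := pS' b bS'; have [e0|ne] := eqVneq (ev c (cr b)) 0.
    by rewrite e0 mul0r.
  have [|q hq] := @choice _ _ (fun a (m : nat) => a \in S -> ev b (cr a) = m%:R).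
    move=> a; case: (boolP (a \in S)) => [aS|_]; last by exists 0%N.
    by have [m em] := psi_cartan hb (pS' b bS') (pS a aS); exists m.
  have sq : (\sum_(a <- S) q a = 2)%N.
    apply: (natr_inj0 char0); rewrite natr_sum -(two_sum uS' pS' oS' pS eqS' bS').
    by apply: eq_big_seq => a aS; rewrite hq.
  move: sq; rewrite (bigD1_seq c) //= => sq.
  have q0 : q c <> 0%N.
    move=> e0; case/eqP: ne; apply: (cartan_eq0 rb rc); by rewrite hq // e0.
  rewrite hq //; case e : (q c) => [|[|m]] //; first by rewrite mulr1.
  move: sq; rewrite e; move sz : (\sum_(i <- S | _) _)%N => Z sq.
  have [Z0 m0] : Z = 0%N /\ m = 0%N by lia.
  rewrite {}Z0 in sz.
  case/negP: cS'; have -> // : c = b.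
  apply: ev_eq => tau ht'; apply: (mulfI (_ : (2 : k) != 0)); first by rewrite (char0_natf_eq0 char0).
  rewrite (two_expansion uS' pS' oS' eqS' bS' ht') (bigD1_seq c) //= hq // e m0 big1_seq ?addr0 // => a /andP[ac aS].
  rewrite hq //; have /eqP -> : q a == 0%N; last by rewrite mul0r.
  by move: sz => /eqP; rewrite sum_nat_seq_eq0 => /allP/(_ a aS); rewrite ac.
have := two_expansion uS pS oS eqS cS (cr_t rc); rewrite (eq_big_seq _ key) s2 ev_cr //.
by rewrite -[2]/(2%:R) -natrM => /(natr_inj0 char0).
Qed.

Let mul_shift (u w u' a w' : M) : a \in unitmx -> u' \in unitmx ->
  u *m w *m u' = a *m w' *m a -> invmx a *m u *m w = w' *m (a *m invmx u').
Proof.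
move=> ua uu' e; apply: (can_inj (mulKmx ua)); rewrite !mulmxA mulmxV // mul1mx.
by rewrite -e mulmxK.
Qed.

Let conj_conjT w s tau : norm w -> T s -> tau \in t -> conj (conj s w) tau = conj w tau.
Proof.
move=> hw Ts ht; have [us uw] := (mT_unit Ts, norm_unit hw).
have -> : conj s w = s *m w *m invmx s by [].
rewrite conj_mul ?unitmx_mul ?us // ?unitmx_inv // (T_fix (mT_inv Ts) ht) conj_mul //.
by rewrite (T_fix Ts) //; exact: norm_t hw ht.
Qed.

(** Conjugation by s u carries exp (- E) = exp (- F) n_S exp (- F) to its
    analogue for S'. The factor of u in exp (g(1) + g(2)) fixes E, since g(3) =
    0, and may be dropped. What remains, and the exponentials of elements of
    g(-2), belong to the Borel subgroup whose roots are the positive roots of L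
    and the roots negative on h. For it, n_S and n_S' are in the same Bruhat
    cell, up to conjugation by s. *)
Lemma orth_uniq S S' s u : uniq S -> (forall a, a \in S -> psi a) ->
  (forall a b, a \in S -> b \in S -> a != b -> ev a (cr b) = 0) ->
  uniq S' -> (forall a, a \in S' -> psi a) ->
  (forall a b, a \in S' -> b \in S' -> a != b -> ev a (cr b) = 0) ->
  T s -> Ugr y 1 u -> conj (s *m u) (\sum_(a <- S) e_ a) = \sum_(a <- S') e_ a -> S =i S'.
Proof.
move=> uS pS oS uS' pS' oS' Ts hu eE.
set E := \sum_(a <- S) e_ a in eE; set E' := \sum_(a <- S') e_ a in eE.
set F := \sum_(a <- S) f_ a; set F' := \sum_(a <- S') f_ a.
have [Eg rE] := orth_E_raises pS; have [E'g rE'] := orth_E_raises pS'.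
have [Fg rF] := orth_F_raises pS; have [F'g rF'] := orth_F_raises pS'.
rewrite -/E -/F -/E' -/F' in Eg rE E'g rE' Fg rF F'g rF'.
have [x0 [v [x0g h0 rx hv uE]]] := levi_split hh hb hdomS hy bP hu.
suff eqS tau : tau \in t -> \sum_(a <- S) ev a tau *: cr a = \sum_(a <- S') ev a tau *: cr a.
  move=> a; apply/idP/idP; apply: (orth_subset) => // tau ht'.
  by rewrite eqS.
(* y2 is positive on the roots negative on h and on the positive roots of L. *)
have [y2 [hy2 ry2 p1 p2]] := perturb (intgN hh) hy ry.
have [ht _] := hh.
have low X : X \in g -> raises (- h) 2 X -> raises y2 1 X.
  move=> Xg rX; apply: (raises_roots hy2 Xg) => a z nz ra0 ez.
  have [z' ez'] : exists z : int, ev a (- h) = z%:~R.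
    by case: ra0 => [->|ra]; [exists 0; rewrite ev0|exact: ev_int ra (intgN hh)].
  have lz' := raises_component (intgN hh) Xg rX nz ez'; case: ra0 => [a0|ra].
    by move: ez'; rewrite a0 ev0 => /esym/eqP; rewrite (char0_intr_eq0 char0) => /eqP e; rewrite e in lz'.
  have z'0 : 0 < z' by apply: lt_le_trans lz'.
  have : kpos (ev a y2) by apply: (p1 a ra); rewrite ez'; exact/(kpos_int D).
  by rewrite ez => /(kpos_int D).
have rx2 : raises y2 1 x0.
  apply: (raises_roots hy2 x0g) => a z nz ra0 ez.
  have ea : ev a h = 0.
    have := pr_lie a x0 ht; rewrite h0 linear0 => /esym/eqP; rewrite scaler_eq0 (negPf nz) orbF.
    by move/eqP.
  case: ra0 => [a0|ra].
    by have := @raises_component _ _ D y 1 x0 a 0 hy x0g rx nz; rewrite a0 ev0 => /(_ erefl).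
  apply: (raises_component hy x0g rx nz); rewrite -ez; apply/esym/(p2 a ra).
  by rewrite linearN /= ea oppr0.
have [UU _ UM UV] := @Ugr_subgroup _ _ D y2 1 (lexx 1).
have Fn := orth_F_nilp pS; have Fn' := orth_F_nilp pS'.
have En := orth_E_nilp pS; have En' := orth_E_nilp pS'.
rewrite -/F -/F' -/E -/E' in Fn Fn' En En'.
have hx2 : Ugr y2 1 (expm x0) by exact: exp_Ugr.
have gN X : X \in g -> - X \in g by move=> Xg; rewrite rpredN.
have ha : Ugr y2 1 (expm (- F)) by apply: exp_Ugr => //; [exact: gN|apply/raisesN/low].
have ha' : Ugr y2 1 (expm (- F')) by apply: exp_Ugr => //; [exact: gN|apply/raisesN/low].
have [hUU _ _ hUV] := @Ugr_subgroup _ _ D h 1 (lexx 1).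
have uv : v \in unitmx by exact: hUU.
have vE : conj v E = E.
  apply/subr0_eq; apply: (h_raises3 hh hb).
    by apply: memvB => //; apply: (conj_in sG) => //; case: hv.
  have -> : conj v E - E = ((v - 1%:M) *m E - E *m (v - 1%:M)) *m invmx v.
    have -> : (v - 1%:M) *m E - E *m (v - 1%:M) = v *m E - E *m v.
      by rewrite mulmxBl mulmxBr mulmx1 mul1mx opprB addrA subrK.
    by rewrite mulmxBl -[E *m v *m _]mulmxA mulmxV // mulmx1.
  rewrite -[3]addr0; apply: raisesM; last exact: (Ugr_raises0 (lexx 1) (hUV _ hv)).
  have [_ rv] := hv; apply: raisesB; first exact: (raisesM rv rE).
  exact: (raisesM rE rv).
have us := mT_unit Ts; have ux : expm x0 \in unitmx by exact: UU.
have eE2 : conj s (conj (expm x0) E) = E'.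
  by rewrite -eE uE !conj_mul ?unitmx_mul ?ux // vE.
set x := expm x0 in ux hx2 eE2; set a := expm (- F) in ha; set a' := expm (- F') in ha'.
set w := orth_refl S; set w' := orth_refl S'.
have hw : norm w by exact: (orth_refl_norm uS pS oS).
have hw' : norm w' by exact: (orth_refl_norm uS' pS' oS').
have [ua ua' uw uw'] := And4 (UU _ ha) (UU _ ha') (norm_unit hw) (norm_unit hw').
have e1 : conj s (conj x (a *m w *m a)) = a' *m w' *m a'.
  rewrite /a /w /a' /w' -(orth_expE pS) -(orth_expE pS') -/E -/E'.
  by rewrite !conj_of_expm // !linearN /= eE2.
pose n1 := conj s w; have hn1 : norm n1 by apply: norm_mul; [exact: norm_mul (norm_T Ts) hw|exact: norm_inv (norm_T Ts)].
pose u1 := conj s (x *m a); pose u2 := conj s (a *m invmx x).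
have hu1 : Ugr y2 1 u1 by apply: Ugr_conjT => //; exact: UM.
have hu2 : Ugr y2 1 u2 by apply: Ugr_conjT => //; apply: UM => //; exact: UV.
have [uu1 uu2 un1] := And3 (UU _ hu1) (UU _ hu2) (norm_unit hn1).
have e2 : u1 *m n1 *m u2 = a' *m w' *m a'.
  by rewrite -e1 /u1 /n1 /u2 -!conjM // /conj !mulmxA.
(* Unipotent factors of the second Borel subgroup on either side of n1 and w'.
   *)
have e3 : invmx a' *m u1 *m n1 = w' *m (a' *m invmx u2) by exact: mul_shift.
have hT := bruhat_uniq hy2 ry2 (UM _ _ (UV _ ha') hu1) (UM _ _ ha' (UV _ hu2)) hn1 hw' e3.
move=> htau; have e4 : conj w' tau = conj w tau.
  have -> : conj w tau = conj n1 tau.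
    by rewrite (conj_conjT hw Ts htau).
  have -> : w' = (w' *m invmx n1) *m n1 by rewrite mulmxKV.
  rewrite (conj_mul _ (mT_unit hT) un1); apply: (T_fix hT).
  exact: norm_t hn1 htau.
move: e4; rewrite (orth_refl_act uS' pS' oS' htau) (orth_refl_act uS pS oS htau).
by move/addrI/oppr_inj.
Qed.

End Uniqueness.

(** * Orbits on the associated bundle *)

Section Bundles.
Variables (k : closedFieldType) (n : nat).
Local Notation M := 'M[k]_n.
Variable P : set M.
Hypothesis gP : subgroup P.
Implicit Types (x g p b : M).

Lemma bundle_act_pt b g x : bundle_act b (bundle_pt P g x) = bundle_pt P (b *m g) x.
Proof.
apply/seteqP; split=> [_ [_ [p Pp ->] <-]|_ [p Pp ->]] /=.
  by exists p => //; rewrite mulmxA.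
by exists (g *m p, conj (invmx p) x); [exists p|rewrite /= mulmxA].
Qed.

Lemma bundle_pt_mul g p x : P p -> bundle_pt P (g *m p) x = bundle_pt P g (conj p x).
Proof.
have [PU P1 PM PV] := gP; move=> Pp; have up : p \in unitmx by exact: PU.
apply/seteqP; split=> _ [q Pq ->]; have uq : q \in unitmx by exact: PU.
  exists (p *m q); first exact: PM.
  by rewrite mulmxA invmxM // conj_mul ?unitmx_inv // conjK.
exists (invmx p *m q); first by apply: PM => //; exact: PV.
rewrite mulmxA -[g *m p *m _]mulmxA mulmxV // mulmx1.
by rewrite invmxM ?unitmx_inv // invmxK conj_mul ?unitmx_inv.
Qed.

Lemma bundle_pt_eq g g' x x' : bundle_pt P g x = bundle_pt P g' x' ->
  exists p, [/\ P p, g = g' *m p & x = conj (invmx p) x'].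
Proof.
have [_ P1 _ _] := gP; move=> e; have : bundle_pt P g x (g, x).
  by exists 1%:M => //; rewrite mulmx1 invmx1 conj1m.
by rewrite e => -[p Pp [e1 e2]]; exists p.
Qed.
End Bundles.

Section Main.
Variables (k : closedFieldType) (n : nat).
Local Notation M := 'M[k]_n.
Implicit Types (x y z u v w tau : M).
Variable D : tordata k n.
Local Notation G := (tG D).
Local Notation T := (tT D).
Local Notation g := (Lie G).
Local Notation t := (Lie T).
Local Notation char0 := (tchar0 D).
Local Notation sG := (tas D).
Local Notation gsp := (@gsp k n D).
Local Notation ev := (@ev k n D).
Local Notation pr := (@pr k n D).
Local Notation wts := (wts D).
Local Notation root := (@root k n D).
Local Notation cr := (@cr k n D).
Local Notation intg := (@intg k n D).
Local Notation triple := (@triple k n D).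
Local Notation norm := (normalizer G T).
Local Notation raises := (raises D).
Local Notation Ugr := (Ugr D).
Local Notation Bgr := (Bgr D).
Local Notation regular := (regular D).
Variable B : set M.
Hypotheses (borelB : borel G B) (sTB : T `<=` B).
Local Notation bpos := (@bpos k n D B).
Local Notation bsimple := (@bsimple k n D B).
Local Notation bposN := (bposN borelB).
Variable h : cartan T.
Local Notation hm := (vsval h).
Local Notation psi := (@psi k n D hm).
Local Notation deg2 := (@deg2 k n D hm).

Lemma characteristic_facts e : N2 G e -> dominant_characteristic G B e h ->
  [/\ intg hm, forall a, root a -> exists z : int, [/\ ev a hm = z%:~R, -2 <= z & z <= 2] &
    forall a, bsimple a -> exists m : nat, ev a hm = m%:R].
Proof.
move=> [[eg [m em]] [q [_ hq] q2]] [dom [w [f [Gw fg [hE hF EF]]]]].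
have uw := asG_unit sG Gw; have ht : hm \in t by exact: subvsP.
have Eg : conj w e \in g by exact: (conj_in sG).
have En : conj w e ^+ n = 0 by rewrite -conj_exp // (nilp_expn em) linear0.
have e3 x : x \in g -> lie e (lie e (lie e x)) = 0.
  move=> xg; apply/eqP/negPn/negP => nz.
  have : (3 <= q)%N by apply: hq; exists x.
  by move=> q3; move: (leq_trans q3 q2).
have E3 x : x \in g -> lie (conj w e) (lie (conj w e) (lie (conj w e) x)) = 0.
  move=> xg; rewrite -[x](conjVK uw) -!conj_lie // e3 ?linear0 //.
  by apply: (conj_in sG) => //; exact: (asG_inv sG).
split.
- exact: (sl2_intg ht hE hF EF En).
- exact: (weight_bound ht Eg fg hE hF EF E3).
- by move=> a /simple_rootP/dom; rewrite evE.
Qed.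

Hypotheses (hh : intg hm)
  (hb : forall a, root a -> exists z : int, [/\ ev a hm = z%:~R, -2 <= z & z <= 2])
  (hdomS : forall a, bsimple a -> exists m : nat, ev a hm = m%:R).
Variable y : M.
Hypotheses (hy : intg y) (ry : regular y) (bP : forall a, bpos a <-> root a /\ kpos (ev a y))
  (BE : B = Bgr y).

Let hdom a : bpos a -> exists m : nat, ev a hm = m%:R.
Proof. exact: (bpos_nonneg hdomS bP). Qed.

Lemma nonneg_gradesP x : nonneg_grades G h x <-> x \in g /\ raises hm 0 x.
Proof.
have [ht _] := hh; split=> [[m [u [hu ->]]]|[xg rx]].
  split; first by apply: rpred_sum => i _; case: (hu i).
  apply: raises_sum => i; have [_ e] := hu i.
  by apply: (@raises_le _ _ D hm i%:Z) => //; exact: (lie_raises hh e).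
exists 3, (fun i => \sum_(a <- wts) (if ev a hm == i%:R then pr a x else 0)); split=> [i|].
  split; first by apply: rpred_sum => a _; case: ifP => _; [case: (pr_gsp a xg)|exact: mem0v].
  rewrite linear_sum scaler_sumr; apply: eq_bigr => a _ /=.
  by case: eqP => [e|_]; rewrite ?linear0 ?scaler0 // lie_pr // e.
rewrite exchange_big /= -{1}(sum_pr D x); apply: eq_bigr => a _.
have [->|nz] := eqVneq (pr a x) 0; first by rewrite big1 // => i _; case: ifP.
have [i ei] : exists i : 'I_3, ev a hm = i%:R.
  case: (pr_root_or0 xg nz) => [->|ra]; first by exists ord0; rewrite ev0.
  have [z [ez _ z2]] := hb ra; have z0 := raises_component hh xg rx nz ez.
  have lt : (absz z < 3)%N by lia.
  exists (Ordinal lt); rewrite ez /= -[RHS]/((absz z)%:Z%:~R); congr (_%:~R); lia.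
rewrite (bigD1 i) //= ei eqxx big1 ?addr0 // => j ji; case: eqP => // /(natr_inj0 char0) e.
by case/eqP: ji; exact/val_inj.
Qed.

Lemma U_raises_h u : Ugr y 1 u -> raises hm 0 u.
Proof.
move=> hu; have [x [xg rx xn <-]] := @Ugr_exp _ _ D y 1 u (lexx 1) hu.
have rh := y_raises_h hh hb hdomS hy bP xg rx.
apply: raises_sum => i; apply: raisesZ; elim: (val i) => [|j IHj]; first exact: raises1.
by rewrite exprS -mulmxE -[0]addr0; apply: raisesM.
Qed.

Lemma deg2P x : deg2 x <-> x \in g /\ raises hm 2 x.
Proof.
split=> -[xg]; first by move/(grade2P hh hb xg).
by move=> rx; split=> //; apply/(grade2P hh hb xg).
Qed.

Lemma deg2_U u x : Ugr y 1 u -> deg2 x -> deg2 (conj u x).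
Proof.
move=> hu /deg2P[xg rx]; apply/deg2P; have [_ _ _ UV] := @Ugr_subgroup _ _ D y 1 (lexx 1).
split; first by apply: (conj_in sG) => //; case: hu.
apply: (@raises_le _ _ D hm (0 + 2 + 0)) => //.
by apply: raisesM; [apply: raisesM => //|]; apply: U_raises_h => //; exact: UV.
Qed.

Lemma deg2_fix w x : G w -> conj w hm = hm -> deg2 x -> deg2 (conj w x).
Proof.
move=> Gw fx [xg ex]; have uw := asG_unit sG Gw; split; first exact: (conj_in sG).
by rewrite -{1}fx -conj_lie // ex linearZ.
Qed.

Lemma raises_fix w m x : w \in unitmx -> conj w hm = hm -> raises hm m x -> raises hm m (conj w x).
Proof.
have [ht _] := hh.
have r0 v : v \in unitmx -> conj v hm = hm -> raises hm 0 v.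
  move=> uv fv; apply: (lie_raises hh (i := 0)); rewrite scale0r.
  by apply/lie_eq0/esym/(conj_fix_comm hm uv).
move=> uw fw rx; have -> : m = 0 + m + 0 by rewrite add0r addr0.
apply: raisesM; first by apply: raisesM => //; exact: r0.
apply: r0; first by rewrite unitmx_inv.
by rewrite -{1}fw conjK.
Qed.

Variables P L : set M.
Hypotheses (gP : closed_subgroup P) (BsP : B `<=` P) (PG : P `<=` G)
  (lieP : forall x, x \in Lie P <-> nonneg_grades G h x).
Hypotheses (gL : closed_subgroup L) (LP : L `<=` P)
  (lieL : forall x, x \in Lie L <-> grade G h 0 x).

Let sP : subgroup P. Proof. by case: gP. Qed.
Let lieP' x : x \in Lie P <-> x \in g /\ raises hm 0 x.
Proof. by split=> [/lieP/nonneg_gradesP|/nonneg_gradesP/lieP]. Qed.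
Let UB : Ugr y 1 `<=` B. Proof. by rewrite BE; exact: U_Bgr. Qed.
Let sB : subgroup B. Proof. by rewrite BE; exact: Bgr_subgroup. Qed.

Lemma P_bruhat p : P p -> exists u w u', [/\ Ugr y 1 u, norm w, Ugr y 1 u', P w & p = u *m w *m u'].
Proof.
move=> Pp; have [u [w [u' [hu hw hu' e]]]] := bruhat hy ry (PG Pp).
have [UU _ _ UV] := @Ugr_subgroup _ _ D y 1 (lexx 1); have [uu uu'] := (UU _ hu, UU _ hu').
exists u, w, u'; split=> //; have [_ _ PM PV] := sP.
have -> : w = invmx u *m p *m invmx u' by rewrite e !mulmxA mulVmx // mul1mx mulmxK.
by apply: (PM); [apply: (PM) => //; apply: PV|apply: PV]; apply/BsP/UB.
Qed.

Lemma P_fix w : P w -> norm w -> conj w hm = hm.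
Proof. exact: (P_norm_fix borelB sTB hh hdomS bP gP lieP'). Qed.

(** By the Bruhat decomposition, as U and the normaliser of T in P act. *)
Lemma deg2_P p x : P p -> deg2 x -> deg2 (conj p x).
Proof.
move=> Pp dx; have [u [w [u' [hu hw hu' Pw ->]]]] := P_bruhat Pp.
have [UU _ _ _] := @Ugr_subgroup _ _ D y 1 (lexx 1).
have [uu uu' uw] := And3 (UU _ hu) (UU _ hu') (norm_unit hw).
rewrite !conj_mul ?unitmx_mul ?uu //; apply: deg2_U => //; apply: deg2_fix; first by case: hw.
  exact: P_fix.
exact: deg2_U.
Qed.

Lemma L_nrefl a e f : triple a e f -> ev a hm = 0 -> L (nrefl e f).
Proof.
move=> tr e0; have [en fn] := triple_nilp tr; have [ra he hf _] := tr; have [ht _] := hh.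
have eL : e \in Lie L.
  by apply/lieL; split; [exact: gsp_in he|rewrite (gsp_lie he ht) e0].
have fL : f \in Lie L.
  by apply/lieL; split; [exact: gsp_in hf|rewrite (gsp_lie hf ht) evN e0 oppr0].
have XL x : x \in Lie L -> x ^+ n = 0 -> L (expm x) by move=> /LieP hx xn; apply: (expm_Lie char0).
have [[_ _ LM _] _] := gL; apply: (LM); last exact: XL.
by apply: (LM); [exact: XL|apply: XL; [rewrite rpredN|exact: nilpN]].
Qed.

Lemma min_reps_levi w a : min_reps G B T L (coset T w) -> norm w -> bpos a -> ev a hm = 0 ->
  bpos (nact w a).
Proof.
move=> mw hw ha e0; have [ra _] := ha; have [e [f tr]] := triple_ex ra.
exact: (min_reps_pos borelB sTB mw hw ha tr (L_nrefl tr e0)).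
Qed.

(** Let m be the Weyl element of p. By [P_norm_fix] m fixes h, and the
    minimality of w' moves the unipotent factors of p across w', so that w and
    w' m agree up to T by [bruhat_uniq]. As both w and w' are positive on the
    positive roots of L, m permutes the positive roots, hence lies in T. *)
Lemma parabolic_coset w w' b p : min_reps G B T L (coset T w) -> min_reps G B T L (coset T w') ->
  norm w -> norm w' -> B b -> P p -> w = b *m w' *m p ->
  coset T w = coset T w' /\ exists s u, [/\ T s, Ugr y 1 u & p = s *m u].
Proof.
move=> mw mw' hw hw' Bb Pp e; have [ht _] := hh.
have [u1 [m [u2 [hu1 hm_ hu2 Pm pE]]]] := P_bruhat Pp; have fm := P_fix Pm hm_.
have [x0 [v [x0g l0 rx hv u1E]]] := levi_split hh hb hdomS hy bP hu1.
have [UU _ UM UV] := @Ugr_subgroup _ _ D y 1 (lexx 1).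
(* The Levi factor of u1 stays in U after conjugation by w', and v after
   conjugation by the inverse of m. *)
have hc := levi_conj hh hy bP hw' (fun a ha e0 => min_reps_levi mw' hw' ha e0) x0g l0 rx.
have um := norm_unit hm_; have uw' := norm_unit hw'; have uw := norm_unit hw.
have fmV : conj (invmx m) hm = hm by rewrite -{1}fm conjK.
have hv' : Ugr y 1 (conj (invmx m) v).
  have Hv : Ugr hm 1 (conj (invmx m) v).
    have [Gv rv] := hv; split.
      have Gm : G m by case: hm_.
      by apply: (asG_mul sG); [apply: (asG_mul sG) => //; exact: (asG_inv sG)|rewrite invmxK].
    have -> : conj (invmx m) v - 1%:M = conj (invmx m) (v - 1%:M).
      by rewrite linearB /= conj_id // unitmx_inv.
    by apply: raises_fix => //; rewrite unitmx_inv.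
  have [z [zg rz zn <-]] := @Ugr_exp _ _ D hm 1 _ (lexx 1) Hv.
  by apply: exp_Ugr => //; apply: (h_raises_y borelB sTB hh hb hdomS hy bP zg rz).
have [s [u [Ts hu bE]]] : Bgr y b by rewrite -BE.
have us := mT_unit Ts; have [uu1 uu2 uu uc] := And4 (UU _ hu1) (UU _ hu2) (UU _ hu) (UU _ hc).
have ux : expm x0 \in unitmx by exact: (expm_unit char0 (@raises_nilp _ _ D y x0 rx)).
have hsw : norm (invmx s *m w) by apply: norm_mul => //; exact: norm_inv (norm_T Ts).
have hwm : norm (w' *m m) by exact: norm_mul.
have e1 : invmx (u *m conj w' (expm x0)) *m (invmx s *m w) = w' *m m *m (conj (invmx m) v *m u2).
  have uuc : u *m conj w' (expm x0) \in unitmx by rewrite unitmx_mul uu.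
  apply: (can_inj (mulKmx uuc)); rewrite (mulKVmx uuc) e bE pE u1E /conj invmxK.
  rewrite !mulmxA mulVmx // mul1mx.
  rewrite -[_ *m invmx w' *m w']mulmxA mulVmx // mulmx1.
  by rewrite -[_ *m m *m invmx m]mulmxA mulmxV // mulmx1.
have hT : T ((w' *m m) *m invmx (invmx s *m w)).
  apply: (bruhat_uniq hy ry _ _ hsw hwm e1); first by apply: UV; exact: UM.
  exact: UM.
have nE a : @nact k n D w' (@nact k n D m a) = nact w a.
  rewrite -nact_mul // -[w' *m m](mulmxKV (norm_unit hsw)) (nact_mul _ (norm_T hT) hsw) (nact_T _ hT).
  by rewrite (nact_mul _ (norm_inv (norm_T Ts)) hw) (nact_T _ (mT_inv Ts)).
have Tm : T m.
  apply: (norm_pos_T borelB sTB) => // a ha; have [ra _] := ha; have rma := root_nact hm_ ra.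
  have em : ev (nact m a) hm = ev a hm by rewrite nactE // fmV.
  have [z ez /andP[z0 _]] := bpos_degree hb hdomS bP ha.
  move: z0; rewrite le_eqVlt => /orP[/eqP z0|z0]; last first.
    by apply: (pos_bpos borelB sTB hb hdomS bP rma (z := z)) => //; rewrite em.
  have e0 : ev a hm = 0 by rewrite ez -z0.
  case: (bpos_total borelB sTB rma) => // hN; exfalso.
  have := min_reps_levi mw' hw' hN; rewrite evN em e0 oppr0 nactN nE => /(_ erefl).
  by apply: bposN; exact: min_reps_levi.
split.
  apply/esym/coset_eq => //.
  have <- : conj (invmx w') (s *m invmx ((w' *m m) *m invmx (invmx s *m w))) *m m = invmx w' *m w.
    have u3 : w' *m m \in unitmx by rewrite unitmx_mul uw'.
    have u4 : invmx s *m w \in unitmx by rewrite unitmx_mul unitmx_inv us.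
    rewrite invmxM ?unitmx_inv // invmxK mulmxA mulKVmx // /conj invmxK invmxM // !mulmxA.
    by rewrite mulmxKV // mulmxKV.
  apply: mT_mul => //; apply: ((norm_inv hw').2 _).1; apply: mT_mul => //; exact: mT_inv.
exists m, (conj (invmx m) u1 *m u2); split=> //.
  by apply: UM => //; apply: Ugr_conjT => //; exact: mT_inv.
by rewrite pE /conj invmxK !mulmxA mulmxV // mul1mx.
Qed.

Variable e_ : cartan_dual T -> M.
Hypothesis he_ : forall al, is_root G al -> e_ al != 0 /\ root_space G al (e_ al).

Let he a : root a -> e_ a != 0 /\ gsp a (e_ a).
Proof. by move=> /is_rootP/he_[e0 /root_space_gsp]. Qed.

Lemma OrtP (S : {fset cartan_dual T}) : Ort G h S <->
  (forall a, a \in S -> psi a) /\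
  forall a b, a \in S -> b \in S -> a != b -> ev a (cr b) = 0.
Proof.
split=> -[pS oS].
  have pS' a : a \in S -> psi a by move=> /pS[/is_rootP ra ea]; split=> //; rewrite evE.
  split=> // a b aS bS ab; have [rb _] := pS' b bS.
  by apply/(dual_form_eq0 a rb); exact: oS.
split=> [a aS|a b aS bS ab]; first by have [ra ea] := pS a aS; split; [exact/is_rootP|rewrite -evE].
by have [rb _] := pS b bS; apply/(dual_form_eq0 a rb); exact: oS.
Qed.

Lemma deg2_eS S : Ort G h S -> deg2 (eS e_ S).
Proof.
case/OrtP=> pS _; have [ht _] := hh; rewrite /eS; split.
  rewrite big_seq; apply: rpred_sum => a aS; have [ra _] := pS a aS.
  by case: (he ra) => _; exact: gsp_in.
rewrite linear_sum scaler_sumr; apply: eq_big_seq => a aS /=; have [ra ea] := pS a aS.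
by have [_ hg] := he ra; rewrite (gsp_lie hg ht) ea.
Qed.

Definition orbit_pt w x := [set bundle_act b (bundle_pt P w x) | b in B].

Lemma orbit_pt_act b w x : B b -> orbit_pt (b *m w) x = orbit_pt w x.
Proof.
have [BU _ BM BV] := sB; move=> Bb; have ub : b \in unitmx by exact: BU.
apply/seteqP; split=> _ [c Bc <-].
  by exists (c *m b); [exact: BM|rewrite !bundle_act_pt mulmxA].
exists (c *m invmx b); first by apply: BM => //; exact: BV.
by rewrite !bundle_act_pt mulmxA mulmxKV.
Qed.

Lemma double_orbitE w x : norm w -> double_orbit B (coset T w) (bundle_pt P 1%:M x) = orbit_pt w x.
Proof.
move=> hw; have uw := norm_unit hw; have [_ B1 BM _] := sB.
apply/seteqP; split=> [_ [b [_ [Bb [s Ts <-] ->]]]|_ [b Bb <-]].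
  exists (b *m conj w s).
    by apply: BM => //; apply: sTB; apply: (hw.2 s).1.
  by rewrite !bundle_act_pt mulmx1 /conj !mulmxA mulmxKV.
exists b, w; split=> //; first by exists 1%:M; rewrite ?mulmx1 //; exact: mT1.
by rewrite !bundle_act_pt mulmx1.
Qed.

Let rep (wS : set M * {fset cartan_dual T}) := double_orbit B wS.1 (bundle_pt P 1%:M (eS e_ wS.2)).

Lemma rep_fun : set_fun (min_reps G B T L `*` Ort G h)
  (bundle_orbits B (bundle G P (grade G h 2))) rep.
Proof.
move=> [W S] [/= [[w hw ->] _] oS]; rewrite /rep /= double_orbitE //.
exists (bundle_pt P w (eS e_ S)) => //; exists w, (eS e_ S); split=> //; first by case: hw.
exact: deg2_eS.
Qed.

Lemma rep_inj : {in min_reps G B T L `*` Ort G h &, injective rep}.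
Proof.
move=> [W S] [W' S']; rewrite !inE => -[/= mW oS] -[/= mW' oS'].
have [[w hw eW] [w' hw' eW']] : weyl G T W /\ weyl G T W' by case: mW; case: mW'.
rewrite /rep /= eW eW' !double_orbitE // => e; rewrite eW in mW; rewrite eW' in mW'.
have [BU B1 BM BV] := sB.
have : orbit_pt w (eS e_ S) (bundle_pt P w (eS e_ S)).
  by exists 1%:M => //; rewrite bundle_act_pt mul1mx.
rewrite e => -[b Bb]; rewrite bundle_act_pt => /esym/(bundle_pt_eq sP)[p [Pp ew ex]].
have [eC [s [u [Ts hu ep]]]] := parabolic_coset mW mW' hw hw' Bb Pp ew; rewrite eC; congr (_, _).
have up : p \in unitmx by case: sP => PU _ _ _; exact: PU.
have [|f_ htr] := @choice _ _ (fun a f => root a -> triple a (e_ a) f).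
  move=> a; case: (pselect (root a)) => [ra|]; last by exists 0.
  by have [e0 hg] := he ra; have [f tr] := triple_of ra hg e0; exists f.
have [[pS oS2] [pS' oS2']] := ((OrtP S).1 oS, (OrtP S').1 oS').
apply/fsetP => a; apply: (orth_uniq hh hb hdomS hy ry bP htr (fset_uniq S) pS oS2 (fset_uniq S') pS' oS2' Ts hu).
by rewrite -ep; move: ex; rewrite /eS => ->; rewrite conjVK.
Qed.

(** [bruhat] reduces to a base point in the normaliser of T, which is made
    minimal by an element of L. The elements a of P with w a w^-1 in B then act
    on g(2); they contain T and the positive root subgroups of L, so that
    [orthogonal_rep] applies. *)
Lemma rep_surj : set_surj (min_reps G B T L `*` Ort G h)
  (bundle_orbits B (bundle G P (grade G h 2))) rep.
Proof.
move=> _ [_ [q [x [Gq dx ->]]] <-]; have {}dx : deg2 x by [].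
have [u [w0 [u' [hu hw0 hu' eq]]]] := bruhat hy ry Gq.
have [UU _ _ _] := @Ugr_subgroup _ _ D y 1 (lexx 1).
have [_ P1 PM PV] := sP; have [BU B1 BM BV] := sB.
have LG : L `<=` G by move=> z /LP/PG.
have [m [Lm hm_ mW]] := min_reps_ex B (proj1 gL) LG hw0.
have um := norm_unit hm_; set w := w0 *m m in mW; have hw : norm w by exact: norm_mul.
have uw := norm_unit hw.
have Pm : P (invmx m) by apply: PV; exact: LP.
pose x2 := conj (invmx m) (conj u' x).
have d2 : deg2 x2 by apply: deg2_P => //; exact: deg2_U.
have e1 : bundle_pt P q x = bundle_pt P (u *m w) x2.
  rewrite eq bundle_pt_mul //; last exact/BsP/UB.
  rewrite /x2 -(bundle_pt_mul sP (u *m w) _ Pm) /w !mulmxA mulmxK //.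
(* Replacing x2 by its image under a in A changes the base point w by an element
   of B. *)
pose A : set M := [set a | P a /\ B (conj w a)].
have AT : T `<=` A.
  by move=> s Ts; split; [exact/BsP/sTB|apply: sTB; apply: (hw.2 s).1].
have AM a b : A a -> A b -> A (a *m b).
  by move=> [Pa Ba] [Pb Bb]; split; [exact: PM|rewrite conjM //; exact: BM].
have AU : A `<=` [set a | a \in unitmx] by move=> a [Pa _]; exact/(asG_unit sG)/PG.
have AE b z : bpos b -> ev b hm = 0 -> gsp b z -> A (expm z).
  move=> hb' e0 hz; have [rb _] := hb'.
  have ex_U c v : bpos c -> gsp c v -> Ugr y 1 (expm v).
    move=> hc hv; have [rc _] := hc; have [z' ez'] := ev_int rc hy.
    have z0 := bpos_deg bP hc ez'.
    by apply: exp_Ugr => //; [exact: gsp_in hv|apply: (raises_le _ (gsp_raises hy hv ez'))].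
  split; first by apply/BsP/UB; exact: ex_U hz.
  rewrite conj_of_expm //; apply/UB; apply: (ex_U (nact w b)); last exact: gsp_nact.
  exact: min_reps_levi.
have [a [r [[Pa Ba] ur pr_ or_ ea]]] := orthogonal_rep borelB sTB hh hb hdom ry bP AT AM AU AE he d2.
pose S : {fset cartan_dual T} := [fset b | b in r]%fset.
have memS b : (b \in S) = (b \in r) by rewrite in_fset.
have eSE : eS e_ S = conj a x2.
  rewrite ea /eS; apply: perm_big; apply: uniq_perm; [exact: fset_uniq|exact: ur|].
  exact: memS.
have oS : Ort G h S.
  by apply/OrtP; split=> [b|b c]; rewrite !memS; [exact: pr_|exact: or_].
have ua : a \in unitmx by exact/(asG_unit sG)/PG.
exists (coset T w, S); first by split.
have e2 : orbit_pt w x2 = orbit_pt (w *m invmx a) (eS e_ S).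
  by rewrite /orbit_pt bundle_pt_mul ?eSE ?conjK //; exact: PV.
have e3 : w *m invmx a = conj w (invmx a) *m w by rewrite /conj mulmxKV.
rewrite /rep /= double_orbitE // e1 -/(orbit_pt (u *m w) x2) orbit_pt_act; last exact: UB.
rewrite e2 e3 orbit_pt_act // conj_inv //; exact: BV.
Qed.

Lemma orbits_parametrized : set_bij (min_reps G B T L `*` Ort G h)
  (bundle_orbits B (bundle G P (grade G h 2))) rep.
Proof. by split; [exact: rep_fun|exact: rep_inj|exact: rep_surj]. Qed.

End Main.

Theorem corollary3p5 (k : closedFieldType) (char0 : [pchar k] =i pred0)
    (n : nat) (G B T : set 'M[k]_n)
    (simpleG : almost_simple G) (borelB : borel G B)
    (torusT : maximal_torus G T) (sTB : T `<=` B)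
    (e_ : cartan_dual T -> 'M[k]_n)
    (he_ : forall al, is_root G al -> e_ al != 0 /\ root_space G al (e_ al))
    (e : 'M[k]_n) (he : N2 G e)
    (h : cartan T) (hh : dominant_characteristic G B e h)
    (P : set 'M[k]_n) (parP : standard_parabolic G B P)
    (lieP : forall x, x \in Lie P <-> nonneg_grades G h x)
    (L : set 'M[k]_n) (leviL : levi_factor P L)
    (lieL : forall x, x \in Lie L <-> grade G h 0 x) :
  set_bij (min_reps G B T L `*` Ort G h)
    (bundle_orbits B (bundle G P (grade G h 2)))
    (fun wS => double_orbit B wS.1 (bundle_pt P 1%:M (eS e_ wS.2))).
Proof.
have [_ [_ _ [g0 ug0 dT]] _] := torusT; have [gP BP PG] := parP; have [gL LP _] := leviL.
pose D := TorData char0 simpleG torusT ug0 dT.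
have [hI hb hd] := @characteristic_facts k n D B h e he hh.
have [y [hy ry bP BE _]] := @borel_grading k n D B borelB sTB.
exact: (@orbits_parametrized k n D B borelB sTB h hI hb hd y hy ry bP BE
  P L gP BP PG lieP gL LP lieL e_ he_).
Qed.
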